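(* Let $r\in\mathbb{N}_0\cup\{\infty\}$ and $\ell\in\mathbb{N}_0$ with $\ell\le r$. If $\ell=0$, let $M$ be a $\sigma$-compact, locally compact rough $C^r$-manifold; if $\ell>0$, let $M$ be a $\sigma$-compact, locally compact $C^r$-manifold with corners. Let $\pi\colon N\to M$ be a $C^r$-fibre bundle over $M$. Let $\sigma\in\Gamma_{C^\ell}(M\leftarrow N)$, $\Omega\subseteq\Gamma_{C^\ell}(M\leftarrow N)$ be a neighbourhood of $\sigma$ in the Whitney $C^\ell$-topology, $U\subseteq M$ be open and $A\subseteq M$ be a closed subset such that $\sigma$ is $RC^r$ on an open neighbourhood of $A\setminus U$ in $M$. Then there exists a section $\tau\in\Omega$ and a homotopy $H\colon[0,1]\times M\to N$ from $\sigma=H(0,\cdot)$ to $\tau=H(1,\cdot)$ such that $H_t:=H(t,\cdot)\in\Omega$ for all $t\in[0,1]$ and the following holds: (a) $\sigma|_{M\setminus U}=H_t|_{M\setminus U}$ for all $t\in[0,1]$; (b) For every open subset $V\subseteq M$ such that $\sigma|_V$ is $RC^r$, also $H_t|_V$ is $RC^r$ for all $t\in[0,1]$. (c) There exists an open neighbourhood $W$ of $A$ in $M$ such that $H_t|_W$ is $RC^r$ for all $t\in\,]0,1]$. Moreover, one can achieve that $H$ is $RC^{0,\ell}$, the restriction $H|_{]0,1]\times M}$ is $RC^{r-\ell,\ell}$, and that, for each $V$ as in (b), the restriction of $H$ to a map $]0,1]\times(V\cup W)\to N$ is $RC^{0,r}$ (resp., $RC^\infty$ if $r=\infty$).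
   Context: ''Locally convex space'' (lcs) means a real, Hausdorff locally convex topological vector space. A subset of a topological space is regular if its interior (denoted ${}^0$) is dense in it. By convention $\infty-\ell=\infty$. Calculus. For lcs $E,F$ and regular $R\subseteq E$, $f\colon R\to F$ is $C^\ell$ if it is continuous and for all $j\in\mathbb{N}$, $j\le\ell$, the iterated directional derivatives $(D_{y_j}\cdots D_{y_1}f)(x)$ exist for $x\in R^0$, $y_i\in E$ and extend to a continuous map $R\times E^j\to F$. For regular $R_1\subseteq E_1$, $R_2\subseteq E_2$ and $k,\ell\in\mathbb{N}_0\cup\{\infty\}$, a continuous map $f\colon R_1\times R_2\to F$ is $C^{k,\ell}$ if for all $i,j\in\mathbb{N}_0$ with $i\le k$, $j\le\ell$ the derivatives $(D_{(v_i,0)}\cdots D_{(v_1,0)}D_{(0,w_j)}\cdots D_{(0,w_1)}f)(x,y)$ exist for $x\in R_1^0$, $y\in R_2^0$, $v_a\in E_1$, $w_b\in E_2$, and extend to a continuous map $R_1\times R_2\times E_1^i\times E_2^j\to F$. Rough manifolds. A rough $C^r$-manifold is a Hausdorff space $M$ with a maximal set of homeomorphisms (charts) $\phi\colon U_\phi\to V_\phi$ from open sets covering $M$ onto regular subsets $V_\phi$ of lcs $E_\phi$ whose transition maps $\phi\circ\psi^{-1}$ are $C^r$ and take the interior of $\psi(U_\phi\cap U_\psi)$ in $E_\psi$ into the interior of $\phi(U_\phi\cap U_\psi)$ in $E_\phi$. $C^r$-manifolds with corners are the special case where the $V_\phi$ are relatively open subsets of sets $[0,\infty[^m\times\mathbb{R}^{d-m}$.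 The formal interior $M^\circ$ is the set of $x$ with $\phi(x)\in V_\phi^0$ for all charts $\phi$ around $x$. An $RC^\ell$-map between rough manifolds is a continuous map $f\colon M\to N$ with $f(M^\circ)\subseteq N^\circ$ which is $C^\ell$ in charts; an $RC^{k,\ell}$-map $f\colon M_1\times M_2\to N$ is a continuous map with $f(M_1^\circ\times M_2^\circ)\subseteq N^\circ$ which is $C^{k,\ell}$ in charts of $M_1$, $M_2$, $N$. Fibre bundles. A $C^r$-fibre bundle over $M$ is a rough $C^r$-manifold $N$ (modelled on lcs) with a surjective $RC^r$-map $\pi\colon N\to M$ such that for each $x\in M$ there are an open neighbourhood $U$ of $x$, a $C^r$-manifold $N_x$ (without boundary) modelled on lcs, and an $RC^r$-diffeomorphism $\theta\colon\pi^{-1}(U)\to U\times N_x$ with first component $\pi|_{\pi^{-1}(U)}$. $\Gamma_{C^\ell}(M\leftarrow N)$ is the set of $RC^\ell$-maps $\sigma\colon M\to N$ with $\pi\circ\sigma=\mathrm{id}_M$. Whitney topology. For $\ell\in\mathbb{N}_0$, the compact-open $C^\ell$-topology on a set $RC^\ell(M,N)$ of $RC^\ell$-maps is the initial topology with respect to the maps $\gamma\mapsto T^j\gamma\in C(T^jM,T^jN)$, $0\le j\le\ell$ (iterated tangent maps), with compact-open topologies. For $M$ $\sigma$-compact and locally compact, the Whitney $C^\ell$-topology on $RC^\ell(M,N)$ is the initial topology with respect to $\gamma\mapsto(\gamma|_{M_n})_{n\in\mathbb{N}}\in\prod_{n\in\mathbb{N}}RC^\ell(M_n,N)$, where $(M_n)_{n\in\mathbb{N}}$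 is a locally finite sequence of (possibly empty) relatively compact, regular subsets of $M$ whose interiors cover $M$, each factor carries the compact-open $C^\ell$-topology and the product carries the box topology (independent of the choice of $(M_n)$). $\Gamma_{C^\ell}(M\leftarrow N)$ carries the induced topology. *)

(* Defs.v *)
From HB Require Import structures.
From mathcomp Require Import all_boot all_order all_algebra.
From mathcomp Require Import all_classical all_reals all_analysis.

Set Implicit Arguments.
Unset Strict Implicit.
Unset Printing Implicit Defensive.

Import Order.TTheory GRing.Theory Num.Theory.
Import numFieldNormedType.Exports.

Local Open Scope classical_set_scope.
Local Open Scope ring_scope.

(* Differentiability orders: [Some n] is n, [None] is infinity. *)
Definition diff_order := option nat.

Definition le_order (j : nat) (l : diff_order) : Prop :=
  if l is Some n then (j <= n)%N else True.

(* infinity - n = infinity *)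
Definition sub_order (l : diff_order) (n : nat) : diff_order :=
  omap (subn^~ n) l.

Definition regular_set (T : topologicalType) (A : set T) : Prop :=
  A `<=` closure A°.

(* [tvsType R] is the library's type of locally convex spaces, not assumed to
   be Hausdorff; the Hausdorff property is part of [is_chart]. Partial maps
   are total functions of which only the values on the stated set matter. *)

Section Calculus.
Variable R : realType.

Definition has_dirder (E F : tvsType R) (f : E -> F) (x v : E) (d : F) : Prop :=
  (fun t : R => t^-1 *: (f (x + t *: v) - f x)) @ (0 : R)^' --> d.

(* On the open set [O], [g] is D_{y_j} ... D_{y_1} f, where
   ys = [:: y_1; ...; y_j]. *)
Fixpoint is_iter_dirder (E F : tvsType R) (O : set E) (f : E -> F)
    (ys : seq E) (g : E -> F) : Prop :=
  if ys is y :: ys' then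
    exists2 f1 : E -> F, forall x, O x -> has_dirder f x y (f1 x)
                       & is_iter_dirder O f1 ys' g
  else forall x, O x -> g x = f x.

Definition tvs_pow (E : tvsType R) (j : nat) := {ptws 'I_j -> E}.

Definition tvs_pow_seq (E : tvsType R) (j : nat) (y : tvs_pow E j) : seq E :=
  [seq y i | i <- enum 'I_j].

Definition C_on (E F : tvsType R) (l : diff_order) (S : set E)
    (f : E -> F) : Prop :=
  {within S, continuous f} /\
  forall j, le_order j l -> exists2 df : E * tvs_pow E j -> F,
    {within S `*` setT, continuous df} &
    forall y : tvs_pow E j,
      is_iter_dirder S° f (tvs_pow_seq y) (fun x => df (x, y)).

Definition C2_on (E1 E2 F : tvsType R) (k l : diff_order) (S1 : set E1)
    (S2 : set E2) (f : E1 * E2 -> F) : Prop :=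
  {within S1 `*` S2, continuous f} /\
  forall i j, le_order i k -> le_order j l ->
    exists2 df : (E1 * E2) * (tvs_pow E1 i * tvs_pow E2 j) -> F,
      {within (S1 `*` S2) `*` setT, continuous df} &
      forall (v : tvs_pow E1 i) (w : tvs_pow E2 j),
        is_iter_dirder (S1° `*` S2°) f
          ([seq (0, b) | b <- tvs_pow_seq w] ++ [seq (a, 0) | a <- tvs_pow_seq v])
          (fun z => df (z, (v, w))).

(* [df] restricted to S x E is the differential of the C^1-map [f] on [S]. *)
Definition is_differential (E F : tvsType R) (S : set E) (f : E -> F)
    (df : E * E -> F) : Prop :=
  {within S `*` setT, continuous df} /\
  forall x v, S° x -> has_dirder f x v (df (x, v)).

End Calculus.

(* A chart with domain [cdom] and values in [E]; the values of [cmap] outside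
   [cdom] are irrelevant. *)
Record chart (R : realType) (M : topologicalType) (E : tvsType R) := Chart {
  cdom : set M;
  cmap :> M -> E
}.

Section Charts.
Variables (R : realType) (M : topologicalType).

Definition cimg (E : tvsType R) (phi : chart M E) : set E := phi @` cdom phi.

(* homeomorphism from an open set onto a regular subset of an lcs *)
Definition is_chart (E : tvsType R) (phi : chart M E) : Prop :=
  [/\ hausdorff_space E,
      open (cdom phi) /\ regular_set (cimg phi),
      {in cdom phi &, injective phi},
      {within cdom phi, continuous phi} &
      forall O : set M, open O -> O `<=` cdom phi ->
        exists2 O' : set E, open O' & phi @` O = O' `&` cimg phi].

(* The transition map psi o phi^-1, represented by a function [h] on the model
   space, is C^r and maps the interior of its domain into that of its image. *)
Definition good_transition (r : diff_order) (E E' : tvsType R)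
    (phi : chart M E) (psi : chart M E') : Prop :=
  let D := cdom phi `&` cdom psi in
  (exists2 h : E -> E', forall x, D x -> h (phi x) = psi x
                      & C_on r (phi @` D) h) /\
  forall x, D x -> (phi @` D)° (phi x) -> (psi @` D)° (psi x).

Definition atlas := forall E : tvsType R, chart M E -> Prop.

Definition rough_atlas (r : diff_order) (A : atlas) : Prop :=
  [/\ forall E (phi : chart M E), A E phi -> is_chart phi,
      forall x : M, exists E (phi : chart M E), A E phi /\ cdom phi x &
      forall E E' (phi : chart M E) (psi : chart M E'),
        A E phi -> A E' psi -> good_transition r phi psi].

(* the maximal rough C^r-atlas determined by the charts in [A] *)
Definition generated_atlas (r : diff_order) (A : atlas) : atlas := fun E phi =>
  is_chart phi /\ forall E' (psi : chart M E'), A E' psi ->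
    good_transition r phi psi /\ good_transition r psi phi.

End Charts.

Record charted_space (R : realType) := ChartedSpace {
  csort :> topologicalType;
  catlas : atlas R csort
}.
Arguments catlas {R} c [E].

Section RoughManifolds.
Variable R : realType.
Implicit Types M N : charted_space R.

Definition rough_manifold (r : diff_order) M : Prop :=
  [/\ hausdorff_space M,
      rough_atlas r (@catlas R M) &
      forall A : atlas R M, rough_atlas r A ->
        (forall E (phi : chart M E), catlas M phi -> A E phi) ->
        forall E (phi : chart M E), A E phi -> catlas M phi].

(* [0, oo[^m x R^(d - m) *)
Definition corner_set (d m : nat) : set 'rV[R]_d :=
  [set x | forall i : 'I_d, (i < m)%N -> 0 <= x ord0 i].

(* A maximal rough atlas always contains charts that are not of corner type, so
   the corner condition asks for a covering by corner charts of the atlas. *)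
Definition manifold_with_corners (r : diff_order) M : Prop :=
  rough_manifold r M /\
  forall x : M, exists d m (phi : chart M ('rV[R]_d)),
    [/\ (m <= d)%N, catlas M phi, cdom phi x &
        exists2 O : set 'rV[R]_d, open O & cimg phi = O `&` @corner_set d m].

Definition manifold (r : diff_order) M : Prop :=
  rough_manifold r M /\
  forall E (phi : chart M E), catlas M phi -> open (cimg phi).

Definition formal_interior M : set M :=
  [set x | forall E (phi : chart M E), catlas M phi -> cdom phi x ->
     (cimg phi)° (phi x)].

(* An lcs as a smooth manifold, with the identity as global chart. *)
Inductive id_atlas (E : tvsType R) : atlas R E :=
  IdAtlas : id_atlas (Chart setT (id : E -> E)).

Definition lcs_manifold (E : tvsType R) : charted_space R :=
  ChartedSpace (generated_atlas None (@id_atlas E)).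

Definition real_line : charted_space R := lcs_manifold R^o.

Definition prod_chart M N (E F : tvsType R) (phi : chart M E) (psi : chart N F) :
    chart (M * N)%type (E * F)%type :=
  Chart (cdom phi `*` cdom psi) (fun z => (phi z.1, psi z.2)).

Inductive prod_atlas M N : atlas R (M * N)%type :=
  ProdAtlas (E F : tvsType R) (phi : chart M E) (psi : chart N F) :
    catlas M phi -> catlas N psi -> prod_atlas (prod_chart phi psi).

Definition prod_manifold (r : diff_order) M N : charted_space R :=
  ChartedSpace (generated_atlas r (@prod_atlas M N)).

(* A regular subset [D] of a rough manifold is a rough manifold in its own
   right, with the restricted charts and formal interior the intersection of
   [D°] with the ambient one; [RC_on l D f] says that f|_D is RC^l. *)

Definition RC_on M N (l : diff_order) (D : set M) (f : M -> N) : Prop :=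
  [/\ {within D, continuous f},
      forall x, D° x -> formal_interior x -> formal_interior (f x) &
      forall (E F : tvsType R) (phi : chart M E) (psi : chart N F),
        catlas M phi -> catlas N psi ->
        let D' := D `&` cdom phi `&` f @^-1` cdom psi in
        exists2 h : E -> F, forall x, D' x -> h (phi x) = psi (f x)
                          & C_on l (phi @` D') h].

(* The local representatives live on product sets, so charts [phi1] and [phi2]
   are used whose product is mapped into the domain of [psi]; as [f] is
   continuous and atlases contain the restrictions of their charts, the domains
   of such pairs cover everything. *)
Definition RC2_on M1 M2 N (k l : diff_order) (D1 : set M1) (D2 : set M2)
    (f : M1 * M2 -> N) : Prop :=
  [/\ {within D1 `*` D2, continuous f},
      forall x y, D1° x -> formal_interior x -> D2° y -> formal_interior y ->
        formal_interior (f (x, y)) &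
      forall (E1 E2 F : tvsType R) (phi1 : chart M1 E1) (phi2 : chart M2 E2)
        (psi : chart N F), catlas M1 phi1 -> catlas M2 phi2 -> catlas N psi ->
        let D1' := D1 `&` cdom phi1 in
        let D2' := D2 `&` cdom phi2 in
        D1' `*` D2' `<=` f @^-1` cdom psi ->
        exists2 h : E1 * E2 -> F,
          forall x y, D1' x -> D2' y -> h (phi1 x, phi2 y) = psi (f (x, y)) &
          C2_on k l (phi1 @` D1') (phi2 @` D2') h].

Definition RC_diffeo_on M N (r : diff_order) (D : set M) (D' : set N)
    (f : M -> N) (g : N -> M) : Prop :=
  [/\ RC_on r D f, RC_on r D' g,
      (forall x, D x -> D' (f x)) /\ (forall y, D' y -> D (g y)),
      forall x, D x -> g (f x) = x &
      forall y, D' y -> f (g y) = y].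

Definition fibre_bundle (r : diff_order) M N (pi : N -> M) : Prop :=
  [/\ rough_manifold r N,
      RC_on r setT pi,
      forall x, exists y, pi y = x &
      forall x : M, exists U : set M, exists F : charted_space R,
        [/\ open U, U x, manifold r F &
            exists (theta : N -> prod_manifold r M F)
                   (theta' : prod_manifold r M F -> N),
              @RC_diffeo_on N (prod_manifold r M F) r
                (pi @^-1` U) (U `*` setT) theta theta' /\
              forall y, U (pi y) -> (theta y).1 = pi y]].

Definition sections M N (pi : N -> M) (l : diff_order) : set (M -> N) :=
  [set s | RC_on l setT s /\ forall x, pi (s x) = x].

(* The tangent space at [x] is the model space of a chart around [x] chosen
   once and for all; coordinates in other charts are obtained by
   differentiating the change of charts. *)

(* junk value, for points not covered by charts *)
Definition default_chart M : {E : tvsType R & chart M E} :=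
  existT _ (R^o : tvsType R) (Chart setT (fun=> 0)).

Definition chart_at M (x : M) : {E : tvsType R & chart M E} :=
  match pselect (exists c : {E : tvsType R & chart M E},
                   catlas M (projT2 c) /\ cdom (projT2 c) x) with
  | left ex => sval (cid ex)
  | right _ => default_chart M
  end.

(* [w] is the value at (phi x, v) of the differential of psi o f|_D o phi^-1 *)
Definition chart_differential M N (D : set M) (f : M -> N) (E F : tvsType R)
    (phi : chart M E) (psi : chart N F) (x : M) (v : E) (w : F) : Prop :=
  let D' := D `&` cdom phi `&` f @^-1` cdom psi in
  exists (h : E -> F) (dh : E * E -> F),
    [/\ forall y, D' y -> h (phi y) = psi (f y),
        is_differential (phi @` D') h dh & w = dh (phi x, v)].

Record tangent M := Tangent {
  tbase : M;
  tvect : projT1 (chart_at tbase)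
}.

(* the component of [xi] in the chart [phi] around its base point *)
Definition tcoord M (E : tvsType R) (phi : chart M E) (xi : tangent M) : E :=
  xget 0 [set w | chart_differential setT id (projT2 (chart_at (tbase xi))) phi
                    (tbase xi) (tvect xi) w].

Definition tangent_chart M (E : tvsType R) (phi : chart M E) :
    tangent M -> E * E :=
  fun xi => (phi (tbase xi), tcoord phi xi).

(* Final topology with respect to the inverses V_phi x E -> TM of the charts:
   [W] is open when each of its chart images is relatively open in V_phi x E. *)
Definition tangent_open M : set_system (tangent M) := [set W |
  forall (E : tvsType R) (phi : chart M E), catlas M phi ->
    exists2 O : set (E * E), open O &
      forall xi, cdom phi (tbase xi) -> (W xi <-> O (tangent_chart phi xi))].

Lemma tangent_openT M : @tangent_open M setT.
Proof. by move=> E phi _; exists setT => //; exact: openT. Qed.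

Lemma tangent_openI M : setI_closed (@tangent_open M).
Proof.
move=> W1 W2 h1 h2 E phi Aphi.
have [B1 o1 e1] := h1 E phi Aphi; have [B2 o2 e2] := h2 E phi Aphi.
exists (B1 `&` B2); first exact: openI.
by move=> xi dxi; rewrite /setI/= (e1 xi dxi) (e2 xi dxi).
Qed.

Lemma tangent_open_bigU M (I : Type) (f : I -> set (tangent M)) :
  (forall i, tangent_open (f i)) -> tangent_open (\bigcup_i f i).
Proof.
move=> hf E phi Aphi.
exists (\bigcup_(B in [set B | open B /\ exists i, forall xi,
  cdom phi (tbase xi) -> (f i xi <-> B (tangent_chart phi xi))]) B).
  by apply: bigcup_open => B [].
move=> xi dxi; split.
  move=> [i _ fxi]; have [B oB eB] := hf i E phi Aphi.
  by exists B; [split=> //; exists i|exact/eB].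
by move=> [B [_ [i eB]] Bxi]; exists i => //; exact/eB.
Qed.

HB.instance Definition _ M := gen_eqMixin (tangent M).
HB.instance Definition _ M := gen_choiceMixin (tangent M).
HB.instance Definition _ M := isOpenTopological.Build (tangent M)
  (@tangent_openT M) (@tangent_openI M) (@tangent_open_bigU M).

Inductive tangent_atlas M : atlas R (tangent M) :=
  TangentAtlas (E : tvsType R) (phi : chart M E) : catlas M phi ->
    tangent_atlas (Chart (tbase (M := M) @^-1` cdom phi) (tangent_chart phi)).

Definition tangent_space M : charted_space R :=
  ChartedSpace (@tangent_atlas M).

(* On TD, [g] is the tangent map of f|_D *)
Definition is_tangent_map M N (D : set M) (f : M -> N)
    (g : tangent_space M -> tangent_space N) : Prop :=
  forall xi : tangent M, D (tbase xi) ->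
    tbase (g xi) = f (tbase xi) /\
    forall (E F : tvsType R) (phi : chart M E) (psi : chart N F),
      catlas M phi -> catlas N psi ->
      cdom phi (tbase xi) -> cdom psi (f (tbase xi)) ->
      chart_differential D f phi psi (tbase xi)
        (tcoord phi xi) (tcoord psi (g xi)).

Fixpoint iter_tangent (j : nat) M : charted_space R :=
  if j is j'.+1 then iter_tangent j' (tangent_space M) else M.

(* T^j D as a subset of T^j M *)
Fixpoint iter_tangent_set (j : nat) M : set M -> set (iter_tangent j M) :=
  if j is j'.+1 then fun D =>
    @iter_tangent_set j' (tangent_space M) (tbase (M := M) @^-1` D)
  else id.

(* On T^j D, [g] is T^j (f|_D) *)
Fixpoint is_iter_tangent_map (j : nat) M N (D : set M) (f : M -> N) :
    (iter_tangent j M -> iter_tangent j N) -> Prop :=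
  if j is j'.+1 then fun g =>
    exists2 f1 : tangent_space M -> tangent_space N, is_tangent_map D f f1 &
      @is_iter_tangent_map j' (tangent_space M) (tangent_space N)
        (tbase (M := M) @^-1` D) f1 g
  else fun g => forall x, D x -> g x = f x.

(* Elements of RC^l(D, N) are represented by total functions; all conditions
   below only depend on the restriction to [D]. *)

(* Subbasis of the compact-open C^l-topology on RC^l(D, N): the sets of all f
   with (T^j f)(K) `<=` O, where K is compact in T^j D, O is open in T^j N and
   j <= l *)
Definition co_subbasis M N (l : nat) (D : set M) : set_system (M -> N) :=
  [set B | exists j (K : set (iter_tangent j M)) (O : set (iter_tangent j N)),
     [/\ (j <= l)%N, compact K /\ K `<=` iter_tangent_set D, open O &
         B = [set f | exists2 g, is_iter_tangent_map D f g & g @` K `<=` O]]].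

Definition co_nbhs M N (l : nat) (D : set M) (f : M -> N)
    (P : set (M -> N)) : Prop :=
  exists2 B, finI_from [set B | co_subbasis l D B /\ B f] id B &
    B `&` RC_on (Some l) D `<=` P.

Definition whitney_cover M (K : nat -> set M) : Prop :=
  [/\ forall n, precompact (K n), forall n, regular_set (K n),
      \bigcup_n (K n)° = setT &
      forall x : M, exists2 V, nbhs x V & finite_set [set n | K n `&` V !=set0]].

(* [Omega] is a neighbourhood of [s] in [Gamma], for the topology induced by
   the Whitney C^l-topology: it contains all elements of [Gamma] whose
   restrictions to the [K n] lie in a box of neighbourhoods. *)
Definition whitney_nbhs M N (l : nat) (Gamma : set (M -> N)) (s : M -> N)
    (Omega : set (M -> N)) : Prop :=
  Omega `<=` Gamma /\
  exists2 K : nat -> set M, whitney_cover K &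
    exists2 P : nat -> set (M -> N), forall n, co_nbhs l (K n) s (P n) &
      Gamma `&` [set f | forall n, P n f] `<=` Omega.

End RoughManifolds.

Definition sigma_compact (T : topologicalType) : Prop :=
  exists2 K : nat -> set T, forall n, compact (K n) & \bigcup_n K n = setT.

(* Main.v *)
Require Import Defs.
From HB Require Import structures.
From mathcomp Require Import all_boot all_order all_algebra.
From mathcomp Require Import finmap.
From mathcomp Require Import all_classical all_reals all_analysis.
From mathcomp Require Import ring lra.

(** The section is smoothed step by step. Near a point of A \ O, where O is an open set
    on which sigma is already regular, sigma becomes a map with values in an open set
    of an lcs, in a chart of M and a bundle chart of N. There one smooths by averaging
    over points which lie inside the corner only, so that nothing has to be extended
    across the boundary, and interpolates with a cut-off function. The scale of the
    smoothing is a parameter s; letting s = e t yields the homotopy. For l = 0, where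
    charts have arbitrary regular images, the model space is finite-dimensional since
    M is locally compact, and values at the nodes of a grid are averaged.

    A locally finite sequence of such steps covers A \ O. The subbasic conditions of
    the compact-open C^l-topology are open along continuous families of C^l-maps, as
    iterated tangent maps of the family depend continuously on the parameter. Hence
    small e preserves the Whitney conditions and keeps the compact sets treated in
    later steps inside their bundle charts; by local finiteness, only finitely many
    of these conditions are affected by a step. *)

Set Implicit Arguments.
Unset Strict Implicit.
Unset Printing Implicit Defensive.

Import Order.TTheory GRing.Theory Num.Theory.
Import numFieldNormedType.Exports.

Local Open Scope classical_set_scope.
Local Open Scope ring_scope.

(** * Calculus in locally convex spaces *)

(** The fibres are modelled on arbitrary locally convex spaces, neither complete nor metrizable in
    general, so convolution integrals are replaced by finite averages. The number of terms of an
    average jumps with the scale. Averages are therefore formed only at the discrete scales 1/(n+1),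
    which accumulate at 0, and are interpolated afterwards by a smooth partition of unity in the
    scale. For positive scale the result is locally a finite sum of smooth functions of scale and
    position times values of the given map at fixed points: it is smooth in position and keeps its
    class in time. Convergence at scale 0 is controlled by convex neighbourhoods and a mean value
    theorem in place of norms. The order r - l in time comes from changes of charts: for a
    C^{k,l}-map they are controlled by charts of class k + l, and k + l must not exceed r. A step
    acts on a whole homotopy rather than on a section, since the earlier steps have already
    introduced a dependence on t; this is why every local tool carries a parameter space. *)

Section ContOn.
Context {T U : topologicalType}.
(** Continuity of the restriction to [A], phrased with neighbourhoods of the ambient space, so that
    [A] and [f] can vary while the type of the domain stays the same. *)
Definition cont_on (A : set T) (f : T -> U) : Prop :=
  forall x, A x -> forall W, nbhs (f x) W -> \forall y \near x, A y -> W (f y).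

Lemma cont_onP (A : set T) (f : T -> U) :
  {within A, continuous f} <-> cont_on A f.
Proof.
split; first by move/subspace_continuousP => h x Ax W /(h x Ax).
by move=> h; apply/subspace_continuousP => x Ax W /(h x Ax).
Qed.

Lemma continuous_cont_on (A : set T) (f : T -> U) : continuous f -> cont_on A f.
Proof.
move=> cf x _ W Wx; have h : nbhs x (f @^-1` W) := cf x W Wx.
by apply: filterS h => y Wy _.
Qed.

Lemma cont_on_setT (f : T -> U) : cont_on setT f -> continuous f.
Proof. by move=> h x W Wx; apply: (filterS _ (h x I W Wx)) => y; exact. Qed.

Lemma cont_on_sub (A B : set T) (f : T -> U) :
  B `<=` A -> cont_on A f -> cont_on B f.
Proof. by move=> BA h x Bx W Wx; apply: filterS (h x (BA _ Bx) W Wx) => y + /BA. Qed.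

Lemma cont_on_eq (A : set T) (f g : T -> U) :
  (forall x, A x -> f x = g x) -> cont_on A f -> cont_on A g.
Proof.
move=> e h x Ax W; rewrite -e// => Wx.
by apply: filterS (h x Ax W Wx) => y + Ay; rewrite -e//; exact.
Qed.

Lemma cont_on_open_at (A : set T) (f : T -> U) x : open A -> A x ->
  cont_on A f -> {for x, continuous f}.
Proof.
move=> oA Ax h W /(h x Ax) => hW; have nA : nbhs x A by exact: open_nbhs_nbhs.
by apply: filterS2 nA hW => y Ay; exact.
Qed.

Lemma cont_on_local (A : set T) (f : T -> U) :
  (forall x, A x -> exists2 N : set T, nbhs x N & cont_on (A `&` N) f) ->
  cont_on A f.
Proof.
move=> h x Ax W Wx; have [N nN cN] := h x Ax.
have := cN x (conj Ax (nbhs_singleton nN)) W Wx.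
by apply: filterS2 nN => y Ny k Ay; exact: k.
Qed.

Lemma cont_on_cst (A : set T) (c : U) : cont_on A (fun=> c).
Proof. by move=> x _ W /nbhs_singleton Wc; apply: filterE. Qed.

End ContOn.

Lemma cont_on_pair {T U V : topologicalType} (A : set T) (f : T -> U) (g : T -> V) :
  cont_on A f -> cont_on A g -> cont_on A (fun x => (f x, g x)).
Proof.
move=> hf hg x Ax W [[B C]] /= [/(hf _ Ax) nB /(hg _ Ax) nC] BC.
by apply: filterS2 nB nC => y b c Ay; apply: BC; split; [exact: b|exact: c].
Qed.

Lemma cont_on_comp {T U V : topologicalType} (A : set T) (B : set U)
    (f : T -> U) (g : U -> V) : (forall x, A x -> B (f x)) ->
  cont_on A f -> cont_on B g -> cont_on A (fun x => g (f x)).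
Proof.
move=> AB hf hg x Ax W /(hg _ (AB _ Ax)) /(hf _ Ax).
by apply: filterS => y k Ay; exact: k (Ay) (AB _ Ay).
Qed.

Lemma continuous_pair {T U V : topologicalType} (f : T -> U) (g : T -> V) :
  continuous f -> continuous g -> continuous (fun x => (f x, g x)).
Proof. by move=> cf cg x; apply: cvg_pair; [exact: cf|exact: cg]. Qed.

Lemma openX {T U : topologicalType} (A : set T) (B : set U) :
  open A -> open B -> open (A `*` B).
Proof.
move=> oA oB; rewrite openE => -[x y] [Ax By]; exists (A, B) => //.
by split; exact: open_nbhs_nbhs.
Qed.

Section Lcs.
Context {R : realType}.
Implicit Types E F G : tvsType R.

Lemma cont_on_add (T : topologicalType) F (A : set T) (f g : T -> F) :
  cont_on A f -> cont_on A g -> cont_on A (fun x => f x + g x).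
Proof.
move=> hf hg; apply: (@cont_on_comp _ _ _ A setT (fun x => (f x, g x))
  (fun z : F * F => z.1 + z.2)) => //; first exact: cont_on_pair.
by apply: continuous_cont_on; exact: add_continuous.
Qed.

Lemma cont_on_scale (T : topologicalType) F (A : set T) (a : T -> R^o)
    (f : T -> F) :
  cont_on A a -> cont_on A f -> cont_on A (fun x => a x *: f x).
Proof.
move=> ha hf; apply: (@cont_on_comp _ _ _ A setT (fun x => (a x, f x))
  (fun z : R^o * F => z.1 *: z.2)) => //; first exact: cont_on_pair.
by apply: continuous_cont_on; exact: scale_continuous.
Qed.

Lemma continuous_add (T : topologicalType) F (f g : T -> F) :
  continuous f -> continuous g -> continuous (fun x => f x + g x).
Proof. by move=> cf cg; apply: cont_on_setT; apply: cont_on_add;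
  exact: continuous_cont_on. Qed.

Lemma continuous_scale (T : topologicalType) F (a : T -> R^o) (f : T -> F) :
  continuous a -> continuous f -> continuous (fun x => a x *: f x).
Proof. by move=> cf cg; apply: cont_on_setT; apply: cont_on_scale;
  exact: continuous_cont_on. Qed.

Definition cvx E (D : set E) := forall x y (a b : R), 0 <= a -> 0 <= b ->
  a + b = 1 -> D x -> D y -> D (a *: x + b *: y).

Lemma cvx_nbhs E (x : E) (W : set E) : nbhs x W ->
  exists D : set E, [/\ open D, cvx D, D x & D `<=` W].
Proof.
have [B Bc [Bo Bx]] := @locally_convex _ E.
move=> /(Bx x)[D [BD Dx] DW]; exists D; split => //; first exact: Bo.
move=> y z a b a0 b0 ab Dy Dz.
have cD : convex_set D by apply: Bc; rewrite inE.
have a1 : a <= 1 by rewrite -ab lerDl.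
have hl : (0 <= a <= 1)%R by rewrite a0 a1.
have := cD y z (Itv01 a0 a1) (mem_set Dy) (mem_set Dz).
rewrite inE /conv /= /unstable.onem /=.
by rewrite (_ : 1 - a = b)// -ab addrC addKr.
Qed.

(** All directional derivatives are treated as derivatives of curves, so that one set of rules
    serves [has_dirder], [is_d1] and [is_d2]. *)
Definition dcurve F (c : R -> F) (s : R) (d : F) : Prop :=
  (fun h : R => h^-1 *: (c (s + h) - c s)) @ (0 : R)^' --> d.

Lemma dcurve_near F (c : R -> F) s d D : dcurve c s d -> nbhs d D ->
  exists2 e : R, 0 < e & forall h : R, `|h| < e -> h != 0 ->
    D (h^-1 *: (c (s + h) - c s)).
Proof.
move=> cd /cd; rewrite /= /nbhs/= /dnbhs /within/= => -[e e0 he].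
exists e => // h hl h0; apply: he => //=.
by rewrite /ball_ sub0r normrN.
Qed.

Lemma dcurveP F (c : R -> F) s d :
  (forall D, nbhs d D -> exists2 e : R, 0 < e & forall h : R, `|h| < e ->
    h != 0 -> D (h^-1 *: (c (s + h) - c s))) -> dcurve c s d.
Proof.
move=> hD D /hD[e e0 he]; rewrite /= /nbhs/= /dnbhs /within/=.
by exists e => // h /=; rewrite /ball_ /= sub0r normrN => hl h0; exact: he.
Qed.

(** The s with c s - c 0 in s D have a supremum which is attained and, if it were below 1, could be
    passed: difference quotients near the supremum lie in [D], and by convexity ([glue]) the
    increments over adjacent intervals combine to a weighted mean. This takes the place of an
    integral or of the Hahn-Banach theorem. *)
Lemma mean_value_convex F (c : R -> F) (D : set F) : cvx D ->
  (forall s, 0 <= s <= 1 -> exists2 d, dcurve c s d & nbhs d D) ->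
  D (c 1 - c 0).
Proof.
move=> cD hD.
have hloc s : 0 <= s <= 1 -> exists2 e : R, 0 < e & forall h : R, `|h| < e ->
    h != 0 -> D (h^-1 *: (c (s + h) - c s)).
  by move=> /hD[d cd nd]; exact: dcurve_near cd nd.
pose P (s : R) := exists2 d, D d & c s - c 0 = s *: d.
have glue a b d : P a -> 0 <= a -> a < b -> D d -> c b - c a = (b - a) *: d ->
    P b.
  move=> [d' Dd' e'] a0 ab Dd e.
  have b0 : 0 < b by exact: le_lt_trans ab.
  exists ((a / b) *: d' + ((b - a) / b) *: d).
    apply: cD => //; first by rewrite divr_ge0// ltW.
      by rewrite divr_ge0 ?ltW// subr_gt0.
    by rewrite -mulrDl addrC subrK divff// gt_eqF.
  rewrite -(subrK (c a) (c b)) -addrA e e' scalerDr !scalerA addrC.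
  by rewrite !(mulrC b) !divfK ?gt_eqF.
have P0 : P 0.
  have [|d _ /nbhs_singleton Dd] := hD 0; first by rewrite lexx ler01.
  by exists d => //; rewrite subrr scale0r.
pose A := [set s : R | 0 <= s <= 1 /\ P s].
have A0 : A 0 by split => //; rewrite lexx ler01.
have sA : has_sup A by split; [exists 0|exists 1 => s [/andP[]]].
have s0 : 0 <= sup A by apply: ub_le_sup => //; exact: sA.2.
have s1 : sup A <= 1 by apply: ge_sup; [exists 0|move=> s [/andP[]]].
have [|e e0 he] := hloc (sup A); first by rewrite s0 s1.
have Ps : P (sup A).
  have [a [a01 Pa] ha] := sup_adherent e0 sA.
  have : a <= sup A by apply: ub_le_sup => //; exact: sA.2.
  rewrite le_eqVlt => /orP[/eqP <-//|alt].
  have h0 : a - sup A != 0 by rewrite subr_eq0 lt_eqF.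
  have hl : `|a - sup A| < e by rewrite ltr0_norm ?subr_lt0//; lra.
  apply: (glue a) (he _ hl h0) _ => //; first by case/andP: a01.
  rewrite subrKC -[sup A - a]opprB.
  by rewrite scaleNr scalerA divff// scale1r opprB.
have [s1'|] := ltP (sup A) 1; last first.
  move=> s1'; have e1 : sup A = 1 by apply/eqP; rewrite eq_le s1 s1'.
  by case: Ps => d Dd; rewrite e1 scale1r => ->.
pose b := Num.min 1 (sup A + e / 2).
have sb : sup A < b by rewrite lt_min s1' /=; lra.
have Pb : P b.
  have h0 : b - sup A != 0 by rewrite subr_eq0 gt_eqF.
  have hl : `|b - sup A| < e.
    rewrite gtr0_norm ?subr_gt0// ltrBlDr.
    by apply: (@le_lt_trans _ _ (sup A + e / 2)); [rewrite ge_min lexx orbT|lra].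
  apply: (glue _ _ _ Ps s0 sb (he _ hl h0)).
  by rewrite subrKC scalerA divff// scale1r.
have : b <= sup A.
  apply: ub_le_sup; first exact: sA.2.
  split => //; rewrite (le_trans s0 (ltW sb)) /= /b ge_min lexx//.
by rewrite leNgt sb.
Qed.

Definition clin E F (L : E -> F) : Prop :=
  [/\ {morph L : x y / x + y}, forall (a : R) x, L (a *: x) = a *: L x
    & continuous L].

Lemma clinB E F (L : E -> F) x y : clin L -> L (x - y) = L x - L y.
Proof. by case=> LD LZ _; rewrite -scaleN1r LD LZ scaleN1r. Qed.

Lemma clin0 E F (L : E -> F) : clin L -> L 0 = 0.
Proof. by move=> cL; rewrite -[X in L X](subrr 0) clinB// subrr. Qed.

Lemma dcurve_linear F G (L : F -> G) (c : R -> F) (s : R) d :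
  clin L -> dcurve c s d -> dcurve (fun t => L (c t)) s (L d).
Proof.
move=> cL cd; have [_ LZ Lc] := cL.
apply: cvg_trans (cvg_comp _ _ cd (Lc d)) => //.
by apply: near_eq_cvg; apply: nearW => h /=; rewrite LZ clinB.
Qed.

Lemma dcurve_scale F (c : R -> F) (a s : R) d :
  dcurve c s d -> dcurve (fun t => a *: c t) s (a *: d).
Proof.
apply: (@dcurve_linear _ _ (fun y => a *: y)); split=> [x y|k x|]; rewrite ?scalerDr ?scalerA 1?mulrC//.
by apply: continuous_scale => //; [move=> ?; exact: cvg_cst|move=> ?; exact: cvg_id].
Qed.

Lemma dcurve_reparam F (c : R -> F) (k s : R) d : k != 0 ->
  dcurve c (k * s) d -> dcurve (fun t => c (k * t)) s (k *: d).
Proof.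
move=> k0 cd; have {}cd := dcurve_scale (a := k) cd.
apply/dcurveP => D nD; have [e e0 he] := dcurve_near cd nD.
exists (e / `|k|) => [|h hl h0]; first by rewrite divr_gt0// normr_gt0.
have := he (k * h); rewrite normrM mulrC -ltr_pdivlMr ?normr_gt0// => /(_ hl).
rewrite mulf_neq0// => /(_ isT).
by rewrite -scalerBr scalerA invfM mulrAC mulVf// mul1r mulrDr.
Qed.

Lemma has_dirder_line E F (f : E -> F) x u (s : R) d :
  has_dirder f (x + s *: u) u d -> dcurve (fun t => f (x + t *: u)) s d.
Proof.
by apply: cvg_trans; apply: near_eq_cvg; apply: nearW => h /=;
  rewrite scalerDl addrA.
Qed.

Lemma has_dirderE E F (f : E -> F) x u d :
  has_dirder f x u d <-> dcurve (fun t => f (x + t *: u)) 0 d.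
Proof.
rewrite /dcurve /has_dirder scale0r addr0.
by under [X in _ <-> X @ _ --> _]funext do rewrite add0r.
Qed.

Lemma dcurve_uniq F (c : R -> F) s d d' : hausdorff_space F ->
  dcurve c s d -> dcurve c s d' -> d = d'.
Proof. by move=> hF; exact: cvg_unique. Qed.

Lemma has_dirder_uniq E F (f : E -> F) x u d d' : hausdorff_space F ->
  has_dirder f x u d -> has_dirder f x u d' -> d = d'.
Proof. by move=> hF; exact: cvg_unique. Qed.

(* The increment [f (c (s + h)) - f (c s)] is estimated by the mean value
   theorem on the segment from [c s] to [c (s + h)]. *)
Lemma chain_curve E F (O : set E) (f : E -> F) (df : E * E -> F) (c : R -> E) s u :
  open O -> (forall x v, O x -> has_dirder f x v (df (x, v))) ->
  cont_on (O `*` setT) df -> O (c s) -> dcurve c s u ->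
  dcurve (fun t => f (c t)) s (df (c s, u)).
Proof.
move=> oO hf cdf Oz cd; apply/dcurveP => W nW.
have [D [oD cD Dd DW]] := cvx_nbhs nW.
have [[A B] /= [nA nB] AB] : nbhs (c s, u) [set z | (O `*` setT) z -> D (df z)].
  by apply: cdf; [split|apply: open_nbhs_nbhs].
have nAO : nbhs (c s) (A `&` O) by apply: filterI => //; exact: open_nbhs_nbhs.
have [A' [oA' cA' A'z A'A]] := cvx_nbhs nAO.
pose P (z : R^o * E) := A' (c s + z.1 *: z.2).
have nP : nbhs (0 : R^o, u) P.
  have cP : continuous (fun z : R^o * E => c s + z.1 *: z.2).
    apply: continuous_add; first by move=> ?; exact: cvg_cst.
    exact: scale_continuous.
  by apply: (cP (0, u)); rewrite /= scale0r addr0; exact: open_nbhs_nbhs.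
have [[I B'] /= [nI nB'] IB'] := nP.
have /nbhs_ballP[e1 /= e10 he1] := nI; have nBB : nbhs u (B `&` B') by exact: filterI.
have [e2 e20 he2] := dcurve_near cd nBB.
exists (Num.min e1 e2) => [|h]; first by rewrite lt_min e10.
rewrite lt_min => /andP[h1 h2] h0; apply: DW.
set w := h^-1 *: (c (s + h) - c s); have [Bw B'w] : (B `&` B') w by exact: he2.
have ew : c (s + h) = c s + h *: w by rewrite scalerA divff// scale1r subrKC.
have ew' : h^-1 *: (f (c (s + h)) - f (c s)) = h^-1 *: (f (c s + h *: w) - f (c s)).
  by rewrite -ew.
rewrite ew' {ew' ew}; clearbody w.
have A'h : A' (c s + h *: w).
  apply: (IB' (h, w)); split => //; apply: he1.
  by rewrite /ball/= sub0r normrN.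
pose g (t : R) := h^-1 *: f (c s + (h * t) *: w).
suff : D (g 1 - g 0).
  by rewrite /g mulr1 mulr0 scale0r addr0 -scalerBr.
apply: mean_value_convex => // t /andP[t0 t1].
have Ax : A' (c s + (h * t) *: w).
  have -> : c s + (h * t) *: w = (1 - t) *: c s + t *: (c s + h *: w).
    by rewrite scalerDr addrA -scalerDl subrK scale1r scalerA mulrC.
  by apply: cA' => //; [rewrite subr_ge0|rewrite subrK].
have [Axx Oxx] := A'A _ Ax.
exists (df (c s + (h * t) *: w, w)); last first.
  by apply: open_nbhs_nbhs; split => //; exact: (AB (_, w)).
have -> : df (c s + (h * t) *: w, w) = h^-1 *: (h *: df (c s + (h * t) *: w, w)).
  by rewrite scalerA mulVf// scale1r.
apply: dcurve_scale; apply: (@dcurve_reparam _ (fun r => f (c s + r *: w))) => //.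
by apply: has_dirder_line; exact: hf.
Qed.

End Lcs.

Section DerivativeLemmas.
Context {R : realType}.
Implicit Types E F G : tvsType R.
Lemma dcurve_eq_near F (c c' : R -> F) (s e : R) d : 0 < e ->
  (forall h, `|h| < e -> c (s + h) = c' (s + h)) -> dcurve c s d -> dcurve c' s d.
Proof.
move=> e0 ce cd; apply/dcurveP => D /(dcurve_near cd)[e' e'0 he'].
exists (Num.min e e'); first by rewrite lt_min e0.
move=> h; rewrite lt_min => /andP[h1 h2] h0.
by rewrite -(ce h h1) -{2}[s]addr0 -(ce 0) ?normr0// addr0; exact: he'.
Qed.

Lemma open_line E (O : set E) y w : open O -> O y ->
  exists2 e : R, 0 < e & forall t, `|t| < e -> O (y + t *: w).
Proof.
move=> oO Oy.
have cP : continuous (fun t : R^o => y + t *: w).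
  apply: continuous_add; first by move=> ?; exact: cvg_cst.
  by apply: continuous_scale => ?; [exact: cvg_id|exact: cvg_cst].
have : nbhs (0 : R^o) [set t | O (y + t *: w)].
  by apply: (cP 0); rewrite scale0r addr0; exact: open_nbhs_nbhs.
move=> /nbhs_ballP[e /= e0 he]; exists e => // t te; apply: he.
by rewrite /ball/= sub0r normrN.
Qed.

Lemma dcurve_pair F G (c : R -> F) (c' : R -> G) s d d' :
  dcurve c s d -> dcurve c' s d' -> dcurve (fun t => (c t, c' t)) s (d, d').
Proof.
by move=> cd cd'; apply: cvg_trans (cvg_pair cd cd');
  apply: near_eq_cvg; apply: nearW.
Qed.

Lemma dcurve_add F (c c' : R -> F) s d d' :
  dcurve c s d -> dcurve c' s d' -> dcurve (fun t => c t + c' t) s (d + d').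
Proof.
move=> cd cd'; have cdd := dcurve_pair cd cd'.
apply: (@dcurve_linear _ _ _ (fun z : F * F => z.1 + z.2)) cdd.
split => [[x x'] [y y']|a [x x']|]/=; first exact: addrACA.
  by rewrite scalerDr.
exact: add_continuous.
Qed.

Lemma dcurve_cst F (u : F) s : dcurve (fun=> u) s 0.
Proof.
apply: (@cvg_trans _ ((fun=> 0) @ (0:R)^')); last exact: cvg_cst.
apply: near_eq_cvg; apply: nearW => h /=.
by rewrite subrr scaler0.
Qed.

Lemma dcurve_affine E F (L : E -> F) (c : F) x v s : clin L ->
  dcurve (fun t => L (x + t *: v) + c) s (L v).
Proof.
move=> cL; have [LD LZ _] := cL.
apply: (@cvg_trans _ ((fun=> L v) @ (0:R)^')); last exact: cvg_cst.
apply: near_eq_cvg; exists 1 => //= h _ h0.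
rewrite opprD addrACA subrr addr0 -clinB//.
rewrite opprD addrACA subrr add0r -scalerBl addrAC subrr add0r LZ.
by rewrite scalerA mulVf// scale1r.
Qed.

End DerivativeLemmas.

(** * Continuous linear maps *)

Section Clin.
Context {R : realType}.
Implicit Types E F G : tvsType R.

Lemma clin_id E : clin (@id E).
Proof. by split=> // x; exact: cvg_id. Qed.

Lemma clin_zero E F : clin (fun=> 0 : F) (E := E).
Proof.
by split=> [x y|a x|x]; rewrite ?addr0 ?scaler0//; exact: cvg_cst.
Qed.

Lemma clin_comp E F G (L : E -> F) (L' : F -> G) :
  clin L -> clin L' -> clin (fun x => L' (L x)).
Proof.
move=> [LD LZ Lc] [LD' LZ' Lc']; split=> [x y|a x|x].
- by rewrite LD LD'.
- by rewrite LZ LZ'.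
- exact: continuous_comp (Lc x) (Lc' _).
Qed.

Lemma clin_pair E F G (L : E -> F) (L' : E -> G) :
  clin L -> clin L' -> clin (fun x => (L x, L' x)).
Proof.
move=> [LD LZ Lc] [LD' LZ' Lc']; split=> [x y|a x|].
- by rewrite LD LD'.
- by rewrite LZ LZ'.
- exact: continuous_pair.
Qed.

Lemma clin_fst E F : clin (@fst E F).
Proof. by split=> // x; exact: cvg_fst. Qed.

Lemma clin_snd E F : clin (@snd E F).
Proof. by split=> // x; exact: cvg_snd. Qed.

Lemma clin_fst_comp E F G (L : G -> E * F) : clin L -> clin (fun x => (L x).1).
Proof. by move=> cL; apply: clin_comp cL _; exact: clin_fst. Qed.

Lemma clin_snd_comp E F G (L : G -> E * F) : clin L -> clin (fun x => (L x).2).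
Proof. by move=> cL; apply: clin_comp cL _; exact: clin_snd. Qed.

Lemma clin_add E F (L L' : E -> F) : clin L -> clin L' -> clin (fun x => L x + L' x).
Proof.
move=> [LD LZ Lc] [LD' LZ' Lc']; split=> [x y|a x|].
- by rewrite LD LD' addrACA.
- by rewrite LZ LZ' scalerDr.
- exact: continuous_add.
Qed.

Lemma clin_scale E F (L : E -> F) (a : R) : clin L -> clin (fun x => a *: L x).
Proof.
move=> [LD LZ Lc]; split=> [x y|b x|].
- by rewrite LD scalerDr.
- by rewrite LZ !scalerA mulrC.
- by apply: continuous_scale => // ?; exact: cvg_cst.
Qed.

Lemma clin_scalel E F (L : E -> R^o) (u : F) : clin L -> clin (fun x => L x *: u).
Proof.
move=> [LD LZ Lc]; split=> [x y|b x|].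
- by rewrite LD scalerDl.
- by rewrite LZ scalerA.
- by apply: continuous_scale => // ?; exact: cvg_cst.
Qed.

Lemma cont_clin E F (L : E -> F) (A : set E) : clin L -> cont_on A L.
Proof. by move=> [_ _ Lc]; exact: continuous_cont_on. Qed.

Lemma cont_on_fst E F (A : set (E * F)) : cont_on A fst.
Proof. exact: cont_clin (clin_fst _ _). Qed.

Lemma cont_on_snd E F (A : set (E * F)) : cont_on A snd.
Proof. exact: cont_clin (clin_snd _ _). Qed.

Lemma cont_on_id E (A : set E) : cont_on A id.
Proof. exact: cont_clin (clin_id _). Qed.

End Clin.

#[global] Hint Resolve clin_id clin_zero clin_fst clin_snd clin_pair
  clin_fst_comp clin_snd_comp : clin.

(** * The classes C^{k,l} and C^n in recursive form *)

Section ClassQ.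
Context {R : realType}.
Implicit Types (E F G : tvsType R) (k l : nat).

Definition is_d1 E1 E2 F (O1 : set E1) (O2 : set E2) (f : E1 * E2 -> F)
    (g : (E1 * E1) * E2 -> F) := forall x v y, O1 x -> O2 y ->
  dcurve (fun t => f (x + t *: v, y)) 0 (g ((x, v), y)).

Definition is_d2 E1 E2 F (O1 : set E1) (O2 : set E2) (f : E1 * E2 -> F)
    (g : E1 * (E2 * E2) -> F) := forall x y w, O1 x -> O2 y ->
  dcurve (fun t => f (x, y + t *: w)) 0 (g (x, (y, w))).

(* Recursive version of the C^{k,l} property: the partial differentials, which
   extend continuously from the [O]'s to the [S]'s, are again of this kind as
   functions on the tangent bundles. When [k = 0], the first variable is a
   mere parameter and [O1] need not be open. *)
Fixpoint Q (k : nat) : nat -> forall E1 E2 F, set E1 -> set E1 -> set E2 ->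
    set E2 -> (E1 * E2 -> F) -> Prop :=
  fix Qk (l : nat) := fun E1 E2 F S1 O1 S2 O2 f =>
  [/\ cont_on (S1 `*` S2) f,
      if l is l'.+1 then exists2 g : E1 * (E2 * E2)%type -> F, is_d2 O1 O2 f g &
        Qk l' E1 (E2 * E2)%type F S1 O1 (S2 `*` setT) (O2 `*` setT) g
      else True &
      if k is k'.+1 then exists2 g : (E1 * E1)%type * E2 -> F, is_d1 O1 O2 f g &
        Q k' l (S1 `*` setT) (O1 `*` setT) S2 O2 g
      else True].

Lemma QE k l E1 E2 F (S1 O1 : set E1) (S2 O2 : set E2) (f : E1 * E2 -> F) :
  Q k l S1 O1 S2 O2 f <->
  [/\ cont_on (S1 `*` S2) f,
      forall l', l = l'.+1 -> exists2 g : E1 * (E2 * E2)%type -> F,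
        is_d2 O1 O2 f g & Q k l' S1 O1 (S2 `*` setT) (O2 `*` setT) g &
      forall k', k = k'.+1 -> exists2 g : (E1 * E1)%type * E2 -> F,
        is_d1 O1 O2 f g & Q k' l (S1 `*` setT) (O1 `*` setT) S2 O2 g].
Proof.
case: k l => [|k] [|l]; split=> -[c h h']; split=> //=.
- by move=> l' [<-].
- exact: h.
- by move=> l' [<-].
- exact: h'.
- by move=> l' [<-].
- by move=> l' [<-].
- exact: h.
- exact: h'.
Qed.

Lemma Qrec (P : nat -> nat -> Prop) :
  (forall k l, (forall l', l = l'.+1 -> P k l') ->
    (forall k', k = k'.+1 -> P k' l) -> P k l) -> forall k l, P k l.
Proof.
move=> h; elim=> [|k IHk]; elim=> [|l IHl]; apply: h => //.
- by move=> l' [<-].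
- by move=> k' [<-].
- by move=> l' [<-].
- by move=> k' [<-].
Qed.

Lemma Q_cont k l E1 E2 F (S1 O1 : set E1) (S2 O2 : set E2) (f : E1 * E2 -> F) :
  Q k l S1 O1 S2 O2 f -> cont_on (S1 `*` S2) f.
Proof. by case/QE. Qed.

Lemma Q_sub k l E1 E2 F (S1 O1 S1' O1' : set E1) (S2 O2 S2' O2' : set E2)
    (f : E1 * E2 -> F) :
  S1' `<=` S1 -> O1' `<=` O1 -> S2' `<=` S2 -> O2' `<=` O2 ->
  Q k l S1 O1 S2 O2 f -> Q k l S1' O1' S2' O2' f.
Proof.
move: k l E1 E2 S1 O1 S1' O1' S2 O2 S2' O2' f.
apply: Qrec => k l IHl IHk E1 E2 S1 O1 S1' O1' S2 O2 S2' O2' f h1 h2 h3 h4.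
move=> /QE[cf hl hk]; apply/QE; split.
- by apply: cont_on_sub cf => -[x y] [/h1 + /h3].
- move=> l' e; have [g dg Qg] := hl _ e; exists g.
    by move=> x y w /h2 Ox /h4 Oy; exact: dg.
  by apply: (IHl _ e) Qg => // -[y w] [/= ? _]; split => //=; [exact: h3|exact: h4].
- move=> l' e; have [g dg Qg] := hk _ e; exists g.
    by move=> x y w /h2 Ox /h4 Oy; exact: dg.
  by apply: (IHk _ e) Qg => // -[y w] [/= ? _]; split => //=; [exact: h1|exact: h2].
Qed.

Lemma Q_le k l k' l' E1 E2 F (S1 O1 : set E1) (S2 O2 : set E2)
    (f : E1 * E2 -> F) : (k' <= k)%N -> (l' <= l)%N ->
  Q k l S1 O1 S2 O2 f -> Q k' l' S1 O1 S2 O2 f.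
Proof.
move: k l k' l' E1 E2 S1 O1 S2 O2 f.
apply: Qrec => k l IHl IHk k' l' E1 E2 S1 O1 S2 O2 f hk hl.
move=> /QE[cf gl gk]; apply/QE; split => //.
- move=> m e; move: hl; rewrite e; case: l IHl IHk gl gk => // l IHl IHk gl gk.
  have [g dg Qg] := gl _ erefl; rewrite ltnS => hl; exists g => //.
  exact: (IHl _ erefl) Qg.
- move=> m e; move: hk; rewrite e; case: k IHl IHk gl gk => // k IHl IHk gl gk.
  have [g dg Qg] := gk _ erefl; rewrite ltnS => hk; exists g => //.
  exact: (IHk _ erefl) Qg.
Qed.

(** A derivative only sees the function on short segments, and these stay inside the open sets [O1]
    and [O2]. For k = 0 no segment in the first variable occurs. *)
Lemma Q_ext k l E1 E2 F (S1 O1 : set E1) (S2 O2 : set E2) (f f' : E1 * E2 -> F) :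
  ((0 < k)%N -> open O1) -> open O2 -> O1 `<=` S1 -> O2 `<=` S2 ->
  (forall x y, S1 x -> S2 y -> f (x, y) = f' (x, y)) ->
  Q k l S1 O1 S2 O2 f -> Q k l S1 O1 S2 O2 f'.
Proof.
move=> oO1 oO2 OS1 OS2 e /QE[cf hl hk]; apply/QE; split.
- by apply: cont_on_eq cf => -[x y] [/= ? ?]; exact: e.
- move=> l' el; have [g dg Qg] := hl _ el; exists g => // x y w Ox Oy.
  have [r r0 hr] := open_line w oO2 Oy.
  apply: dcurve_eq_near (r0) _ (dg x y w Ox Oy) => h hhr; rewrite add0r.
  by apply: e; [exact: OS1|exact/OS2/hr].
- move=> k' ek; have [g dg Qg] := hk _ ek; exists g => // x v y Ox Oy.
  have oO1' : open O1 by apply: oO1; rewrite ek.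
  have [r r0 hr] := open_line v oO1' Ox.
  apply: dcurve_eq_near (r0) _ (dg x v y Ox Oy) => h hhr; rewrite add0r.
  by apply: e; [exact/OS1/hr|exact: OS2].
Qed.

Lemma Q_pair k l E1 E2 F G (S1 O1 : set E1) (S2 O2 : set E2)
    (f : E1 * E2 -> F) (f' : E1 * E2 -> G) :
  Q k l S1 O1 S2 O2 f -> Q k l S1 O1 S2 O2 f' ->
  Q k l S1 O1 S2 O2 (fun z => (f z, f' z)).
Proof.
move: k l E1 E2 S1 O1 S2 O2 f f'.
apply: Qrec => k l IHl IHk E1 E2 S1 O1 S2 O2 f f' /QE[cf hl hk] /QE[cf' hl' hk'].
apply/QE; split; first exact: cont_on_pair.
- move=> m e; have [g dg Qg] := hl _ e; have [g' dg' Qg'] := hl' _ e.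
  exists (fun z => (g z, g' z)); last exact: (IHl _ e).
  by move=> x y w Ox Oy; apply: dcurve_pair; [exact: dg|exact: dg'].
- move=> m e; have [g dg Qg] := hk _ e; have [g' dg' Qg'] := hk' _ e.
  exists (fun z => (g z, g' z)); last exact: (IHk _ e).
  by move=> x y w Ox Oy; apply: dcurve_pair; [exact: dg|exact: dg'].
Qed.

Lemma Q_linear k l E1 E2 F G (S1 O1 : set E1) (S2 O2 : set E2)
    (f : E1 * E2 -> F) (L : F -> G) : clin L ->
  Q k l S1 O1 S2 O2 f -> Q k l S1 O1 S2 O2 (fun z => L (f z)).
Proof.
move=> cL; move: k l E1 E2 S1 O1 S2 O2 f.
apply: Qrec => k l IHl IHk E1 E2 S1 O1 S2 O2 f /QE[cf hl hk].
apply/QE; split.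
- by apply: (@cont_on_comp _ _ _ _ setT) cf _ => //; exact: cont_clin.
- move=> m e; have [g dg Qg] := hl _ e.
  exists (fun z => L (g z)); last exact: (IHl _ e).
  by move=> x y w Ox Oy; apply: dcurve_linear => //; exact: dg.
- move=> m e; have [g dg Qg] := hk _ e.
  exists (fun z => L (g z)); last exact: (IHk _ e).
  by move=> x y w Ox Oy; apply: dcurve_linear => //; exact: dg.
Qed.

Lemma Q_add k l E1 E2 F (S1 O1 : set E1) (S2 O2 : set E2)
    (f f' : E1 * E2 -> F) :
  Q k l S1 O1 S2 O2 f -> Q k l S1 O1 S2 O2 f' ->
  Q k l S1 O1 S2 O2 (fun z => f z + f' z).
Proof.
move=> Qf Qf'; apply: (@Q_linear _ _ _ _ _ _ _ _ _ _ (fun z => (f z, f' z))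
  (fun z : F * F => z.1 + z.2)); last exact: Q_pair.
by apply: clin_add; eauto with clin.
Qed.

Lemma Q_cst k l E1 E2 F (S1 O1 : set E1) (S2 O2 : set E2) (u : F) :
  Q k l S1 O1 S2 O2 (fun=> u).
Proof.
move: k l E1 E2 u S1 O1 S2 O2.
apply: Qrec => k l IHl IHk E1 E2 u S1 O1 S2 O2; apply/QE; split.
- exact: cont_on_cst.
- move=> m e; exists (fun=> 0); last exact: (IHl _ e).
  by move=> x y w Ox Oy; exact: dcurve_cst.
- move=> m e; exists (fun=> 0); last exact: (IHk _ e).
  by move=> x y w Ox Oy; exact: dcurve_cst.
Qed.

(** Affine maps send lines to lines, so difference quotients are carried over literally instead of
    by the chain rule. *)
Lemma Q_affine k l E1 E2 F1 F2 F (S1 O1 : set E1) (S2 O2 : set E2)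
    (S1' O1' : set F1) (S2' O2' : set F2) (A1 : F1 -> E1) (A2 : F2 -> E2)
    (c1 : E1) (c2 : E2) (f : E1 * E2 -> F) : clin A1 -> clin A2 ->
  (forall x, S1' x -> S1 (A1 x + c1)) -> (forall x, O1' x -> O1 (A1 x + c1)) ->
  (forall y, S2' y -> S2 (A2 y + c2)) -> (forall y, O2' y -> O2 (A2 y + c2)) ->
  Q k l S1 O1 S2 O2 f ->
  Q k l S1' O1' S2' O2' (fun z => f (A1 z.1 + c1, A2 z.2 + c2)).
Proof.
move: k l E1 E2 F1 F2 S1 O1 S2 O2 S1' O1' S2' O2' A1 A2 c1 c2 f.
apply: Qrec => k l IHl IHk E1 E2 F1 F2 S1 O1 S2 O2 S1' O1' S2' O2' A1 A2 c1 c2 f.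
move=> cA1 cA2 h1 h2 h3 h4 /QE[cf hl hk].
apply/QE; split.
- apply: (@cont_on_comp _ _ _ _ (S1 `*` S2)
    (fun z : F1 * F2 => (A1 z.1 + c1, A2 z.2 + c2))) cf.
    by move=> [x y] [/= Sx Sy]; split; [exact: h1|exact: h3].
  apply: continuous_cont_on; apply: continuous_pair; apply: continuous_add.
  + by have [_ _] : clin (fun z : F1 * F2 => A1 z.1) by apply: clin_comp cA1; exact: clin_fst.
  + by move=> ?; exact: cvg_cst.
  + by have [_ _] : clin (fun z : F1 * F2 => A2 z.2) by apply: clin_comp cA2; exact: clin_snd.
  + by move=> ?; exact: cvg_cst.
- move=> m e; have [g dg Qg] := hl _ e.
  exists (fun z => g (A1 z.1 + c1, (A2 z.2.1 + c2, A2 z.2.2))).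
    move=> x y w Ox Oy; have := dg _ _ (A2 w) (h2 _ Ox) (h4 _ Oy).
    case: cA2 => AD AZ _; apply: dcurve_eq_near ltr01 _ => h _ /=.
    by rewrite AD AZ addrAC.
  have cA : clin (fun z : F2 * F2 => (A2 z.1, A2 z.2)).
    by apply: clin_pair; apply: clin_comp cA2; eauto with clin.
  have := IHl _ e _ _ _ _ _ _ _ _ S1' O1' (S2' `*` setT) (O2' `*` setT)
    _ _ c1 (c2, 0) _ cA1 cA h1 h2 _ _ Qg.
  rewrite [X in _ -> _ -> Q _ _ _ _ _ _ X](_ : _ =
    fun z => g (A1 z.1 + c1, (A2 z.2.1 + c2, A2 z.2.2))); last first.
    apply/funext => -[x [y w]] /=; congr (g (_, _)).
    by rewrite -[LHS]/(A2 y + c2, A2 w + 0) addr0.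
  apply.
    by move=> [y w] [/= Sy _]; split => //; exact: h3.
  by move=> [y w] [/= Oy _]; split => //; exact: h4.
- move=> m e; have [g dg Qg] := hk _ e.
  exists (fun z => g ((A1 z.1.1 + c1, A1 z.1.2), A2 z.2 + c2)).
    move=> x v y Ox Oy; have := dg _ (A1 v) _ (h2 _ Ox) (h4 _ Oy).
    case: cA1 => AD AZ _; apply: dcurve_eq_near ltr01 _ => h _ /=.
    by rewrite AD AZ addrAC.
  have cA : clin (fun z : F1 * F1 => (A1 z.1, A1 z.2)).
    by apply: clin_pair; apply: clin_comp cA1; eauto with clin.
  have := IHk _ e _ _ _ _ _ _ _ _ (S1' `*` setT) (O1' `*` setT) S2' O2'
    _ _ (c1, 0) c2 _ cA cA2 _ _ h3 h4 Qg.
  rewrite [X in _ -> _ -> Q _ _ _ _ _ _ X](_ : _ =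
    fun z => g ((A1 z.1.1 + c1, A1 z.1.2), A2 z.2 + c2)); last first.
    apply/funext => -[[x v] y] /=; congr (g (_, _)).
    by rewrite -[LHS]/(A1 x + c1, A1 v + 0) addr0.
  apply.
    by move=> [y w] [/= Sy _]; split => //; exact: h1.
  by move=> [y w] [/= Oy _]; split => //; exact: h2.
Qed.

Lemma Q_fst k l E1 E2 E3 F (S1 O1 : set E1) (S2 O2 : set E2)
    (f : E1 * E2 -> F) : Q k l S1 O1 S2 O2 f ->
  Q k l S1 O1 (S2 `*` [set: E3]) (O2 `*` setT) (fun z => f (z.1, z.2.1)).
Proof.
move=> /(@Q_affine k l E1 E2 E1 (E2 * E3)%type F S1 O1 S2 O2 S1 O1
  (S2 `*` [set: E3]) (O2 `*` setT) id fst 0 0) H.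
have -> : (fun z : E1 * (E2 * E3) => f (z.1, z.2.1)) =
          (fun z => f (z.1 + 0, z.2.1 + 0)).
  by apply/funext => z; rewrite !addr0.
by apply: H; eauto with clin; move=> x; rewrite ?addr0//; case.
Qed.

Lemma Q_fst1 k l E1 E2 E3 F (S1 O1 : set E1) (S2 O2 : set E2)
    (f : E1 * E2 -> F) : Q k l S1 O1 S2 O2 f ->
  Q k l (S1 `*` [set: E3]) (O1 `*` setT) S2 O2 (fun z => f (z.1.1, z.2)).
Proof.
move=> /(@Q_affine k l E1 E2 (E1 * E3)%type E2 F S1 O1 S2 O2
  (S1 `*` [set: E3]) (O1 `*` setT) S2 O2 fst id 0 0) H.
have -> : (fun z : (E1 * E3) * E2 => f (z.1.1, z.2)) =
          (fun z => f (z.1.1 + 0, z.2 + 0)).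
  by apply/funext => z; rewrite !addr0.
by apply: H; eauto with clin; move=> x; rewrite ?addr0//; case.
Qed.

Lemma Q_param l E1 E2 E3 F (S1 O1 : set E1) (S2 O2 : set E2) (S3 O3 : set E3)
    (p : E3 -> E1) (f : E1 * E2 -> F) : cont_on S3 p ->
  (forall x, S3 x -> S1 (p x)) -> (forall x, O3 x -> O1 (p x)) ->
  Q 0 l S1 O1 S2 O2 f -> Q 0 l S3 O3 S2 O2 (fun z => f (p z.1, z.2)).
Proof.
move=> cp h1 h2; elim: l E2 S2 O2 f => [|l IH] E2 S2 O2 f /QE[cf hl _];
  apply/QE; split => //.
- apply: (@cont_on_comp _ _ _ _ (S1 `*` S2) (fun z : E3 * E2 => (p z.1, z.2))) cf.
    by move=> [x y] [/= Sx Sy]; split => //; exact: h1.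
  apply: cont_on_pair; last exact: cont_on_snd.
  by apply: (@cont_on_comp _ _ _ _ S3 fst) cp => [[x y] []//|]; exact: cont_on_fst.
- apply: (@cont_on_comp _ _ _ _ (S1 `*` S2) (fun z : E3 * E2 => (p z.1, z.2))) cf.
    by move=> [x y] [/= Sx Sy]; split => //; exact: h1.
  apply: cont_on_pair; last exact: cont_on_snd.
  by apply: (@cont_on_comp _ _ _ _ S3 fst) cp => [[x y] []//|]; exact: cont_on_fst.
- move=> l' e; have [g dg Qg] := hl _ e; exists (fun z => g (p z.1, z.2)).
    by move=> x y w Ox Oy; apply: dg => //; exact: h2.
  by case: e Qg => <-; exact: IH.
Qed.

(** A dummy real parameter turns C^n-maps into a case of [Q], so that all rules for [Q] apply to
    them. *)
Definition C n E F (S O : set E) (f : E -> F) :=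
  Q 0 n [set: R^o] setT S O (fun z => f z.2).

Lemma C_cont n E F (S O : set E) (f : E -> F) : C n S O f -> cont_on S f.
Proof.
move=> /Q_cont cf; apply: (@cont_on_comp _ _ _ _ (setT `*` S)
  (fun x : E => (0 : R^o, x))) cf => //.
by apply: cont_on_pair; [exact: cont_on_cst|exact: cont_on_id].
Qed.

Lemma C0 E F (S O : set E) (f : E -> F) : cont_on S f -> C 0 S O f.
Proof.
move=> cf; apply/QE; split => //.
by apply: (@cont_on_comp _ _ _ _ S snd) cf => [[x y] []//|]; exact: cont_on_snd.
Qed.

Lemma C_S n E F (S O : set E) (f : E -> F) (df : E * E -> F) : cont_on S f ->
  (forall x v, O x -> dcurve (fun t => f (x + t *: v)) 0 (df (x, v))) ->
  C n (S `*` setT) (O `*` setT) df -> C n.+1 S O f.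
Proof.
move=> cf hf Cdf; apply/QE; split => //.
  exact: Q_cont (C0 O cf).
by move=> l' [<-]; exists (fun z => df z.2) => // x y w _; exact: hf.
Qed.

Lemma C_inv n E F (S O : set E) (f : E -> F) : C n.+1 S O f ->
  exists2 df : E * E -> F,
  (forall x v, O x -> dcurve (fun t => f (x + t *: v)) 0 (df (x, v))) &
  C n (S `*` setT) (O `*` setT) df.
Proof.
move=> /QE[_ /(_ n erefl)[g dg Qg] _]; exists (fun z => g (0, z)).
  by move=> x v Ox; exact: (dg 0 x v).
by apply: (@Q_param _ _ _ _ _ _ _ _ _ _ _ (fun=> 0)) Qg => //; exact: cont_on_cst.
Qed.

Lemma C_affine n E F (S O : set E) (L : E -> F) (c : F) : clin L ->
  C n S O (fun x => L x + c).
Proof.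
elim: n E F S O L c => [|n IH] E F S O L c cL.
  by apply: C0; apply: cont_on_add; [exact: cont_clin|exact: cont_on_cst].
apply: (@C_S _ _ _ _ _ _ (fun z => L z.2 + 0)).
- by apply: cont_on_add; [exact: cont_clin|exact: cont_on_cst].
- by move=> x v _; rewrite addr0; exact: dcurve_affine.
- by apply: IH; exact: clin_comp (clin_snd _ _) cL.
Qed.

Lemma C_lin n E F (S O : set E) (L : E -> F) : clin L -> C n S O L.
Proof.
by move=> cL; have := C_affine n S O 0 cL; under eq_fun do rewrite addr0.
Qed.

Lemma C_cst n E F (S O : set E) (c : F) : C n S O (fun=> c).
Proof. exact: Q_cst. Qed.

Lemma C_le n m E F (S O : set E) (f : E -> F) : (m <= n)%N ->
  C n S O f -> C m S O f.
Proof. exact: Q_le. Qed.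

Lemma C_sub n E F (S O S' O' : set E) (f : E -> F) : S' `<=` S -> O' `<=` O ->
  C n S O f -> C n S' O' f.
Proof. by move=> ? ?; exact: Q_sub. Qed.

Lemma C_ext n E F (S O : set E) (f f' : E -> F) : open O -> O `<=` S ->
  (forall x, S x -> f x = f' x) -> C n S O f -> C n S O f'.
Proof. by move=> oO OS e; apply: Q_ext => // x y _ ; exact: e. Qed.

Lemma C_pair n E F G (S O : set E) (f : E -> F) (f' : E -> G) :
  C n S O f -> C n S O f' -> C n S O (fun x => (f x, f' x)).
Proof. exact: Q_pair. Qed.

Lemma C_fst n E E' F (S O : set E) (f : E -> F) : C n S O f ->
  C n (S `*` [set: E']) (O `*` setT) (fun z => f z.1).
Proof. exact: Q_fst. Qed.

(** The differential of g o f is dg o (f, df), again a composition with a map of the same kind on a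
    tangent bundle. Each derivative, in either variable, costs one order of [g]; hence the order k +
    l. *)
Lemma Q_comp k l E1 E2 F G (S1 O1 : set E1) (S2 O2 : set E2) (S O : set F)
    (f : E1 * E2 -> F) (g : F -> G) : open O -> O `<=` S ->
  (forall x y, S1 x -> S2 y -> S (f (x, y))) ->
  (forall x y, O1 x -> O2 y -> O (f (x, y))) ->
  Q k l S1 O1 S2 O2 f -> C (k + l) S O g ->
  Q k l S1 O1 S2 O2 (fun z => g (f z)).
Proof.
move: k l E1 E2 F S1 O1 S2 O2 S O f g.
apply: Qrec => k l IHl IHk E1 E2 F S1 O1 S2 O2 S O f g oO OS h1 h2 Qf Cg.
have /QE[cf hl hk] := Qf; apply/QE; split.
- apply: (@cont_on_comp _ _ _ _ S f) cf (C_cont Cg) => -[x y] [Sx Sy].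
  exact: h1.
- move=> l' e; move: Cg; rewrite e addnS => Cg.
  have [dg hdg Cdg] := C_inv Cg; have [f2 df2 Qf2] := hl _ e.
  exists (fun z => dg (f (z.1, z.2.1), f2 z)).
    move=> x y w Ox Oy.
    have := @chain_curve R F G O g dg (fun t => f (x, y + t *: w)) 0
      (f2 (x, (y, w))) oO.
    rewrite scale0r addr0; apply.
    + by move=> u v Ou; apply/has_dirderE; exact: hdg.
    + by apply: cont_on_sub (C_cont Cdg) => -[u v] [/OS].
    + exact: h2.
    + exact: df2.
  apply: (IHl _ e _ _ _ _ _ _ _ (S `*` setT) (O `*` setT)
    (fun z => (f (z.1, z.2.1), f2 z)) dg) Cdg.
  + by apply: openX => //; exact: openT.
  + by move=> [u v] [/OS].
  + by move=> x [y w] Sx [/= Sy _]; split => //; exact: h1.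
  + by move=> x [y w] Ox [/= Oy _]; split => //; exact: h2.
  + by apply: Q_pair Qf2; apply: Q_fst; apply: Q_le Qf; rewrite ?e.
- move=> k' e; move: Cg; rewrite e addSn => Cg.
  have [dg hdg Cdg] := C_inv Cg; have [f1 df1 Qf1] := hk _ e.
  exists (fun z => dg (f (z.1.1, z.2), f1 z)).
    move=> x v y Ox Oy.
    have := @chain_curve R F G O g dg (fun t => f (x + t *: v, y)) 0
      (f1 ((x, v), y)) oO.
    rewrite scale0r addr0; apply.
    + by move=> u u' Ou; apply/has_dirderE; exact: hdg.
    + by apply: cont_on_sub (C_cont Cdg) => -[u u'] [/OS].
    + exact: h2.
    + exact: df1.
  apply: (IHk _ e _ _ _ _ _ _ _ (S `*` setT) (O `*` setT)
    (fun z => (f (z.1.1, z.2), f1 z)) dg) Cdg.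
  + by apply: openX => //; exact: openT.
  + by move=> [u v] [/OS].
  + by move=> [x v] y [/= Sx _] Sy; split => //; exact: h1.
  + by move=> [x v] y [/= Ox _] Oy; split => //; exact: h2.
  + by apply: Q_pair Qf1; apply: Q_fst1; apply: Q_le Qf; rewrite ?e.
Qed.

End ClassQ.

#[global] Arguments Q {R} k l {E1 E2 F} S1 O1 S2 O2 f : simpl never.
#[global] Arguments C {R} n {E F} S O f : simpl never.

Section ClassQ2.
Context {R : realType}.
Implicit Types (E F G : tvsType R) (k l : nat).
(** The inner maps keep the two variables apart; so, unlike in [Q_comp], each of them only has to
    match the order of its own variable. *)
Lemma Q_precomp k l E1 E2 E1' E2' F (S1 O1 : set E1) (S2 O2 : set E2)
    (S1' O1' : set E1') (S2' O2' : set E2') (p1 : E1' -> E1) (p2 : E2' -> E2)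
    (f : E1 * E2 -> F) : ((0 < k)%N -> open O1) -> open O2 -> O1 `<=` S1 ->
  O2 `<=` S2 ->
  (forall x, S1' x -> S1 (p1 x)) -> (forall x, O1' x -> O1 (p1 x)) ->
  (forall y, S2' y -> S2 (p2 y)) -> (forall y, O2' y -> O2 (p2 y)) ->
  C k S1' O1' p1 -> C l S2' O2' p2 -> Q k l S1 O1 S2 O2 f ->
  Q k l S1' O1' S2' O2' (fun z => f (p1 z.1, p2 z.2)).
Proof.
move: k l E1 E2 E1' E2' S1 O1 S2 O2 S1' O1' S2' O2' p1 p2 f.
apply: Qrec => k l IHl IHk E1 E2 E1' E2' S1 O1 S2 O2 S1' O1' S2' O2' p1 p2 f.
move=> oO1 oO2 OS1 OS2 h1 h2 h3 h4 C1 C2 /QE[cf hl hk]; apply/QE; split.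
- apply: (@cont_on_comp _ _ _ _ (S1 `*` S2)
    (fun z : E1' * E2' => (p1 z.1, p2 z.2))) cf.
    by move=> [x y] [/= Sx Sy]; split; [exact: h1|exact: h3].
  apply: cont_on_pair.
    by apply: (@cont_on_comp _ _ _ _ S1' fst) (C_cont C1) => [[x y] []//|];
      exact: cont_on_fst.
  by apply: (@cont_on_comp _ _ _ _ S2' snd) (C_cont C2) => [[x y] []//|];
    exact: cont_on_snd.
- move=> m e; have [g dg Qg] := hl _ e; subst l.
  have [dp hdp Cdp] := C_inv C2.
  exists (fun z => g (p1 z.1, (p2 z.2.1, dp z.2))).
    move=> x y w Ox Oy.
    have := @chain_curve R E2 F O2 (fun u => f (p1 x, u)) (fun u => g (p1 x, u))
      (fun t => p2 (y + t *: w)) 0 (dp (y, w)) oO2.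
    rewrite scale0r addr0; apply.
    + by move=> u v Ou; apply/has_dirderE; apply: dg => //; exact: h2.
    + apply: (@cont_on_comp _ _ _ _ (S1 `*` (S2 `*` setT)) (fun u => (p1 x, u)))
        (Q_cont Qg) => [[u v] [/= Ou _]|].
        by split => /=; [exact/OS1/h2|split => //; exact: OS2].
      by apply: cont_on_pair; [exact: cont_on_cst|exact: cont_on_id].
    + exact: h4.
    + exact: hdp.
  apply: (IHl _ erefl _ _ _ _ _ O1 (S2 `*` setT) (O2 `*` setT) _ O1'
    (S2' `*` setT) (O2' `*` setT) p1 (fun z => (p2 z.1, dp z))) Qg => //.
  + by apply: openX => //; exact: openT.
  + by move=> [u v] [/OS2].
  + by move=> [y w] [/= Sy _]; split => //; exact: h3.
  + by move=> [y w] [/= Oy _]; split => //; exact: h4.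
  + by apply: C_pair Cdp; apply: C_fst; apply: C_le C2.
- move=> m e; have [g dg Qg] := hk _ e; subst k.
  have [dp hdp Cdp] := C_inv C1; have {}oO1 := oO1 isT.
  exists (fun z => g ((p1 z.1.1, dp z.1), p2 z.2)).
    move=> x v y Ox Oy.
    have := @chain_curve R E1 F O1 (fun u => f (u, p2 y)) (fun u => g (u, p2 y))
      (fun t => p1 (x + t *: v)) 0 (dp (x, v)) oO1.
    rewrite scale0r addr0; apply.
    + by move=> u u' Ou; apply/has_dirderE; apply: dg => //; exact: h4.
    + apply: (@cont_on_comp _ _ _ _ ((S1 `*` setT) `*` S2) (fun u => (u, p2 y)))
        (Q_cont Qg) => [[u u'] [/= Ou _]|].
        by split => /=; [split => //; exact: OS1|exact/OS2/h4].
      by apply: cont_on_pair; [exact: cont_on_id|exact: cont_on_cst].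
    + exact: h2.
    + exact: hdp.
  apply: (IHk _ erefl _ _ _ _ (S1 `*` setT) (O1 `*` setT) S2 O2
    (S1' `*` setT) (O1' `*` setT) _ O2' (fun z => (p1 z.1, dp z)) p2) Qg => //.
  + by move=> _; apply: openX => //; exact: openT.
  + by move=> [u v] [/OS1].
  + by move=> [y w] [/= Sy _]; split => //; exact: h1.
  + by move=> [y w] [/= Oy _]; split => //; exact: h2.
  + by apply: C_pair Cdp; apply: C_fst; apply: C_le C1.
Qed.

Lemma C_comp n E F G (S O : set E) (S' O' : set F) (f : E -> F) (g : F -> G) :
  open O' -> O' `<=` S' -> (forall x, S x -> S' (f x)) ->
  (forall x, O x -> O' (f x)) -> C n S O f -> C n S' O' g ->
  C n S O (fun x => g (f x)).
Proof.
move=> oO OS h1 h2 Cf Cg.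
by apply: (@Q_comp _ 0 n _ _ _ _ _ _ _ _ S' O' (fun z => f z.2) g) => // x y _;
  [exact: h1|exact: h2].
Qed.

Lemma C_bilin n E E' F (B : E * E' -> F) : continuous B ->
  (forall x, clin (fun y => B (x, y))) -> (forall y, clin (fun x => B (x, y))) ->
  C n setT setT B.
Proof.
move=> cB B1 B2; elim: n => [|n IH]; first by apply: C0; exact: continuous_cont_on.
apply: (@C_S _ _ _ _ _ _ _ (fun z => B (z.1.1, z.2.2) + B (z.2.1, z.1.2))).
- exact: continuous_cont_on.
- move=> [x y] [v w] _ /=.
  have [d1 z1 _] := B1 x; have [d2 z2 _] := B2 y; have [d3 z3 _] := B1 v.
  (* For h nonzero, [L h] is exactly the difference quotient of [B] in the direction (v, w). *)
  pose L (t : R) := (B (x, w) + B (v, y)) + t *: B (v, w).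
  have cL0 : continuous (L : R^o -> F).
    apply: continuous_add; first by move=> ?; exact: cvg_cst.
    by apply: continuous_scale => ?; [exact: cvg_id|exact: cvg_cst].
  have cL : (L : R^o -> F) @ (0 : R)^' --> B (x, w) + B (v, y).
    have := cL0 0; rewrite /continuous_at {2}/L scale0r addr0.
    by apply: cvg_trans; apply: cvg_app; exact: cvg_within.
  apply: cvg_trans cL; apply: near_eq_cvg; exists 1 => //= h _ h0.
  rewrite add0r scale0r addr0 /L.
  have -> : B ((x, y) + h *: (v, w)) =
      B (x, y) + h *: (B (x, w) + B (v, y) + h *: B (v, w)).
    have [d4 z4 _] := B2 (y + h *: w).
    rewrite -[LHS]/(B (x + h *: v, y + h *: w)) d4 d1 z1 z4 d3 z3.
    by rewrite !scalerDr !addrA.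
  rewrite [X in _^-1 *: X](_ : _ = h *: (B (x, w) + B (v, y) + h *: B (v, w))).
    by rewrite scalerA mulVf// scale1r.
  by rewrite addrC addKr.
- have lin1 : clin (fun z : (E * E') * (E * E') => (z.1.1, z.2.2)) by eauto 6 with clin.
  have lin2 : clin (fun z : (E * E') * (E * E') => (z.2.1, z.1.2)) by eauto 6 with clin.
  by apply: Q_add; [apply: C_comp (C_lin n _ _ lin1) IH|apply: C_comp (C_lin n _ _ lin2) IH] => //; exact: openT.
Qed.

Lemma Q_scale k l E1 E2 F (S1 O1 : set E1) (S2 O2 : set E2)
    (a : E1 * E2 -> R^o) (f : E1 * E2 -> F) :
  Q k l S1 O1 S2 O2 a -> Q k l S1 O1 S2 O2 f ->
  Q k l S1 O1 S2 O2 (fun z => a z *: f z).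
Proof.
move=> Qa Qf.
apply: (@Q_comp _ k l _ _ _ _ _ _ _ _ setT setT (fun z => (a z, f z))
  (fun z : R^o * F => z.1 *: z.2)) => //; first exact: openT.
  exact: Q_pair.
apply: C_bilin => [|x|y]; first exact: scale_continuous.
  exact: clin_scale (clin_id _).
exact: clin_scalel (clin_id _).
Qed.

Lemma Q_snd k l E1 E2 F (S1 O1 : set E1) (S2 O2 : set E2) (f : E2 -> F) :
  C l S2 O2 f -> Q k l S1 O1 S2 O2 (fun z => f z.2).
Proof.
elim: l k E1 E2 S1 O1 S2 O2 f => [|l IH].
  elim=> [|k IHk] E1 E2 S1 O1 S2 O2 f Cf; apply/QE; split => //.
  - by apply: (@cont_on_comp _ _ _ _ S2 snd) (C_cont Cf) => [[x y] []//|];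
      exact: cont_on_snd.
  - by apply: (@cont_on_comp _ _ _ _ S2 snd) (C_cont Cf) => [[x y] []//|];
      exact: cont_on_snd.
  - move=> m _; exists (fun=> 0); last exact: Q_cst.
    by move=> x v y _ _; exact: (dcurve_cst (f y)).
move=> k E1 E2 S1 O1 S2 O2 f Cf; have [df hdf Cdf] := C_inv Cf; apply/QE; split.
- by apply: (@cont_on_comp _ _ _ _ S2 snd) (C_cont Cf) => [[x y] []//|];
    exact: cont_on_snd.
- move=> m [<-]; exists (fun z => df z.2); last exact: IH.
  by move=> x y w _; exact: hdf.
- move=> m _; exists (fun=> 0); last exact: Q_cst.
  by move=> x v y _ _; exact: (dcurve_cst (f y)).
Qed.

Lemma Q_fst_only k l E1 E2 F (S1 O1 : set E1) (S2 O2 : set E2) (f : E1 -> F) :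
  C k S1 O1 f -> Q k l S1 O1 S2 O2 (fun z => f z.1).
Proof.
elim: k l E1 E2 S1 O1 S2 O2 f => [|k IH].
  elim=> [|l IHl] E1 E2 S1 O1 S2 O2 f Cf; apply/QE; split => //.
  - by apply: (@cont_on_comp _ _ _ _ S1 fst) (C_cont Cf) => [[x y] []//|];
      exact: cont_on_fst.
  - by apply: (@cont_on_comp _ _ _ _ S1 fst) (C_cont Cf) => [[x y] []//|];
      exact: cont_on_fst.
  - move=> m _; exists (fun=> 0); last exact: Q_cst.
    by move=> x v y _ _; exact: (dcurve_cst (f x)).
move=> l E1 E2 S1 O1 S2 O2 f Cf; have [df hdf Cdf] := C_inv Cf; apply/QE; split.
- by apply: (@cont_on_comp _ _ _ _ S1 fst) (C_cont Cf) => [[x y] []//|];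
    exact: cont_on_fst.
- move=> m _; exists (fun=> 0); last exact: Q_cst.
  by move=> x v y _ _; exact: (dcurve_cst (f x)).
- move=> m [<-]; exists (fun z => df z.1); last exact: IH.
  by move=> x v y Ox _; exact: hdf.
Qed.

Lemma cont_on_uniq (T : topologicalType) F (A B : set T) (f g : T -> F) z :
  hausdorff_space F -> cont_on A f -> cont_on A g -> B `<=` A -> A z ->
  closure B z -> (forall y, B y -> f y = g y) -> f z = g z.
Proof.
move=> hF cf cg BA Az cB e; apply: hF => W W' nW nW'.
have n1 := cf z Az W nW; have n2 := cg z Az W' nW'.
have [y [By [h1 h2]]] := cB _ (filterI n1 n2).
exists (f y); split; first exact/h1/BA.
by rewrite e//; exact/h2/BA.
Qed.

Lemma closure_setX (T U : topologicalType) (A : set T) (B : set U) x y :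
  closure A x -> closure B y -> closure (A `*` B) (x, y).
Proof.
move=> cA cB W [[V V'] /= [/cA[a [Aa Va]] /cB[b [Bb Vb]]] VW].
by exists (a, b); split; [split|exact: VW].
Qed.

Lemma closureI_open (T : topologicalType) (A N : set T) x :
  open N -> N x -> closure A x -> closure (A `&` N) x.
Proof.
move=> oN Nx cA W nW; have nN : nbhs x N by exact: open_nbhs_nbhs.
by have [a [Aa [Na Wa]]] := cA _ (filterI nN nW); exists a.
Qed.

Lemma in_closureT (T : topologicalType) (x : T) : closure setT x.
Proof. exact: subset_closure. Qed.

(** The global derivative takes, at each point, the value of the local derivative chosen for that
    point. Two local derivatives agree over the [O] sets by uniqueness of limits, and then over the
    [S] sets by density and continuity; so the patched function locally coincides with a single
    local derivative. *)
Lemma Q_local k l E1 E2 F (S1 O1 : set E1) (S2 O2 : set E2) (f : E1 * E2 -> F) :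
  hausdorff_space F -> S1 `<=` closure O1 -> S2 `<=` closure O2 ->
  O1 `<=` S1 -> O2 `<=` S2 -> ((0 < k)%N -> open O1) -> open O2 ->
  (forall x y, S1 x -> S2 y -> exists N1 N2, [/\ open N1, open N2, N1 x, N2 y &
    Q k l (S1 `&` N1) (O1 `&` N1) (S2 `&` N2) (O2 `&` N2) f]) ->
  Q k l S1 O1 S2 O2 f.
Proof.
move=> hF; move: k l E1 E2 S1 O1 S2 O2 f.
apply: Qrec => k l IHl IHk E1 E2 S1 O1 S2 O2 f d1 d2 OS1 OS2 oO1 oO2 loc.
apply/QE; split.
- apply: cont_on_local => -[x y] [/= Sx Sy].
  have [N1 [N2 [oN1 oN2 N1x N2y /Q_cont]]] := loc x y Sx Sy.
  move=> cQ; exists (N1 `*` N2).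
    by exists (N1, N2) => //; split; exact: open_nbhs_nbhs.
  by apply: cont_on_sub cQ => -[u v] [[/= ? ?] [/= ? ?]].
- move=> m e.
  have /choice[P hP] : forall z : E1 * E2,
      exists p : (set E1 * set E2) * (E1 * (E2 * E2) -> F),
      S1 z.1 -> S2 z.2 -> [/\ [/\ open p.1.1, open p.1.2, p.1.1 z.1 & p.1.2 z.2],
        is_d2 (O1 `&` p.1.1) (O2 `&` p.1.2) f p.2 &
        Q k m (S1 `&` p.1.1) (O1 `&` p.1.1) ((S2 `&` p.1.2) `*` setT)
          ((O2 `&` p.1.2) `*` setT) p.2].
    move=> [x y]; have [[Sx Sy]|nS] := pselect (S1 x /\ S2 y); last first.
      by exists ((setT, setT), fun=> 0) => Sx Sy; case: nS.
    have [N1 [N2 [oN1 oN2 N1x N2y /QE[_ /(_ _ e)[g dg Qg] _]]]] := loc x y Sx Sy.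
    by exists ((N1, N2), g).
  exists (fun z => (P (z.1, z.2.1)).2 z).
    move=> x y w Ox Oy /=.
    by have [[_ _ ? ?] dg _] := hP (x, y) (OS1 _ Ox) (OS2 _ Oy); apply: dg; split.
  apply: (IHl _ e).
  + exact: d1.
  + by move=> [y w] [/= Sy _]; apply: closure_setX; [exact: d2|exact: in_closureT].
  + exact: OS1.
  + by move=> [y w] [/= /OS2].
  + exact: oO1.
  + by apply: openX => //; exact: openT.
  move=> x0 [y0 w0] Sx0 [/= Sy0 _].
  have [[oN1 oN2 N1x N2y] dg Qg] := hP (x0, y0) Sx0 Sy0.
  set N1 := (P (x0, y0)).1.1 in oN1 N1x dg Qg *.
  set N2 := (P (x0, y0)).1.2 in oN2 N2y dg Qg *.
  exists N1, (N2 `*` setT); split => //; first by apply: openX => //; exact: openT.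
  have {}Qg : Q k m (S1 `&` N1) (O1 `&` N1) ((S2 `*` setT) `&` (N2 `*` setT))
      ((O2 `*` setT) `&` (N2 `*` setT)) (P (x0, y0)).2.
    by apply: Q_sub Qg => // -[u v] [[/= ? _] [/= ? _]].
  apply: Q_ext Qg.
  + by move=> k0; apply: openI => //; exact: oO1.
  + by apply: openI; apply: openX => //; exact: openT.
  + by move=> x [/OS1].
  + by move=> [u v] [[/= /OS2 ? _] [/= ? _]].
  move=> x [y w] [/= Sx Nx] [[/= Sy _] [/= Ny _]].
  have [[oM1 oM2 M1x M2y] dg' Qg'] := hP (x, y) Sx Sy.
  set M1 := (P (x, y)).1.1 in oM1 M1x dg' Qg'.
  set M2 := (P (x, y)).1.2 in oM2 M2y dg' Qg'.
  have {hP} [_ _ /Q_cont Qg] := hP (x0, y0) Sx0 Sy0.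
  apply: (@cont_on_uniq _ _ ((S1 `&` (M1 `&` N1)) `*` ((S2 `&` (M2 `&` N2)) `*` setT))
    ((O1 `&` (M1 `&` N1)) `*` ((O2 `&` (M2 `&` N2)) `*` setT))) => //.
  + by apply: cont_on_sub Qg => -[u [v t]] [[/= ? [? ?]] [[/= ? [? ?]] ?]].
  + by apply: cont_on_sub (Q_cont Qg') => -[u [v t]] [[/= ? [? ?]] [[/= ? [? ?]] ?]].
  + by move=> [u [v t]] [[/= /OS1 ? [? ?]] [[/= /OS2 ? [? ?]] ?]].
  + apply: closure_setX.
      by apply: closureI_open; [exact: openI|split|exact: d1].
    apply: closure_setX; last exact: in_closureT.
    by apply: closureI_open; [exact: openI|split|exact: d2].
  + move=> [u [v t]] [[/= Ou [? ?]] [[/= Ov [? ?]] _]].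
    by apply: (dcurve_uniq hF (dg _ _ _ _ _) (dg' _ _ _ _ _)); split.
- move=> m e.
  have /choice[P hP] : forall z : E1 * E2,
      exists p : (set E1 * set E2) * ((E1 * E1) * E2 -> F),
      S1 z.1 -> S2 z.2 -> [/\ [/\ open p.1.1, open p.1.2, p.1.1 z.1 & p.1.2 z.2],
        is_d1 (O1 `&` p.1.1) (O2 `&` p.1.2) f p.2 &
        Q m l ((S1 `&` p.1.1) `*` setT) ((O1 `&` p.1.1) `*` setT) (S2 `&` p.1.2)
          (O2 `&` p.1.2) p.2].
    move=> [x y]; have [[Sx Sy]|nS] := pselect (S1 x /\ S2 y); last first.
      by exists ((setT, setT), fun=> 0) => Sx Sy; case: nS.
    have [N1 [N2 [oN1 oN2 N1x N2y /QE[_ _ /(_ _ e)[g dg Qg]]]]] := loc x y Sx Sy.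
    by exists ((N1, N2), g).
  have {}oO1 : open O1 by apply: oO1; rewrite e.
  exists (fun z => (P (z.1.1, z.2)).2 z).
    move=> x v y Ox Oy /=.
    by have [[_ _ ? ?] dg _] := hP (x, y) (OS1 _ Ox) (OS2 _ Oy); apply: dg; split.
  apply: (IHk _ e).
  + by move=> [y w] [/= Sy _]; apply: closure_setX; [exact: d1|exact: in_closureT].
  + exact: d2.
  + by move=> [y w] [/= /OS1].
  + exact: OS2.
  + by move=> _; apply: openX => //; exact: openT.
  + exact: oO2.
  move=> [x0 v0] y0 [/= Sx0 _] Sy0.
  have [[oN1 oN2 N1x N2y] dg Qg] := hP (x0, y0) Sx0 Sy0.
  set N1 := (P (x0, y0)).1.1 in oN1 N1x dg Qg *.
  set N2 := (P (x0, y0)).1.2 in oN2 N2y dg Qg *.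
  exists (N1 `*` setT), N2; split => //; first by apply: openX => //; exact: openT.
  have {}Qg : Q m l ((S1 `*` setT) `&` (N1 `*` setT)) ((O1 `*` setT) `&` (N1 `*` setT))
      (S2 `&` N2) (O2 `&` N2) (P (x0, y0)).2.
    by apply: Q_sub Qg => // -[u v] [[/= ? _] [/= ? _]].
  apply: Q_ext Qg.
  + by move=> _; apply: openI; apply: openX => //; exact: openT.
  + exact: openI.
  + by move=> [u v] [[/= /OS1 ? _] [/= ? _]].
  + by move=> x [/OS2].
  move=> [x v] y [[/= Sx _] [/= Nx _]] [/= Sy Ny].
  have [[oM1 oM2 M1x M2y] dg' Qg'] := hP (x, y) Sx Sy.
  set M1 := (P (x, y)).1.1 in oM1 M1x dg' Qg'.
  set M2 := (P (x, y)).1.2 in oM2 M2y dg' Qg'.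
  have {hP} [_ _ /Q_cont Qg] := hP (x0, y0) Sx0 Sy0.
  apply: (@cont_on_uniq _ _ (((S1 `&` (M1 `&` N1)) `*` setT) `*` (S2 `&` (M2 `&` N2)))
    (((O1 `&` (M1 `&` N1)) `*` setT) `*` (O2 `&` (M2 `&` N2)))) => //.
  + by apply: cont_on_sub Qg => -[[u v'] t] [[[/= ? [? ?]] ?] [/= ? [? ?]]].
  + by apply: cont_on_sub (Q_cont Qg') => -[[u v'] t] [[[/= ? [? ?]] ?] [/= ? [? ?]]].
  + by move=> [[u v'] t] [[[/= /OS1 ? [? ?]] ?] [/= /OS2 ? [? ?]]].
  + apply: closure_setX.
      apply: closure_setX; last exact: in_closureT.
      by apply: closureI_open; [exact: openI|split|exact: d1].
    by apply: closureI_open; [exact: openI|split|exact: d2].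
  + move=> [[u v'] t] [[[/= Ou [? ?]] _] [/= Ov [? ?]]].
    by apply: (dcurve_uniq hF (dg _ _ _ _ _) (dg' _ _ _ _ _)); split.
Qed.

Lemma mean_value_line E F (f : E -> F) y w (h : R) (D : set F) : h != 0 ->
  open D -> cvx D -> (forall s, 0 <= s <= 1 ->
    exists2 d, dcurve (fun t => f ((y + (h * s) *: w) + t *: w)) 0 d & D d) ->
  D (h^-1 *: (f (y + h *: w) - f y)).
Proof.
move=> h0 oD cD hD; pose g (t : R) := h^-1 *: f (y + (h * t) *: w).
suff : D (g 1 - g 0) by rewrite /g mulr1 mulr0 scale0r addr0 -scalerBr.
apply: mean_value_convex => // s /hD[d cd Dd]; exists d; last first.
  exact: open_nbhs_nbhs.
rewrite -[d]scale1r -(mulVf h0) -scalerA.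
apply: dcurve_scale; apply: (@dcurve_reparam _ _ (fun r => f (y + r *: w))) => //.
by apply: has_dirder_line; exact/has_dirderE.
Qed.

Lemma cvx_closed_nbhs F (d : F) (W : set F) : nbhs d W ->
  exists D : set F, [/\ open D, cvx D, D d & closure D `<=` W].
Proof.
move=> /(@uniform_regular F d)[V nV VW].
have [D [oD cD Dd DV]] := cvx_nbhs nV; exists D; split => //.
by apply: subset_trans VW; exact: closureS.
Qed.

(* By the mean value theorem, a derivative along [y] which exists for the
   parameters in a dense set and extends continuously is a derivative for all
   parameters. *)
Lemma Q_dense_param l E1 E2 F (S1 O1 : set E1) (S2 O2 : set E2)
    (f : E1 * E2 -> F) : S1 `<=` closure O1 -> O1 `<=` S1 -> O2 `<=` S2 ->
  open O2 -> Q 0 l S1 O1 S2 O2 f -> Q 0 l S1 S1 S2 O2 f.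
Proof.
move=> d1 OS1; elim: l E2 S2 O2 f => [|l IH] E2 S2 O2 f OS2 oO2 /QE[cf hl _];
  apply/QE; split => // m [<-].
have [g dg Qg] := hl _ erefl; exists g; last first.
  apply: IH Qg; first by move=> [u v] [/= /OS2].
  by apply: openX => //; exact: openT.
move=> x y w Sx Oy; apply/dcurveP => W nW.
have [D [oD cD Dd DW]] := cvx_closed_nbhs nW.
have [[N1 A] /= [nN1 nA] NA] : nbhs (x, (y, w))
    [set z | (S1 `*` (S2 `*` setT)) z -> D (g z)].
  apply: (Q_cont Qg); last exact: open_nbhs_nbhs.
  by split => //; split => //; exact: OS2.
have [[N2 N3] /= [nN2 nN3] N23] := nA.
have oN : open (N2° `&` O2) by apply: openI => //; exact: open_interior.
have [e e0 he] := open_line w oN (conj nN2 Oy).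
exists e => // h hl' h0; rewrite add0r scale0r addr0; apply: DW => V nV.
have Oh : O2 (y + h *: w) by have [] := he _ hl'.
have n1 : nbhs x [set x' | S1 x' -> V (h^-1 *: (f (x', y + h *: w) - f (x', y)))].
  have c1 (v : E2) : S2 v -> cont_on S1 (fun x' => f (x', v)).
    move=> Sv; apply: (@cont_on_comp _ _ _ _ (S1 `*` S2) (fun x' => (x', v))) cf => //.
    by apply: cont_on_pair; [exact: cont_on_id|exact: cont_on_cst].
  have c2 : cont_on S1 (fun x' => h^-1 *: (f (x', y + h *: w) - f (x', y))).
    apply: cont_on_scale; first exact: cont_on_cst.
    apply: cont_on_add; first exact/c1/OS2.
    apply: (@cont_on_comp _ _ _ _ setT (fun x' => f (x', y)) -%R) => //.
      exact/c1/OS2.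
    by apply: continuous_cont_on; exact: opp_continuous.
  exact: c2.
have [x' [Ox' [N1x' Vx']]] := d1 x Sx _ (filterI nN1 n1).
exists (h^-1 *: (f (x', y + h *: w) - f (x', y))); split; last exact/Vx'/OS1.
apply: (@mean_value_line _ _ (fun u => f (x', u))) => // s /andP[s0 s1].
have hs : `|h * s| < e.
  by rewrite normrM (le_lt_trans _ hl')// ler_piMr// ger0_norm.
have [/interior_subset N2s O2s] := he _ hs.
exists (g (x', (y + (h * s) *: w, w))); first exact: dg.
apply: (NA (x', (_, w))) => //=.
  by split => //; apply: (N23 (_, _)); split => //; exact: nbhs_singleton.
by split; [exact: OS1|split => //; exact: OS2].
Qed.

End ClassQ2.

(** * Passage between iterated directional derivatives and the recursive classes *)

Section Links.
Context {R : realType}.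
Implicit Types (E F G P W : tvsType R) (k l n m : nat).
(** Additivity follows from f (x + t v + t w) - f (x + t v), whose quotient by t tends to g (x, w)
    by the mean value theorem and continuity of [g]; homogeneity is a change of parameter on the
    line. *)
Lemma dcurve_differential_linear E F (O : set E) (f : E -> F) (g : E * E -> F) x :
  hausdorff_space F -> open O ->
  (forall x v, O x -> dcurve (fun t => f (x + t *: v)) 0 (g (x, v))) ->
  cont_on (O `*` setT) g -> O x ->
  (forall v w, g (x, v + w) = g (x, v) + g (x, w)) /\
  (forall (a : R) v, g (x, a *: v) = a *: g (x, v)).
Proof.
move=> hF oO hg cg Ox; split=> [v w|a v].
  have d1 : dcurve (fun t => f (x + t *: v + t *: w) - f (x + t *: v)) 0 (g (x, w)).
    apply/dcurveP => W nW; have [D [oD cD Dd DW]] := cvx_nbhs nW.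
    have [[A B] /= [nA nB] AB] : nbhs (x, w) [set z | (O `*` setT) z -> D (g z)].
      by apply: cg; [split|apply: open_nbhs_nbhs].
    have nAO : nbhs x (A `&` O) by apply: filterI => //; exact: open_nbhs_nbhs.
    have [A' [oA' cA' A'x A'A]] := cvx_nbhs nAO.
    have [e1 e10 he1] := open_line v oA' A'x.
    have [e2 e20 he2] := open_line (v + w) oA' A'x.
    exists (Num.min e1 e2); first by rewrite lt_min e10.
    move=> h; rewrite lt_min => /andP[h1 h2] h0; apply: DW.
    rewrite add0r !scale0r !addr0 subrr subr0.
    apply: (@mean_value_line _ _ _ f) => // s /andP[s0 s1].
    have A'xs : A' (x + h *: v + (h * s) *: w).
      have -> : x + h *: v + (h * s) *: w =
          (1 - s) *: (x + h *: v) + s *: (x + h *: (v + w)).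
        rewrite (scalerDr h) addrA [s *: _]scalerDr addrA -scalerDl subrK scale1r.
        by rewrite scalerA mulrC.
      by apply: cA'; [rewrite subr_ge0| |rewrite subrK|exact: he1|exact: he2].
    have [Axs Oxs] := A'A _ A'xs.
    exists (g (x + h *: v + (h * s) *: w, w)); first exact: hg.
    by apply: (AB (_, _)); split => //; exact: nbhs_singleton.
  apply: (dcurve_uniq hF (hg x (v + w) Ox)).
  have := dcurve_add (hg x v Ox) d1.
  apply: dcurve_eq_near ltr01 _ => h _ /=.
  by rewrite subrKC scalerDr addrA.
have [->|a0] := eqVneq a 0.
  rewrite !scale0r; apply: (dcurve_uniq hF (hg x 0 Ox)).
  apply: dcurve_eq_near ltr01 _ (dcurve_cst (f x) 0) => h _.
  by rewrite scaler0 addr0.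
apply: (dcurve_uniq hF (hg x (a *: v) Ox)).
have := @dcurve_reparam _ _ (fun t => f (x + t *: v)) a 0 _ a0.
rewrite mulr0 => /(_ _ (hg x v Ox)).
by apply: dcurve_eq_near ltr01 _ => h _; rewrite scalerA mulrC.
Qed.

Lemma dcurve_mul F (c : R -> F) : {for (0 : R^o), continuous (c : R^o -> F)} ->
  dcurve (fun t => t *: c t) 0 (c 0).
Proof.
move=> cc; apply/dcurveP => D nD; have := cc D nD.
move=> /nbhs_ballP[e /= e0 he]; exists e => // h hl h0.
rewrite add0r scale0r subr0 scalerA mulVf// scale1r.
by apply: he; rewrite /ball/= sub0r normrN.
Qed.

Lemma continuous_line E (y w : E) : continuous (fun t : R^o => y + t *: w).
Proof.
apply: continuous_add; first by move=> ?; exact: cvg_cst.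
by apply: continuous_scale => ?; [exact: cvg_id|exact: cvg_cst].
Qed.

(* A parameter on which the function depends linearly may be turned into an
   active variable: its derivative only involves the function itself. *)
Lemma Q_linear_param n (E1 W E2 F : tvsType R) (S2 O2 : set E2) (f : (E1 * W) * E2 -> F) :
  hausdorff_space F -> open O2 -> O2 `<=` S2 ->
  (forall p y, O2 y -> (forall v w, f ((p, v + w), y) = f ((p, v), y) + f ((p, w), y)) /\
     (forall (a : R) v, f ((p, a *: v), y) = a *: f ((p, v), y))) ->
  Q 0 n setT setT S2 O2 f ->
  Q 0 n setT setT (S2 `*` setT) (O2 `*` setT) (fun z => f ((z.1, z.2.2), z.2.1)).
Proof.
move=> hF; elim: n E2 S2 O2 f => [|n IH] E2 S2 O2 f oO OS lin Qf.
  apply/QE; split => //.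
  apply: (@cont_on_comp _ _ _ _ _ (fun z : E1 * (E2 * W) => ((z.1, z.2.2), z.2.1)))
    (Q_cont Qf) => [[p [y w]] [_ [/= Sy _]]//|].
  by apply: cont_clin; eauto 7 with clin.
have /QE[cf /(_ _ erefl)[g dg Qg] _] := Qf.
apply/QE; split => //.
  apply: (@cont_on_comp _ _ _ _ _ (fun z : E1 * (E2 * W) => ((z.1, z.2.2), z.2.1)))
    cf => [[p [y w]] [_ [/= Sy _]]//|].
  by apply: cont_clin; eauto 7 with clin.
move=> _ [<-].
exists (fun z => g ((z.1, z.2.1.2), (z.2.1.1, z.2.2.1)) + f ((z.1, z.2.2.2), z.2.1.1)).
  move=> p [y w] [u w'] _ [/= Oy _].
  have [e e0 he] := open_line u oO Oy.
  have d1 := dg (p, w) y u I Oy.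
  have d2 : dcurve (fun t => t *: f ((p, w'), y + t *: u)) 0 (f ((p, w'), y)).
    have := @dcurve_mul F (fun t => f ((p, w'), y + t *: u)).
    rewrite scale0r addr0; apply.
    have cl := @continuous_line E2 y u 0.
    apply: (@continuous_comp R^o E2 F (fun t => y + t *: u)
      (fun y => f ((p, w'), y))) => //.
    rewrite scale0r addr0; apply: (@cont_on_open_at _ _ O2) => //.
    apply: (@cont_on_comp _ _ _ _ _ (fun y : E2 => ((p, w'), y))) cf.
      by move=> y' Oy'; split => //; exact: OS.
    by apply: cont_on_pair; [exact: cont_on_cst|exact: cont_on_id].
  apply: dcurve_eq_near e0 _ (dcurve_add d1 d2) => h hl; rewrite add0r.
  have [D1 D2] := lin p _ (he h hl).
  by rewrite -[RHS]/(f ((p, w + h *: w'), y + h *: u)) D1 D2.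
apply: Q_add.
- have Qg' : Q 0 n setT setT ((S2 `*` setT) `*` setT) ((O2 `*` setT) `*` setT)
      (fun z : E1 * ((E2 * E2) * W) => g ((z.1, z.2.2), z.2.1)).
    apply: IH Qg; first by apply: openX => //; exact: openT.
      by move=> [u v] [/OS].
    move=> p [y u] [/= Oy _]; have [e e0 he] := open_line u oO Oy.
    split=> [v w|a v].
      apply: (dcurve_uniq hF (dg (p, v + w) y u I Oy)).
      apply: dcurve_eq_near e0 _ (dcurve_add (dg (p, v) y u I Oy) (dg (p, w) y u I Oy)).
      move=> h hl; rewrite add0r.
      by have [D1 _] := lin p _ (he h hl); rewrite D1.
    apply: (dcurve_uniq hF (dg (p, a *: v) y u I Oy)).
    apply: dcurve_eq_near e0 _ (dcurve_scale (a := a) (dg (p, v) y u I Oy)).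
    move=> h hl; rewrite add0r.
    by have [_ D1] := lin p _ (he h hl); rewrite D1.
  apply: (@Q_precomp _ 0 n _ _ _ _ _ _ _ _ _ _ _ _ _ id
    (fun z : (E2 * W) * (E2 * W) => ((z.1.1, z.2.1), z.1.2))) Qg' => //.
  + by do 2! (apply: openX; last exact: openT).
  + by move=> [[y u] w] [[/= /OS ? _] _].
  + by apply: C_lin; exact: clin_id.
  + by apply: C_lin; eauto 7 with clin.
- have Qf' := IH _ _ _ _ oO OS lin (Q_le (leqnn 0) (leqnSn n) Qf).
  apply: (@Q_precomp _ 0 n _ _ _ _ _ _ _ _ _ _ _ _ _ id
    (fun z : (E2 * W) * (E2 * W) => (z.1.1, z.2.2))) Qf' => //.
  + by apply: openX => //; exact: openT.
  + by move=> [y u] [/= /OS ? _].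
  + by move=> [[y w] [u w']] [[/= ? _] _].
  + by move=> [[y w] [u w']] [[/= ? _] _].
  + by apply: C_lin; exact: clin_id.
  + by apply: C_lin; eauto 7 with clin.
Qed.

(* Only [x] is differentiated; the directions become parameters, as in the
   definition of C^n-maps by iterated directional derivatives. *)
Fixpoint WC n P E F (S O : set E) (f : P * E -> F) : Prop :=
  cont_on (setT `*` S) f /\
  if n is n'.+1 then exists2 g : (P * E)%type * E -> F,
    (forall p x v, O x -> dcurve (fun t => f (p, x + t *: v)) 0 (g ((p, v), x))) &
    @WC n' (P * E)%type E F S O g
  else True.

(** The differential is linear in its direction, so the direction can be turned from a parameter
    into an active variable by [Q_linear_param]. *)
Lemma WC_Q n P E F (S O : set E) (f : P * E -> F) : hausdorff_space F ->
  open O -> O `<=` S -> WC n S O f -> Q 0 n setT setT S O f.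
Proof.
move=> hF oO OS; elim: n P f => [|n IH] P f [cf h]; apply/QE; split => //.
move=> _ [<-]; have [g dg Qg] := h.
exists (fun z => g ((z.1, z.2.2), z.2.1)); first by move=> p x v _; exact: dg.
apply: Q_linear_param (IH _ _ Qg) => // p x Ox.
apply: (@dcurve_differential_linear _ _ O (fun x => f (p, x))
  (fun z => g ((p, z.2), z.1))) => //; first by move=> y v; exact: dg.
have [cg _] : cont_on (setT `*` S) g /\ True by case: (n) Qg => [|?] [].
apply: (@cont_on_comp _ _ _ _ _ (fun z : E * E => ((p, z.2), z.1))) cg.
  by move=> [y v] [/= /OS].
apply: cont_on_pair; last exact: cont_on_fst.
by apply: cont_on_pair; [exact: cont_on_cst|exact: cont_on_snd].
Qed.

(** Tuples of directions as iterated products, the latest direction outermost: the nesting in which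
    [WC] collects its parameters. *)
Fixpoint powT E m : tvsType R := if m is m'.+1 then (powT E m' * E)%type else R^o.

Fixpoint powT_seq E m : powT E m -> seq E :=
  if m is m'.+1 then fun p => rcons (powT_seq p.1) p.2 else fun=> [::].

Lemma size_powT_seq E m (p : powT E m) : size (powT_seq p) = m.
Proof. by elim: m p => //= m IH p; rewrite size_rcons IH. Qed.

Definition powT_tuple E m (p : powT E m) : tvs_pow E m :=
  fun i => nth 0 (powT_seq p) i.

Lemma tvs_pow_seq_powT E m (p : powT E m) : tvs_pow_seq (powT_tuple p) = powT_seq p.
Proof.
have -> : tvs_pow_seq (powT_tuple p) =
    map (nth 0 (powT_seq p)) (map val (enum 'I_m)) by rewrite -map_comp.
by rewrite val_enum_ord -[in iota _ _](size_powT_seq p) -/(mkseq _ _) mkseq_nth.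
Qed.

Lemma tvs_pow_continuous E (T : topologicalType) m (f : T -> tvs_pow E m) :
  (forall i, continuous (fun t => f t i)) -> continuous f.
Proof.
move=> h x; apply/cvg_sup => i.
exact: (@continuous_comp_initial _ _ _ (fun g : 'I_m -> E => g i) f (h i) x).
Qed.

Lemma continuous_powT_tuple E m : continuous (@powT_tuple E m).
Proof.
apply: tvs_pow_continuous => i; rewrite /powT_tuple.
elim: m i => [|m IH] [i /= hi] //.
have [im|mi] := ltnP i m; last first.
  have -> : (fun p : powT E m * E => nth 0 (rcons (powT_seq p.1) p.2) i) = snd.
    apply/funext => p; rewrite nth_rcons size_powT_seq ltnNge mi/=.
    by rewrite eqn_leq mi andbT -ltnS hi.
  by move=> ?; exact: cvg_snd.
have -> : (fun p : powT E m * E => nth 0 (rcons (powT_seq p.1) p.2) i) =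
    (fun p => nth 0 (powT_seq p) (Ordinal im)) \o fst.
  by apply/funext => p; rewrite nth_rcons size_powT_seq im.
by move=> p; apply: continuous_comp (IH _ _); exact: cvg_fst.
Qed.

Lemma iter_dirder_eq E F (O : set E) (f f' : E -> F) ys g : open O ->
  (forall x, O x -> f x = f' x) -> is_iter_dirder O f ys g ->
  is_iter_dirder O f' ys g.
Proof.
move=> oO; case: ys => [|y ys] e /=; first by move=> h x Ox; rewrite -e// h.
move=> [f1 hf1 h]; exists f1 => // x Ox; apply/has_dirderE.
have [r r0 hr] := open_line y oO Ox.
by apply: dcurve_eq_near r0 _ ((has_dirderE _ _ _ _).1 (hf1 x Ox)) => h' hh';
  rewrite add0r; exact/e/hr.
Qed.

Lemma iter_dirder_rcons E F (O : set E) (f : E -> F) ys v g g0 :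
  hausdorff_space F -> open O -> is_iter_dirder O f ys g0 ->
  is_iter_dirder O f (rcons ys v) g -> forall x, O x -> has_dirder g0 x v (g x).
Proof.
move=> hF oO; elim: ys f => [|y ys IH] f /=.
  move=> e [f1 hf1 e1] x Ox; rewrite e1//.
  apply: (@has_dirderE _ _ _ _ _ _ _).2.
  have [r r0 hr] := open_line v oO Ox.
  apply: dcurve_eq_near r0 _ ((has_dirderE _ _ _ _).1 (hf1 x Ox)) => h' hh'.
  by rewrite add0r -e//; exact: hr.
move=> [f1 hf1 h1] [f2 hf2 h2]; apply: (IH f1) => //.
apply: iter_dirder_eq h2 => // x Ox.
exact: has_dirder_uniq hF (hf2 x Ox) (hf1 x Ox).
Qed.

(** The extensions [G m] of the iterated derivatives are chosen separately for every order m.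
    Uniqueness of limits in the Hausdorff space [F] makes [G m.+1] a derivative of [G m] on the
    interior, which is what [WC] asks for. *)
Lemma C_on_C n (l : diff_order) E F (S : set E) (f : E -> F) :
  hausdorff_space F -> le_order n l -> C_on l S f -> C n S S° f.
Proof.
move=> hF hn [/cont_onP cf hf].
have hle m : (m <= n)%N -> le_order m l.
  by case: l hn {hf} => //= k hk hm; exact: leq_trans hm hk.
have GG : forall m, exists G : powT E m * E -> F, (m <= n)%N ->
    cont_on (setT `*` S) G /\ forall p,
      is_iter_dirder S° f (powT_seq p) (fun x => G (p, x)).
  move=> m; have [mn|nm] := leqP m n; last by exists (fun=> 0).
  have [df /cont_onP cdf hdf] := hf m (hle m mn).
  exists (fun z => df (z.2, powT_tuple z.1)) => _; split.
    apply: (@cont_on_comp _ _ _ _ _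
      (fun z : powT E m * E => (z.2, powT_tuple z.1))) cdf.
      by move=> [p x] [_ /= Sx].
    apply: continuous_cont_on; apply: continuous_pair.
      by move=> ?; exact: cvg_snd.
    move=> p; apply: continuous_comp; first exact: cvg_fst.
    exact: continuous_powT_tuple.
  by move=> p; rewrite -tvs_pow_seq_powT; exact: hdf.
pose G m := sval (cid (GG m)).
have hG m : (m <= n)%N -> cont_on (setT `*` S) (G m) /\ forall p,
    is_iter_dirder S° f (powT_seq p) (fun x => G m (p, x)) := svalP (cid (GG m)).
have WG m k : (m.+1 + k <= n)%N -> WC k S S° (G m.+1).
  elim: k m => [|k IH] m hm.
    by split => //; have [] := hG m.+1; rewrite ?addn0 in hm *.
  have m1 : (m.+1 <= n)%N by apply: leq_trans hm; rewrite leq_addr.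
  have m2 : (m.+2 <= n)%N by apply: leq_trans hm; rewrite addnS ltnS leq_addr.
  split; first by have [] := hG m.+1 m1.
  exists (G m.+2); last by apply: (IH m.+1); rewrite addSnnS.
  move=> p x v Ox.
  apply: (@has_dirderE R E F (fun y => G m.+1 (p, y)) x v _).1.
  have [_ /(_ p) h1] := hG m.+1 m1; have [_ /(_ (p, v)) h2] := hG m.+2 m2.
  exact: iter_dirder_rcons hF (open_interior _) h1 h2 _ Ox.
have Wf : WC n S S° (fun z : R^o * E => f z.2).
  have cf2 : cont_on (setT `*` S) (fun z : R^o * E => f z.2).
    by apply: (@cont_on_comp _ _ _ _ S snd) cf => [[x y] []//|];
      exact: cont_on_snd.
  clearbody G; case: n WG hG {hn hle GG} => [|n] WG hG; first by split.
  split => //; exists (G 1%N); last exact: (WG 0%N n (leqnn _)).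
  move=> p x v Ox; apply: (@has_dirderE R E F f x v _).1.
  have [_ /(_ (p, v)) h1] := hG 1%N isT.
  have h0 : is_iter_dirder S° f [::] f by [].
  exact: iter_dirder_rcons hF (open_interior _) h0 h1 _ Ox.
by apply: WC_Q Wf => //; [exact: open_interior|exact: interior_subset].
Qed.

Section Back.
Variables (A B X F : tvsType R) (al : A -> X) (be : B -> X).
Hypotheses (cal : clin al) (cbe : clin be).

(** Analogue of [WC] with two kinds of directions, [al a] and [be b], in one space: the format of
    [C2_on], where both kinds are directions of a product. *)
Fixpoint WD (k : nat) : nat -> forall P, set X -> set X -> (P * X -> F) -> Prop :=
  fix WDk l := fun P S O f =>
  [/\ cont_on (setT `*` S) f,
      if l is l'.+1 then exists2 g : (P * B)%type * X -> F,
        (forall p b x, O x -> dcurve (fun t => f (p, x + t *: be b)) 0 (g ((p, b), x))) &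
        WDk l' (P * B)%type S O g
      else True &
      if k is k'.+1 then exists2 g : (P * A)%type * X -> F,
        (forall p a x, O x -> dcurve (fun t => f (p, x + t *: al a)) 0 (g ((p, a), x))) &
        WD k' l S O g
      else True].

Lemma WDE k l P (S O : set X) (f : P * X -> F) :
  WD k l S O f <->
  [/\ cont_on (setT `*` S) f,
      forall l', l = l'.+1 -> exists2 g : (P * B)%type * X -> F,
        (forall p b x, O x -> dcurve (fun t => f (p, x + t *: be b)) 0 (g ((p, b), x))) &
        WD k l' S O g &
      forall k', k = k'.+1 -> exists2 g : (P * A)%type * X -> F,
        (forall p a x, O x -> dcurve (fun t => f (p, x + t *: al a)) 0 (g ((p, a), x))) &
        WD k' l S O g].
Proof.
case: k l => [|k] [|l]; split=> -[c h h']; split=> //=.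
- by move=> l' [<-].
- exact: h.
- by move=> l' [<-].
- exact: h'.
- by move=> l' [<-].
- by move=> l' [<-].
- exact: h.
- exact: h'.
Qed.

(** A point of an iterated tangent bundle is written as a p + i1 x (or b p + i2 x): only x moves,
    while the parameter p keeps the directions used so far. *)
Lemma Q_WD k l P E1 E2 (S1 O1 : set E1) (S2 O2 : set E2) (f : E1 * E2 -> F)
    (S O : set X) (a : P -> E1) (b : P -> E2) (i1 : X -> E1) (i2 : X -> E2) :
  clin i1 -> clin i2 -> (forall u, i1 (be u) = 0) -> (forall u, i2 (al u) = 0) ->
  continuous a -> continuous b ->
  (forall p x, S x -> S1 (a p + i1 x) /\ S2 (b p + i2 x)) ->
  (forall p x, O x -> O1 (a p + i1 x) /\ O2 (b p + i2 x)) ->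
  Q k l S1 O1 S2 O2 f ->
  WD k l S O (fun z => f (a z.1 + i1 z.2, b z.1 + i2 z.2)).
Proof.
move: k l P E1 E2 S1 O1 S2 O2 f a b i1 i2; apply: Qrec => k l IHl IHk.
move=> P E1 E2 S1 O1 S2 O2 f a b i1 i2 c1 c2 e1 e2 ca cb hS hO /QE[cf hl hk].
have [iD1 iZ1 k1] := c1.
have [iD2 iZ2 k2] := c2.
apply/WDE; split.
- apply: (@cont_on_comp _ _ _ _ _
    (fun z : P * X => (a z.1 + i1 z.2, b z.1 + i2 z.2))) cf.
    by move=> [p x] [_ /= Sx]; have [] := hS p x Sx.
  apply: continuous_cont_on; apply: continuous_pair; apply: continuous_add => z.
  + by apply: continuous_comp (ca _); exact: cvg_fst.
  + by apply: continuous_comp (k1 _); exact: cvg_snd.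
  + by apply: continuous_comp (cb _); exact: cvg_fst.
  + by apply: continuous_comp (k2 _); exact: cvg_snd.
- move=> m e; have [g dg Qg] := hl _ e.
  exists (fun z => g (a z.1.1 + i1 z.2, (b z.1.1 + i2 z.2, i2 (be z.1.2)))).
    move=> p u x Ox /=; have [hx1 hx2] := hO p x Ox.
    have := dg _ _ (i2 (be u)) hx1 hx2.
    apply: dcurve_eq_near ltr01 _ => h _.
    by rewrite iD1 iZ1 e1 scaler0 addr0 iD2 iZ2 addrA.
  have := IHl _ e (P * B)%type E1 (E2 * E2)%type S1 O1 (S2 `*` setT) (O2 `*` setT)
    g (fun p => a p.1) (fun p => (b p.1, i2 (be p.2))) i1 (fun x => (i2 x, 0)).
  rewrite (_ : (fun z => g (a z.1.1 + i1 z.2, _)) =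
    fun z => g (a z.1.1 + i1 z.2, (b z.1.1 + i2 z.2, i2 (be z.1.2)))); last first.
    apply/funext => z; congr (g (_, _)).
    by rewrite -[LHS]/(b z.1.1 + i2 z.2, i2 (be z.1.2) + 0) addr0.
  apply=> //.
  + by apply: clin_pair => //; exact: clin_zero.
  + by move=> u; rewrite e2.
  + by move=> z; apply: continuous_comp (ca _); exact: cvg_fst.
  + apply: continuous_pair => z; first by apply: continuous_comp (cb _); exact: cvg_fst.
    have [_ _ kb] := clin_comp (clin_comp (@clin_snd R P B) cbe) c2.
    exact: kb.
  + by move=> p x /(hS p.1)[].
  + by move=> p x /(hO p.1)[].
- move=> m e; have [g dg Qg] := hk _ e.
  exists (fun z => g ((a z.1.1 + i1 z.2, i1 (al z.1.2)), b z.1.1 + i2 z.2)).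
    move=> p u x Ox /=; have [hx1 hx2] := hO p x Ox.
    have := dg _ (i1 (al u)) _ hx1 hx2.
    apply: dcurve_eq_near ltr01 _ => h _.
    by rewrite iD2 iZ2 e2 scaler0 addr0 iD1 iZ1 addrA.
  have := IHk _ e (P * A)%type (E1 * E1)%type E2 (S1 `*` setT) (O1 `*` setT) S2 O2
    g (fun p => (a p.1, i1 (al p.2))) (fun p => b p.1) (fun x => (i1 x, 0)) i2.
  rewrite (_ : (fun z => g (_ , b z.1.1 + i2 z.2)) =
    fun z => g ((a z.1.1 + i1 z.2, i1 (al z.1.2)), b z.1.1 + i2 z.2)); last first.
    apply/funext => z; congr (g (_, _)).
    by rewrite -[LHS]/(a z.1.1 + i1 z.2, i1 (al z.1.2) + 0) addr0.
  apply=> //.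
  + by apply: clin_pair => //; exact: clin_zero.
  + by move=> u; rewrite e1.
  + apply: continuous_pair => z; first by apply: continuous_comp (ca _); exact: cvg_fst.
    have [_ _ kb] := clin_comp (clin_comp (@clin_snd R P A) cal) c1.
    exact: kb.
  + by move=> z; apply: continuous_comp (cb _); exact: cvg_fst.
  + by move=> p x /(hS p.1)[].
  + by move=> p x /(hO p.1)[].
Qed.

Lemma tvs_pow_seqS E j (w : tvs_pow E j.+1) :
  tvs_pow_seq w = w ord0 :: tvs_pow_seq (fun i => w (lift ord0 i) : E).
Proof. by rewrite /tvs_pow_seq enum_ordSl /= -map_comp. Qed.

Lemma continuous_tvs_pow_proj E j (i : 'I_j) : continuous (fun w : tvs_pow E j => w i).
Proof. exact: (@proj_continuous _ (fun=> E)). Qed.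

Lemma WD_dirder k l P (S O : set X) (f : P * X -> F) : open O -> O `<=` S ->
  WD k l S O f ->
  exists2 G : (P * X) * (tvs_pow A k * tvs_pow B l) -> F,
    cont_on ((setT `*` S) `*` setT) G &
    forall p (v : tvs_pow A k) (w : tvs_pow B l),
      is_iter_dirder O (fun x => f (p, x))
        ([seq be b | b <- tvs_pow_seq w] ++ [seq al a | a <- tvs_pow_seq v])
        (fun x => G ((p, x), (v, w))).
Proof.
move=> oO OS; elim: l P f => [|l IHl].
  elim: k => [|k IHk] P f /WDE[cf _ hk].
    exists (fun z => f z.1).
      apply: (@cont_on_comp _ _ _ _ _ fst) cf => [[z w] []//|].
      by apply: continuous_cont_on => ?; exact: cvg_fst.
    by move=> p v w; rewrite /tvs_pow_seq enum_ord0.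
  have [g dg /IHk[G cG hG]] := hk _ erefl.
  exists (fun z => G (((z.1.1, z.2.1 ord0), z.1.2),
    ((fun i => z.2.1 (lift ord0 i)), z.2.2))).
    apply: (@cont_on_comp _ _ _ _ _
      (fun z : (P * X) * (tvs_pow A k.+1 * tvs_pow B 0) =>
        (((z.1.1, z.2.1 ord0), z.1.2),
         ((fun i => z.2.1 (lift ord0 i)) : tvs_pow A k, z.2.2)))) cG.
      by move=> [[p x] [v w]] [[_ /= Sx] _].
    apply: continuous_cont_on; apply: continuous_pair; first apply: continuous_pair.
    - apply: continuous_pair => z.
        by apply: continuous_comp; [exact: cvg_fst|exact: cvg_fst].
      apply: (@continuous_comp _ _ _ (fun z => z.2.1) (fun w : tvs_pow A _ => w ord0)).
        by apply: continuous_comp; [exact: cvg_snd|exact: cvg_fst].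
      exact: continuous_tvs_pow_proj.
    - by move=> z; apply: continuous_comp; [exact: cvg_fst|exact: cvg_snd].
    - apply: continuous_pair; last by move=> z; apply: continuous_comp;
        [exact: cvg_snd|exact: cvg_snd].
      apply: tvs_pow_continuous => i z.
      apply: (@continuous_comp _ _ _ (fun z => z.2.1)
        (fun w : tvs_pow A _ => w (lift ord0 i))).
        by apply: continuous_comp; [exact: cvg_snd|exact: cvg_fst].
      exact: continuous_tvs_pow_proj.
  move=> p v w; rewrite (_ : tvs_pow_seq w = [::]); last first.
    by rewrite /tvs_pow_seq enum_ord0.
  rewrite tvs_pow_seqS /=; exists (fun x => g ((p, v ord0), x)).
    by move=> x Ox; apply/has_dirderE; exact: dg.
  have := hG (p, v ord0) (fun i => v (lift ord0 i)) w.
  by rewrite (_ : tvs_pow_seq w = [::])// /tvs_pow_seq enum_ord0.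
move=> P f /WDE[cf hl _].
have [g dg /IHl[G cG hG]] := hl _ erefl.
exists (fun z => G (((z.1.1, z.2.2 ord0), z.1.2),
  (z.2.1, (fun i => z.2.2 (lift ord0 i))))).
  apply: (@cont_on_comp _ _ _ _ _
    (fun z : (P * X) * (tvs_pow A k * tvs_pow B l.+1) =>
      (((z.1.1, z.2.2 ord0), z.1.2),
       (z.2.1, (fun i => z.2.2 (lift ord0 i)) : tvs_pow B l)))) cG.
    by move=> [[p x] [v w]] [[_ /= Sx] _].
  apply: continuous_cont_on; apply: continuous_pair; first apply: continuous_pair.
  - apply: continuous_pair => z.
      by apply: continuous_comp; [exact: cvg_fst|exact: cvg_fst].
    apply: (@continuous_comp _ _ _ (fun z => z.2.2) (fun w : tvs_pow B _ => w ord0)).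
      by apply: continuous_comp; [exact: cvg_snd|exact: cvg_snd].
    exact: continuous_tvs_pow_proj.
  - by move=> z; apply: continuous_comp; [exact: cvg_fst|exact: cvg_snd].
  - apply: continuous_pair; first by move=> z; apply: continuous_comp;
      [exact: cvg_snd|exact: cvg_fst].
    apply: tvs_pow_continuous => i z.
    apply: (@continuous_comp _ _ _ (fun z => z.2.2)
      (fun w : tvs_pow B _ => w (lift ord0 i))).
      by apply: continuous_comp; [exact: cvg_snd|exact: cvg_snd].
    exact: continuous_tvs_pow_proj.
move=> p v w; rewrite tvs_pow_seqS /=; exists (fun x => g ((p, w ord0), x)).
  by move=> x Ox; apply/has_dirderE; exact: dg.
exact: hG.
Qed.

End Back.

Lemma Q_C2_on (k l : diff_order) E1 E2 F (S1 : set E1) (S2 : set E2)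
    (f : E1 * E2 -> F) :
  (forall i j, le_order i k -> le_order j l -> Q i j S1 S1° S2 S2° f) ->
  C2_on k l S1 S2 f.
Proof.
move=> Qf; split.
  apply/cont_onP/Q_cont/(Qf 0%N 0%N); [by case: k {Qf}|by case: l {Qf}].
move=> i j hi hj.
have cal : clin (fun a : E1 => (a, 0 : E2)) by eauto with clin.
have cbe : clin (fun b : E2 => (0 : E1, b)) by eauto with clin.
have oO : open (S1° `*` S2°) by apply: openX; exact: open_interior.
have OS : S1° `*` S2° `<=` S1 `*` S2.
  by move=> [x y] [/= /interior_subset ? /interior_subset].
have W : WD (fun a : E1 => (a, 0 : E2)) (fun b : E2 => (0 : E1, b)) i j
    (S1 `*` S2) (S1° `*` S2°)
    (fun z : R^o * (E1 * E2) => f (0 + z.2.1, 0 + z.2.2)).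
  apply: (@Q_WD E1 E2 (E1 * E2)%type F _ _ cal cbe i j R^o E1 E2 S1 S1° S2 S2° f
    (S1 `*` S2) (S1° `*` S2°) (fun=> 0) (fun=> 0) fst snd) => //.
  - exact: clin_fst.
  - exact: clin_snd.
  - by move=> ?; exact: cvg_cst.
  - by move=> ?; exact: cvg_cst.
  - by move=> _ [x y] [/= ? ?]; rewrite !add0r.
  - by move=> _ [x y] [/= ? ?]; rewrite !add0r.
  - exact: Qf.
have [G cG hG] := WD_dirder oO OS W.
exists (fun z => G ((0, z.1), z.2)).
  apply/cont_onP; apply: (@cont_on_comp _ _ _ _ _
    (fun z : (E1 * E2) * (tvs_pow E1 i * tvs_pow E2 j) => ((0 : R^o, z.1), z.2))) cG.
    by move=> [x w] [/= Sx _].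
  apply: continuous_cont_on; apply: continuous_pair; last by move=> ?; exact: cvg_snd.
  by apply: continuous_pair => ?; [exact: cvg_cst|exact: cvg_fst].
move=> v w; apply: (@iter_dirder_eq _ _ _ (fun x => f (0 + x.1, 0 + x.2))) => //.
  by move=> [x y] _; rewrite !add0r.
exact: hG.
Qed.

Lemma C_C_on (l : diff_order) E F (S : set E) (f : E -> F) :
  (forall n, le_order n l -> C n S S° f) -> C_on l S f.
Proof.
move=> Cf; split; first by apply/cont_onP/C_cont/(Cf 0%N); case: l {Cf}.
move=> j hj.
have W : WD (fun=> 0 : E) (@id E) 0 j S S°
    (fun z : R^o * E => f (0 + z.2)) (A := R^o).
  apply: (@Q_WD R^o E E F _ _ (clin_zero _ _) (clin_id _) 0 j R^o R^o E
    setT setT S S° (fun z => f z.2) S S° (fun=> 0) (fun=> 0) (fun=> 0) id) => //.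
  - exact: clin_zero.
  - exact: clin_id.
  - by move=> ?; exact: cvg_cst.
  - by move=> ?; exact: cvg_cst.
  - by move=> _ x Sx; split => //=; rewrite add0r.
  - by move=> _ x Sx; split => //=; rewrite add0r.
  - exact: Cf.
have [G cG hG] := WD_dirder (open_interior _) (@interior_subset _ _) W.
exists (fun z => G ((0, z.1), ((fun=> 0), z.2))).
  apply/cont_onP; apply: (@cont_on_comp _ _ _ _ _
    (fun z : E * tvs_pow E j => ((0 : R^o, z.1), ((fun=> 0) : tvs_pow R^o 0, z.2)))) cG.
    by move=> [x w] [/= Sx _].
  by apply: continuous_cont_on; apply: continuous_pair; apply: continuous_pair => ?;
    (exact: cvg_cst || exact: cvg_fst || exact: cvg_snd).
move=> y; apply: (@iter_dirder_eq _ _ _ (fun x => f (0 + x))) => //.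
- exact: open_interior.
- by move=> x _; rewrite add0r.
have := hG 0 (fun=> 0) y.
by rewrite {2}/tvs_pow_seq enum_ord0 cats0 map_id.
Qed.

(** The total differential is the sum of the partial ones. The increment in the second variable is
    taken at the moving point x + t v and handled by the mean value theorem. *)
Lemma Q_C n E1 E2 F (S1 O1 : set E1) (S2 O2 : set E2) (f : E1 * E2 -> F) :
  open O1 -> open O2 -> O1 `<=` S1 -> O2 `<=` S2 -> Q n n S1 O1 S2 O2 f ->
  C n (S1 `*` S2) (O1 `*` O2) f.
Proof.
elim: n E1 E2 S1 O1 S2 O2 f => [|n IH] E1 E2 S1 O1 S2 O2 f oO1 oO2 OS1 OS2 Qf.
  exact/C0/Q_cont/Qf.
have /QE[cf /(_ _ erefl)[f2 df2 Qf2] /(_ _ erefl)[f1 df1 Qf1]] := Qf.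
apply: (@C_S _ _ _ _ _ _ _ (fun z => f1 ((z.1.1, z.2.1), z.1.2) + f2 (z.1.1, (z.1.2, z.2.2)))).
- exact: cf.
- move=> [x y] [v w] [/= Ox Oy].
  have d1 := df1 x v y Ox Oy.
  have d2 : dcurve (fun t => f (x + t *: v, y + t *: w) - f (x + t *: v, y)) 0
      (f2 (x, (y, w))).
    apply/dcurveP => W nW; have [D [oD cD Dd DW]] := cvx_nbhs nW.
    have [[A1 A2] /= [nA1 [[A3 A4] /= [nA3 nA4] A34]] A12] : nbhs (x, (y, w))
        [set z | (S1 `*` (S2 `*` setT)) z -> D (f2 z)].
      apply: (Q_cont Qf2); last exact: open_nbhs_nbhs.
      by split; [exact: OS1|split => //; exact: OS2].
    have o1 : open (A1° `&` O1) by apply: openI => //; exact: open_interior.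
    have o2 : open (A3° `&` O2) by apply: openI => //; exact: open_interior.
    have [e1 e10 he1] := open_line v o1 (conj nA1 Ox).
    have [e2 e20 he2] := open_line w o2 (conj nA3 Oy).
    exists (Num.min e1 e2); first by rewrite lt_min e10.
    move=> h; rewrite lt_min => /andP[h1 h2] h0; apply: DW.
    rewrite add0r !scale0r !addr0 subrr subr0.
    have [/interior_subset A1x Oxv] := he1 h h1.
    apply: (@mean_value_line _ _ _ (fun u => f (x + h *: v, u))) => // s /andP[s0 s1].
    have hs : `|h * s| < e2.
      by rewrite normrM (le_lt_trans _ h2)// ler_piMr// ger0_norm.
    have [/interior_subset A3y Oyw] := he2 _ hs.
    exists (f2 (x + h *: v, (y + (h * s) *: w, w))); first exact: df2.
    apply: (A12 (_, (_, _))) => /=.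
      by split => //; apply: (A34 (_, _)); split => //; exact: nbhs_singleton.
    by split => /=; [exact: OS1|split => //; exact: OS2].
  have := dcurve_add d1 d2; apply: dcurve_eq_near ltr01 _ => h _ /=.
  by rewrite add0r subrKC.
have QG : Q n n (S1 `*` setT) (O1 `*` setT) (S2 `*` setT) (O2 `*` setT)
    (fun z : (E1 * E1) * (E2 * E2) => f1 (z.1, z.2.1) + f2 (z.1.1, z.2)).
  apply: Q_add.
    by apply: Q_fst; apply: Q_le Qf1 => //; exact: leqnSn.
  by apply: Q_fst1; apply: Q_le Qf2 => //; exact: leqnSn.
have CG : C n ((S1 `*` setT) `*` (S2 `*` setT)) ((O1 `*` setT) `*` (O2 `*` setT))
    (fun z : (E1 * E1) * (E2 * E2) => f1 (z.1, z.2.1) + f2 (z.1.1, z.2)).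
  apply: IH QG; do ?by apply: openX => //; exact: openT.
  - by move=> [u v] [/= /OS1].
  - by move=> [u v] [/= /OS2].
apply: (@C_comp _ n _ _ _ _ _ ((S1 `*` setT) `*` (S2 `*` setT))
  ((O1 `*` setT) `*` (O2 `*` setT))
  (fun z : (E1 * E2) * (E1 * E2) => ((z.1.1, z.2.1), (z.1.2, z.2.2)))) CG.
- by do 2! (apply: openX => //); exact: openT.
- by move=> [[u v] [u' v']] [[/= /OS1 ? _] [/= /OS2 ? _]].
- by move=> [[u v] [u' v']] [[/= ? ?] _].
- by move=> [[u v] [u' v']] [[/= ? ?] _].
- by apply: C_lin; eauto 9 with clin.
Qed.

End Links.

(** * Smooth functions of a real variable *)

Section Smooth.
Context {R : realType}.
Implicit Types (f g : R -> R) (x y : R).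
Local Notation dR f x d := (@dcurve R (R^o : tvsType R) (f : R -> R^o) x (d : R^o)).

Lemma is_derive_dcurve f x (d : R) : is_derive x (1 : R) (f : R -> R^o) d -> dR f x d.
Proof.
move=> [df <-]; rewrite /dcurve.
have : (fun h : R => h^-1 *: (((f : R -> R^o) \o shift x) (h *: (1 : R)) - f x)) @ 0^' -->
    'D_1 (f : R -> R^o) x by exact: df.
apply: cvg_trans; apply: near_eq_cvg; apply: nearW => h /=.
by rewrite /shift/= [h *: _]mulr1 [h + x]addrC.
Qed.

Lemma hausdorff_R : hausdorff_space (R^o : tvsType R).
Proof. exact: (@norm_hausdorff R R^o). Qed.

Lemma dcurve_is_derive f x (d : R) : dR f x d -> is_derive x (1 : R) (f : R -> R^o) d.
Proof.
move=> fd; have h : (fun h : R => h^-1 *: (((f : R -> R^o) \o shift x) (h *: (1 : R)) - f x)) @ 0^' --> (d : R^o).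
  apply: cvg_trans fd; apply: near_eq_cvg; apply: nearW => h /=.
  by rewrite /shift/= [h *: _]mulr1 [h + x]addrC.
split; first by apply/cvg_ex; exists d.
exact: (cvg_lim hausdorff_R h).
Qed.

Lemma dcurve_line f x v (d : R) : dR f x d -> dR (fun t => f (x + t *: (v : R^o))) 0 (v *: (d : R^o)).
Proof.
move=> fd; have [->|v0] := eqVneq v 0.
  rewrite scale0r; apply: dcurve_eq_near ltr01 _ (dcurve_cst (f x : R^o) 0) => h _.
  by rewrite scaler0 addr0.
have := @dcurve_reparam R R^o (fun t => f (x + t)) v 0 d v0; rewrite mulr0.
have fd' : dR (fun t => f (x + t)) 0 d.
  apply: cvg_trans fd; apply: near_eq_cvg; apply: nearW => h /=.
  by rewrite add0r addr0.
move=> /(_ fd'); apply: dcurve_eq_near ltr01 _ => h _.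
by rewrite add0r [_ *: _]mulrC.
Qed.

Definition smooth f := forall n, C n setT setT (f : R^o -> R^o).

Lemma dcurve_continuous (F : tvsType R) (c : R -> F) s d : dcurve c s d ->
  {for s, continuous (c : R^o -> F)}.
Proof.
move=> cd W nW.
have cP : continuous (fun z : R^o * F => c s + z.1 *: z.2).
  apply: continuous_add; first by move=> ?; exact: cvg_cst.
  exact: scale_continuous.
have [|[I B] /= [/nbhs_ballP[e1 /= e10 he1] nB] IB] := cP (0, d) W.
  by rewrite scale0r addr0.
have [e2 e20 he2] := dcurve_near cd nB.
apply/nbhs_ballP; exists (Num.min e1 e2) => [|x]; first by rewrite /= lt_min e10.
rewrite /ball/= lt_min distrC => /andP[h1 h2].
have [->|xs] := eqVneq x s; first exact: nbhs_singleton.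
have := IB (x - s, (x - s)^-1 *: (c (s + (x - s)) - c s)).
rewrite /= scalerA divff ?subr_eq0// scale1r !subrKC; apply; split => /=.
  by apply: he1; rewrite /ball/= sub0r normrN.
have := he2 _ h2; rewrite subr_eq0 subrKC; exact.
Qed.

Definition der f x : R := lim ((fun h : R => h^-1 *: (f (x + h) - f x : R^o)) @ 0^').

Lemma derE f x (d : R) : dR f x d -> der f x = d.
Proof. by move=> fd; exact: (cvg_lim hausdorff_R fd). Qed.

Lemma smooth_der f : smooth f -> (forall x, dR f x (der f x)) /\ smooth (der f).
Proof.
move=> sf.
have fd n : exists2 df : R^o * R^o -> R^o, (forall x, dR f x (df (x, 1))) & C n setT setT df.
  have [df hdf Cdf] := C_inv (sf n.+1); exists df; last exact: C_sub Cdf.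
  move=> x; have := hdf x 1 I; rewrite /dcurve.
  by apply: cvg_trans; apply: near_eq_cvg; apply: nearW => h /=;
    rewrite !add0r scale0r addr0 [h *: _]mulr1.
split=> [x|n].
  by have [df hdf _] := fd 0%N; rewrite (derE (hdf x)).
have [df hdf Cdf] := fd n.
have -> : der f = (fun x => df (x, 1)) by apply/funext => x; exact: derE.
apply: (@C_comp _ n _ _ _ setT setT setT setT (fun x : R^o => (x, 1 : R^o)) df) => //.
  exact: openT.
have := @C_affine R n R^o (R^o * R^o)%type setT setT (fun x => (x, 0)) (0, 1).
rewrite (_ : (fun x : R^o => _ + _) = fun x : R^o => (x, 1 : R^o)); last first.
  by apply/funext => x; rewrite -[LHS]/(x + 0, 0 + 1) addr0 add0r.
by apply; apply: clin_pair; [exact: clin_id|exact: clin_zero].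
Qed.

(** The functions x^-k exp(-1/x), extended by 0. As the derivative of one is a combination of two
    others, smoothness of all of them follows by a single induction. *)
Definition flat (k : nat) x : R := if 0 < x then x^-1 ^+ k * expR (- x^-1) else 0.

Lemma flat_le k x : 0 < x -> flat k x <= (k.+2)`!%:R * x ^+ 2.
Proof.
move=> x0; rewrite /flat x0 expRN.
(* Only the summand of order k + 2 of the exponential series at 1/x is kept. *)
have h := expR_ge1Dxn k.+1 (ltW (_ : 0 < x^-1)); rewrite invr_gt0 in h.
have {}h := h x0.
have h2 : x^-1 ^+ k.+2 / k.+2`!%:R <= expR x^-1.
  by apply: le_trans h; rewrite lerDr.
rewrite ler_pdivrMr ?expR_gt0//.
have -> : x^-1 ^+ k = x^-1 ^+ k.+2 * x ^+ 2.
  by rewrite -addn2 exprD -mulrA -exprMn mulVf ?gt_eqF// expr1n mulr1.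
rewrite [leRHS]mulrAC ler_pM2r ?exprn_gt0//.
by rewrite -ler_pdivrMl ?ltr0n ?fact_gt0// mulrC.
Qed.

Lemma flat_ge0 k x : 0 <= flat k x.
Proof.
rewrite /flat; case: ifPn => // x0.
by rewrite mulr_ge0 ?expR_ge0// exprn_ge0// invr_ge0 ltW.
Qed.

Lemma flat_dcurve k x : dR (flat k) x (flat k.+2 x - k%:R * flat k.+1 x).
Proof.
have [x0|x0|->] := ltgtP x 0.
- have -> : flat k.+2 x - k%:R * flat k.+1 x = 0.
    by rewrite /flat ltNge (ltW x0)/= mulr0 subrr.
  apply: (@dcurve_eq_near _ _ (fun=> 0) _ _ (- x)); first by rewrite oppr_gt0.
    move=> h; rewrite ltr_norml opprK => /andP[_ h1].
    by rewrite /flat ltNge ltW// addrC -ltrBrDr sub0r.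
  exact: dcurve_cst.
- have hx : dR (fun y => y^-1 ^+ k * expR (- y^-1)) x (flat k.+2 x - k%:R * flat k.+1 x).
    apply: is_derive_dcurve.
    have hV : is_derive x (1 : R) (fun y : R => y^-1) (- x ^- 2).
      have := @is_deriveV R id x 1 1 (lt0r_neq0 x0) (is_derive_id _ _).
      by rewrite [_ *: _]mulr1.
    have hN : is_derive x (1 : R) (fun y : R => - y^-1) (x ^- 2).
      by have := is_deriveN hV; rewrite opprK.
    have hE := @is_derive1_comp R expR (fun y : R => - y^-1) x _ _
      (is_derive_expR _) hN.
    have := is_deriveM (is_deriveX k hV) hE.
    rewrite (_ : _ * _ = fun y => y^-1 ^+ k * expR (- y^-1)); last first.
      by apply/funext => y /=; rewrite -[LHS]/(_ y * _ y) fctE.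
    move=> hm; apply: (is_derive_eq hm); rewrite /flat x0 fctE -exprVn -[_ *: _]/(_ * _).
    rewrite -[X in _ + X = _]/(_ * (_ * _)) /=.
    clear hm; case: k => [|k] /=; first by rewrite !mul0r mulr0 addr0 subr0 !mul1r mulrC.
    by rewrite !exprS expr0; ring.
  apply: dcurve_eq_near x0 _ hx => h; rewrite ltr_norml => /andP[h1 _].
  by rewrite /flat -ltrBlDl sub0r h1.
- rewrite /flat ltxx mulr0 subrr; apply/dcurveP => W.
  move=> /nbhs_ballP[e /= e0 he].
  pose K : R := k.+2`!%:R; have K0 : 0 < K by rewrite ltr0n fact_gt0.
  exists (e / K) => [|h hl h0]; first by rewrite divr_gt0.
  apply: he; rewrite /ball/= sub0r normrN add0r /flat ltxx subr0.
  case: ifPn => h0'; last by rewrite scaler0 normr0.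
  have := flat_le k h0'; rewrite /flat h0' => hf.
  rewrite normrZ ger0_norm ?invr_ge0 ?(ltW h0')// ger0_norm; last first.
    by have := flat_ge0 k h; rewrite /flat h0'.
  rewrite mulrC ltr_pdivrMr//; apply: le_lt_trans hf _.
  rewrite gtr0_norm// in hl; rewrite expr2 mulrA ltr_pM2r//.
  by rewrite mulrC -ltr_pdivlMr.
Qed.

Lemma flat_smooth k : smooth (flat k).
Proof.
move=> n; elim: n k => [|n IH] k.
  by apply: C0; apply: continuous_cont_on => x; exact: (dcurve_continuous (@flat_dcurve k x)).
apply: (@C_S _ _ _ _ _ _ _ (fun z : R^o * R^o => z.2 *: (flat k.+2 z.1 - k%:R * flat k.+1 z.1 : R^o))).
- by apply: continuous_cont_on => x; exact: (dcurve_continuous (@flat_dcurve k x)).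
- by move=> x v _; exact: dcurve_line (@flat_dcurve k x).
apply: Q_scale; first by apply: C_lin; exact: clin_snd.
apply: (@C_fst R n R^o R^o R^o setT setT (fun x => flat k.+2 x - k%:R * flat k.+1 x)).
apply: Q_add; first exact: IH.
have L : clin (fun y : R^o => (- k%:R : R) *: y) by apply: clin_scale; exact: clin_id.
have := Q_linear L (IH k.+1 : Q _ _ _ _ _ _ _).
by congr Q; apply/funext => z; rewrite /= [_ *: _]mulNr.
Qed.

Lemma C_inv_fun n : C n [set x : R^o | 0 < x] [set x : R^o | 0 < x] (fun x : R^o => x^-1 : R^o).
Proof.
have hV x : 0 < x -> dR (fun x => x^-1) x (- (x^-1 * x^-1)).
  move=> x0; apply: is_derive_dcurve.
  have := @is_deriveV R id x 1 1 (lt0r_neq0 x0) (is_derive_id _ _).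
  by rewrite [_ *: _]mulr1 -exprVn expr2.
have cV : cont_on [set x : R^o | 0 < x] (fun x : R^o => x^-1 : R^o).
  move=> x /= x0 W nW; have h : nbhs (x : R^o) _ := @dcurve_continuous R^o _ _ _ (hV x x0) _ nW.
  by apply: filterS h => y.
elim: n => [|n IH]; first exact: C0.
apply: (@C_S _ _ _ _ _ _ _ (fun z : R^o * R^o => (- z.2) *: ((z.1)^-1 *: (z.1)^-1 : R^o))) => //.
  move=> x v /= x0; have := dcurve_line (v := v) (hV x x0).
  congr (@dcurve R R^o _ _ _).
  by rewrite -[LHS]/(v * _) -[RHS]/(- v * _) mulrN mulNr.
apply: Q_scale.
  apply: (@C_lin R n _ R^o _ _ (fun z : R^o * R^o => - z.2)).
  have := clin_scale (-1) (@clin_snd R R^o R^o).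
  by congr clin; apply/funext => z; rewrite scaleN1r.
by apply: Q_scale; apply: (@C_fst R n R^o R^o R^o).
Qed.

Lemma smoothM f g : smooth f -> smooth g -> smooth (fun x => f x * g x).
Proof. by move=> sf sg n; exact: Q_scale (sf n) (sg n). Qed.

Lemma smoothD f g : smooth f -> smooth g -> smooth (fun x => f x + g x).
Proof. by move=> sf sg n; exact: Q_add (sf n) (sg n). Qed.

Lemma smooth_affine (a b : R) : smooth (fun x => a * x + b).
Proof.
by move=> n; apply: (@C_affine R n R^o R^o _ _ (fun x => a *: x) b);
  apply: clin_scale; exact: clin_id.
Qed.

Lemma smooth_comp f g : smooth f -> smooth g -> smooth (fun x => g (f x)).
Proof. by move=> sf sg n; apply: C_comp (sf n) (sg n) => //; exact: openT. Qed.

Lemma smooth_cst (a : R) : smooth (fun=> a).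
Proof. by move=> n; exact: C_cst. Qed.

Definition step x : R := flat 0 x / (flat 0 x + flat 0 (1 - x)).

Lemma flat0_gt0 x : 0 < x -> 0 < flat 0 x.
Proof. by move=> x0; rewrite /flat x0 expr0 mul1r expR_gt0. Qed.

Lemma step_den_gt0 x : 0 < flat 0 x + flat 0 (1 - x).
Proof.
have [x0|x0] := ltP 0 x.
  by rewrite ltr_pwDl ?flat0_gt0 ?flat_ge0.
by rewrite ltr_wpDl ?flat_ge0// flat0_gt0// subr_gt0 (le_lt_trans x0).
Qed.

Lemma step_smooth : smooth step.
Proof.
apply: smoothM; first exact: flat_smooth.
have sd : smooth (fun x => flat 0 x + flat 0 (1 - x)).
  apply: smoothD; first exact: flat_smooth.
  apply: (@smooth_comp (fun x => 1 - x) (flat 0)); last exact: flat_smooth.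
  have := smooth_affine (-1) 1; congr smooth; apply/funext => x.
  by rewrite mulN1r addrC.
move=> n; apply: (@C_comp _ n _ _ _ setT setT [set x : R^o | 0 < x]
  [set x : R^o | 0 < x] (fun x : R^o => flat 0 x + flat 0 (1 - x) : R^o)) (sd n) (C_inv_fun n) => //.
- by move=> x _; exact: step_den_gt0.
- by move=> x _; exact: step_den_gt0.
Qed.

Lemma step0 x : x <= 0 -> step x = 0.
Proof. by move=> x0; rewrite /step {1}/flat ltNge x0/= mul0r. Qed.

Lemma step1 x : 1 <= x -> step x = 1.
Proof.
move=> x1; rewrite /step [flat 0 (1 - x)]/flat subr_gt0 ltNge x1/= addr0 divff//.
by rewrite gt_eqF// flat0_gt0// (lt_le_trans ltr01).
Qed.

Lemma dcurve_eq_cst f (a : R) : (forall x, dR f x a) -> forall x y, f x - f y = a * (x - y).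
Proof.
move=> fa x y; pose g : R -> R := f - (a *: id).
have hg z : is_derive z (1 : R) g 0.
  apply: (is_derive_eq (is_deriveB (dcurve_is_derive (fa z))
    (is_deriveZ a (is_derive_id z (1:R))))).
  by rewrite [_ *: _]mulr1 subrr.
have : g x = g y by apply: is_derive_0_is_cst.
rewrite /g !fctE /= => /(congr1 (fun u => u + a *: x - f y)); rewrite subrK => ->.
by rewrite -[a *: y]/(a * y) -[a *: x]/(a * x); ring.
Qed.

Definition Delta f x : R := f x - f (x - 1).

Lemma Delta_dcurve f f' : (forall x, dR f x (f' x)) -> forall x, dR (Delta f) x (Delta f' x).
Proof.
move=> ff' x; apply: dcurve_add; first exact: ff'.
have h : dR (fun y => f (y - 1)) x (f' (x - 1)).
  move: (ff' (x - 1)); apply: cvg_trans; apply: near_eq_cvg; apply: nearW => h /=.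
  by rewrite addrAC.
have := dcurve_scale (a := -1) h; rewrite scaleN1r.
by apply: dcurve_eq_near ltr01 _ => h' _; rewrite scaleN1r.
Qed.

Lemma Delta_smooth f : smooth f -> smooth (Delta f).
Proof.
move=> sf; apply: smoothD => //.
have s1 : smooth (fun x => f (x - 1)).
  apply: (@smooth_comp (fun x => x - 1) f) => //.
  by have := smooth_affine 1 (-1); congr smooth; apply/funext => x; rewrite mul1r.
have := smoothM (smooth_cst (-1)) s1.
by congr smooth; apply/funext => x; rewrite mulN1r.
Qed.

(* [f] is a polynomial of degree at most [n] with n-th derivative [a]. *)
Fixpoint polyn (n : nat) (a : R) f : Prop :=
  if n is n'.+1 then exists2 f', (forall x, dR f x (f' x)) & polyn n' a f'
  else forall x, f x = a.

Lemma Delta_polyn n a f : polyn n.+1 a f -> polyn n a (Delta f).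
Proof.
elim: n f => [|n IH] f /= [f' ff' h].
  move=> x; rewrite /Delta.
  have fa y : dR f y a by have := ff' y; rewrite h.
  by rewrite (dcurve_eq_cst fa); ring.
by exists (Delta f'); [exact: Delta_dcurve|exact: IH].
Qed.

Lemma iter_Delta_polyn m n a f : polyn (m + n) a f -> polyn n a (iter m Delta f).
Proof. by elim: m n f => //= m IH n f h; apply: Delta_polyn; apply: IH; rewrite addnS. Qed.

Lemma polyn_iter_der m n a f : polyn (m + n) a f -> polyn n a (iter m der f).
Proof.
elim: m f => //= m IH f [f' ff' h]; rewrite -iterS iterSr; apply: IH.
by rewrite (_ : der f = f')//; apply/funext => x; exact: derE.
Qed.

Lemma polyn_exp n : polyn n 1 (fun x => x ^+ n / n`!%:R).
Proof.
elim: n => [|n IH] /=; first by move=> x; rewrite expr0 fact0 divr1.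
exists (fun x => x ^+ n / n`!%:R) => // x.
have := is_deriveM (is_deriveX n.+1 (is_derive_id x (1:R))) (is_derive_cst (n.+1`!%:R^-1 : R) x (1:R)).
rewrite (_ : _ * _ = fun x => x ^+ n.+1 / n.+1`!%:R); last first.
  by apply/funext => y /=; rewrite -[LHS]/(_ y * _ y) fctE.
move=> h; apply: is_derive_dcurve; apply: (is_derive_eq h).
rewrite scaler0 add0r -[_ *: _]/(_ * (_ * _)) mulr1 /= factS natrM invfM.
rewrite /cst mulrC mulrA; congr (_ * _).
by rewrite mulrAC divff ?mul1r// pnatr_eq0.
Qed.

Lemma iter_smooth_der j f : smooth f -> smooth (iter j der f).
Proof. by elim: j => //= j IH sf; apply: (smooth_der _).2; exact: IH. Qed.

Lemma iter_smooth_Delta j f : smooth f -> smooth (iter j Delta f).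
Proof. by elim: j => //= j IH sf; apply: Delta_smooth; exact: IH. Qed.

Lemma der_eq_near f g x (e : R) : 0 < e ->
  (forall h, `|h| < e -> f (x + h) = g (x + h)) -> der f x = der g x.
Proof.
move=> e0 h; have fx : f x = g x by have := h 0; rewrite addr0 normr0; exact.
rewrite /der; congr (lim _).
by rewrite eqEsubset; split; apply: near_eq_cvg; exists e => //= k;
  rewrite /ball_/= sub0r normrN => ke _; rewrite h// fx.
Qed.

Lemma iter_der_eq_gt j f g (c : R) :
  (forall x, c < x -> f x = g x) -> forall x, c < x -> iter j der f x = iter j der g x.
Proof.
elim: j f g => //= j IH f g h x cx; rewrite -!iterS !iterSr.
apply: IH cx => {}x cx; apply: (@der_eq_near _ _ _ (x - c)); first by rewrite subr_gt0.
by move=> k; rewrite ltr_norml => /andP[k1 _]; apply: h; lra.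
Qed.

Lemma iter_der_eq0_lt j f (c : R) :
  (forall x, x < c -> f x = 0) -> forall x, x < c -> iter j der f x = 0.
Proof.
elim: j f => //= j IH f h x cx; rewrite -iterS iterSr; apply: IH cx => {}x cx.
rewrite (@der_eq_near f (fun=> 0) x (c - x)) ?subr_gt0//; last first.
  by move=> k; rewrite ltr_norml => /andP[_ k1]; apply: h; lra.
by apply: derE; exact: dcurve_cst.
Qed.

Lemma iter_Delta_eq_gt j f g (c : R) :
  (forall x, c < x -> f x = g x) ->
  forall x, c + j%:R < x -> iter j Delta f x = iter j Delta g x.
Proof.
move=> h; elim: j => [|j IH] x /=; first by rewrite addr0; exact: h.
rewrite /Delta -natr1 => hx; rewrite !IH//; lra.
Qed.

Lemma iter_Delta_eq0_le j f (c : R) :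
  (forall x, x <= c -> f x = 0) -> forall x, x <= c -> iter j Delta f x = 0.
Proof.
move=> h; elim: j => [|j IH] x /= xc; first exact: h.
by rewrite /Delta !IH ?subr0//; lra.
Qed.

Lemma smooth_continuous f : smooth f -> continuous (f : R^o -> R^o).
Proof. by move=> sf; apply: cont_on_setT; exact: C_cont (sf 0%N). Qed.

Lemma eq0_le f (c : R) : continuous (f : R^o -> R^o) ->
  (forall x, x < c -> f x = 0) -> forall x, x <= c -> f x = 0.
Proof.
move=> cf h x; rewrite le_eqVlt => /orP[/eqP ->|]; last exact: h.
apply/eqP; apply: contrapT => /negP fc0.
have nf : nbhs (f c : R^o) [set y | y != 0].
  by apply: open_nbhs_nbhs; split => //; exact: open_neq.
have := cf c _ nf => /nbhs_ballP[e /= e0 he].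
have : f (c - e / 2) != 0.
  by apply: he; rewrite /ball/= opprB addrC subrK ger0_norm//; lra.
by rewrite h ?eqxx//; lra.
Qed.

(* Kernels [ker L j] for [j <= L]: smooth, supported in [0, L + 2], with integer
   translates summing to 1, and such that differentiating [ker L j] amounts to
   taking a backward difference of [ker L j.+1]. *)
Definition ramp (L : nat) x : R := x ^+ L / L`!%:R * step x.

(** The construction of cardinal B-splines, from a truncated power with a smooth start. Beyond 1 + m
    this is a polynomial of degree L - (j + m), as derivatives and differences both lower the
    degree; for m = L - j it is the constant 1, and one more difference produces compact support. *)
Definition ker0 (L j m : nat) : R -> R := iter m Delta (iter j der (ramp L)).

Definition ker (L j : nat) : R -> R := ker0 L j (L - j).+1.

Lemma smooth_exp n : smooth (fun x => x ^+ n).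
Proof.
elim: n => [|n IH]; first exact: (smooth_cst 1).
have := smoothM (_ : smooth id) IH.
rewrite (_ : (fun x => id x * x ^+ n) = fun x => x ^+ n.+1); last first.
  by apply/funext => x; rewrite exprS.
by apply=> k; exact: C_lin (clin_id _).
Qed.

Lemma ramp_smooth L : smooth (ramp L).
Proof.
apply: smoothM step_smooth; apply: smoothM (smooth_exp L) (smooth_cst _).
Qed.

Lemma ker0_smooth L j m : smooth (ker0 L j m).
Proof. by apply: iter_smooth_Delta; apply: iter_smooth_der; exact: ramp_smooth. Qed.

Lemma ker_smooth L j : smooth (ker L j).
Proof. exact: ker0_smooth. Qed.

Lemma ker0_le0 L j m x : x <= 0 -> ker0 L j m x = 0.
Proof.
apply: iter_Delta_eq0_le => {}x; apply: eq0_le.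
  by apply: smooth_continuous; apply: iter_smooth_der; exact: ramp_smooth.
by apply: iter_der_eq0_lt => {}x x0; rewrite /ramp step0 ?mulr0// ltW.
Qed.

Lemma ker0_polyn L j m : (j + m <= L)%N -> exists2 g, polyn (L - (j + m)) 1 g &
  forall x, 1 + m%:R < x -> ker0 L j m x = g x.
Proof.
move=> jm; exists (iter m Delta (iter j der (fun x => x ^+ L / L`!%:R))).
  apply: iter_Delta_polyn; apply: polyn_iter_der.
  by rewrite addnA subnKC//; exact: polyn_exp.
move=> x hx; apply: iter_Delta_eq_gt hx => {}x; apply: iter_der_eq_gt => {}x x1.
by rewrite /ramp step1 ?mulr1// ltW.
Qed.

Lemma ker0_one L j x : (j <= L)%N -> 1 + (L - j)%:R < x -> ker0 L j (L - j) x = 1.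
Proof.
move=> jL hx; have [|g pg ->//] := @ker0_polyn L j (L - j); first by rewrite subnKC.
by move: pg; rewrite subnKC// subnn; exact.
Qed.

Lemma ker_le0 L j x : x <= 0 -> ker L j x = 0.
Proof. exact: ker0_le0. Qed.

Lemma kerE L j x : ker L j x = ker0 L j (L - j) x - ker0 L j (L - j) (x - 1).
Proof. by []. Qed.

Lemma ker_ge L j x : (j <= L)%N -> L.+2%:R < x -> ker L j x = 0.
Proof.
move=> jL hx; have h : ((L - j)%:R : R) <= L%:R by rewrite ler_nat leq_subr.
by rewrite -!natr1 in hx; rewrite kerE !ker0_one ?subrr//; lra.
Qed.

Lemma ker_dcurve L j x : (j < L)%N ->
  dR (ker L j) x (ker L j.+1 x - ker L j.+1 (x - 1)).
Proof.
move=> jL; have d1 (f : R -> R) : smooth f -> forall m y, dR (iter m Delta f) y (iter m Delta (der f) y).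
  move=> sf; elim=> [|m IH] y /=; first exact: (smooth_der sf).1.
  exact: (@Delta_dcurve (iter m Delta f)).
have := d1 _ (iter_smooth_der j (ramp_smooth L)) (L - j).+1 x.
by rewrite /ker (subnSK jL).
Qed.

(** The sum telescopes, because [ker] is the backward difference of a function that is 0 on the left
    and 1 far to the right. *)
Lemma ker_sum L j (a b : nat) y : (j <= L)%N -> a%:R <= y + 1 -> y + L.+2%:R < b%:R -> (a <= b)%N ->
  \sum_(a <= k < b.+1) ker L j (k%:R - y) = 1.
Proof.
move=> jL ha hb ab; have h : ((L - j)%:R : R) <= L%:R by rewrite ler_nat leq_subr.
pose F (k : nat) := ker0 L j (L - j) (k%:R - 1 - y).
rewrite (eq_bigr (fun k => F k.+1 - F k)); last first.
  by move=> k _; rewrite kerE /F -natr1 addrK addrAC.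
rewrite telescope_sumr; last by rewrite ltnW.
rewrite /F -natr1 addrK ker0_one//; last by rewrite -!natr1 in hb; lra.
by rewrite ker0_le0 ?subr0//; lra.
Qed.

Lemma ker_bounded L j : (j <= L)%N -> exists2 B : R, 0 < B & forall x, `|ker L j x| <= B.
Proof.
move=> jL; pose f x : R := `|ker L j x|.
have cf : {within `[0 : R, L.+2%:R : R], continuous f}.
  apply: continuous_subspaceT => x; apply: (@continuous_comp R^o R^o R^o (ker L j)).
    exact: (smooth_continuous (ker_smooth L j)).
  exact: (@norm_continuous R R^o).
have [c _ hc] := EVT_max (ler0n R L.+2) cf.
exists (f c + 1); first by rewrite ltr_wpDl ?ltr01 ?normr_ge0.
move=> x; have [x0|x0] := leP x 0; first by rewrite ker_le0// normr0 addr_ge0 ?normr_ge0 ?ler01.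
have [x1|x1] := ltP L.+2%:R x; first by rewrite ker_ge// normr0 addr_ge0 ?normr_ge0 ?ler01.
by apply: (@le_trans _ _ (f c)); [apply: hc; rewrite in_itv/= (ltW x0)|rewrite lerDl ler01].
Qed.

End Smooth.

(** * Smoothing on half spaces *)

Section Smoothing.
Context {R : realType}.
Implicit Types (E F G P : tvsType R) (k l n m : nat).
(** The admissible scales. Away from 0 they are isolated, so continuity in the scale is an issue at
    0 only, although the number of terms of an average jumps with the scale. *)
Definition inv_nat : set R^o := [set u | u = 0 \/ exists n : nat, u = n.+1%:R^-1].

Lemma inv_nat0 : inv_nat 0. Proof. by left. Qed.

Lemma inv_natS n : inv_nat n.+1%:R^-1. Proof. by right; exists n. Qed.

Lemma inv_nat_ge0 u : inv_nat u -> 0 <= u.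
Proof. by move=> [->//|[n ->]]; rewrite invr_ge0. Qed.

Lemma inv_nat_gt0 u : inv_nat u -> u != 0 -> 0 < u.
Proof. by move=> /inv_nat_ge0; rewrite le0r => /orP[->|]. Qed.

Lemma inv_nat_lt (e : R) : 0 < e -> exists m, forall n, (m <= n)%N -> n.+1%:R^-1 < e.
Proof.
move=> e0; exists (Num.truncn e^-1) => n mn.
rewrite invf_plt ?posrE//; apply: (lt_le_trans (truncnS_gt _)).
by rewrite ler_nat.
Qed.

Lemma inv_nat_isolated u : inv_nat u -> u != 0 ->
  exists2 N : set R^o, nbhs u N & forall v, inv_nat v -> N v -> v = u.
Proof.
move=> [->|[n ->]] u0; first by rewrite eqxx in u0.
pose a : R := n.+2%:R^-1.
pose N : set R^o := [set v | a < v /\ (n = 0%N \/ v < n%:R^-1)].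
exists N.
  apply: filterI.
    apply: open_nbhs_nbhs; split; first exact: (@open_gt R a).
    by rewrite /= /a ltf_pV2 ?posrE// ltr_nat.
  case: n @a @N u0 => [|n] a N u0; first by apply: filterE; left.
  apply: (@filterS _ _ _ [set v : R^o | v < n.+1%:R^-1]); first by move=> v; right.
  apply: open_nbhs_nbhs; split; first exact: (@open_lt R n.+1%:R^-1).
  by rewrite /= ltf_pV2 ?posrE// ltr_nat.
move=> v [->|[m ->]] [av vn].
  by move: av; rewrite /a invr_lt0 ltrn0.
have mn : (m <= n)%N by move: av; rewrite /a ltf_pV2 ?posrE// ltr_nat !ltnS.
case: vn => [n0|]; first by move: mn; rewrite n0 leqn0 => /eqP ->.
case: (n) mn => [|n'] mn; first by move: mn; rewrite leqn0 => /eqP ->.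
rewrite ltf_pV2 ?posrE// ltr_nat ltnS => nm.
by have -> : m = n'.+1 by apply/eqP; rewrite eqn_leq mn.
Qed.

(** Handles averages without any sign condition on the kernels: the number of terms and the size of
    the coefficients are bounded, so a small enough neighbourhood of 0 absorbs the sum. *)
Lemma small_sum F n (B : R) (W : set F) : nbhs 0 W ->
  exists2 V, nbhs (0 : F) V & forall (a : nat -> R) (f : nat -> F),
    (forall i, (i < n)%N -> `|a i| <= B /\ V (f i)) ->
    W (\sum_(i < n) a i *: f i).
Proof.
elim: n W => [|n IH] W nW.
  exists setT; first exact: filterT.
  by move=> a f _; rewrite big_ord0; exact: nbhs_singleton.
have [[W1 W2] /= [nW1 nW2] W12] : nbhs (0 : F, 0 : F) [set z | W (z.1 + z.2)].
  by apply: (@add_continuous F (0, 0)); rewrite /= addr0.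
have [V1 nV1 hV1] := IH _ nW1.
have [D [oD cD D0 DW2]] := cvx_nbhs nW2.
pose b := Num.max 1 B; have b0 : 0 < b by rewrite lt_max ltr01.
pose V2 : set F := [set x | D (b *: x) /\ D ((- b) *: x)].
have nV2 : nbhs 0 V2.
  have cs (c : R) : continuous (fun x : F => c *: x).
    by apply: continuous_scale => ?; [exact: cvg_cst|exact: cvg_id].
  by apply: filterI; apply: cs; rewrite scaler0; exact: open_nbhs_nbhs.
exists (V1 `&` V2); first exact: filterI.
have {}W12 x y : W1 x -> W2 y -> W (x + y) by move=> ? ?; exact: (W12 (x, y)).
move=> a f h.
have E : \sum_(i < n.+1) a i *: f i = \sum_(i < n) a i *: f i + a n *: f n by rewrite big_ord_recr.
rewrite E {E}; apply: W12.
  by apply: hV1 => i ib; have [? []] := h i (ltnW ib).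
apply: DW2; have [ab [_ [Db DNb]]] := h n (ltnSn n).
have ab1 : `|a n| / b <= 1.
  by rewrite ler_pdivrMr// mul1r (le_trans ab)// le_max lexx orbT.
have [a0|a0] := leP 0 (a n).
  have -> : a n *: f n = (`|a n| / b) *: (b *: f n) + (1 - `|a n| / b) *: 0.
    by rewrite scaler0 addr0 scalerA divfK ?gt_eqF// ger0_norm.
  by apply: cD => //; rewrite ?divr_ge0 ?subr_ge0 ?(ltW b0)// subrKC.
have -> : a n *: f n = (`|a n| / b) *: ((- b) *: f n) + (1 - `|a n| / b) *: 0.
  by rewrite scaler0 addr0 scalerA mulrN divfK ?gt_eqF// ltr0_norm// opprK.
by apply: cD => //; rewrite ?divr_ge0 ?subr_ge0 ?(ltW b0)// subrKC.
Qed.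

Lemma cvx_sum F (D : set F) n (a : nat -> R) (f : nat -> F) : cvx D ->
  (forall i, (i < n)%N -> 0 <= a i) -> \sum_(i < n) a i = 1 ->
  (forall i, (i < n)%N -> a i != 0 -> D (f i)) -> D (\sum_(i < n) a i *: f i).
Proof.
move=> cD; elim: n a f => [|n IH] a f a0 a1 Df.
  by move: a1; rewrite big_ord0 => /eqP; rewrite eq_sym oner_eq0.
rewrite big_ord_recr /= in a1.
have E : \sum_(i < n.+1) a i *: f i = \sum_(i < n) a i *: f i + a n *: f n by rewrite big_ord_recr.
rewrite E {E}.
have s0 : 0 <= \sum_(i < n) a i by apply: sumr_ge0 => i _; apply: a0; exact: ltnW (ltn_ord i).
have [sz|sz] := eqVneq (\sum_(i < n) a i) 0.
  have an : a n = 1 by move: a1; rewrite sz add0r.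
  rewrite big1 ?add0r ?an ?scale1r; first by apply: Df => //; rewrite an oner_eq0.
  move=> i _; have /psumr_eq0P : forall i : 'I_n, true -> 0 <= a i.
    by move=> i' _; apply: a0; exact: ltnW (ltn_ord i').
  by move=> /(_ sz i isT) ->; rewrite scale0r.
have [an0|an0] := eqVneq (a n) 0.
  rewrite an0 scale0r addr0; apply: IH => //.
  - by move=> i ib; apply: a0; exact: ltnW.
  - by move: a1; rewrite an0 addr0.
  - by move=> i ib; apply: Df; exact: ltnW.
set s := \sum_(i < n) a i in s0 sz a1 *.
have -> : \sum_(i < n) a i *: f i = s *: (\sum_(i < n) (a i / s) *: f i).
  by rewrite scaler_sumr; apply: eq_bigr => i _; rewrite scalerA mulrCA divff ?mulr1.
apply: cD => //; first exact: a0; last exact: Df.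
apply: (IH (fun i => a i / s)).
- by move=> i ib; rewrite divr_ge0//; apply: a0; exact: ltnW.
- by rewrite -mulr_suml divff.
- move=> i ib; rewrite mulf_eq0 negb_or => /andP[ai _].
  by apply: Df => //; exact: ltnW.
Qed.

(** The difference quotient of [G] along [e] with the scale as its step; at scale 0 it is completed
    by the derivative. *)
Definition dq P E F (G : (R^o * P) * E -> F) (g : (R^o * P) * (E * E) -> F) (e : E) :=
  fun z : (R^o * P) * E => if z.1.1 == 0 then g (z.1, (z.2, e))
    else z.1.1^-1 *: (G (z.1, z.2 + z.1.1 *: e) - G z).

Lemma continuous_eval (T : topologicalType) (A : set T) E F (S : set E) (f : T * E -> F) p :
  A p -> cont_on (A `*` S) f -> cont_on S (fun y => f (p, y)).
Proof.
move=> Ap cf; apply: (@cont_on_comp _ _ _ _ _ (fun y => (p, y))) cf => //.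
by apply: cont_on_pair; [exact: cont_on_cst|exact: cont_on_id].
Qed.

Lemma cont_on_sum (T : topologicalType) F (A : set T) n (f : nat -> T -> F) :
  (forall i, (i < n)%N -> cont_on A (f i)) -> cont_on A (fun x => \sum_(i < n) f i x).
Proof.
elim: n => [|n IH] h.
  by apply: cont_on_eq (@cont_on_cst _ _ A 0) => x _; rewrite big_ord0.
apply: (@cont_on_eq _ _ _ (fun x => \sum_(i < n) f i x + f n x)).
  by move=> x _; rewrite big_ord_recr.
by apply: cont_on_add; [apply: IH => i ib; apply: h; exact: ltnW|exact: h].
Qed.

Section DifferenceQuotient.
Variables (P F : tvsType R) (S1 : set P).
Local Notation A := (inv_nat `*` S1).
Local Notation A' := ((inv_nat `&` [set u | u != 0]) `*` S1).

(** At scale 0 the mean value theorem confines nearby quotients to a convex neighbourhood of the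
    derivative. It applies to base points in [O2] only; a point of [S2] is approximated by such
    points, which is why the closure of the convex set has to lie in the target. *)
Lemma dq_cont E (e : E) (S2 O2 : set E) (G : (R^o * P) * E -> F)
    (g : (R^o * P) * (E * E) -> F) : open O2 -> O2 `<=` S2 -> S2 `<=` closure O2 ->
  (forall y (c : R), 0 <= c -> S2 y -> S2 (y + c *: e)) ->
  (forall y (c : R), 0 <= c -> O2 y -> O2 (y + c *: e)) ->
  cont_on (A `*` S2) G -> cont_on (A `*` (S2 `*` setT)) g -> is_d2 A O2 G g ->
  cont_on (A `*` S2) (dq G g e).
Proof.
move=> oO OS SO hS hO cG cg dg.
have cq u : inv_nat u -> cont_on (S1 `*` S2)
    (fun z => u^-1 *: (G ((u, z.1), z.2 + u *: e) - G ((u, z.1), z.2))).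
  move=> Uu; apply: cont_on_scale; first exact: cont_on_cst.
  apply: cont_on_add.
    apply: (@cont_on_comp _ _ _ _ _ (fun z : P * E => ((u, z.1), z.2 + u *: e))) cG.
      by move=> [p y] [/= Sp Sy]; split => //; apply: hS => //; exact: inv_nat_ge0.
    apply: cont_on_pair.
      by apply: cont_on_pair; [exact: cont_on_cst|exact: cont_on_fst].
    by apply: cont_on_add; [exact: cont_on_snd|exact: cont_on_cst].
  apply: (@cont_on_comp _ _ _ _ setT (fun z => G ((u, z.1), z.2)) -%R) => //.
    apply: (@cont_on_comp _ _ _ _ _ (fun z : P * E => ((u, z.1), z.2))) cG.
      by move=> [p y] [/= Sp Sy].
    apply: cont_on_pair; last exact: cont_on_snd.
    by apply: cont_on_pair; [exact: cont_on_cst|exact: cont_on_fst].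
  by apply: continuous_cont_on; exact: opp_continuous.
move=> [[u0 p0] y0] [[/= Uu0 Sp0] Sy0] W; rewrite /dq /=.
case: ifPn => [/eqP u00|u00] nW; last first.
  have [N nN hN] := inv_nat_isolated Uu0 u00.
  have [[N1 N2] /= [nN1 nN2] N12] := cq u0 Uu0 (p0, y0) (conj Sp0 Sy0) W nW.
  exists (N `*` N1, N2).
    by split => //=; exists (N, N1).
  move=> [[u p] y] [[/= Nu N1p] N2y] [[/= Uu Sp] Sy].
  by rewrite (hN u Uu Nu) (negbTE u00); apply: (N12 (p, y)).
subst u0; have [D [oD cD Dd DW]] := cvx_closed_nbhs nW.
have [[N12 N34] /= [nN12 nN34] NN] : nbhs (((0 : R^o), p0), (y0, e))
    [set z | (A `*` (S2 `*` setT)) z -> D (g z)].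
  by apply: cg; [split|exact: open_nbhs_nbhs].
have [[N1 Np] /= [nN1 nNp] N12'] := nN12.
have [[N3 N4] /= [nN3 nN4] N34'] := nN34.
have [A3 [oA3 cA3 A3y A3N]] := cvx_nbhs nN3.
have ct : continuous (fun z : R^o * E => z.2 + z.1 *: e).
  apply: continuous_add; first by move=> ?; exact: cvg_snd.
  by apply: continuous_scale => ?; [exact: cvg_fst|exact: cvg_cst].
have [[I B] /= [nI nB] IB] : nbhs ((0 : R^o), y0) [set z | A3 (z.2 + z.1 *: e)].
  by apply: (ct (0, y0)); rewrite /= scale0r addr0; exact: open_nbhs_nbhs.
have [B' [oB' _ B'y B'B]] := cvx_nbhs nB.
exists ((N1 `&` I) `*` Np, A3 `&` B').
  split; last by apply: open_nbhs_nbhs; split => //; exact: openI.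
  by exists (N1 `&` I, Np) => //; split => //; exact: filterI.
move=> [[u p] y] [[/= [N1u Iu] Npp] [A3y' B'y']] [[/= Uu Sp] Sy].
case: ifPn => u0.
  move: Uu N1u; rewrite (eqP u0) => Uu N1u; apply: DW; apply: subset_closure.
  apply: (NN ((_, _), (_, _))); last by split.
  by split => /=; [exact: N12'|apply: N34'; split => //=; [exact: A3N|exact: nbhs_singleton]].
apply: DW => V nV; have u_gt0 := inv_nat_gt0 Uu u0.
have cu := continuous_eval Sp (cq u Uu).
have nO : nbhs y (A3 `&` B') by apply: open_nbhs_nbhs; split => //; exact: openI.
have [y' [Oy' [[A3y'' B'y''] Vy']]] := SO y Sy _ (filterI nO (cu y Sy V nV)).
exists (u^-1 *: (G ((u, p), y' + u *: e) - G ((u, p), y'))); split; last exact/Vy'/OS.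
apply: (@mean_value_line _ _ _ (fun v => G ((u, p), v))) => // s /andP[s0 s1].
exists (g ((u, p), (y' + (u * s) *: e, e))).
  by apply: dg => //; apply: hO => //; rewrite mulr_ge0// ltW.
apply: (NN ((_, _), (_, _))); last first.
  by split => //; split => //; apply: OS; apply: hO => //; rewrite mulr_ge0// ltW.
split => /=; first exact: N12'.
apply: N34'; split => /=; last exact: nbhs_singleton.
apply: A3N; have -> : y' + (u * s) *: e = (1 - s) *: y' + s *: (y' + u *: e).
  by rewrite scalerDr addrA -scalerDl subrK scale1r scalerA mulrC.
apply: cA3 => //; rewrite ?subr_ge0 ?subrK//.
by apply: (IB (_, _)); split => //; exact: B'B.
Qed.

Lemma inv_nat_closure : inv_nat `<=` closure (inv_nat `&` [set u | u != 0]).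
Proof.
move=> u Uu; have [->|u0] := eqVneq u 0; last by apply: subset_closure.
move=> N /nbhs_ballP[e /= e0 he]; have [m hm] := inv_nat_lt e0.
exists (m.+1%:R^-1); split; first by split; [exact: inv_natS|rewrite /= invr_eq0 pnatr_eq0].
by apply: he; rewrite /ball/= sub0r normrN ger0_norm ?invr_ge0//; exact: hm.
Qed.

(* The derivative of a difference quotient is the difference quotient of the
   derivative; the case of the vanishing step follows by [Q_dense_param]. *)
Lemma Q_dq l E (e : E) (S2 O2 : set E) (G : (R^o * P) * E -> F)
    (g : (R^o * P) * (E * E) -> F) : open O2 -> O2 `<=` S2 -> S2 `<=` closure O2 ->
  (forall y (c : R), 0 <= c -> S2 y -> S2 (y + c *: e)) ->
  (forall y (c : R), 0 <= c -> O2 y -> O2 (y + c *: e)) ->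
  cont_on (A `*` S2) G -> is_d2 A O2 G g ->
  Q 0 l A A (S2 `*` setT) (O2 `*` setT) g ->
  Q 0 l A A S2 O2 (dq G g e).
Proof.
move=> oO OS SO hS hO cG dg Qg.
have A'A : A' `<=` A by move=> [u p] [[? ?] ?].
have AA' : A `<=` closure A'.
  move=> [u p] [/= Uu Sp]; apply: closure_setX; first exact: inv_nat_closure.
  exact: subset_closure.
apply: (Q_dense_param AA' A'A OS oO).
elim: l E e S2 O2 G g oO OS SO hS hO cG dg Qg => [|l IH] E e S2 O2 G g oO OS SO hS hO cG dg Qg.
  by apply/QE; split => //; apply: dq_cont cG (Q_cont Qg) dg.
have /QE[cg /(_ _ erefl)[g2 dg2 Qg2] _] := Qg.
apply/QE; split => //; first exact: dq_cont cG cg dg.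
move=> _ [<-]; exists (dq g g2 (e, 0)).
  move=> [u p] y w [/= [Uu u0] Sp] Oy; rewrite /dq /= (negbTE u0).
  have u_ge0 := inv_nat_ge0 Uu.
  have d1 := dg (u, p) _ w (conj Uu Sp) (hO _ _ u_ge0 Oy).
  have d2 := dcurve_scale (a := -1) (dg (u, p) _ w (conj Uu Sp) Oy).
  have := dcurve_scale (a := u^-1) (dcurve_add d1 d2).
  rewrite scaleN1r (_ : (y, w) + u *: (e, 0) = (y + u *: e, w)); last first.
    by rewrite -[LHS]/(y + u *: e, w + u *: 0) scaler0 addr0.
  by apply: dcurve_eq_near ltr01 _ => h _; rewrite scaleN1r addrAC.
apply: IH Qg2 => //.
- by apply: openX => //; exact: openT.
- by move=> [y w] [/= /OS].
- by move=> [y w] [/= Sy _]; apply: closure_setX; [exact: SO|exact: in_closureT].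
- by move=> [y w] c c0 [/= Sy _]; split => //=; exact: hS.
- by move=> [y w] c c0 [/= Oy _]; split => //=; exact: hO.
Qed.

End DifferenceQuotient.

Section SmoothingOperator.
Variables (P F : tvsType R) (S1 : set P) (hF : hausdorff_space F) (L : nat) (X : R).
Local Notation A := (inv_nat `*` S1).

(** Since the kernels live on [0, L + 2], these nodes include every node with nonzero weight, for
    all heights in [0, X[ at once. The number does not depend on the point, so sums can be
    differentiated term by term. *)
Definition nb_terms (u : R) : nat := (Num.truncn (X / u) + L.+4)%N.

(* Replaces G (u, p, y) by an average of values of G at the points of heights u,
   2 u, 3 u, ... over the projection of y to the hyperplane lam = 0 along e. No
   extension of G across that hyperplane is needed, and derivatives along e of the
   average are averages, with the next kernel, of difference quotients of G. *)
Definition smoothing E (lam : E -> R^o) (e : E) (j : nat) (G : (R^o * P) * E -> F) :=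
  fun z : (R^o * P) * E => if z.1.1 == 0 then G z else
    \sum_(i < nb_terms z.1.1) ker L j (i.+1%:R - lam z.2 / z.1.1) *:
      G (z.1, (z.2 - lam z.2 *: e) + (i.+1%:R * z.1.1) *: e).

Lemma dcurve_scale2 (a : R -> R^o) (c : R -> F) s a' d : dcurve a s a' -> dcurve c s d ->
  dcurve (fun t => a t *: c t) s (a s *: d + a' *: c s).
Proof.
move=> da dc; have ca : (fun h : R => a (s + h)) @ 0^' --> a s.
  move=> W /(dcurve_continuous da) /nbhs_ballP[e /= e0 he].
  rewrite /= /nbhs/= /dnbhs /within/=; exists e => // k /=.
  rewrite /ball_/= sub0r normrN => ke _; apply: he.
  by rewrite /ball/= opprD addrA subrr sub0r normrN.
have e1 : (fun h : R => a (s + h) *: (h^-1 *: (c (s + h) - c s))) @ 0^' --> a s *: d.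
  by apply: (cvg_comp2 (h := fun (x : R^o) (y : F) => x *: y) ca dc); exact: (@scale_continuous R F (a s, d)).
have e2 : (fun h : R => (h^-1 *: (a (s + h) - a s)) *: c s) @ 0^' --> a' *: c s.
  apply: (cvg_comp2 (h := fun (x : R^o) (y : F) => x *: y) da (@cvg_cst _ (c s) _ _ _)).
  exact: (@scale_continuous R F (a', c s)).
rewrite /dcurve.
pose q1 (h : R) : F := a (s + h) *: (h^-1 *: (c (s + h) - c s)).
pose q2 (h : R) : F := (h^-1 *: (a (s + h) - a s)) *: c s.
have hh : (fun h : R => q1 h + q2 h) @ 0^' --> a s *: d + a' *: c s.
  apply: (cvg_comp2 (h := fun x y : F => x + y) e1 e2).
  exact: (@add_continuous F (a s *: d, a' *: c s)).
apply: cvg_trans hh; apply: near_eq_cvg; apply: nearW => h /=.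
have -> : q2 h = h^-1 *: ((a (s + h) - a s) *: c s) by rewrite scalerA.
have -> : q1 h = h^-1 *: (a (s + h) *: (c (s + h) - c s)).
  by rewrite /q1 !scalerA mulrC.
by rewrite -scalerDr scalerBr scalerBl addrA subrK.
Qed.

Lemma dcurve_sum n (c : nat -> R -> F) s (d : nat -> F) :
  (forall i, (i < n)%N -> dcurve (c i) s (d i)) ->
  dcurve (fun t => \sum_(i < n) c i t) s (\sum_(i < n) d i).
Proof.
elim: n => [|n IH] h.
  rewrite big_ord0; apply: dcurve_eq_near ltr01 _ (dcurve_cst 0 s) => k _.
  by rewrite big_ord0.
have E t : \sum_(i < n.+1) c i t = \sum_(i < n) c i t + c n t by rewrite big_ord_recr.
have -> : \sum_(i < n.+1) d i = \sum_(i < n) d i + d n by rewrite big_ord_recr.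
have := dcurve_add (IH (fun i hi => h i (ltnW hi))) (h n (ltnSn n)).
by apply: dcurve_eq_near ltr01 _ => k _; rewrite E.
Qed.

Lemma nb_terms_gt u y : 0 < u -> y < X -> y / u + L.+2%:R < (nb_terms u)%:R.
Proof.
move=> u0 yX; rewrite /nb_terms natrD.
have h1 : y / u < X / u by rewrite ltr_pM2r ?invr_gt0.
have := truncnS_gt (X / u); rewrite -[(_).+1%:R]natr1 => h2.
by rewrite -[L.+4%:R]natr1 -[L.+3%:R]natr1; lra.
Qed.

Lemma smoothing_weights j u y : (j <= L)%N -> 0 < u -> 0 <= y -> y < X ->
  \sum_(i < nb_terms u) ker L j (i.+1%:R - y / u) = 1.
Proof.
move=> jL u0 y0 yX.
transitivity (\sum_(1 <= k < (nb_terms u).+1) ker L j (k%:R - y / u)).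
  by rewrite big_add1 big_mkord.
apply: ker_sum => //.
- by rewrite lerDr divr_ge0// ltW.
- exact: nb_terms_gt.
- by rewrite /nb_terms addnS.
Qed.

(** Summation by parts. The boundary weights vanish, one because y is nonnegative and the other
    because [nb_terms] reaches beyond the support of the kernel. *)
Lemma smoothing_parts j u y (f : nat -> F) : (j < L)%N -> 0 < u -> 0 <= y -> y < X ->
  \sum_(i < nb_terms u) (ker L j.+1 (i.+1%:R - 1 - y / u) - ker L j.+1 (i.+1%:R - y / u)) *: f i.+1 =
  \sum_(i < nb_terms u) ker L j.+1 (i.+1%:R - y / u) *: (f i.+2 - f i.+1).
Proof.
move=> jL u0 y0 yX; set n := nb_terms u.
pose c (i : nat) := ker L j.+1 (i%:R - y / u).
have c0 : c 0%N = 0 by rewrite /c ker_le0// sub0r oppr_le0 divr_ge0// ltW.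
have cn : c n = 0.
  by rewrite /c ker_ge// ltrBrDr addrC; exact: nb_terms_gt.
transitivity (\sum_(i < n) (c i *: f i.+1 - c i.+1 *: f i.+1)).
  apply: eq_bigr => i _; rewrite scalerBl.
  by have -> : i.+1%:R - 1 = i%:R :> R by rewrite -natr1 addrK.
transitivity (\sum_(i < n) (c i.+1 *: f i.+2 - c i.+1 *: f i.+1)); last first.
  by apply: eq_bigr => i _; rewrite scalerBr.
rewrite !sumrB; congr (_ - _).
have : \sum_(i < n.+1) c i *: f i.+1 = \sum_(i < n.+1) c i *: f i.+1 by [].
rewrite {1}big_ord_recr big_ord_recl /= cn c0 !scale0r.
by rewrite -[X in X = _]/(_ + 0) addr0 add0r.
Qed.

Lemma cont_on_prod_isolated E (S : set E) (f : (R^o * P) * E -> F) u0 p0 y0 :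
  inv_nat u0 -> u0 != 0 -> S1 p0 -> S y0 ->
  cont_on (S1 `*` S) (fun z => f ((u0, z.1), z.2)) ->
  forall W, nbhs (f ((u0, p0), y0)) W ->
    \forall z \near ((u0, p0), y0), (A `*` S) z -> W (f z).
Proof.
move=> Uu0 u00 Sp0 Sy0 cf W nW.
have [N nN hN] := inv_nat_isolated Uu0 u00.
have [[N1 N2] /= [nN1 nN2] N12] := cf (p0, y0) (conj Sp0 Sy0) W nW.
exists (N `*` N1, N2); first by split => //=; exists (N, N1).
move=> [[u p] y] [[/= Nu N1p] N2y] [[/= Uu Sp] Sy].
by rewrite (hN u Uu Nu); apply: (N12 (p, y)).
Qed.

Lemma big_window (f : nat -> F) (m b c : nat) :
  (forall i, (i < m)%N || (m + b <= i)%N -> f i = 0) -> (m + b <= c)%N ->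
  \sum_(i < c) f i = \sum_(i < b) f (m + i)%N.
Proof.
move=> h mbc; rewrite -(big_mkord predT f).
rewrite (@big_cat_nat _ _ _ m) //=; last exact: leq_trans (leq_addr _ _) mbc.
rewrite big_nat big1 ?add0r => [|i /andP[_ im]]; last by rewrite h ?im.
rewrite (@big_cat_nat _ _ _ (m + b)) //= ?leq_addr//.
rewrite [X in _ + X]big_nat [X in _ + X]big1 ?addr0 => [|i /andP[im _]]; last first.
  by rewrite h ?im ?orbT.
by rewrite -[X in \sum_(X <= _ < _) _]add0n [X in \sum_(_ <= _ < X) _]addnC big_addn addnK big_mkord;
  apply: eq_bigr => i _; rewrite addnC.
Qed.

Section Data.
Variables (E : tvsType R) (lam : E -> R^o) (e : E) (S2 O2 : set E).
Hypotheses (clam : clin lam) (lam1 : lam e = 1) (oO : open O2) (OS : O2 `<=` S2)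
  (SO : S2 `<=` closure O2) (S_ge0 : forall y, S2 y -> 0 <= lam y)
  (hS : forall y (c : R), 0 <= c -> S2 y -> S2 (y - lam y *: e + c *: e))
  (hO : forall y (c : R), 0 < c -> O2 y -> O2 (y - lam y *: e + c *: e)).
Local Notation SX := (S2 `&` [set y | lam y < X]).
Local Notation OX := (O2 `&` [set y | lam y < X]).

(** At scale 0 the limit value [G0] is subtracted from all terms, as the weights sum to 1. At most L
    + 4 weights are then nonzero, uniformly bounded, and their nodes are within (L + 2) u of the
    point, so [small_sum] applies with a number of terms independent of u. *)
Lemma smoothing_cont j (G : (R^o * P) * E -> F) : (j <= L)%N ->
  cont_on (A `*` S2) G -> cont_on (A `*` SX) (smoothing lam e j G).
Proof.
move=> jL cG.
have [_ _ klam] := clam.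
have cu u : inv_nat u -> u != 0 -> cont_on (S1 `*` SX)
    (fun z => smoothing lam e j G ((u, z.1), z.2)).
  move=> Uu u0; rewrite /smoothing /= (negbTE u0).
  apply: (@cont_on_sum _ _ _ _ (fun i z => ker L j (i.+1%:R - lam z.2 / u) *:
      G ((u, z.1), (z.2 - lam z.2 *: e) + (i.+1%:R * u) *: e))) => i _.
  have cl2 : continuous (fun z : P * E => lam z.2).
    by move=> z; apply: continuous_comp (klam _); exact: cvg_snd.
  apply: cont_on_scale.
    apply: continuous_cont_on => z.
    apply: (@continuous_comp _ R^o R^o (fun z : P * E => i.+1%:R - lam z.2 / u : R^o) (ker L j)); last first.
      exact: (smooth_continuous (ker_smooth L j)).
    apply: (@cvgB _ R^o); first exact: cvg_cst.
    by apply: (@cvgM _ _ (nbhs z)); [exact: cl2|exact: cvg_cst].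
  apply: (@cont_on_comp _ _ _ _ _ (fun z : P * E => ((u, z.1),
    (z.2 - lam z.2 *: e) + (i.+1%:R * u) *: e))) cG.
    move=> [p y] [/= Sp [Sy _]]; split => //=.
    by apply: hS => //; rewrite mulr_ge0// ?ler0n// inv_nat_ge0.
  apply: cont_on_pair.
    by apply: cont_on_pair; [exact: cont_on_cst|exact: cont_on_fst].
  apply: cont_on_add; last exact: cont_on_cst.
  apply: (@cont_on_eq _ _ _ (fun z => z.2 + (- lam z.2) *: e)).
    by move=> z _; rewrite scaleNr.
  apply: cont_on_add; first exact: cont_on_snd.
  apply: cont_on_scale; last exact: cont_on_cst.
  apply: continuous_cont_on => z; apply: (@cvgN _ R^o); exact: cl2.
move=> [[u0 p0] y0] [[/= Uu0 Sp0] Sy0] W.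
have [u00|u00] := eqVneq u0 0; last first.
  exact: (cont_on_prod_isolated (f := smoothing lam e j G) Uu0 u00 Sp0 Sy0 (cu _ Uu0 u00)).
subst u0; rewrite {1}/smoothing eqxx.
set G0 := G _ => nW.
have [[W1 W2] /= [nW1 nW2] W12] : nbhs (G0, 0 : F) [set z | W (z.1 + z.2)].
  by apply: (@add_continuous F (G0, 0)); rewrite /= addr0.
have [B B0 hB] := @ker_bounded R L j jL.
have [V nV hV] := small_sum L.+4 B nW2.
have nGV : nbhs G0 [set v | W (v) /\ V (v - G0)].
  apply: filterI => //.
  have := @sub_continuous F (G0, G0) V; rewrite /= subrr => /(_ nV)[[V1 V2] /= [nV1 nV2] V12].
  by apply: filterS nV1 => v Vv; apply: (V12 (v, G0)); split => //; exact: nbhs_singleton.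
have [[N12 N3] /= [[[N1 N2] /= [nN1 nN2] N12'] nN3] NN] :=
  cG ((0, p0), y0) (conj (conj Uu0 Sp0) Sy0.1) _ nGV.
have ct : continuous (fun z : R^o * E => z.2 + z.1 *: e).
  apply: continuous_add; first by move=> ?; exact: cvg_snd.
  by apply: continuous_scale => ?; [exact: cvg_fst|exact: cvg_cst].
have [[I D] /= [/nbhs_ballP[d /= d0 hd] nD] ID] : nbhs ((0 : R^o), y0) [set z | N3 (z.2 + z.1 *: e)].
  by apply: (ct (0, y0)); rewrite /= scale0r addr0.
pose d' := d / L.+2%:R; have d'0 : 0 < d' by rewrite divr_gt0.
exists ((N1 `&` ball (0 : R^o) d') `*` N2, D `&` N3).
  split; last exact: filterI.
  exists (N1 `&` ball (0 : R^o) d', N2) => //; split => //.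
  by apply: filterI => //; exact: nbhsx_ballx.
move=> [[u p] y] [[/= [N1u bu] N2p] [Dy N3y]] [[/= Uu Sp] [Sy yX]].
rewrite /smoothing /=; case: ifPn => u0.
  by have [] := NN ((u, p), y) (conj (N12' (u, p) (conj N1u N2p)) N3y) (conj (conj Uu Sp) Sy).
have u_gt0 := inv_nat_gt0 Uu u0; have ly := S_ge0 Sy.
set pt := fun i : nat => (y - lam y *: e) + (i.+1%:R * u) *: e.
pose c i := ker L j (i.+1%:R - lam y / u).
have -> : \sum_(i < nb_terms u) ker L j (i.+1%:R - lam y / u) *: G ((u, p), pt i) =
    G0 + \sum_(i < nb_terms u) c i *: (G ((u, p), pt i) - G0).
  have -> : \sum_(i < nb_terms u) c i *: (G ((u, p), pt i) - G0) =
      \sum_(i < nb_terms u) (c i *: G ((u, p), pt i) - c i *: G0).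
    by apply: eq_bigr => i _; rewrite scalerBr.
  by rewrite sumrB -scaler_suml smoothing_weights// scale1r subrKC.
apply: (W12 (_, _)); split => /=; first exact: nbhs_singleton.
(* Terms with i < m have argument at most 0, and terms with i >= m + L + 4 have argument beyond L +
   2: all weights outside this window vanish. *)
pose m := Num.truncn (lam y / u).
have ly0 : 0 <= lam y / u by rewrite divr_ge0// ltW.
have mle : m%:R <= lam y / u by rewrite truncn_le.
have mlt := truncnS_gt (lam y / u); rewrite -/m in mlt.
pose f (i : nat) : F := if (m <= i < m + L.+4)%N then c i *: (G ((u, p), pt i) - G0) else 0.
have cz i : ~~ (m <= i < m + L.+4)%N -> c i = 0.
  rewrite negb_and -ltnNge -leqNgt => /orP[im|im].
    apply: ker_le0; rewrite subr_le0; apply: le_trans mle.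
    by rewrite ler_nat.
  apply: ker_ge => //; rewrite ltrBrDr.
  have : ((m + L.+4)%:R : R) <= i%:R by rewrite ler_nat.
  rewrite natrD -[i.+1%:R]natr1 -[L.+4%:R]natr1 -[L.+3%:R]natr1.
  by rewrite -natr1 in mlt; lra.
rewrite (eq_bigr (fun i => f (nat_of_ord i))); last first.
  by move=> i _; rewrite /f; case: ifPn => // /cz ->; rewrite scale0r.
have hmb : (m + L.+4 <= nb_terms u)%N.
  rewrite leq_add2r; apply: le_truncn; rewrite ler_pM2r ?invr_gt0//; exact: ltW.
rewrite (@big_window f m L.+4) => // [|i hi]; last first.
  by rewrite /f ifF//; apply/negbTE; rewrite negb_and -ltnNge -leqNgt.
(* A node of weight 0 may be far from [y], so its difference is replaced by 0 before [small_sum] is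
   applied. *)
rewrite (eq_bigr (fun i : 'I_L.+4 => (c (m + i)%N : R) *: (if c (m + i)%N == 0 then 0 else G ((u, p), pt (m + i)%N) - G0))); last first.
  move=> i _; rewrite /f leq_addr ltn_add2l ltn_ord/=.
  by case: eqP => // ->; rewrite !scale0r.
apply: (hV (fun i => c (m + i)%N) (fun i => if c (m + i)%N == 0 then 0 else G ((u, p), pt (m + i)%N) - G0)).
move=> i _; split; first exact: hB.
case: ifPn => [_|ci0]; first exact: nbhs_singleton.
set k := (m + i)%N in ci0 *.
have k1 : lam y / u < k.+1%:R.
  by rewrite ltNge; apply: contra ci0 => h; rewrite /c ker_le0// subr_le0.
have k2 : k.+1%:R - lam y / u <= L.+2%:R.
  by rewrite leNgt; apply: contra ci0 => h; rewrite /c ker_ge.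
have ept : pt k = y + (k.+1%:R * u - lam y) *: e.
  by rewrite /pt scalerBl -addrA [- _ + _]addrC.
have Spt : S2 (pt k).
  by apply: hS => //; rewrite mulr_ge0// ltW.
suff N3k : N3 (pt k).
  by have [_] := NN ((u, p), pt k) (conj (N12' (u, p) (conj N1u N2p)) N3k) (conj (conj Uu Sp) Spt).
rewrite ept; apply: (ID (_, y)); split => //=; apply: hd.
rewrite /ball/= sub0r normrN.
rewrite /ball/= sub0r normrN gtr0_norm// in bu.
rewrite gtr0_norm; last by rewrite subr_gt0 -ltr_pdivrMr.
apply: (@le_lt_trans _ _ (L.+2%:R * u)).
  by rewrite -ler_pdivrMr// mulrBl mulfK// gt_eqF.
by rewrite mulrC -ltr_pdivlMr.
Qed.

End Data.

End SmoothingOperator.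
End Smoothing.

(** * Derivatives of the averages *)

Section SmoothingQ.
Context {R : realType}.
Variables (P F : tvsType R) (S1 : set P) (hF : hausdorff_space F) (L : nat) (X : R).
Local Notation A := ((inv_nat : set R^o) `*` S1).

(** A direction w is split into [lam w *: e] and a part on which [lam] vanishes. Along the second
    part the nodes move with the point and [G] is differentiated. Along [e] only the weights change:
    summation by parts turns this into an average of difference quotients with kernel j + 1. Both
    results are averages again, the second over E x E with direction (e, 0), so the induction has to
    range over all spaces, functionals and directions. Each derivative uses up one kernel, whence j
    + l <= L. *)
Lemma Q_smoothing l j (E : tvsType R) (lam : E -> R^o) (e : E) (S2 O2 : set E)
    (G : (R^o * P) * E -> F) :
  clin lam -> lam e = 1 -> open O2 -> O2 `<=` S2 -> S2 `<=` closure O2 ->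
  (forall y, S2 y -> 0 <= lam y) ->
  (forall y (c : R), 0 <= c -> S2 y -> S2 (y - lam y *: e + c *: e)) ->
  (forall y (c : R), 0 < c -> O2 y -> O2 (y - lam y *: e + c *: e)) ->
  (j + l <= L)%N -> Q 0 l A A S2 O2 G ->
  Q 0 l A A (S2 `&` [set y | lam y < X]) (O2 `&` [set y | lam y < X])
    (smoothing L X lam e j G).
Proof.
elim: l j E lam e S2 O2 G => [|l IH] j E lam e S2 O2 G clam lam1 oO OS SO S_ge0 hS hO jl QG.
  apply/QE; split => //; rewrite addn0 in jl.
  by apply: smoothing_cont => //; exact: Q_cont QG.
have jL : (j < L)%N by apply: leq_trans jl; rewrite addnS ltnS leq_addr.
have [lD lZ _] := clam.
have /QE[cG /(_ _ erefl)[g dg Qg] _] := QG.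
have hS' y (c : R) : 0 <= c -> S2 y -> S2 (y + c *: e).
  move=> c0 Sy; have := @hS y (lam y + c) (addr_ge0 (S_ge0 y Sy) c0) Sy.
  by rewrite scalerDl addrA subrK.
have hO' y (c : R) : 0 <= c -> O2 y -> O2 (y + c *: e).
  rewrite le_eqVlt => /orP[/eqP <-|c0] Oy; first by rewrite scale0r addr0.
  have := @hO y (lam y + c) (ltr_wpDl (S_ge0 y (OS _ Oy)) c0) Oy.
  by rewrite scalerDl addrA subrK.
pose gt (z : (R^o * P) * (E * E)) := g (z.1, (z.2.1, z.2.2 - lam z.2.2 *: e)).
apply/QE; split => //.
  by apply: smoothing_cont => //; exact: ltnW.
move=> _ [<-].
exists (fun z => lam z.2.2 *: smoothing L X lam e j.+1 (dq G g e) (z.1, z.2.1) +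
  smoothing L X (fun y : E * E => lam y.1) (e, 0) j gt z).
  move=> [u p] y w [/= Uu Sp] [/= Oy yX].
  (* At scale 0 the average is [G] itself, and the two summands add up to its derivative because the
     differential is linear in the direction. *)
  have [u0|u0] := eqVneq u 0.
    subst u; rewrite /smoothing /dq /= eqxx /gt /=.
    have [gD gZ] : (forall v w, g ((0, p), (y, v + w)) = g ((0, p), (y, v)) + g ((0, p), (y, w))) /\
        (forall (a : R) v, g ((0, p), (y, a *: v)) = a *: g ((0, p), (y, v))).
      apply: (@dcurve_differential_linear R E F O2 (fun y => G ((0, p), y))
        (fun z => g ((0, p), z))) => //.
        by move=> x v Ox; apply: dg => //.
      have A0 : A ((0 : R^o), p) by [].
      by apply: cont_on_sub (continuous_eval A0 (Q_cont Qg)) => -[x v] [/OS].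
    rewrite -gZ -gD subrKC; exact: dg.
  have u_gt0 := inv_nat_gt0 Uu u0; have ly := S_ge0 y (OS _ Oy).
  rewrite /smoothing /dq /= (negbTE u0).
  pose pt i := (y - lam y *: e) + (i%:R * u) *: e.
  have Opt i : O2 (pt i.+1) by apply: hO => //; rewrite mulr_gt0.
  pose a i (t : R) : R^o := ker L j (i.+1%:R - lam (y + t *: w) / u).
  pose a' i : R^o := (ker L j.+1 (i.+1%:R - lam y / u) -
    ker L j.+1 (i.+1%:R - lam y / u - 1)) * - (lam w / u).
  pose c i (t : R) := G ((u, p), (y + t *: w - lam (y + t *: w) *: e) + (i.+1%:R * u) *: e).
  have da i : dcurve (a i) 0 (a' i).
    have := dcurve_line (v := - (lam w / u)) (@ker_dcurve R L j (i.+1%:R - lam y / u) jL).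
    rewrite [_ *: _]mulrC; apply: dcurve_eq_near ltr01 _ => h _.
    rewrite /a add0r lD lZ; congr (ker L j _).
    by rewrite -[_ *: - _]/(_ * - _) -[h *: lam w]/(h * lam w); ring.
  have dc i : dcurve (c i) 0 (g ((u, p), (pt i.+1, w - lam w *: e))).
    have := dg (u, p) _ (w - lam w *: e) (conj Uu Sp) (Opt i).
    apply: dcurve_eq_near ltr01 _ => h _; rewrite /c add0r /pt; congr (G (_, _)).
    rewrite addrAC; congr (_ + _).
    by rewrite lD lZ scalerBr scalerA scalerDl opprD addrACA.
  have := @dcurve_sum R F (nb_terms L X u) (fun i t => a i t *: c i t) 0 _
    (fun i _ => dcurve_scale2 (da i) (dc i)).
  rewrite big_split /= addrC.
  have -> : \sum_(i < nb_terms L X u) a' i *: c i 0 = lam w *: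
      \sum_(i < nb_terms L X u) ker L j.+1 (i.+1%:R - lam y / u) *:
        (u^-1 *: (G ((u, p), (y - lam y *: e + (i.+1%:R * u) *: e) + u *: e) -
           G ((u, p), y - lam y *: e + (i.+1%:R * u) *: e))).
    have -> : \sum_(i < nb_terms L X u) ker L j.+1 (i.+1%:R - lam y / u) *:
        (u^-1 *: (G ((u, p), (y - lam y *: e + (i.+1%:R * u) *: e) + u *: e) -
           G ((u, p), y - lam y *: e + (i.+1%:R * u) *: e))) = u^-1 *:
        \sum_(i < nb_terms L X u) ker L j.+1 (i.+1%:R - lam y / u) *:
          (G ((u, p), pt i.+2) - G ((u, p), pt i.+1)).
      rewrite scaler_sumr; apply: eq_bigr => i _; rewrite !scalerA mulrC.
      congr (_ *: (G (_, _) - _)); rewrite /pt -addrA -scalerDl -[i.+2%:R]natr1.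
      by rewrite mulrDl mul1r.
    rewrite -(@smoothing_parts R F L X j u (lam y) (fun k => G ((u, p), pt k)) jL u_gt0 ly yX).
    rewrite !scaler_sumr; apply: eq_bigr => i _; rewrite !scalerA /c scale0r addr0.
    congr (_ *: _); rewrite /a' (addrAC _ (- 1)); ring.
  rewrite (_ : \sum_(i < _) a i 0 *: _ = \sum_(i < nb_terms L X u)
      ker L j (i.+1%:R - lam y / u) *:
        gt (u, p, (y, w) - lam y *: (e, 0) + (i.+1%:R * u) *: (e, 0))); last first.
    apply: eq_bigr => i _; rewrite /a scale0r addr0; congr (_ *: _).
    have -> : (y, w) - lam y *: (e, 0) + (i.+1%:R * u) *: (e, 0) = (pt i.+1, w).
      rewrite -[LHS]/(y - lam y *: e + (i.+1%:R * u) *: e,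
        w - lam y *: 0 + (i.+1%:R * u) *: 0).
      by rewrite !scaler0 subr0 addr0.
    by [].
  by [].
apply: Q_add.
  apply: Q_scale.
    apply: (@Q_snd R 0 l _ _ _ _ _ _ _ (fun w : E * E => lam w.2)).
    by apply: C_lin; apply: clin_comp clam; exact: clin_snd.
  apply: (@Q_sub R 0 l _ _ F A A _ _ ((S2 `&` [set y : E | lam y < X]) `*` setT)
    ((O2 `&` [set y : E | lam y < X]) `*` setT)) => //.
  apply: Q_fst; apply: IH => //; first by rewrite addSnnS.
  exact: Q_dq.
have Qgt : Q 0 l A A (S2 `*` setT) (O2 `*` setT) gt.
  have := @Q_affine R 0 l _ _ _ _ F A A (S2 `*` [set: E]) (O2 `*` [set: E]) A A
    (S2 `*` [set: E]) (O2 `*` [set: E]) id (fun z : E * E => (z.1, z.2 - lam z.2 *: e))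
    0 0 g (clin_id _) _ _ _ _ _ Qg.
  rewrite (_ : (fun z => g _) = gt); last first.
    by apply/funext => z; rewrite !addr0.
  apply.
  - apply: clin_pair; first exact: clin_fst.
    have h1 : clin (fun z : E * E => z.2) by exact: clin_snd.
    have := clin_add h1 (clin_scale (-1) (clin_scalel e (clin_comp h1 clam))).
    by congr clin; apply/funext => z; rewrite scaleN1r.
  - by move=> x; rewrite addr0.
  - by move=> x; rewrite addr0.
  - by move=> [x y] [/= ? _]; rewrite addr0.
  - by move=> [x y] [/= ? _]; rewrite addr0.
apply: (@Q_sub R 0 l _ _ F A A _ _ ((S2 `*` setT) `&` [set y : E * E | lam y.1 < X])
  ((O2 `*` setT) `&` [set y : E * E | lam y.1 < X])) => //.
- by move=> [x y] [[/= ? ?] _].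
- by move=> [x y] [[/= ? ?] _].
apply: IH Qgt => //.
- by apply: clin_comp clam; exact: clin_fst.
- by apply: openX => //; exact: openT.
- by move=> [x y] [/= /OS].
- by move=> [x y] [/= Sx _]; apply: closure_setX; [exact: SO|exact: in_closureT].
- by move=> [x y] [/= /S_ge0].
- by move=> [x y] c c0 [/= Sx _]; split => //=; exact: hS.
- by move=> [x y] c c0 [/= Ox _]; split => //=; exact: hO.
- by apply: leq_trans jl; rewrite leq_add2l.
Qed.

End SmoothingQ.

(** * Interpolation between the discrete scales *)

Section Interpolation.
Context {R : realType}.

Lemma step_mono : {homo (@step R) : x y / x <= y}.
Proof.
have f_mono : {homo (@flat R 0) : x y / x <= y}.
  move=> x y xy; rewrite {1}/flat; case: ifPn => [x0|_]; last exact: flat_ge0.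
  have y0 := lt_le_trans x0 xy.
  rewrite /flat y0 !expr0 !mul1r ler_expR lerN2 lef_pV2//.
move=> x y xy; rewrite /step ler_pdivrMr ?step_den_gt0// mulrAC.
rewrite ler_pdivlMr ?step_den_gt0// !mulrDr [flat 0 y * flat 0 x]mulrC lerD2l.
by apply: ler_pM; rewrite ?flat_ge0//; apply: f_mono; rewrite // lerD2l lerN2.
Qed.

Definition chi (n : nat) (s : R) : R := step (2 ^+ n.+1 * s - 1) - step (2 ^+ n * s - 1).

Lemma chi_ge0 n s : 0 <= s -> 0 <= chi n s.
Proof.
move=> s0; rewrite subr_ge0; apply: step_mono; rewrite lerD2r ler_wpM2r//.
by rewrite exprS ler_peMl// ?exprn_ge0// ler1n.
Qed.

Lemma chi_smooth n : smooth (chi n).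
Proof.
have h m : smooth (fun s : R => step (2 ^+ m * s - 1)).
  by apply: (smooth_comp (smooth_affine (2 ^+ m) (-1))); exact: step_smooth.
apply: smoothD => //; have := smoothM (smooth_cst (-1)) (h n).
by congr smooth; apply/funext => s; rewrite mulN1r.
Qed.

Lemma chi_eq0 n s : 0 <= s -> 2 <= 2 ^+ n * s -> chi n s = 0.
Proof.
move=> s0 h.
have : 2 ^+ n * s <= 2 ^+ n.+1 * s.
  by rewrite ler_wpM2r// exprS ler_peMl// ?exprn_ge0// ler1n.
by move=> h'; rewrite /chi !step1 ?subrr// lerBrDr; lra.
Qed.

Lemma chi_neq0 n s : chi n s != 0 -> 0 <= s -> 1 < 2 ^+ n.+1 * s.
Proof.
move=> h s0; rewrite ltNge; apply: contra h => h; apply/eqP.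
have : 2 ^+ n * s <= 2 ^+ n.+1 * s.
  by rewrite ler_wpM2r// exprS ler_peMl// ?exprn_ge0// ler1n.
by move=> h'; rewrite /chi !step0 ?subrr// ?subr_le0//; lra.
Qed.

Lemma chi_sum n s : s <= 1 -> 2 <= 2 ^+ n * s -> \sum_(i < n) chi i s = 1.
Proof.
move=> s1 h; rewrite -(big_mkord predT (chi ^~ s)) /chi telescope_sumr//.
rewrite (@step1 _ (_ - 1)); last by lra.
by rewrite step0 ?subr0// expr0 mul1r; lra.
Qed.

Definition nb_interp (s : R) : nat := (Num.truncn (2 / s)).+1.

Lemma nb_interpP s : 0 < s -> 2 <= 2 ^+ nb_interp s * s.
Proof.
move=> s0; rewrite -ler_pdivrMr//; apply: (le_trans (ltW (truncnS_gt _))).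
by rewrite -natrX ler_nat; apply: ltnW; exact: ltn_expl.
Qed.

Lemma nb_interp_gt (m : nat) : exists2 e : R, 0 < e & forall n s, 0 < s < e ->
  chi n s != 0 -> (m <= n)%N.
Proof.
exists (2 ^+ m)^-1; first by rewrite invr_gt0 exprn_gt0.
move=> n s /andP[s0 se] /chi_neq0 /(_ (ltW s0)) h.
have h2 : 2 ^+ m * s < 1 by rewrite mulrC -ltr_pdivlMr ?exprn_gt0// mul1r.
have : (2 ^+ m < 2 ^+ n.+1 :> R).
  by rewrite -(ltr_pM2r s0); apply: lt_trans h.
rewrite -!natrX ltr_nat ltn_exp2l//.
Qed.

Variables (P F : tvsType R).

(* The functions [chi i] form a smooth partition of unity on ]0, 1], with [chi i]
   supported near 2^-i; so the values at the scales 1/(i+1) become a smooth family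
   in s > 0 which extends continuously to s = 0. *)
Definition interp (E : tvsType R) (f : (R^o * P) * E -> F) (z : (R^o * P) * E) : F :=
  if z.1.1 <= 0 then f ((0, z.1.2), z.2) else
  \sum_(i < nb_interp z.1.1) chi i z.1.1 *: f ((i.+1%:R^-1, z.1.2), z.2).

Lemma interpE (E : tvsType R) (f : (R^o * P) * E -> F) s p y n : 0 < s ->
  2 <= 2 ^+ n * s ->
  interp f ((s, p), y) = \sum_(i < n) chi i s *: f ((i.+1%:R^-1, p), y).
Proof.
move=> s0 hn; rewrite /interp /= [s <= 0]leNgt s0 /=.
have key a b : (a <= b)%N -> 2 <= 2 ^+ a * s ->
  \sum_(i < a) chi i s *: f ((i.+1%:R^-1, p), y) =
  \sum_(i < b) chi i s *: f ((i.+1%:R^-1, p), y).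
  move=> ab ha; rewrite -!(big_mkord predT (fun i => chi i s *: f ((i.+1%:R^-1, p), y))).
  rewrite (@big_cat_nat _ _ _ a 0 b)//= [X in _ = _ + X]big_nat [X in _ = _ + X]big1 ?addr0//.
  move=> i /andP[ai _]; rewrite chi_eq0 ?scale0r ?(ltW s0)//; apply: le_trans ha _.
  by rewrite ler_pM2r// -!natrX ler_nat leq_exp2l.
have hb := nb_interpP s0.
case: (leqP n (nb_interp s)) => [nb|/ltnW bn]; last exact: key.
by rewrite (key n (nb_interp s)).
Qed.

Local Notation I01 := ([set s : R^o | 0 <= s <= 1]).

(** Near a positive s one number of terms serves all scales above s/2. Near 0 only terms of large
    index occur, so their convex combination stays in a convex neighbourhood of the limit value. *)
Lemma interp_cont (E : tvsType R) (S1 : set P) (S2 : set E) (f : (R^o * P) * E -> F) :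
  cont_on ((inv_nat `*` S1) `*` S2) f -> cont_on ((I01 `*` S1) `*` S2) (interp f).
Proof.
move=> cf; have c1 u : inv_nat u -> cont_on (S1 `*` S2) (fun z => f ((u, z.1), z.2)).
  move=> Uu; apply: (@cont_on_comp _ _ _ _ _ (fun z : P * E => ((u, z.1), z.2))) cf.
    by move=> [p y] [/= ? ?].
  apply: cont_on_pair; last exact: cont_on_snd.
  by apply: cont_on_pair; [exact: cont_on_cst|exact: cont_on_fst].
move=> [[s0 p0] y0] [[/= /andP[s00 s01] Sp0] Sy0].
have [s0z|s0z] := eqVneq s0 0; last first.
  have s0gt : 0 < s0 by rewrite lt_neqAle eq_sym s0z.
  have hgt : 0 < s0 / 2 by rewrite divr_gt0.
  pose N := nb_interp (s0 / 2); have hN := nb_interpP hgt.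
  have cN : cont_on ([set: R^o] `*` S1 `*` S2)
      (fun z => \sum_(i < N) chi i z.1.1 *: f ((i.+1%:R^-1, z.1.2), z.2)).
    apply: (@cont_on_sum _ _ _ _ _ (fun i z => chi i z.1.1 *: f ((i.+1%:R^-1, z.1.2), z.2))) => i _.
    apply: cont_on_scale.
      apply: (@cont_on_comp _ _ _ _ setT (fun z : (R^o * P) * E => z.1.1) (chi i)) => //.
        by apply: cont_clin; eauto with clin.
      exact: C_cont (chi_smooth i 0).
    apply: (@cont_on_comp _ _ _ _ (S1 `*` S2) (fun z : (R^o * P) * E => (z.1.2, z.2)))
      (c1 _ (inv_natS i)) => [[[s p] y] [[_ /= ?] ?]//|].
    by apply: cont_clin; eauto 6 with clin.
  move=> W; rewrite (interpE f p0 y0 s0gt (n := N)); last first.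
    apply: (le_trans hN); rewrite ler_wpM2l ?exprn_ge0// ler_pdivrMr//.
    by rewrite ler_peMr ?(ltW s0gt)// ler1n.
  move=> nW; have h := cN ((s0, p0), y0) (conj (conj I Sp0) Sy0) W nW.
  have n1 : nbhs ((s0 : R^o, p0), y0) [set z : (R^o * P) * E | s0 / 2 < z.1.1].
    exists ([set z : R^o * P | s0 / 2 < z.1], setT) => [|[[s p] y] [/= ? _]//].
    split; last exact: filterT; exists ([set s | s0 / 2 < s], setT) => [|[s p] [/= ? _]//].
    split; last exact: filterT.
    apply: open_nbhs_nbhs; split; first exact: (@open_gt R (s0 / 2)).
    by rewrite /= ltr_pdivrMr// ltr_pMr// ltr1n.
  apply: filterS2 n1 h => -[[s p] y] /= hs hz [[/= _ Sp] Sy].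
  rewrite (interpE f p y (lt_trans hgt hs) (n := N)); first exact: hz.
  by apply: (le_trans hN); rewrite ler_wpM2l ?exprn_ge0// ltW.
subst s0; move=> W; rewrite {1}/interp /= lexx => nW.
have [D [oD cD Dd DW]] := cvx_nbhs nW.
have [[N12 N3] /= [[[N1 N2] /= [/nbhs_ballP[e1 /= e10 he1] nN2] N12'] nN3] NN] :=
  cf ((0, p0), y0) (conj (conj inv_nat0 Sp0) Sy0) D (open_nbhs_nbhs (conj oD Dd)).
have [m hm] := inv_nat_lt e10; have [e2 e20 he2] := nb_interp_gt m.
exists (ball (0 : R^o) e2 `*` N2, N3).
  split => //; exists (ball (0 : R^o) e2, N2) => //; split => //; exact: nbhsx_ballx.
move=> [[s p] y] [[/= bs N2p] N3y] [[/= /andP[hs0 hs1] Sp] Sy]; apply: DW.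
have inD i : (m <= i)%N -> D (f ((i.+1%:R^-1, p), y)).
  move=> mi; apply: (NN ((_, _), _)); last by split => //; split => //; exact: inv_natS.
  split => //=; apply: N12'; split => //=; apply: he1.
  by rewrite /ball/= sub0r normrN ger0_norm ?invr_ge0//; exact: hm.
rewrite /interp /=; case: ifPn => [_|].
  apply: (NN ((_, _), _)); last by split => //; split => //; exact: inv_nat0.
  split => //=; apply: N12'; split => //=; apply: he1.
  by rewrite /ball/= subrr normr0.
rewrite -ltNge => sgt.
apply: (@cvx_sum R F D _ (fun i => chi i s) (fun i => f ((i.+1%:R^-1, p), y))) => //.
- by move=> i _; exact: chi_ge0.
- by apply: chi_sum => //; exact: nb_interpP.
move=> i _ /(he2 i s) => h; apply: inD; apply: h.
by rewrite sgt; move: bs; rewrite /ball/= sub0r normrN gtr0_norm.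
Qed.

Lemma Q_interp l (E : tvsType R) (S1 : set P) (S2 O2 : set E) (f : (R^o * P) * E -> F) :
  Q 0 l (inv_nat `*` S1) (inv_nat `*` S1) S2 O2 f ->
  Q 0 l (I01 `*` S1) (I01 `*` S1) S2 O2 (interp f).
Proof.
elim: l E S2 O2 f => [|l IH] E S2 O2 f /QE[cf hl _]; apply/QE; split => //;
  try exact: interp_cont.
move=> _ [<-]; have [g dg Qg] := hl _ erefl; exists (interp g); last exact: IH.
move=> [s p] y w [/= _ Sp] Oy; rewrite /interp /=; case: ifPn => _.
  by apply: dg => //; split => //; exact: inv_nat0.
apply: (@dcurve_sum R F _ (fun i t => chi i s *: f ((i.+1%:R^-1, p), y + t *: w)) 0
  (fun i => chi i s *: g ((i.+1%:R^-1, p), (y, w)))) => i _.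
by apply: dcurve_scale; apply: dg => //; split => //; exact: inv_natS.
Qed.

(** Near a positive s the interpolation is a sum with a fixed number of terms, each a smooth
    function of s times one slice of [f]; no regularity of [f] across different scales enters. *)
Lemma Q_interp_pos k j (E : tvsType R) (S1 O1 : set P) (S2 O2 : set E)
    (f : (R^o * P) * E -> F) : hausdorff_space F ->
  open O1 -> open O2 -> O1 `<=` S1 -> O2 `<=` S2 -> S1 `<=` closure O1 ->
  S2 `<=` closure O2 ->
  (forall i : nat, Q k j S1 O1 S2 O2 (fun z => f ((i.+1%:R^-1, z.1), z.2))) ->
  Q k j ([set s : R^o | 0 < s] `*` S1) ([set s : R^o | 0 < s] `*` O1) S2 O2 (interp f).
Proof.
move=> hF oO1 oO2 OS1 OS2 d1 d2 Qf.
have oP : open [set s : R^o | 0 < s] by exact: (@open_gt R 0).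
apply: Q_local => //.
- by move=> [s p] [/= s0 Sp]; apply: closure_setX; [exact: subset_closure|exact: d1].
- by move=> [s p] [/= ? /OS1].
- by move=> _; exact: openX.
move=> [s0 p0] y0 [/= s0gt Sp0] Sy0.
have hgt : 0 < s0 / 2 by rewrite divr_gt0.
pose N := nb_interp (s0 / 2); have hN := nb_interpP hgt.
pose N1 : set (R^o * P) := [set s : R^o | s0 / 2 < s] `*` setT.
have oN1 : open N1 by apply: openX; [exact: (@open_gt R (s0 / 2))|exact: openT].
exists N1, setT; split => //; first exact: openT.
  by split => //=; rewrite ltr_pdivrMr// ltr_pMr// ltr1n.
rewrite !setIT.
apply: (@Q_ext R k j _ _ F _ _ _ _
  (fun z => \sum_(i < N) chi i z.1.1 *: f ((i.+1%:R^-1, z.1.2), z.2))) => //.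
- by move=> _; apply: openI => //; exact: openX.
- by move=> [s p] [[/= ? /OS1 ?] ?].
- move=> [s p] y [[/= s1 Sp] [/= hs _]] Sy; rewrite (interpE f p y s1 (n := N))//.
  by apply: (le_trans hN); rewrite ler_wpM2l ?exprn_ge0// ltW.
move: N hN => N _; elim: N => [|n IHn].
  have := @Q_cst R k j _ _ F ((([set s : R^o | 0 < s] `*` S1) `&` N1)) ((([set s : R^o | 0 < s] `*` O1) `&` N1)) S2 O2 0.
  by congr Q; apply/funext => z; rewrite big_ord0.
rewrite (_ : (fun z => _) = fun z => \sum_(i < n) chi i z.1.1 *: f ((i.+1%:R^-1, z.1.2), z.2) +
  chi n z.1.1 *: f ((n.+1%:R^-1, z.1.2), z.2)); last first.
  by apply/funext => z; rewrite big_ord_recr.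
apply: Q_add => //; apply: Q_scale.
  apply: (@Q_fst_only R k j (R^o * P)%type E R^o _ _ S2 O2 (fun z => chi n z.1)).
  apply: (@C_sub R k _ _ setT setT) => //.
  apply: (@C_comp R k _ _ _ setT setT setT setT (fun z : R^o * P => z.1) (chi n)) => //.
  - exact: openT.
  - by apply: C_lin; exact: clin_fst.
  - exact: chi_smooth.
have := @Q_affine R k j _ _ (R^o * P)%type E F S1 O1 S2 O2
  (([set s : R^o | 0 < s] `*` S1) `&` N1) (([set s : R^o | 0 < s] `*` O1) `&` N1) S2 O2
  snd id 0 0 _ (clin_snd _ _) (clin_id _) _ _ _ _ (Qf n).
rewrite (_ : (fun z => f _) = fun z => f ((n.+1%:R^-1, z.1.2), z.2)); last first.
  by apply/funext => z; rewrite !addr0.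
apply.
- by move=> [s p] [[/= ? ?] _]; rewrite addr0.
- by move=> [s p] [[/= ? ?] _]; rewrite addr0.
- by move=> y; rewrite addr0.
- by move=> y; rewrite addr0.
Qed.

End Interpolation.

(** * Smoothing in corner charts and in rough charts *)

Lemma Q_sum {R : realType} k l (E1 E2 F : tvsType R) (S1 O1 : set E1) (S2 O2 : set E2)
    (I : Type) (r : seq I) (f : I -> E1 * E2 -> F) : (forall i, Q k l S1 O1 S2 O2 (f i)) ->
  Q k l S1 O1 S2 O2 (fun z => \sum_(i <- r) f i z).
Proof.
move=> Qf; elim: r => [|i r IH].
  have -> : (fun z : E1 * E2 => \sum_(i <- [::]) f i z) = (fun=> 0).
    by apply/funext => z; rewrite big_nil.
  exact: Q_cst.
have -> : (fun z => \sum_(i <- i :: r) f i z) = (fun z => f i z + \sum_(i <- r) f i z).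
  by apply/funext => z; rewrite big_cons.
exact: (Q_add (Qf i) IH).
Qed.

Lemma cvx_sum_fin {R : realType} (F : tvsType R) (I : finType) (D : set F) (a : I -> R) (f : I -> F) : cvx D ->
  (forall i, 0 <= a i) -> \sum_i a i = 1 -> (forall i, a i != 0 -> D (f i)) ->
  D (\sum_i a i *: f i).
Proof.
move=> cD a0 a1 Df.
case: (pickP (fun i : I => true)) => [i0 _|I0]; last first.
  by move: a1; rewrite big_pred0// => /eqP; rewrite eq_sym oner_eq0.
have E (G : tvsType R) (h : I -> G) : \sum_i h i = \sum_(n < size (index_enum I)) h (nth i0 (index_enum I) n).
  by rewrite (big_nth i0) big_mkord.
rewrite E; apply: (@cvx_sum R F D _ (fun n => a (nth i0 _ n)) (fun n => f (nth i0 _ n))) => //.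
  by rewrite -(E R^o a).
by move=> i _; exact: Df.
Qed.

Section Coordinates.
Context {R : realType} (d : nat).
Local Notation V := ('rV[R]_d : tvsType R).
Implicit Types (y : V) (i : 'I_d).

Definition coord_at i (y : V) : R^o := y ord0 i.

Lemma clin_coord i : clin (coord_at i).
Proof.
split=> [x y|a x|]; rewrite /coord_at ?mxE//.
by move=> x; exact: coord_continuous.
Qed.

Lemma nbhs_rV (y : V) (W : set V) : nbhs y W ->
  exists2 e : R, 0 < e & forall z : V, (forall i, `|z ord0 i - y ord0 i| < e) -> W z.
Proof.
move=> /nbhs_ballP[e /= e0 he]; exists e => // z hz; apply: he; split=> // i j.
by rewrite (ord1 i) /ball/= distrC.
Qed.

Lemma nbhs_rV_box (y : V) (e : R) : 0 < e ->
  nbhs y [set z : V | forall i, `|z ord0 i - y ord0 i| < e].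
Proof.
move=> e0; apply/nbhs_ballP; exists e => //= z hz i.
by have := hz.2 ord0 i; rewrite /ball/= distrC.
Qed.

Definition C_infty (E F : tvsType R) (f : E -> F) := forall n, C n setT setT f.

Lemma C_infty_coord i : C_infty (coord_at i).
Proof. by move=> n; apply: C_lin; exact: clin_coord. Qed.

Lemma C_infty_comp (E F G : tvsType R) (f : E -> F) (g : F -> G) :
  C_infty f -> C_infty g -> C_infty (fun x => g (f x)).
Proof. by move=> hf hg n; apply: C_comp (hf n) (hg n) => //; exact: openT. Qed.

Lemma C_infty_add (E F : tvsType R) (f g : E -> F) :
  C_infty f -> C_infty g -> C_infty (fun x => f x + g x).
Proof. by move=> hf hg n; exact: Q_add (hf n) (hg n). Qed.

Lemma C_infty_scale (E F : tvsType R) (a : E -> R^o) (g : E -> F) :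
  C_infty a -> C_infty g -> C_infty (fun x => a x *: g x).
Proof. by move=> hf hg n; exact: Q_scale (hf n) (hg n). Qed.

Lemma C_infty_cst (E F : tvsType R) (c : F) : C_infty (fun _ : E => c).
Proof. by move=> n; exact: C_cst. Qed.

Lemma C_infty_prod (E : tvsType R) (I : Type) (s : seq I) (f : I -> E -> R^o) :
  (forall k, C_infty (f k)) -> C_infty (fun x => \prod_(k <- s) f k x : R^o).
Proof.
move=> hf; elim: s => [|a s IH].
  have := @C_infty_cst E R^o 1; congr C_infty.
  by apply/funext => x; rewrite big_nil.
have := C_infty_scale (hf a) IH; congr C_infty.
by apply/funext => x; rewrite big_cons.
Qed.

Lemma cutoff (y0 : V) (B : set V) : nbhs y0 B -> exists (h : V -> R^o) (K : set V),
  [/\ C_infty h, closed K, K `<=` B, forall y, ~ K y -> h y = 0 &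
      nbhs y0 [set y | h y = 1]].
Proof.
move=> /nbhs_rV[e e0 he]; pose dl := e / 2; have dl0 : 0 < dl by rewrite divr_gt0.
(* [b] is 1 for |x| <= dl and 0 for |x| >= sqrt 2 dl. With dl = e / 2 the latter bound is below 3/4
   e, the size of the box [K]. *)
pose b (x : R) : R := step (2 - (x / dl) ^+ 2).
have b_smooth : smooth b.
  apply: (@smooth_comp _ (fun x => 2 - (x / dl) ^+ 2) (@step R)); last exact: step_smooth.
  have h1 : smooth (fun x : R => (x / dl) ^+ 2).
    apply: (@smooth_comp _ (fun x => x / dl) (fun x => x ^+ 2)); last exact: smooth_exp.
    by have := smooth_affine (dl^-1) 0; congr smooth; apply/funext => x; rewrite addr0 mulrC.
  have := smoothD (smooth_cst 2) (smoothM (smooth_cst (-1)) h1).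
  by congr smooth; apply/funext => x; rewrite mulN1r.
pose h (y : V) : R^o := \prod_(i <- index_enum 'I_d) (b (y ord0 i - y0 ord0 i) : R^o).
pose K : set V := [set y | forall i, `|y ord0 i - y0 ord0 i| <= 3 / 4 * e].
exists h, K; split.
- apply: C_infty_prod => i.
  apply: (@C_infty_comp V R^o R^o (fun y => y ord0 i - y0 ord0 i) b) => //.
  by apply: C_infty_add; [exact: C_infty_coord|exact: C_infty_cst].
- rewrite -[K]setCK; apply: open_closedC; rewrite openE => y /existsNP[i /negP].
  rewrite -ltNge -subr_gt0 => yi; apply: filterS (nbhs_rV_box y yi) => z zy Kz.
  have := Kz i; have := zy i; have := ler_distD (z ord0 i) (y ord0 i) (y0 ord0 i).
  by rewrite (distrC (y ord0 i) (z ord0 i)); set u := `|_ - y0 ord0 i|; lra.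
- by move=> y Ky; apply: he => i; apply: le_lt_trans (Ky i) _; lra.
- move=> y /existsNP[i /negP]; rewrite -ltNge => hi.
  rewrite /h (bigD1_seq i) ?mem_index_enum ?index_enum_uniq//= /b step0 ?mul0r//.
  rewrite subr_le0 exprMn -real_normK ?num_real// exprVn ler_pdivlMr ?exprn_gt0//.
  apply: (@le_trans _ _ ((3 / 4 * e) ^+ 2)).
    by rewrite /dl !exprMn; have := exprn_gt0 2 e0; set ee := e ^+ 2; nra.
  by rewrite lerXn2r ?nnegrE ?normr_ge0 ?(ltW hi)// mulr_ge0 ?ltW//; lra.
- apply: filterS (nbhs_rV_box y0 dl0) => y /= hy.
  rewrite /h big1_seq// => i _; rewrite /b step1// lerBrDr addrC -lerBrDr.
  rewrite (_ : 2 - 1 = 1); last by lra.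
  rewrite -[_ ^+ 2]ger0_norm ?sqr_ge0// normrX expr_le1// normrM normfV (gtr0_norm dl0).
  by rewrite ler_pdivrMr// mul1r ltW.
Qed.

Lemma C_infty_id (E : tvsType R) : C_infty (@id E).
Proof. by move=> n; apply: C_lin; exact: clin_id. Qed.

Definition orthant : set V := [set y | forall i, 0 <= y ord0 i].
Definition orthant0 : set V := [set y | forall i, 0 < y ord0 i].

Lemma orthant0_sub : orthant0 `<=` orthant.
Proof. by move=> y h i; exact/ltW/h. Qed.

Lemma open_coords (P : 'I_d -> set R) : (forall i, open (P i : set R^o)) ->
  open [set y : V | forall i, P i (y ord0 i)].
Proof.
move=> oP; rewrite openE => y Py; rewrite /interior.
have h (i : 'I_d) : nbhs y [set z : V | P i (z ord0 i)].
  have [_ _ ci] := clin_coord i; apply: ci.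
  by apply: open_nbhs_nbhs; split; [exact: oP|exact: Py].
exact: (@filter_forall V 'I_d (fun i z => P i (z ord0 i)) (nbhs y) _ h).
Qed.

Lemma orthant0_open : open orthant0.
Proof. by apply: (@open_coords (fun _ => [set x | 0 < x])) => i; exact: open_gt. Qed.

Lemma orthant_closure : orthant `<=` closure orthant0.
Proof.
move=> y oy W /nbhs_rV[e e0 he]; exists (y + const_mx (e / 2)); split.
  by move=> i; rewrite !mxE ltr_wpDl// ?divr_gt0//; exact: oy.
by apply: he => i; rewrite !mxE addrAC subrr add0r gtr0_norm ?divr_gt0//; lra.
Qed.

Section CornerOperator.
Variables (P F : tvsType R) (hF : hausdorff_space F) (X : R) (L : nat).

Definition coord_dir i : V := delta_mx ord0 i.

Lemma coord_dirE i j : coord_dir i ord0 j = (j == i)%:R.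
Proof. by rewrite /coord_dir mxE eqxx. Qed.

Definition below (s : seq 'I_d) : set V := [set y | forall i, i \in s -> y ord0 i < X].

Lemma below_open s : open (below s).
Proof.
apply: (@open_coords (fun i => [set x | i \in s -> x < X])) => i.
have [is_|is_] := boolP (i \in s).
  rewrite (_ : [set _ | _] = [set x : R | x < X]); first exact: open_lt.
  by apply/seteqP; split => x /= h //; exact: h.
by rewrite (_ : [set _ | _] = setT); [exact: openT|apply/seteqP; split].
Qed.

Definition corner_smoothing (s : seq 'I_d) (G : (R^o * P) * V -> F) : (R^o * P) * V -> F :=
  foldr (fun i G => smoothing L X (coord_at i) (coord_dir i) 0 G) G s.

Lemma move_coord i (y : V) (c : R) j :
  (y - coord_at i y *: coord_dir i + c *: coord_dir i) ord0 j =
  if j == i then c else y ord0 j.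
Proof.
rewrite !mxE eqxx /coord_at /=; case: eqVneq => [->|_].
  by rewrite !mulr1 subrr add0r.
by rewrite !mulr0 subr0 addr0.
Qed.

(** Smoothing in one coordinate direction moves that coordinate only, so the bounds on the
    coordinates already treated, which the preceding operators rely on, persist. *)
Lemma Q_corner_smoothing s (S1 : set P) (G : (R^o * P) * V -> F) : uniq s ->
  Q 0 L (inv_nat `*` S1) (inv_nat `*` S1) orthant orthant0 G ->
  Q 0 L (inv_nat `*` S1) (inv_nat `*` S1) (orthant `&` below s) (orthant0 `&` below s)
    (corner_smoothing s G).
Proof.
move=> us QG; elim: s us => [_|i s IH /= /andP[is_ us]].
  by apply: Q_sub QG => // y [].
have h : Q 0 L (inv_nat `*` S1) (inv_nat `*` S1)
    ((orthant `&` below s) `&` [set y | coord_at i y < X])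
    ((orthant0 `&` below s) `&` [set y | coord_at i y < X])
    (smoothing L X (coord_at i) (coord_dir i) 0 (corner_smoothing s G)).
  have ji j : j \in s -> (j == i) = false by move=> js; apply: contraNF is_ => /eqP <-.
  apply: Q_smoothing => //.
  - exact: clin_coord.
  - by rewrite /coord_at coord_dirE eqxx.
  - by apply: openI; [exact: orthant0_open|exact: below_open].
  - by move=> y [/orthant0_sub oy by_].
  - by move=> y [oy by_]; apply: closureI_open => //; [exact: below_open|exact: orthant_closure].
  - by move=> y [oy _]; exact: oy.
  - move=> y c c0 [oy by_]; split => j.
      by rewrite move_coord; case: eqVneq => // ? _.
    by move=> js; rewrite move_coord ji//; exact: by_.
  - move=> y c c0 [oy by_]; split => j.
      by rewrite move_coord; case: eqVneq => // ? _.
    by move=> js; rewrite move_coord ji//; exact: by_.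
  - exact: IH.
apply: Q_sub h => // y [oy by_]; (split; first split => //).
- by move=> j js; apply: by_; rewrite inE js orbT.
- by apply: by_; rewrite inE eqxx.
- by move=> j js; apply: by_; rewrite inE js orbT.
- by apply: by_; rewrite inE eqxx.
Qed.

(* After smoothing in the directions of [s] at scale [u], the values of the
   result on a set where the other coordinates are constant only involve
   finitely many of the functions [G (u, _, y)]. *)
Lemma corner_smoothing_smooth k j s (u : R) (S1 O1 : set P) (T2 O2 : set V)
    (G : (R^o * P) * V -> F) (q : V -> V) : 0 < u -> open O1 -> O1 `<=` S1 ->
  open O2 -> O2 `<=` T2 ->
  (forall y, orthant y -> C k S1 O1 (fun p => G ((u, p), y))) ->
  C_infty q -> (forall y, T2 y -> orthant (q y)) ->
  (forall i, i \notin s -> forall y y', q y ord0 i = q y' ord0 i) ->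
  Q k j S1 O1 T2 O2 (fun z => corner_smoothing s G ((u, z.1), q z.2)).
Proof.
move=> u0 oO1 OS1 oO2 OT2 CG; elim: s q => [|i s IH] q qC qT qc /=.
  have [[y Ty]|nT] := pselect (exists y, T2 y).
    have -> : (fun z : P * V => G ((u, z.1), q z.2)) = (fun z => G ((u, z.1), q y)).
      apply/funext => z; congr (G (_, _)); apply/matrixP => a b.
      by rewrite (ord1 a); exact: qc.
    by apply: (@Q_fst_only _ _ _ _ _ _ _ _ _ _ (fun p => G ((u, p), q y))); apply: CG; exact: qT.
  apply: (@Q_ext _ _ _ _ _ _ _ _ _ _ (fun=> 0)) => //; last exact: Q_cst.
  by move=> p y _ Ty; case: nT; exists y.
rewrite /smoothing /= gt_eqF//.
apply: (@Q_sum R k j P V F S1 O1 T2 O2 _ (index_enum 'I_(nb_terms L X u)) (fun n z => ker L 0 (n.+1%:R - coord_at i (q z.2) / u) *: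
  corner_smoothing s G ((u, z.1), q z.2 - coord_at i (q z.2) *: coord_dir i + (n.+1%:R * u) *: coord_dir i))).
move=> n; have cq : C_infty (fun y => coord_at i (q y)).
  exact: (C_infty_comp qC (C_infty_coord i)).
apply: Q_scale.
  apply: (@Q_snd _ _ _ _ _ _ _ _ _ _ (fun y => ker L 0 (n.+1%:R - coord_at i (q y) / u) : R^o)).
  apply: (@C_sub _ _ _ _ setT setT) => //.
  apply: (@C_infty_comp V R^o R^o (fun y => n.+1%:R - coord_at i (q y) / u) (ker L 0)); last exact: ker_smooth.
  apply: (@C_infty_comp V R^o R^o _ (fun x => n.+1%:R - x / u)) => // m.
  by have := smooth_affine (- u^-1) n.+1%:R m; congr C; apply/funext => x; ring.
apply: (IH (fun y => q y - coord_at i (q y) *: coord_dir i + (n.+1%:R * u) *: coord_dir i)).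
- apply: C_infty_add; last exact: C_infty_cst; apply: C_infty_add => // m.
  have -> : (fun y => - (coord_at i (q y) *: coord_dir i)) =
     fun y => (-1) *: (coord_at i (q y) *: coord_dir i).
    by apply/funext => y; rewrite scaleN1r.
  apply: (@C_infty_scale V V (fun=> -1)); first exact: C_infty_cst.
  by apply: C_infty_scale => //; exact: C_infty_cst.
- move=> y Ty b; rewrite move_coord; case: eqVneq => // _; last exact: qT.
  by rewrite mulr_ge0// ?ler0n// ltW.
- move=> b bs y y'; rewrite !move_coord; case: eqVneq => // bi.
  by apply: qc; rewrite inE negb_or bi.
Qed.

End CornerOperator.

(* Local smoothing operators g |-> gs near [y0]: for s > 0 the functions
   gs (s, p, _) are smooth whatever the class of g (p, _), and they converge to
   g (p, _) with derivatives up to order l as s -> 0. *)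
Definition smoothable (l : nat) (S : set V) (y0 : V) := forall N : set V, nbhs y0 N ->
  exists B : set V, [/\ open B, B y0, B `<=` N & forall (P F : tvsType R) (S1 : set P)
    (g : P * V -> F), hausdorff_space F -> Q 0 l S1 S1 S S° g ->
    exists gs : (R^o * P) * V -> F,
    [/\ Q 0 l ([set s : R^o | 0 <= s <= 1] `*` S1) ([set s : R^o | 0 <= s <= 1] `*` S1)
          (S `&` B) (S° `&` B) gs,
        forall p y, S1 p -> S y -> B y -> gs ((0, p), y) = g (p, y) &
        forall k j (S1' O1' : set P), open O1' -> O1' `<=` S1' -> S1' `<=` closure O1' ->
          (forall y, S y -> C k S1' O1' (fun p => g (p, y))) ->
          Q k j ([set s : R^o | 0 < s] `*` S1') ([set s : R^o | 0 < s] `*` O1')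
            (S `&` B) (S° `&` B) gs]].

Lemma interior_orthant (S N : set V) y : open N -> N y -> S `&` N `<=` orthant ->
  S° y -> orthant0 y.
Proof.
move=> oN Ny SN Sy i; have : nbhs y (S `&` N) by apply: filterI Sy _; exact: open_nbhs_nbhs.
move=> /nbhs_rV[e e0 he]; have : (S `&` N) (y - (e / 2) *: coord_dir i).
  apply: he => j; rewrite !mxE eqxx /=; have [_|_] := eqVneq j i.
    by rewrite mulr1 addrAC subrr add0r normrN gtr0_norm ?divr_gt0//; lra.
  by rewrite mulr0 subr0 subrr normr0.
move=> /SN /(_ i); rewrite !mxE !eqxx mulr1; lra.
Qed.

(** The averages reach for values of [g] far from [y0]. So [g] is first multiplied by a cut-off
    function and extended by 0 to the whole orthant; on [B], where the cut-off is 1, scale 0 gives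
    back [g]. The bound [X] is chosen above all coordinates of [y0]. *)
Lemma smoothable_orthant l (S N0 : set V) y0 : open N0 -> N0 y0 -> S y0 ->
  S `&` N0 = orthant `&` N0 -> smoothable l S y0.
Proof.
move=> oN0 Ny0 Sy0 SN N nN.
have nB1 : nbhs y0 (N `&` N0)° by apply: nbhs_interior; apply: filterI => //; exact: open_nbhs_nbhs.
have [h [K [hC Kcl KN hK h1]]] := cutoff nB1.
pose s := enum 'I_d; pose X : R := 1 + \sum_i `|y0 ord0 i|.
have Xy0 i : y0 ord0 i < X.
  apply: (@le_lt_trans _ _ (\sum_i `|y0 ord0 i|)); last by rewrite ltrDr.
  apply: le_trans (ler_norm _) _; rewrite (bigD1 i)//= lerDl.
  by apply: sumr_ge0 => j _.
pose B : set V := ([set y | h y = 1] `&` N)° `&` N0 `&` below X s.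
have oB : open B.
  by apply: openI; [apply: openI => //; exact: open_interior|exact: below_open].
exists B; split => //.
- split; [split => //; exact: filterI|by move=> i _; exact: Xy0].
- by move=> y [[/interior_subset[]]].
move=> P F S1 g hF Qg.
have S_orth y : S y -> N0 y -> orthant y.
  by move=> Sy Ny; have [] : (orthant `&` N0) y by rewrite -SN.
have orth_S y : orthant y -> N0 y -> S y.
  by move=> Sy Ny; have [] : (S `&` N0) y by rewrite SN.
have Si_orth y : S° y -> N0 y -> orthant0 y.
  by move=> Sy Ny; apply: (@interior_orthant S N0) => //; rewrite SN => z [].
have orth_Si y : orthant0 y -> N0 y -> S° y.
  move=> oy Ny; rewrite /interior; apply: (@filterS _ _ _ (orthant0 `&` N0)).
    by move=> z [/orthant0_sub oz Nz]; exact: orth_S.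
  by apply: open_nbhs_nbhs; split => //; apply: openI => //; exact: orthant0_open.
pose gh (z : P * V) := h z.2 *: g z.
have Qgh : Q 0 l S1 S1 orthant orthant0 gh.
  apply: Q_local => //.
  - by move=> p Sp; exact: subset_closure.
  - exact: orthant_closure.
  - exact: orthant0_sub.
  - exact: orthant0_open.
  move=> p y Sp oy; have [By|nBy] := pselect ((N `&` N0)° y).
    exists setT, (N `&` N0)°; split => //; [exact: openT|exact: open_interior|].
    apply: Q_scale.
      apply: (@Q_snd _ _ _ _ _ _ _ _ _ _ h).
      by apply: (@C_sub _ _ _ _ setT setT) => //; exact: hC.
    apply: Q_sub Qg => [x []//|x []//|x [ox /interior_subset[_ Nx]]|x [ox /interior_subset[_ Nx]]].
      exact: orth_S.
    exact: orth_Si.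
  exists setT, (~` K); split => //; [exact: openT|exact: closed_openC|by move=> /KN|].
  apply: (@Q_ext _ _ _ _ _ _ _ _ _ _ (fun=> 0)) => //; last exact: Q_cst.
  - by apply: openI; [exact: orthant0_open|exact: closed_openC].
  - by move=> x [/orthant0_sub].
  - by move=> x z _ [_ Kz]; rewrite /gh /= hK// scale0r.
pose G (z : (R^o * P) * V) := gh (z.1.2, z.2).
have QG : Q 0 l (inv_nat `*` S1) (inv_nat `*` S1) orthant orthant0 G.
  apply: (@Q_param _ _ _ _ _ _ S1 S1 _ _ _ _ snd) Qgh; first exact: cont_on_snd.
    by move=> x [].
  by move=> x [].
have Qf := Q_corner_smoothing hF X (enum_uniq _ : uniq s) QG.
pose f := corner_smoothing X l s G.
have sBo : S `&` B `<=` orthant `&` below X s.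
  by move=> y [Sy [[_ Ny] by_]]; split => //; exact: S_orth.
have sBo0 : S° `&` B `<=` orthant0 `&` below X s.
  by move=> y [Sy [[_ Ny] by_]]; split => //; exact: Si_orth.
exists (interp f); split.
- by apply: Q_interp; apply: Q_sub Qf.
- move=> p y Sp Sy By; rewrite /interp /= lexx.
  have -> : f ((0, p), y) = gh (p, y).
    have cs0 (s1 : seq _) : corner_smoothing X l s1 G ((0, p), y) = gh (p, y).
      by elim: s1 => //= a s1 IH; rewrite /smoothing eqxx.
    exact: cs0.
  by have [[/interior_subset[/= h1y _] _] _] := By; rewrite /gh /= h1y scale1r.
- move=> k j S1' O1' oO1 OS1 SO1 Cg; apply: Q_interp_pos => //.
  + by apply: openI => //; exact: open_interior.
  + by move=> y [/interior_subset Sy By].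
  + move=> y [Sy By]; apply: closureI_open => //.
    have [[_ Ny] _] := By; have := orthant_closure (S_orth y Sy Ny) => cy.
    have := closureI_open oN0 Ny cy; apply: closure_subset => z [oz Nz]; exact: orth_Si.
  move=> i; apply: (@corner_smoothing_smooth P F X l k j s i.+1%:R^-1 S1' O1' _ _ G id) => //.
  + by apply: openI => //; exact: open_interior.
  + by move=> y [/interior_subset Sy By].
  + move=> y oy; rewrite /G /gh /=.
    have [Ky|nKy] := pselect (K y).
      apply: (@Q_scale _ _ _ _ _ _ _ _ _ _ (fun=> h y) (fun z => g (z.2, y))).
        exact: Q_cst.
      by apply: Cg; apply: orth_S => //; have [] := interior_subset (KN _ Ky).
    apply: (@C_ext _ _ _ _ _ _ (fun=> 0)) => //; last exact: C_cst.
    by move=> x _; rewrite hK// scale0r.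
  + exact: C_infty_id.
  + by move=> y /sBo[].
  + by move=> b; rewrite mem_enum.
Qed.

Lemma interior_shift (S : set V) c : [set y | S (y + c)]° = [set y | S° (y + c)].
Proof.
have ct (a : V) : continuous (fun y : V => y + a).
  by apply: cont_on_setT; exact: C_cont (@C_affine R 0 V V setT setT id a (@clin_id _ _)).
apply/seteqP; split => y; rewrite /interior /= => h; last exact: (ct c y).
have := @ct (- c) (y + c) [set y | S (y + c)]; rewrite /= addrK => /(_ h) h'.
have {}h' : nbhs (y + c) [set z | S (z - c + c)] := h'.
by apply: filterS h' => z /=; rewrite subrK.
Qed.

Lemma smoothable_shift l (S : set V) y0 c :
  smoothable l [set y | S (y + c)] (y0 - c) -> smoothable l S y0.
Proof.
move=> sm N nN; have ct (a : V) : continuous (fun y : V => y + a).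
  by apply: cont_on_setT; exact: C_cont (@C_affine R 0 V V setT setT id a (@clin_id _ _)).
have nN' : nbhs (y0 - c) [set y | N (y + c)] by apply: (ct c (y0 - c)); rewrite /= subrK.
have [B [oB By0 BN hB]] := sm _ nN'; exists [set y | B (y - c)]; split => //.
- by apply: open_comp => // ? _; exact: ct.
- by move=> y /BN /=; rewrite subrK.
move=> P F S1 g hF Qg.
have Qg' : Q 0 l S1 S1 [set y | S (y + c)] [set y | S (y + c)]° (fun z => g (z.1, z.2 + c)).
  rewrite interior_shift.
  have -> : (fun z : P * V => g (z.1, z.2 + c)) = (fun z => g (id z.1 + 0, id z.2 + c)).
    by apply/funext => z; rewrite addr0.
  by apply: (@Q_affine R 0 l P V P V F S1 S1 S S° S1 S1 _ _ id id 0 c g) => //; try exact: clin_id; move=> x; rewrite addr0.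
have [gs [h1 h2 h3]] := hB P F S1 _ hF Qg'.
have shE : (fun z : (R^o * P) * V => gs (z.1, z.2 - c)) = (fun z => gs (id z.1 + 0, id z.2 - c)).
  by apply/funext => z; rewrite addr0.
exists (fun z => gs (z.1, z.2 - c)); split.
- rewrite shE; move: h1 => H.
  apply: (@Q_affine R _ _ _ V _ V F _ _ _ _ _ _ _ _ id id 0 (- c) gs _ _ _ _ _ _ H); try exact: clin_id; try (by move=> x; rewrite addr0);
  by move=> y [Sy By]; rewrite ?interior_shift; split => //=; rewrite /= subrK.
- by move=> p y Sp Sy By; rewrite /= h2//= subrK.
- move=> k j S1' O1' o1 o2 o3 Cg.
  have h1' := h3 k j S1' O1' o1 o2 o3 (fun y Sy => Cg _ Sy).
  rewrite shE; move: h1' => H.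
  apply: (@Q_affine R _ _ _ V _ V F _ _ _ _ _ _ _ _ id id 0 (- c) gs _ _ _ _ _ _ H); try exact: clin_id; try (by move=> x; rewrite addr0);
  by move=> y [Sy By]; rewrite ?interior_shift; split => //=; rewrite /= subrK.
Qed.

(** The translation by [c] moves the coordinates of [y0] without boundary condition to 1. Near the
    translated point these coordinates stay positive, so there the corner cannot be distinguished
    from a full orthant. *)
Lemma smoothable_corner l m (O : set V) y0 : open O -> O y0 -> corner_set m y0 ->
  smoothable l (O `&` @corner_set R d m) y0.
Proof.
move=> oO Oy0 cy0; pose c : V := \row_i (if (i < m)%N then 0 else y0 ord0 i - 1).
apply: (@smoothable_shift _ _ _ c).
pose N0 : set V := [set y | O (y + c)] `&` [set y | forall i : 'I_d, (m <= i)%N -> 0 < y ord0 i].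
have ct : continuous (fun y : V => y + c).
  by apply: cont_on_setT; exact: C_cont (@C_affine R 0 V V setT setT id c (@clin_id _ _)).
apply: (@smoothable_orthant _ _ N0).
- apply: openI; first by apply: open_comp => // ? _; exact: ct.
  apply: (@open_coords (fun i : 'I_d => [set x | (m <= i)%N -> 0 < x])) => i.
  have [mi|mi] := leqP m i; last by rewrite (_ : [set _ | _] = setT); [exact: openT|apply/seteqP; split].
  rewrite (_ : [set _ | _] = [set x : R | 0 < x]); first exact: open_gt.
  by apply/seteqP; split => x /= h //; exact: h.
- split; first by rewrite /= subrK.
  by move=> i mi; rewrite !mxE ltnNge mi /= opprB addrC subrK.
- by rewrite /= subrK.
apply/seteqP; split => y [].
  move=> [_ cy] [Oy Ny]; split => // i; have [mi|im] := leqP m i; first exact/ltW/Ny.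
  by have := cy i im; rewrite !mxE im addr0.
move=> oy [Oy Ny]; split => //; split => // i im.
by rewrite !mxE im addr0; exact: oy.
Qed.

Section RoughOperator.
Variables (P F : tvsType R) (S : set V) (y0 : V) (g : P * V -> F).
Local Notation K u := (nb_terms 0 2 u).

(** Coordinates at distance less than 1 from those of [y0] are shifted into ]0, 2[, the range in
    which the kernel translates counted by [nb_terms 0 2 u] sum to 1. *)
Definition grid_coord (y : V) i (u : R) (n : nat) : R :=
  n.+1%:R - (y ord0 i - y0 ord0 i + 1) / u.

Definition grid_weight u (kap : {ffun 'I_d -> 'I_(K u)}) (y : V) : R^o :=
  \prod_i ker 0 0 (grid_coord y i u (kap i)).

(** A cell that misses [S] receives the default point [y0]; this is harmless, as the weight of such
    a cell vanishes on [S]. *)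
Definition grid_point u (kap : {ffun 'I_d -> 'I_(K u)}) : V :=
  xget y0 [set c | S c /\ forall i, 0 <= grid_coord c i u (kap i) <= 2].

(* A convex combination of values of [g] at points chosen in the traces on [S] of
   the cells of a grid of mesh u; no shape of [S] is needed, as only continuity at
   u = 0 is claimed. *)
Definition grid_smoothing (z : (R^o * P) * V) : F := if z.1.1 == 0 then g (z.1.2, z.2) else
  \sum_(kap : {ffun 'I_d -> 'I_(K z.1.1)}) grid_weight kap z.2 *: g (z.1.2, grid_point kap).

Hypothesis Sy0 : S y0.

Lemma grid_point_in u (kap : {ffun 'I_d -> 'I_(K u)}) : S (grid_point kap).
Proof. by rewrite /grid_point; case: xgetP => [x _ []|]. Qed.

Lemma grid_point_close u (kap : {ffun 'I_d -> 'I_(K u)}) y i : 0 < u -> S y ->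
  grid_weight kap y != 0 -> `|grid_point kap ord0 i - y ord0 i| <= 2 * u.
Proof.
move=> u0 Sy /prodf_neq0 hk.
have hy j : 0 <= grid_coord y j u (kap j) <= 2.
  have := hk j isT; rewrite /= => hj; apply/andP; split.
    by rewrite leNgt; apply: contra hj => /ltW h; rewrite ker_le0.
  by rewrite leNgt; apply: contra hj => h; rewrite ker_ge.
have hc j : 0 <= grid_coord (grid_point kap) j u (kap j) <= 2.
  by rewrite /grid_point; case: xgetP => [x _ []//|/(_ y) []].
have := hc i; have := hy i; rewrite /grid_coord; set c := grid_point kap.
set n := (_.+1)%:R => h1 h2.
have -> : c ord0 i - y ord0 i = u * ((n - (y ord0 i - y0 ord0 i + 1) / u) - (n - (c ord0 i - y0 ord0 i + 1) / u)).
  by field; rewrite gt_eqF.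
by rewrite normrM gtr0_norm// mulrC ler_pM2r// ler_norml; apply/andP; split; lra.
Qed.

Lemma ker00_ge0 (x : R) : 0 <= ker 0 0 x.
Proof.
rewrite /ker /ker0 /= /Delta subr_ge0 /ramp !expr0 fact0 divr1 !mul1r.
by apply: step_mono; lra.
Qed.

Lemma grid_weight_sum u y : 0 < u -> (forall i, `|y ord0 i - y0 ord0 i| < 1) ->
  \sum_(kap : {ffun 'I_d -> 'I_(K u)}) grid_weight kap y = 1.
Proof.
move=> u0 hy; rewrite /grid_weight -(bigA_distr_bigA (fun i (n : 'I_(K u)) => ker 0 0 (grid_coord y i u n))) /=.
rewrite big1// => i _; have := hy i; rewrite ltr_norml => h.
by apply: (@smoothing_weights R 0 2 0 u) => //; lra.
Qed.

Lemma grid_smoothing_slice k j (S1 O1 : set P) (T2 O2 : set V) u : u != 0 ->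
  (forall y, S y -> C k S1 O1 (fun p => g (p, y))) ->
  Q k j S1 O1 T2 O2 (fun z => grid_smoothing ((u, z.1), z.2)).
Proof.
move=> u0 Cg; rewrite /grid_smoothing /= (negbTE u0).
apply: (@Q_sum R k j P V F S1 O1 T2 O2 _ (index_enum _)
  (fun (kap : {ffun 'I_d -> 'I_(K u)}) z => grid_weight kap z.2 *: g (z.1, grid_point kap))).
move=> kap; apply: Q_scale; last first.
  by apply: (@Q_fst_only _ _ _ _ _ _ _ _ _ _ (fun p => g (p, grid_point kap))); apply: Cg; exact: grid_point_in.
apply: (@Q_snd _ _ _ _ _ _ _ _ _ _ (fun y => grid_weight kap y : R^o)).
apply: (@C_sub _ _ _ _ setT setT) => //.
apply: (@C_infty_prod V 'I_d (index_enum 'I_d) (fun i y => ker 0 0 (grid_coord y i u (kap i)))) => i.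
apply: (@C_infty_comp V R^o R^o (fun y => grid_coord y i u (kap i)) (ker 0 0)); last exact: ker_smooth.
apply: (@C_infty_comp V R^o R^o (@coord_at i) (fun x => (kap i).+1%:R - (x - y0 ord0 i + 1) / u)).
  exact: C_infty_coord.
move=> m; have := smooth_affine (- u^-1) ((kap i).+1%:R - (- y0 ord0 i + 1) / u) m.
by congr C; apply/funext => x; ring.
Qed.

Lemma grid_smoothing_cont (S1 : set P) (T : set V) : T `<=` S ->
  (forall y, T y -> forall i, `|y ord0 i - y0 ord0 i| < 1) ->
  cont_on (S1 `*` S) g -> cont_on ((inv_nat `*` S1) `*` T) grid_smoothing.
Proof.
move=> TS Tb cg [[u1 p1] y1] [[/= Uu1 Sp1] Ty1] W.
have [u10|u10] := eqVneq u1 0; last first.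
  apply: (cont_on_prod_isolated (f := grid_smoothing) Uu1 u10 Sp1 Ty1).
  apply: (@Q_cont _ 0 0 _ _ _ S1 S1 T T).
  apply: grid_smoothing_slice => // y Sy; apply: C0.
  apply: (@cont_on_comp _ _ _ _ _ (fun p => (p, y))) cg => //.
  by apply: cont_on_pair; [exact: cont_on_id|exact: cont_on_cst].
subst u1; rewrite {1}/grid_smoothing eqxx /= => /cvx_nbhs[D [oD cD Dg DW]].
have nD : nbhs (g (p1, y1)) D by exact: open_nbhs_nbhs.
have [[N1 N2] /= [nN1 /nbhs_rV[e e0 he]] NN] := cg (p1, y1) (conj Sp1 (TS _ Ty1)) _ nD.
have e4 : 0 < e / 4 by rewrite divr_gt0.
have e2 : 0 < e / 2 by rewrite divr_gt0.
exists (ball (0 : R^o) (e / 4) `*` N1, [set y : V | forall i, `|y ord0 i - y1 ord0 i| < e / 2]) => /=.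
  split; last exact: nbhs_rV_box.
  by exists (ball (0 : R^o) (e / 4), N1) => //=; split => //; exact: nbhsx_ballx.
move=> [[u p] y] [[/= bu N1p] hy] [[/= Uu Sp] Ty]; apply: DW.
have DNN z : S z -> (forall i, `|z ord0 i - y1 ord0 i| < e) -> D (g (p, z)).
  by move=> Sz hz; apply: (NN (p, z)); split => //=; exact: he.
rewrite /grid_smoothing /=; case: eqVneq => u0.
  by apply: DNN => [|i]; [exact: TS|apply: lt_trans (hy i) _; lra].
have u_gt0 := inv_nat_gt0 Uu u0.
have ue : u < e / 4 by move: bu; rewrite /ball/= sub0r normrN gtr0_norm.
apply: cvx_sum_fin => //.
- by move=> kap; apply: prodr_ge0 => i _; exact: ker00_ge0.
- by apply: grid_weight_sum => //; exact: Tb.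
- move=> kap kap0; have hk i := grid_point_close i u_gt0 (TS _ Ty) kap0.
  apply: DNN => [|i]; first exact: grid_point_in.
  have := ler_distD (y ord0 i) (grid_point kap ord0 i) (y1 ord0 i).
  by have := hk i; have := hy i; set a := `|_ - y1 ord0 i|; lra.
Qed.

End RoughOperator.

Lemma smoothable_rough (S : set V) y0 : S `<=` closure S° -> S y0 -> smoothable 0 S y0.
Proof.
move=> SS Sy0 N nN.
pose B : set V := [set y : V | forall i, `|y ord0 i - y0 ord0 i| < 1]° `&` N°.
have oB : open B by apply: openI; exact: open_interior.
exists B; split => //.
- by split => //; exact: nbhs_rV_box.
- by move=> y [_ /interior_subset].
move=> P F S1 g hF Qg; pose f := @grid_smoothing P F S y0 g.
exists (interp f); split.
- apply: Q_interp; apply/QE; split => //.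
  apply: (@grid_smoothing_cont P F S y0 g Sy0 S1) => //; last exact: Q_cont Qg.
  by move=> y [_ [/interior_subset]].
- by move=> p y Sp Sy By; rewrite /interp /= lexx /f /grid_smoothing eqxx.
- move=> k j S1' O1' oO1 OS1 SO1 Cg; apply: Q_interp_pos => //.
  + by apply: openI => //; exact: open_interior.
  + by move=> y [/interior_subset Sy By].
  + by move=> y [Sy By]; apply: closureI_open => //; exact: SS.
  + move=> i; apply: (@grid_smoothing_slice P F S y0 g Sy0) => //.
Qed.

End Coordinates.

(** * Locally compact spaces are finite-dimensional *)

Lemma compact_finite_cover (T : topologicalType) (J : eqType) (K : set T) (f : J -> set T) :
  compact K -> (forall x, K x -> exists j, nbhs x (f j)) ->
  exists s : seq J, forall x, K x -> exists2 j, j \in s & f j x.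
Proof.
move=> /compact_near_coveringP cK hf.
(* The filter of finite lists ordered by inclusion: the near-covering form of compactness, applied
   to it, provides one list that works for all of [K]. *)
pose F : set_system (seq J) := [set A | exists s0 : seq J, forall s : seq J,
  (forall j, j \in s0 -> j \in s) -> A s].
have FF : Filter F.
  split; first by exists [::].
    move=> A B [s1 h1] [s2 h2]; exists (s1 ++ s2) => s hs; split.
      by apply: h1 => j js; apply: hs; rewrite mem_cat js.
    by apply: h2 => j js; apply: hs; rewrite mem_cat js orbT.
  by move=> A B AB [s1 h1]; exists s1 => s /h1/AB.
have [x /hf[j nj]|s0 hs0] := cK _ F (fun s x => exists2 j, j \in s & f j x) FF.
  exists (f j, [set s : seq J | j \in s]) => /=.
    by split => //; exists [:: j] => s; apply; rewrite inE.
  by move=> [y s] [/= fy js]; exists j.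
by exists s0; exact: hs0.
Qed.

Section FiniteDimension.
Context {R : realType}.

Lemma clin_sum (E F : tvsType R) (I : Type) (r : seq I) (f : I -> E -> F) :
  (forall i, clin (f i)) -> clin (fun x => \sum_(i <- r) f i x).
Proof.
move=> cf; elim: r => [|i r IH].
  by under eq_fun do rewrite big_nil; exact: clin_zero.
have -> : (fun x => \sum_(j <- i :: r) f j x) = (fun x => f i x + \sum_(j <- r) f j x).
  by apply/funext => x; rewrite big_cons.
exact: (clin_add (cf i) IH).
Qed.

Lemma compact_absorbed (E : tvsType R) (K W : set E) : compact K -> nbhs (0 : E) W ->
  exists2 dl : R, 0 < dl & forall t k, `|t| < dl -> K k -> W (t *: k).
Proof.
move=> /compact_near_coveringP cK nW.
have := cK R^o (nbhs (0 : R^o)) (fun t k => W (t *: k)) _.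
case.
  move=> k Kk; have : nbhs ((0 : R^o), k) [set z : R^o * E | W (z.1 *: z.2)].
    by apply: (@scale_continuous R E (0, k)); rewrite /= scale0r.
  move=> [[A B] /= [nA nB] AB]; exists (B, A) => //= -[k' t] [/= Bk At].
  exact: (AB (t, k')).
move=> e /= e0 he; exists e => // t k te Kk; apply: he => //=.
by rewrite sub0r normrN.
Qed.

Lemma continuous_dilation (E : tvsType R) (c : R) (x : E) :
  continuous (fun z : E => c *: (z - x)).
Proof.
have -> : (fun z : E => c *: (z - x)) = (fun z => c *: z + - (c *: x)).
  by apply/funext => z; rewrite scalerBr.
apply: cont_on_setT; apply: C_cont (_ : C 0 setT setT _).
by apply: (@C_affine R 0 E E setT setT (fun z => c *: z)); apply: clin_scale; exact: clin_id.
Qed.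

Section Riesz.
Variables (E : tvsType R) (hE : hausdorff_space E) (K : set E).
Hypotheses (cK : compact K) (nK : nbhs (0 : E) K).

(** The starting point of Riesz' theorem: finitely many translates of K/2 cover the compact
    neighbourhood [K] of 0. Their centres span the image of [T]. *)
Definition half_cover n := exists2 T : 'rV[R]_n -> E, clin (T : ('rV[R]_n : tvsType R) -> E) &
  forall x, K x -> exists a k, K k /\ x = T a + 2^-1 *: k.

Lemma half_cover_ex : exists n, half_cover n.
Proof.
pose f (x : E) : set E := [set z | K (2 *: (z - x))]°.
have fx x : f x x.
  by apply: (@continuous_dilation E 2 x x); rewrite subrr scaler0.
have [X hX] : exists X : seq E, forall z, K z -> exists2 x, x \in X & f x z.
  apply: compact_finite_cover => // x _; exists x.
  by apply: open_nbhs_nbhs; split; [exact: open_interior|exact: fx].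
exists (size X), (fun a => \sum_(i <- index_enum 'I_(size X)) coord_at i a *: nth 0 X i).
  by apply: clin_sum => i; apply: clin_scalel; exact: clin_coord.
move=> z Kz; have [x xX fxz] := hX z Kz.
have hi : (index x X < size X)%N by rewrite index_mem.
exists (delta_mx ord0 (Ordinal hi)), (2 *: (z - x)); split; first exact: interior_subset fxz.
rewrite scalerA mulVf// scale1r (bigD1_seq (Ordinal hi)) ?mem_index_enum ?index_enum_uniq//=.
rewrite big1 ?addr0 => [|i /negbTE ni]; last by rewrite /coord_at mxE ni andbF scale0r.
by rewrite /coord_at mxE !eqxx scale1r nth_index// addrC subrK.
Qed.

(** A vector [v] in the kernel of [T] with nonzero i-th coordinate allows that coordinate to be
    eliminated; hence [T] is injective when n is minimal. *)
Lemma half_cover_drop n (T : 'rV[R]_n.+1 -> E) (v : 'rV[R]_n.+1) i :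
  clin (T : ('rV[R]_n.+1 : tvsType R) -> E) -> T v = 0 -> v ord0 i != 0 ->
  (forall x, K x -> exists a k, K k /\ x = T a + 2^-1 *: k) -> half_cover n.
Proof.
move=> cT Tv vi hT; have [TD TZ _] := cT.
pose ins (b : 'rV[R]_n) : 'rV[R]_n.+1 := \row_j oapp (fun j' => b ord0 j') 0 (unlift i j).
have clin_ins : clin (ins : ('rV[R]_n : tvsType R) -> ('rV[R]_n.+1 : tvsType R)).
  split=> [x y|a x|].
  - by apply/rowP => j; rewrite !mxE; case: unlift => [j'|]/=; rewrite ?mxE ?addr0.
  - by apply/rowP => j; rewrite !mxE; case: unlift => [j'|]/=; rewrite ?mxE ?mulr0.
  - move=> b W /(@nbhs_rV R _ (ins b))[e e0 he]; apply: filterS (nbhs_rV_box b e0) => z hz.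
    by apply: he => j; rewrite !mxE; case: unlift => [j'|]/=; rewrite ?subrr ?normr0.
exists (fun b => T (ins b)); first exact: (clin_comp clin_ins cT).
move=> x /hT[a [k [Kk ->]]].
pose a' := a - (a ord0 i / v ord0 i) *: v.
have Ta' : T a' = T a by rewrite clinB// TZ Tv scaler0 subr0.
exists (\row_j a' ord0 (lift i j)), k; split => //; congr (_ + _); rewrite -Ta'; congr T.
apply/rowP => j; rewrite [RHS]mxE; case: unliftP => [j' ->|->] /=; rewrite ?mxE//.
by rewrite divfK// subrr.
Qed.

Lemma half_cover_inj : exists n (T : 'rV[R]_n -> E),
  [/\ clin (T : ('rV[R]_n : tvsType R) -> E), forall v, T v = 0 -> v = 0 &
    forall x, K x -> exists a k, K k /\ x = T a + 2^-1 *: k].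
Proof.
have [n0 hn0] := half_cover_ex.
have ex : exists n, `[<half_cover n>] by exists n0; exact/asboolP.
case: (ex_minnP ex) => n /asboolP[T cT hT] nmin; exists n, T; split => // v Tv.
apply: contrapT => /eqP v0; have [i vi] : exists i, v ord0 i != 0.
  apply: contrapT => h; move/eqP: v0; apply; apply/rowP => i; rewrite mxE.
  by apply: contrapT => /eqP vi; apply: h; exists i.
case: n => [|n] in T cT hT nmin v Tv v0 i vi *; first by case: i vi.
have /asboolP/nmin := half_cover_drop cT Tv vi hT.
by rewrite ltnn.
Qed.

(** The image of the unit sphere is compact and misses 0, so a convex neighbourhood [D] of 0 bounds
    [a] in terms of [T a]; this makes the inverse continuous. Iterating the half cover writes x in
    [K] as T a + 2^-m k with [a] in a fixed ball, so x is in the closure of the compact, hence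
    closed, image of that ball. As [K] absorbs every vector, [T] is onto. *)
Lemma riesz : exists n (T : 'rV[R]_n -> E) (L : E -> 'rV[R]_n),
  [/\ clin (T : ('rV[R]_n : tvsType R) -> E), clin (L : E -> ('rV[R]_n : tvsType R)),
      cancel T L & cancel L T].
Proof.
have [n [T [cT T0 hT]]] := half_cover_inj; exists n, T; have [TD TZ Tc] := cT.
have normc : continuous (fun a : 'rV[R]_n => `|a| : R^o) := @norm_continuous _ _.
have ball_cpt (c : R) : compact [set a : 'rV[R]_n | `|a| <= c].
  apply: bounded_closed_compact.
    by exists c; split; [exact: num_real|move=> x cx a /= /le_trans; apply; exact: ltW].
  by apply: (@closed_comp _ _ _ [set x : R^o | x <= c]) => [a _|]; [exact: normc|exact: closed_le].
have sph_cpt : compact [set a : 'rV[R]_n | `|a| = 1].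
  apply: (@subclosed_compact _ _ _ _ (ball_cpt 1)) => [|a /= ->//].
  by apply: (@closed_comp _ _ _ [set x : R^o | x = 1]) => [a _|]; [exact: normc|exact: closed_eq].
have img_cl (A : set 'rV[R]_n) : compact A -> closed (T @` A).
  move=> cA; apply: compact_closed => //; apply: continuous_compact => //.
  exact: continuous_subspaceT.
have [D [oD cD D0 hD]] : exists D : set E, [/\ open D, cvx D, D 0 & forall a, D (T a) -> `|a| < 1].
  have : nbhs (0 : E) (~` (T @` [set a : 'rV[R]_n | `|a| = 1])).
    apply: open_nbhs_nbhs; split; first exact: closed_openC (img_cl _ sph_cpt).
    by move=> [a /= a1 /T0 a0]; move: a1; rewrite a0 normr0 => /eqP; rewrite eq_sym oner_eq0.
  move=> /cvx_nbhs[D [oD cD D0 DW]]; exists D; split => // a Da.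
  rewrite ltNge; apply/negP => a1; have a0 : 0 < `|a| by apply: lt_le_trans a1.
  apply: (DW (`|a|^-1 *: T a)).
    have h1 : 0 <= `|a|^-1 by rewrite invr_ge0.
    have h2 : 0 <= 1 - `|a|^-1 by rewrite subr_ge0 invf_le1.
    by have := cD (T a) 0 _ _ h1 h2; rewrite scaler0 addr0 subrKC; exact.
  exists (`|a|^-1 *: a); rewrite ?TZ//= normrZ normfV normr_id mulVf// gt_eqF//.
have Tinj a b : T a = T b -> a = b.
  by move=> e; apply/eqP; rewrite -subr_eq0; apply/eqP/T0; rewrite clinB// e subrr.
have TK x : K x -> exists a, T a = x.
  move=> Kx; have approx m : exists a k, K k /\ x = T a + (2^-1) ^+ m *: k.
    elim: m => [|m [a [k [Kk ->]]]].
      by exists 0, x; split => //; rewrite (clin0 cT) add0r expr0 scale1r.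
    have [b [k' [Kk' ->]]] := hT k Kk; exists (a + (2^-1) ^+ m *: b), k'; split => //.
    by rewrite TD TZ scalerDr scalerA addrA exprSr.
  have [W1 nW1 hW1] : exists2 W1, nbhs (0 : E) W1 & forall u v, W1 u -> W1 v -> D (u - v).
    have := @sub_continuous E (0, 0) D; rewrite /= subrr.
    case; first exact: open_nbhs_nbhs.
    move=> [A B] /= [nA nB] AB; exists (A `&` B); first exact: filterI.
    by move=> u v [Au _] [_ Bv]; exact: (AB (u, v)).
  have [W [oW cW W0 WW1]] := cvx_nbhs nW1.
  have [dl dl0 hdl] := compact_absorbed cK (open_nbhs_nbhs (conj oW W0)).
  pose d2 := dl / 2; have d20 : 0 < d2 by rewrite divr_gt0.
  have d2K k : K k -> W (d2 *: k).
    by move=> Kk; apply: hdl => //; rewrite gtr0_norm// /d2; lra.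
  (* Both d2 x and d2 2^-m k lie in the convex set [W], so their difference, the image of d2 a, lies
     in [D]. *)
  have bnd m a k : K k -> x = T a + (2^-1) ^+ m *: k -> `|a| <= d2^-1.
    move=> Kk xE; have : D (T (d2 *: a)).
      have -> : T (d2 *: a) = d2 *: x - d2 *: ((2^-1) ^+ m *: k).
        by rewrite TZ -scalerBr xE addrK.
      apply: hW1; apply: WW1; first exact: d2K.
      rewrite scalerA mulrC -scalerA.
      have h1 : 0 <= (2^-1 : R) ^+ m by rewrite exprn_ge0// invr_ge0.
      have h2 : 0 <= 1 - (2^-1 : R) ^+ m.
        by rewrite subr_ge0 exprn_ile1 ?invr_ge0// invf_le1// ler1n.
      have := cW (d2 *: k) 0 _ _ h1 h2; rewrite scaler0 addr0 subrKC; apply => //.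
      exact: d2K.
    by move=> /hD; rewrite normrZ gtr0_norm// -ltr_pdivlMl// mulr1 => /ltW.
  have : (T @` [set a : 'rV[R]_n | `|a| <= d2^-1]) x.
    apply: (img_cl _ (ball_cpt _)) => V nV; have nV' : nbhs (0 : E) [set u | V (x - u)].
      have := @sub_continuous E (x, 0) V; rewrite /= subr0 => /(_ nV)[[A B] /= [nA nB] AB].
      apply: filterS nB => u Bu; apply: (AB (x, u)); split => //; exact: nbhs_singleton.
    have [dl' dl'0 hdl'] := compact_absorbed cK nV'.
    have [m hm] := inv_nat_lt dl'0.
    have [a [k [Kk xE]]] := approx m.
    exists (T a); split; first by exists a => //=; exact: bnd xE.
    have -> : T a = x - (2^-1) ^+ m *: k by rewrite xE addrK.
    apply: hdl' => //; rewrite ger0_norm ?exprn_ge0 ?invr_ge0//.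
    apply: le_lt_trans (hm m (leqnn _)); rewrite exprVn lef_pV2 ?posrE ?exprn_gt0//.
    by rewrite -natrX ler_nat ltn_expl.
  by move=> [a _ <-]; exists a.
have Tsurj x : exists a, T a = x.
  have [dl dl0 hdl] := compact_absorbed (@compact_set1 _ x) nK.
  have [a Ta] : exists a, T a = (dl / 2) *: x.
    by apply: TK; apply: hdl => //; rewrite gtr0_norm ?divr_gt0//; lra.
  exists ((dl / 2)^-1 *: a); rewrite TZ Ta scalerA mulVf ?scale1r// gt_eqF// divr_gt0//.
pose L x := sval (cid (Tsurj x)).
have LK : cancel L T by move=> x; rewrite /L; case: cid.
have TL : cancel T L by move=> a; apply: Tinj; rewrite LK.
exists L; split => //; have LD : {morph L : x y / x + y}.
  by move=> x y; apply: Tinj; rewrite TD !LK.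
have LZ (a : R) x : L (a *: x) = a *: L x by apply: Tinj; rewrite TZ !LK.
split => // x W /nbhs_ballP[e /= e0 he].
have nD : nbhs x [set z | D (e^-1 *: (z - x))].
  by apply: (@continuous_dilation E e^-1 x x); rewrite subrr scaler0; exact: open_nbhs_nbhs.
apply: filterS nD => z Dz; apply: he.
have Lsub : L (z - x) = L z - L x by apply: Tinj; rewrite (clinB _ _ cT) !LK.
have := hD (e^-1 *: L (z - x)); rewrite TZ LK => /(_ Dz).
rewrite normrZ gtr0_norm ?invr_gt0// -ltr_pdivlMl ?invr_gt0// invrK mulr1 Lsub.
by rewrite -ball_normE /ball_/= distrC.
Qed.

End Riesz.

End FiniteDimension.

(** * Charts and local representatives *)

Section ChartTopology.
Context {R : realType}.
Implicit Types (M N : charted_space R) (E F P : tvsType R).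
Local Notation fi := (@formal_interior R _).

Lemma interiorX (T U : topologicalType) (A : set T) (B : set U) : (A `*` B)° = A° `*` B°.
Proof.
apply/seteqP; split => -[x y].
  move=> [[V W] /= [nV nW] VW]; split => /=; [apply: filterS nV|apply: filterS nW] => z Vz.
    by have [] := VW (z, y) (conj Vz (nbhs_singleton nW)).
  by have [] := VW (x, z) (conj (nbhs_singleton nV) Vz).
by move=> [/= nA nB]; exists (A, B).
Qed.

Section OneChart.
Variables (T : topologicalType) (E : tvsType R) (phi : chart T E) (hphi : is_chart phi).

Lemma chart_hausdorff : hausdorff_space E. Proof. by case: hphi. Qed.

Lemma chart_open : open (cdom phi). Proof. by case: hphi => _ []. Qed.

Lemma chart_inj x y : cdom phi x -> cdom phi y -> phi x = phi y -> x = y.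
Proof. by case: hphi => _ _ h _ _ dx dy e; apply: h => //; exact: mem_set. Qed.

Lemma chart_cont : cont_on (cdom phi) phi.
Proof. by case: hphi => _ _ _ /cont_onP. Qed.

Lemma chart_img (O : set T) : open O -> O `<=` cdom phi ->
  exists2 O' : set E, open O' & phi @` O = O' `&` cimg phi.
Proof. by case: hphi => _ _ _ _; apply. Qed.

Lemma chart_nbhs x (W : set E) : cdom phi x -> nbhs (phi x) W ->
  nbhs x (cdom phi `&` phi @^-1` W).
Proof.
move=> dx nW; have nd : nbhs x (cdom phi) by apply: open_nbhs_nbhs; split => //; exact: chart_open.
by apply: filterS2 nd (chart_cont dx nW) => y dy h; split => //; exact: h.
Qed.

Lemma chart_nbhs_img x (V : set T) : cdom phi x -> nbhs x V -> exists2 W : set E,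
  nbhs (phi x) W & forall y, cdom phi y -> W (phi y) -> V y.
Proof.
move=> dx nV; pose O := V° `&` cdom phi.
have oO : open O by apply: openI; [exact: open_interior|exact: chart_open].
have [W oW WE] := chart_img oO (@subIsetr _ _ _).
have : (phi @` O) (phi x) by exists x.
rewrite WE => -[Wx _]; exists W; first exact: open_nbhs_nbhs.
move=> y dy Wy; have : (phi @` O) (phi y) by rewrite WE; split => //; exists y.
by move=> [z [/interior_subset Vz dz] /chart_inj <-].
Qed.

Lemma img_interior (D : set T) x : D `<=` cdom phi -> cdom phi x ->
  (phi @` D)° (phi x) <-> D° x /\ (cimg phi)° (phi x).
Proof.
move=> Dd dx; split => [h|[nD nc]].
  split; last by apply: interiorS h => _ [y Dy <-]; exists y => //; exact: Dd.
  apply: filterS (chart_nbhs dx h) => y [dy [z Dz e]].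
  by rewrite -(chart_inj (Dd _ Dz) dy e).
have [W nW hW] := chart_nbhs_img dx nD.
by apply: filterS2 nW nc => w Ww [y dy e]; exists y => //; apply: hW => //; rewrite e.
Qed.

Lemma img_interiorE (D : set T) y : D `<=` cdom phi -> (phi @` D)° y ->
  exists x, [/\ D x, D° x, (cimg phi)° (phi x) & y = phi x].
Proof.
move=> Dd h; have [x Dx xE] := interior_subset h; subst y.
by have [nD nc] := (img_interior Dd (Dd _ Dx)).1 h; exists x.
Qed.

Lemma img_regular (D : set T) : D `<=` cdom phi -> D `<=` closure D° ->
  phi @` D `<=` closure (phi @` D)°.
Proof.
move=> Dd DD _ [x Dx <-] W nW; have dx := Dd _ Dx.
have [x1 [Dx1 [dx1 Wx1]]] := DD x Dx _ (chart_nbhs dx (nbhs_interior nW)).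
have nO : nbhs x1 (D° `&` (cdom phi `&` phi @^-1` W°)).
  by apply: filterI; [exact: nbhs_interior|apply: chart_nbhs => //; exact: nbhs_interior].
have [V nV hV] := chart_nbhs_img dx1 nO.
have [_ [_ rg] _ _ _] := hphi.
have c1 : cimg phi (phi x1) by exists x1.
have [w [nc Vy]] := rg _ c1 _ (nbhs_interior nV).
have [x2 dx2 e] := interior_subset nc; subst w.
have [Dx2 [_ Wx2]] := hV x2 dx2 (interior_subset Vy).
by exists (phi x2); split; [apply/img_interior|exact: interior_subset].
Qed.

Definition cinv (x0 : T) (y : E) : T := xget x0 [set x | cdom phi x /\ phi x = y].

Lemma cinvK x0 x : cdom phi x -> cinv x0 (phi x) = x.
Proof.
move=> dx; rewrite /cinv; case: xgetP => [z _ [dz]|/(_ x)[]//]; exact: chart_inj.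
Qed.

End OneChart.

(* A manifold of class C^n whose atlas need not be maximal. *)
Definition nice (n : nat) M : Prop :=
  [/\ forall E (phi : chart M E), catlas M phi -> is_chart phi,
      forall x : M, exists E (phi : chart M E), catlas M phi /\ cdom phi x,
      forall E E' (phi : chart M E) (psi : chart M E'), catlas M phi -> catlas M psi ->
        let D := cdom phi `&` cdom psi in
        exists2 h : E -> E', forall x, D x -> h (phi x) = psi x &
                C n (phi @` D) (phi @` D)° h &
      forall E E' (phi : chart M E) (psi : chart M E'), catlas M phi -> catlas M psi ->
        forall x, cdom phi x -> cdom psi x -> (cimg phi)° (phi x) -> (cimg psi)° (psi x)].

Lemma rough_nice r n M : rough_manifold r M -> le_order n r -> nice n M.
Proof.
move=> [_ [hc hcov ht] _] nr; split => //.
  move=> E E' phi psi Aphi Apsi D; have [[h hE hC] _] := ht _ _ _ _ Aphi Apsi.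
  by exists h => //; apply: C_on_C hC => //; exact: chart_hausdorff (hc _ _ Apsi).
move=> E E' phi psi Aphi Apsi x dx dx'; have [_ hi] := ht _ _ _ _ Aphi Apsi.
have [c1 c2] := (hc _ _ Aphi, hc _ _ Apsi).
have nd : nbhs x (cdom phi `&` cdom psi).
  by apply: open_nbhs_nbhs; split => //; apply: openI; exact: chart_open.
move=> nc; have h1 : (phi @` (cdom phi `&` cdom psi))° (phi x).
  by apply/(img_interior c1) => //; exact: subIsetl.
by have /(img_interior c2 (@subIsetr _ _ _) dx')[] := hi x (conj dx dx') h1.
Qed.

Lemma nice_fi n M E (phi : chart M E) x : nice n M -> catlas M phi -> cdom phi x ->
  formal_interior x <-> (cimg phi)° (phi x).
Proof.
move=> [_ _ _ h4] A dx; split => [h|h E' psi A' dx']; [exact: h|exact: h4 h].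
Qed.

Lemma nice_chart n M E (phi : chart M E) : nice n M -> catlas M phi -> is_chart phi.
Proof. by case=> h _ _ _; exact: h. Qed.

Lemma nice_img n M E (phi : chart M E) (D : set M) x : nice n M -> catlas M phi ->
  D `<=` cdom phi -> cdom phi x -> (phi @` D)° (phi x) <-> D° x /\ formal_interior x.
Proof.
move=> nM A Dd dx; have fE := nice_fi nM A dx.
have := img_interior (nice_chart nM A) Dd dx.
by move=> [h1 h2]; split => [/h1[? /fE]|[? /fE ?]] //; exact: h2.
Qed.

Lemma nice_imgE n M E (phi : chart M E) (D : set M) y : nice n M -> catlas M phi ->
  D `<=` cdom phi -> (phi @` D)° y ->
  exists x, [/\ D x, D° x, formal_interior x & y = phi x].
Proof.
move=> nM A Dd /(img_interiorE (nice_chart nM A) Dd)[x [Dx nD nc ->]].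
by exists x; split => //; apply/(nice_fi nM A) => //; exact: Dd.
Qed.

Definition rep k j P M N (S1 O1 : set P) (U2 : set M) (f : P * M -> N)
    E F (phi : chart M E) (psi : chart N F) : Prop :=
  [/\ forall p x, S1 p -> U2 x -> cdom psi (f (p, x)),
      forall p x, S1 p -> U2 x -> formal_interior x -> formal_interior (f (p, x)) &
      exists h : P * E -> F, (forall p x, S1 p -> U2 x -> h (p, phi x) = psi (f (p, x))) /\
        Q k j S1 O1 (phi @` U2) (phi @` U2)° h].

Lemma rep_sub k j k' j' P M N (S1 O1 S1' O1' : set P) (U2 U2' : set M) (f : P * M -> N)
    E F (phi : chart M E) (psi : chart N F) : (k' <= k)%N -> (j' <= j)%N ->
  S1' `<=` S1 -> O1' `<=` O1 -> U2' `<=` U2 ->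
  rep k j S1 O1 U2 f phi psi -> rep k' j' S1' O1' U2' f phi psi.
Proof.
move=> kk jj s1 o1 u2 [h1 h2 [h [hE hQ]]]; split.
- by move=> p x /s1 ? /u2 ?; exact: h1.
- by move=> p x /s1 ? /u2 ?; exact: h2.
exists h; split; first by move=> p x /s1 ? /u2 ?; exact: hE.
apply: Q_le kk jj _; apply: Q_sub hQ => //; first exact: image_subset.
by apply: interiorS; exact: image_subset.
Qed.

(* Local C^{k,j} property at (p, x) of a family of maps; the parameter space is an
   lcs used without charts, and [O1] is the set where parameters are active. *)
Definition LQ k j P M N (S1 O1 : set P) (f : P * M -> N) (p : P) (x : M) : Prop :=
  exists E F (phi : chart M E) (psi : chart N F) U1 U2,
    [/\ open U1 /\ U1 p, open U2 /\ U2 x, U2 `<=` cdom phi, catlas M phi /\ catlas N psi &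
        rep k j (S1 `&` U1) (O1 `&` U1) U2 f phi psi].

Lemma LQ_sub k j k' j' P M N (S1 O1 S1' O1' : set P) (f : P * M -> N) p x :
  (k' <= k)%N -> (j' <= j)%N -> S1' `<=` S1 -> O1' `<=` O1 ->
  LQ k j S1 O1 f p x -> LQ k' j' S1' O1' f p x.
Proof.
move=> kk jj s1 o1 [E [F [phi [psi [U1 [U2 [h1 h2 h3 h4 h5]]]]]]].
exists E, F, phi, psi, U1, U2; split => //.
by apply: rep_sub h5 => //; exact: setSI.
Qed.

Lemma LQ_cont k j n P M N (S1 O1 : set P) (f : P * M -> N) p x : nice n M -> nice n N ->
  LQ k j S1 O1 f p x -> S1 p -> forall W, nbhs (f (p, x)) W ->
  \forall z \near (p, x), S1 z.1 -> W (f z).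
Proof.
move=> nM nN [E [F [phi [psi [U1 [U2 [[oU1 U1p] [oU2 U2x] U2d [Ap Aq]]]]]]]].
move=> [hd _ [h [hE /Q_cont ch]]] Sp W nW.
have cq := nice_chart nN Aq; have cp := nice_chart nM Ap.
have dfx : cdom psi (f (p, x)) by exact: hd.
have [V nV hV] := chart_nbhs_img cq dfx nW.
have imx : ((S1 `&` U1) `*` (phi @` U2)) (p, phi x) by split => //=; exists x.
have := ch (p, phi x) imx V; rewrite hE// => /(_ nV)[[A B] /= [nA nB] AB].
exists (A `&` U1, U2 `&` (cdom phi `&` phi @^-1` B)).
  split => /=; first by apply: filterI => //; exact: open_nbhs_nbhs.
  by apply: filterI; [exact: open_nbhs_nbhs|apply: chart_nbhs => //; exact: U2d].
move=> [p' x'] [[/= Ap' Up'] [Ux' [dx' Bx']]] /= Sp'; apply: hV; first exact: hd.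
by rewrite -hE//; apply: (AB (p', phi x')) => //; split => //=; exists x'.
Qed.

(** The chart change in [N] is composed from outside and needs the full order k + j, whereas the one
    in [M] only acts on the second variable. Both are available in a space of class n >= k + j. *)
Lemma LQ_chart k j n P M N (S1 O1 : set P) (f : P * M -> N) p x
    E F (phi : chart M E) (psi : chart N F) : nice n M -> nice n N -> (k + j <= n)%N ->
  ((0 < k)%N -> open O1) -> O1 `<=` S1 -> S1 p ->
  catlas M phi -> catlas N psi -> cdom phi x -> cdom psi (f (p, x)) ->
  LQ k j S1 O1 f p x -> forall V1 V2, nbhs p V1 -> nbhs x V2 ->
  exists U1 U2, [/\ open U1 /\ U1 p, open U2 /\ U2 x, U1 `<=` V1, U2 `<=` V2 `&` cdom phi &
    rep k j (S1 `&` U1) (O1 `&` U1) U2 f phi psi].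
Proof.
move=> nM nN kjn oO1 OS1 Sp Aphi Apsi dx dfx L V1 V2 nV1 nV2.
have cq := nice_chart nN Apsi; have cp := nice_chart nM Aphi.
have nd : nbhs (f (p, x)) (cdom psi) by apply: open_nbhs_nbhs; split => //; exact: chart_open.
have [[W1 W2] /= [nW1 nW2] hW] := LQ_cont nM nN L Sp nd.
have [E0 [F0 [phi0 [psi0 [U1 [U2 [[oU1 U1p] [oU2 U2x] U2d [Ap0 Aq0]]]]]]]] := L.
move=> [hd hfi [h [hE hQ]]].
have cp0 := nice_chart nM Ap0; have cq0 := nice_chart nN Aq0.
pose T1 := U1 `&` V1° `&` W1°; pose T2 := U2 `&` V2° `&` W2° `&` cdom phi.
have oT1 : open T1 by apply: openI; [apply: openI => //|]; exact: open_interior.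
have oT2 : open T2.
  apply: openI; last exact: chart_open.
  by apply: openI; [apply: openI => //|]; exact: open_interior.
have T2d : T2 `<=` cdom phi by move=> y [].
have T2d0 : T2 `<=` cdom phi0 by move=> y [[[/U2d]]].
have T1s q : T1 q -> [/\ U1 q, V1 q & W1 q].
  by move=> [[? /interior_subset ?] /interior_subset ?].
have T2s y : T2 y -> [/\ U2 y, V2 y & W2 y].
  by move=> [[[? /interior_subset ?] /interior_subset ?] ?].
have hd1 q y : S1 q -> T1 q -> T2 y -> cdom psi (f (q, y)).
  by move=> Sq /T1s[_ _ Wq] /T2s[_ _ Wy]; exact: (hW (q, y)).
have hd0 q y : S1 q -> T1 q -> T2 y -> cdom psi0 (f (q, y)).
  by move=> Sq /T1s[Uq _ _] /T2s[Uy _ _]; exact: hd.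
exists T1, T2; split.
- by split => //; split => //; split.
- by split => //; split => //; split => //; split.
- by move=> q /T1s[].
- by move=> y Ty; split; [have [] := T2s y Ty|exact: T2d].
split; first by move=> q y [Sq Tq] Ty; exact: hd1.
  by move=> q y [Sq /T1s[Uq _ _]] /T2s[Uy _ _]; exact: hfi.
have [_ _ tM _] := nM; have [_ _ tN _] := nN.
have [m1 m1E m1C] := tM _ _ _ _ Aphi Ap0.
have [m2 m2E m2C] := tN _ _ _ _ Aq0 Apsi.
exists (fun z => m2 (h (z.1, m1 z.2))); split.
  move=> q y [Sq Tq] Ty /=; have [Uq _ _] := T1s q Tq; have [Uy _ _] := T2s y Ty.
  by rewrite m1E ?hE ?m2E//; split; auto.
have TI y : (phi @` T2)° y -> exists x', [/\ T2 x', formal_interior x' & y = phi x'].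
  by move=> /(nice_imgE nM Aphi T2d)[x' [? _ ? ?]]; exists x'.
apply: (@Q_comp _ k j P E F0 F _ _ _ _ (psi0 @` (cdom psi0 `&` cdom psi))
  (psi0 @` (cdom psi0 `&` cdom psi))° (fun z => h (z.1, m1 z.2)) m2).
- exact: open_interior.
- exact: interior_subset.
- move=> q _ [Sq Tq] [y Ty <-]; have [Uq _ _] := T1s q Tq; have [Uy _ _] := T2s y Ty.
  by rewrite m1E; [rewrite hE//; exists (f (q, y)) => //; split; auto|split; auto].
- move=> q _ [/OS1 Sq Tq] /TI[y [Ty fy ->]]; have [Uq _ _] := T1s q Tq; have [Uy _ _] := T2s y Ty.
  rewrite m1E; last by split; auto.
  rewrite hE//; apply/(nice_img nN Aq0); [by move=> ? []|exact: hd0|].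
  split; last exact: hfi.
  apply: open_nbhs_nbhs; split; last by split; auto.
  by apply: openI; exact: chart_open.
- apply: (@Q_precomp _ k j _ _ _ _ _ (S1 `&` U1) (O1 `&` U1) (phi0 @` U2) (phi0 @` U2)°
    (S1 `&` T1) (O1 `&` T1) _ _ id m1 h) => //.
  + by move=> k0; apply: openI => //; exact: oO1.
  + exact: open_interior.
  + by move=> q [/OS1].
  + exact: interior_subset.
  + by move=> q [Sq /T1s[]].
  + by move=> q [Sq /T1s[]].
  + move=> _ [y Ty <-]; have [Uy _ _] := T2s y Ty; exists y => //.
    by rewrite m1E//; split; auto.
  + move=> _ /TI[y [Ty fy ->]]; have [Uy _ _] := T2s y Ty.
    rewrite m1E; last by split; auto.
    apply/(nice_img nM Ap0) => //; [exact: T2d0|split => //].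
    exact: open_nbhs_nbhs.
  + by apply: C_lin; exact: clin_id.
  + apply: (@C_le _ n _); first exact: leq_trans (leq_addl _ _) kjn.
    apply: C_sub m1C; first by move=> _ [y Ty <-]; exists y => //; split; auto.
    apply: interiorS; by move=> _ [y Ty <-]; exists y => //; split; auto.
- exact: C_le kjn m2C.
Qed.

(** The candidate is [f] read through the pointwise inverse [cinv] of the chart. It coincides
    locally with the given representatives, and regularity of the chart image lets [Q_local] patch
    them. *)
Lemma LQ_glob k j n P M N (S1 O1 : set P) (U2 : set M) (f : P * M -> N)
    E F (phi : chart M E) (psi : chart N F) : nice n M -> nice n N -> (k + j <= n)%N ->
  ((0 < k)%N -> open O1) -> O1 `<=` S1 -> S1 `<=` closure O1 ->
  catlas M phi -> catlas N psi -> open U2 -> U2 `<=` cdom phi ->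
  (forall p x, S1 p -> U2 x -> cdom psi (f (p, x))) ->
  (forall p x, S1 p -> U2 x -> LQ k j S1 O1 f p x) ->
  rep k j S1 O1 U2 f phi psi.
Proof.
move=> nM nN kjn oO1 OS1 SO1 Aphi Apsi oU2 U2d hd L.
have cp := nice_chart nM Aphi; have cq := nice_chart nN Apsi.
have loc p x : S1 p -> U2 x -> exists U1 U2', [/\ open U1 /\ U1 p, open U2' /\ U2' x,
    U1 `<=` setT, U2' `<=` U2 `&` cdom phi & rep k j (S1 `&` U1) (O1 `&` U1) U2' f phi psi].
  move=> Sp Ux; apply: (LQ_chart nM nN kjn oO1 OS1 Sp Aphi Apsi _ _ (L p x Sp Ux)).
  - exact: U2d.
  - exact: hd.
  - exact: filterT.
  - exact: open_nbhs_nbhs.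
split => //.
  move=> p x Sp Ux fx; have [U1 [U2' [[_ U1p] [_ U2x] _ _ [_ hfi _]]]] := loc p x Sp Ux.
  exact: hfi.
have [[x0 _]|nU2] := pselect (exists x, U2 x); last first.
  exists (fun=> 0); split; first by move=> p x _ Ux; case: nU2; exists x.
  exact: Q_cst.
pose h (z : P * E) := psi (f (z.1, cinv phi x0 z.2)); exists h; split.
  by move=> p x Sp Ux; rewrite /h /= cinvK//; exact: U2d.
apply: Q_local => //.
- exact: chart_hausdorff cq.
- apply: (img_regular cp U2d) => x Ux; apply: subset_closure.
  by rewrite /interior; exact: open_nbhs_nbhs.
- exact: interior_subset.
- exact: open_interior.
move=> p _ Sp [x Ux <-]; have [U1 [U2' [[oU1 U1p] [oU2' U2x] _ U2s [_ _ [h' [h'E h'Q]]]]]] := loc p x Sp Ux.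
have [V oV VE] : exists2 V : set E, open V & phi @` U2' = V `&` cimg phi.
  by apply: chart_img => // y /U2s[].
exists U1, V; split => //.
  have : (phi @` U2') (phi x) by exists x.
  by rewrite VE => -[].
have sub : phi @` U2 `&` V `<=` phi @` U2'.
  by move=> _ [[y Uy <-] Vy]; rewrite VE; split => //; exists y => //; exact: U2d.
apply: (@Q_ext _ _ _ _ _ _ _ _ _ _ h').
- by move=> k0; apply: openI => //; exact: oO1.
- by apply: openI => //; exact: open_interior.
- by move=> q [/OS1].
- by move=> q [/interior_subset].
- move=> q y Sq /sub[z Uz <-]; rewrite h'E// /h /= cinvK//.
  by have [] := U2s _ Uz.
- apply: Q_sub h'Q => //.
  have := interiorS sub; rewrite interiorI; apply: subset_trans => y [? Vy]; split => //.
  by rewrite /interior; exact: open_nbhs_nbhs.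
Qed.

Lemma LQ_ext k j P M N (S1 O1 : set P) (f f' : P * M -> N) p x :
  LQ k j S1 O1 f p x -> nbhs x [set y | forall q, S1 q -> f (q, y) = f' (q, y)] ->
  LQ k j S1 O1 f' p x.
Proof.
move=> [E [F [phi [psi [U1 [U2 [h1 [oU2 U2x] U2d h4 [hd hfi [h [hE hQ]]]]]]]]]].
set A := (X in nbhs x X) => nA.
exists E, F, phi, psi, U1, (U2 `&` A°); split => //.
- split; first by apply: openI => //; exact: open_interior.
  by split => //; exact: nbhs_interior.
- by move=> y [/U2d].
have fE p' y : (S1 `&` U1) p' -> (U2 `&` A°) y -> f' (p', y) = f (p', y).
  by move=> [Sp _] [_ /interior_subset ->].
split.
- by move=> p' y Sp Uy; rewrite fE//; apply: hd => //; case: Uy.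
- by move=> p' y Sp Uy; rewrite fE//; apply: hfi => //; case: Uy.
exists h; split; first by move=> p' y Sp Uy; rewrite fE//; apply: hE => //; case: Uy.
apply: Q_sub hQ => //; first by apply: image_subset => y [].
by apply: interiorS; apply: image_subset => y [].
Qed.

Lemma LQ_param j P P' M N (S1 O1 : set P) (S3 O3 : set P') (c : P' -> P) (f : P * M -> N) p x :
  cont_on S3 c -> O3 `<=` S3 -> (forall q, S3 q -> S1 (c q)) -> (forall q, O3 q -> O1 (c q)) -> S3 p ->
  LQ 0 j S1 O1 f (c p) x -> LQ 0 j S3 O3 (fun z => f (c z.1, z.2)) p x.
Proof.
move=> cc OS h1 h2 Sp [E [F [phi [psi [U1 [U2 [[oU1 U1p] h4 h5 h6 [hd hfi [h [hE hQ]]]]]]]]]].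
have nU : nbhs (c p) U1 by exact: open_nbhs_nbhs.
pose V := [set q | S3 q -> U1 (c q)]; have nV : nbhs p V := cc p Sp U1 nU.
have hV q : (S3 `&` V°) q -> (S1 `&` U1) (c q).
  by move=> [Sq /interior_subset Vq]; split; [exact: h1|exact: Vq].
exists E, F, phi, psi, V°, U2; split => //.
  by split; [exact: open_interior|exact: nV].
split.
- by move=> q y /hV Sq Uy; exact: hd.
- by move=> q y /hV Sq Uy; exact: hfi.
exists (fun z => h (c z.1, z.2)); split; first by move=> q y /hV Sq Uy /=; exact: hE.
apply: Q_param hQ => //.
- by apply: cont_on_sub cc => q [].
- move=> q [Oq Vq]; split; first exact: h2.
  by have [] := hV q (conj (OS _ Oq) Vq).
Qed.

End ChartTopology.

(** * Local regularity of single maps *)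

Section MapsLocal.
Context {R : realType}.
Implicit Types (M N : charted_space R) (E F P : tvsType R).
Lemma RC_on_LQ r n M N P (V : set M) (f : M -> N) (S1 O1 : set P) p x :
  nice n M -> nice n N -> le_order n r -> open V -> RC_on r V f -> V x ->
  LQ 0 n S1 O1 (fun z => f z.2) p x.
Proof.
move=> nM nN nr oV [/cont_onP cf hfi hch] Vx.
have [_ covM _ _] := nM; have [_ covN _ _] := nN.
have [E [phi [Aphi dx]]] := covM x; have [F [psi [Apsi dfx]]] := covN (f x).
have cp := nice_chart nM Aphi; have cq := nice_chart nN Apsi.
have := hch _ _ _ _ Aphi Apsi; set D' := (_ `&` _) => -[h hE hC].
have oD : open D'.
  rewrite openE => y [[Vy dy] dfy]; rewrite /interior.
  have nV : nbhs y V by exact: open_nbhs_nbhs.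
  have nd : nbhs y (cdom phi) by apply: open_nbhs_nbhs; split => //; exact: chart_open.
  have nd' : nbhs (f y) (cdom psi) by apply: open_nbhs_nbhs; split => //; exact: chart_open.
  have h1 := cf y Vy _ nd'; near=> z.
  have Vz : V z by near: z.
  by split; [split => //|]; near: z => //; apply: filterS2 nV h1 => z Vz; exact.
exists E, F, phi, psi, setT, D'; split => //.
- by split => //; exact: openT.
- by move=> y [[]].
split => //.
- by move=> q y _ [].
- move=> q y _ [[Vy _] _] fy; apply: hfi => //.
  by rewrite /interior; exact: open_nbhs_nbhs.
exists (fun z => h z.2); split; first by move=> q y _ /hE.
by apply: Q_snd; apply: C_on_C hC => //; exact: chart_hausdorff cq.
Unshelve. all: by end_near. Qed.

Definition LC n M N (f : M -> N) x := LQ 0 n [set: R^o] [set: R^o] (fun z => f z.2) 0 x.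

Lemma LC_LQ n M N P (S1 O1 : set P) (f : M -> N) p x : S1 p -> O1 `<=` S1 ->
  LC n f x -> LQ 0 n S1 O1 (fun z => f z.2) p x.
Proof.
move=> Sp OS; apply: (@LQ_param _ _ _ _ _ _ setT setT S1 O1 (fun=> 0) (fun z => f z.2)) => //.
exact: cont_on_cst.
Qed.

Lemma LQ_LC n M N P (S1 : set P) (f : P * M -> N) p x : S1 p ->
  LQ 0 n S1 S1 f p x -> LC n (fun y => f (p, y)) x.
Proof.
move=> Sp; apply: (@LQ_param _ _ _ _ _ _ S1 S1 setT setT (fun=> p) f) => //.
exact: cont_on_cst.
Qed.

Lemma LC_cont n M N (f : M -> N) x : nice n M -> nice n N -> LC n f x -> {for x, continuous f}.
Proof.
move=> nM nN L W nW; have := LQ_cont nM nN L I nW.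
by move=> [[A B] /= [nA nB] AB]; apply: filterS nB => y By; apply: (AB (0, y)) => //; split => //; exact: nbhs_singleton.
Qed.

Lemma LC_RC_on r M N (V : set M) (f : M -> N) : open V ->
  (forall n, le_order n r -> nice n M /\ nice n N) ->
  (forall x n, V x -> le_order n r -> LC n f x) -> RC_on r V f.
Proof.
move=> oV hn hL; have r0 : le_order 0 r by case: (r).
have [n0M n0N] := hn 0%N r0.
have cf : forall x, V x -> {for x, continuous f}.
  by move=> x Vx; apply: LC_cont (hL x 0%N Vx r0).
split.
- apply/cont_onP => x Vx W /(cf x Vx) nW; have {}nW : nbhs x (f @^-1` W) := nW.
  by apply: filterS nW => y Wy _.
- move=> x /interior_subset Vx; have [E [F [phi [psi [U1 [U2 [[_ U1p] [_ U2x] _ _ [_ hfi _]]]]]]]] := hL x 0%N Vx r0.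
  exact: (hfi 0 x).
move=> E F phi psi Aphi Apsi; set D' := (_ `&` _).
have cp := nice_chart n0M Aphi; have cq := nice_chart n0N Apsi.
have oD : open D'.
  rewrite openE => y [[Vy dy] dfy]; rewrite /interior.
  have nV : nbhs y V by exact: open_nbhs_nbhs.
  have nd : nbhs y (cdom phi) by apply: open_nbhs_nbhs; split => //; exact: chart_open.
  have nd' : nbhs (f y) (cdom psi) by apply: open_nbhs_nbhs; split => //; exact: chart_open.
  exact: filterI (filterI nV nd) (cf y Vy _ nd').
have Dd : D' `<=` cdom phi by move=> y [[]].
have [[x0 _]|nD] := pselect (exists x, D' x); last first.
  exists (fun=> 0); first by move=> x Dx; case: nD; exists x.
  by apply: C_C_on => n _; exact: C_cst.
exists (fun y => psi (f (cinv phi x0 y))).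
  by move=> x Dx; rewrite cinvK//; exact: Dd.
apply: C_C_on => n nr; have [nM nN] := hn n nr.
have : rep 0 n setT setT D' (fun z : R^o * M => f z.2) phi psi.
  apply: (@LQ_glob _ 0 n n) => //; first by move=> y _; apply: subset_closure.
    by move=> p x _ [].
  by move=> p x _ [[Vx _] _]; apply: (@LC_LQ n M N _ _ _ f) => //; exact: hL.
move=> [_ _ [h [hE hQ]]].
have hC : C n (phi @` D') (phi @` D')° (fun y => h (0, y)).
  by apply: (@Q_param _ _ _ _ _ _ _ _ _ _ _ _ (fun=> 0)) hQ => //; exact: cont_on_cst.
apply: C_ext hC; [exact: open_interior|exact: interior_subset|].
by move=> _ [x Dx <-]; rewrite hE// cinvK//; exact: Dd.
Qed.

Lemma RC_on_LC r n M N (V : set M) (f : M -> N) x :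
  nice n M -> nice n N -> le_order n r -> open V -> RC_on r V f -> V x -> LC n f x.
Proof. by move=> nM nN nr oV rf Vx; exact: RC_on_LQ rf Vx. Qed.

Lemma C_on_sub r E F (S S' : set E) (f : E -> F) : S' `<=` S -> C_on r S f -> C_on r S' f.
Proof.
move=> SS [/cont_onP cf hd]; split; first by apply/cont_onP; exact: cont_on_sub cf.
move=> j jr; have [df /cont_onP cdf hdf] := hd j jr; exists df.
  by apply/cont_onP; apply: cont_on_sub cdf => -[x y] [/= ? ?]; split => //; exact: SS.
move=> y; have : S'° `<=` S° by exact: interiorS.
move: (S'°) (S°) (hdf y) => O' O + OO; elim: (tvs_pow_seq y) f (fun x => df (x, y)) {cf hd hdf cdf} => [|v s IH] f g /=.
  by move=> h x /OO; exact: h.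
by move=> [f1 h1 h2]; exists f1; [move=> x /OO; exact: h1|exact: IH].
Qed.

Lemma RC_on_sub r M N (D D' : set M) (f : M -> N) : D' `<=` D -> RC_on r D f -> RC_on r D' f.
Proof.
move=> DD [/cont_onP cf hfi hch]; split.
- by apply/cont_onP; exact: cont_on_sub cf.
- by move=> x Dx; apply: hfi; exact: interiorS DD _ Dx.
move=> E F phi psi A1 A2 D1; have [h hE hC] := hch _ _ _ _ A1 A2.
exists h; first by move=> x [[/DD ? ?] ?]; exact: hE.
by apply: C_on_sub hC; apply: image_subset => x [[/DD ? ?] ?].
Qed.

End MapsLocal.

(** * The real line as a manifold and maps depending on time *)

Section RealLine.
Context {R : realType}.
Implicit Types (M N : charted_space R) (E F P : tvsType R).

Definition line_chart : chart (real_line R) (R^o : tvsType R) := Chart setT (id : R^o -> R^o).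

Lemma is_chart_id E : hausdorff_space E -> is_chart (Chart setT (id : E -> E)).
Proof.
move=> hE; split => //=.
- split; first exact: openT.
  by move=> x [y _ <-]; rewrite /cimg/= image_id interiorT; exact: in_closureT.
- by apply: continuous_subspaceT => x; exact: cvg_id.
- by move=> O oO _; exists O => //; rewrite /cimg /= !image_id setIT.
Qed.

Lemma line_generated E (phi : chart (real_line R) E) : catlas (real_line R) phi ->
  is_chart phi /\ good_transition None phi line_chart /\ good_transition None line_chart phi.
Proof. by move=> [h1 h2]; split => //; exact: (h2 _ _ (IdAtlas _)). Qed.

(** Time is treated throughout in the identity chart of the line; an arbitrary chart of the
    generated atlas is reduced to it by its smooth transition map [m]. *)
Lemma LQ_RC2_on (k l : diff_order) M N (D1 : set (real_line R)) (V : set M)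
    (H : real_line R * M -> N) : open V -> (D1 : set R^o) `<=` closure (D1 : set R^o)° ->
  (forall i j, le_order i k -> le_order j l -> nice (i + j) M /\ nice (i + j) N) ->
  (forall i j, le_order i k -> le_order j l -> forall t x, D1 t -> V x ->
    LQ i j (D1 : set R^o) (D1 : set R^o)° (H : R^o * M -> N) t x) ->
  RC2_on k l D1 V H.
Proof.
move=> oV D1D hn hL.
have k0 : le_order 0 k by case: (k). have l0 : le_order 0 l by case: (l).
have [n0M n0N] := hn 0%N 0%N k0 l0.
split.
- apply/cont_onP => -[t x] [/= Dt Vx] W nW.
  have := LQ_cont n0M n0N (hL 0%N 0%N k0 l0 t x Dt Vx) Dt nW.
  by apply: filterS => -[t' x'] h [/= ? _]; exact: h.
- move=> t x /interior_subset Dt _ /interior_subset Vx.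
  have [E [F [phi [psi [U1 [U2 [[_ U1p] [_ U2x] _ _ [_ hfi _]]]]]]]] := hL 0%N 0%N k0 l0 t x Dt Vx.
  exact: (hfi t x).
move=> E1 E F phi1 phi psi A1 Aphi Apsi D1' D2' hd.
have [c1 [[[m mE mC] mi] _]] := line_generated A1.
have cp := nice_chart n0M Aphi; have cq := nice_chart n0N Apsi.
have oD2 : open D2' by apply: openI => //; exact: chart_open cp.
have D2d : D2' `<=` cdom phi by exact: subIsetr.
have [[x0 _]|nD] := pselect (exists x, D2' x); last first.
  exists (fun=> 0); first by move=> t x _ Dx; case: nD; exists x.
  by apply: Q_C2_on => i j _ _; exact: Q_cst.
exists (fun z => psi (H (m z.1, cinv phi x0 z.2))).
  move=> t x Dt Dx /=; rewrite mE ?cinvK//; first exact: D2d.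
  by split => //; case: Dt.
apply: Q_C2_on => i j ik jl; have [nM nN] := hn i j ik jl.
pose O1 : set R^o := (D1 : set R^o)° `&` cdom phi1.
have oO1 : open O1 by apply: openI; [exact: open_interior|exact: chart_open c1].
have : rep i j (D1' : set R^o) O1 D2' (H : R^o * M -> N) phi psi.
  apply: (@LQ_glob _ i j (i + j)) => //.
  - by move=> t [/interior_subset].
  - move=> t [Dt dt]; apply: (@closureI_open R^o) => //; last exact: D1D.
    exact: chart_open c1.
  - by move=> t x Dt Dx; exact: (hd (t, x)).
  - move=> t x [Dt dt] [Vx dx].
    have [E' [F' [phi' [psi' [U1 [U2 [[oU1 U1p] h2 h3 h4 h5]]]]]]] := hL i j ik jl t x Dt Vx.
    exists E', F', phi', psi', U1, U2; split => //.
    by apply: rep_sub h5 => // u [[]].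
move=> [_ _ [h [hE hQ]]].
have m1E t : cdom phi1 t -> m (phi1 t) = t by move=> dt; rewrite mE.
apply: (@Q_ext _ _ _ _ _ _ _ _ _ _ (fun z => h (m z.1, z.2))).
- by move=> _; exact: open_interior.
- exact: open_interior.
- exact: interior_subset.
- exact: interior_subset.
- move=> _ _ [t Dt <-] [x Dx <-] /=; have [_ dt] := Dt.
  by rewrite m1E// hE// cinvK//; exact: D2d.
apply: (@Q_precomp _ i j _ _ _ _ _ (D1' : set R^o) O1 (phi @` D2') (phi @` D2')°
  (phi1 @` D1') (phi1 @` D1')° _ _ m id h) => //.
- exact: open_interior.
- by move=> t [/interior_subset].
- exact: interior_subset.
- by move=> _ [t Dt <-]; have [_ dt] := Dt; rewrite m1E.
- move=> _ /(img_interiorE c1 (@subIsetr _ _ _))[t [[Dt dt] nD _ ->]]; rewrite m1E//.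
  by split => //; apply: interiorS nD => ? [].
- have : C i (phi1 @` (cdom phi1 `&` setT)) (phi1 @` (cdom phi1 `&` setT))° m.
    by apply: C_on_C mC => //; exact: hausdorff_R.
  have sub : phi1 @` D1' `<=` phi1 @` (cdom phi1 `&` setT).
    by apply: image_subset => t [].
  by apply: C_sub => //; exact: interiorS.
- by apply: C_lin; exact: clin_id.
Qed.

End RealLine.

(** * Products of rough manifolds *)

Section Products.
Context {R : realType}.
Implicit Types (M N : charted_space R) (E F P : tvsType R).
Lemma C_prod n E E' F F' (S O : set E) (S' O' : set E') (f : E -> F) (g : E' -> F') :
  open O -> O `<=` S -> open O' -> O' `<=` S' -> C n S O f -> C n S' O' g ->
  C n (S `*` S') (O `*` O') (fun z => (f z.1, g z.2)).
Proof.
move=> oO OS oO' OS' Cf Cg; apply: C_pair.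
  apply: (@C_comp _ n _ _ _ _ _ S O fst f) => // [z []//|z []//|].
  by apply: C_lin; exact: clin_fst.
apply: (@C_comp _ n _ _ _ _ _ S' O' snd g) => // [z []//|z []//|].
by apply: C_lin; exact: clin_snd.
Qed.

Lemma hausdorffX E F : hausdorff_space E -> hausdorff_space F -> hausdorff_space (E * F)%type.
Proof.
move=> hE hF [x y] [x' y'] h; congr pair.
  apply: hE => A B nA nB; have [] := h (A `*` setT) (B `*` setT).
  - by exists (A, setT) => //=; split => //; exact: filterT.
  - by exists (B, setT) => //=; split => //; exact: filterT.
  by move=> [u v] [[Au _] [Bu _]]; exists u.
apply: hF => A B nA nB; have [] := h (setT `*` A) (setT `*` B).
- by exists (setT, A) => //=; split => //; exact: filterT.
- by exists (setT, B) => //=; split => //; exact: filterT.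
by move=> [u v] [[_ Au] [_ Bu]]; exists v.
Qed.

Lemma imageX (T1 T2 U1 U2 : Type) (f : T1 -> U1) (g : T2 -> U2) (A : set T1) (B : set T2) :
  (fun z => (f z.1, g z.2)) @` (A `*` B) = (f @` A) `*` (g @` B).
Proof.
apply/seteqP; split => [_ [[a b] [/= Aa Bb] <-]|[u v] [/= [a Aa <-] [b Bb <-]]].
  by split => /=; [exists a|exists b].
by exists (a, b).
Qed.

Lemma prod_cimg M N E F (phi : chart M E) (psi : chart N F) :
  cimg (prod_chart phi psi) = cimg phi `*` cimg psi.
Proof. exact: imageX. Qed.

Lemma is_chart_prod M N E F (phi : chart M E) (psi : chart N F) :
  is_chart phi -> is_chart psi -> is_chart (prod_chart phi psi).
Proof.
move=> c1 c2; split.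
- by apply: hausdorffX; [exact: chart_hausdorff c1|exact: chart_hausdorff c2].
- split; first by apply: openX; [exact: chart_open c1|exact: chart_open c2].
  rewrite prod_cimg /regular_set interiorX => -[x y] [/= xc yc].
  have [_ [_ r1] _ _ _] := c1; have [_ [_ r2] _ _ _] := c2.
  by apply: closure_setX; [exact: r1|exact: r2].
- move=> [x y] [x' y'] /set_mem[/= dx dy] /set_mem[/= dx' dy'] [e1 e2].
  by rewrite (chart_inj c1 dx dx' e1) (chart_inj c2 dy dy' e2).
- apply/cont_onP; apply: cont_on_pair.
    apply: (@cont_on_comp _ _ _ _ (cdom phi) fst) (chart_cont c1); first by move=> z [].
    by apply: continuous_cont_on => z; exact: cvg_fst.
  apply: (@cont_on_comp _ _ _ _ (cdom psi) snd) (chart_cont c2); first by move=> z [].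
  by apply: continuous_cont_on => z; exact: cvg_snd.
- move=> O oO Od; pose c := prod_chart phi psi.
  exists (\bigcup_(B in [set B | open B /\ B `&` cimg c `<=` c @` O]) B).
    by apply: bigcup_open => B [].
  apply/seteqP; split => [_ [[x y] Oxy <-]|z [[B [oB hB] Bz] cz]]; last exact: hB.
  have [dx dy] : cdom phi x /\ cdom psi y by have := Od _ Oxy.
  split; last by exists (x, y).
  have [[A B] /= [nA nB] AB] : nbhs (x, y) O by exact: open_nbhs_nbhs.
  have [A' nA' hA'] := chart_nbhs_img c1 dx nA.
  have [B' nB' hB'] := chart_nbhs_img c2 dy nB.
  exists (A'° `*` B'°); last by split; [exact: nA'|exact: nB'].
  split; first by apply: openX; exact: open_interior.
  move=> w [[/= /interior_subset A1 /interior_subset B1] [[x' y'] [/= dx' dy'] e]].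
  subst w; exists (x', y') => //; apply: AB; split => /=.
    exact: hA'.
  exact: hB'.
Qed.

Lemma good_transition_prod r M N E F E' F' (phi : chart M E) (psi : chart N F)
    (phi' : chart M E') (psi' : chart N F') :
  is_chart phi -> is_chart psi -> is_chart phi' -> is_chart psi' ->
  good_transition r phi phi' -> good_transition r psi psi' ->
  good_transition r (prod_chart phi psi) (prod_chart phi' psi').
Proof.
move=> c1 c2 c1' c2' [[h1 h1E h1C] i1] [[h2 h2E h2C] i2].
have DE : cdom (prod_chart phi psi) `&` cdom (prod_chart phi' psi') =
    (cdom phi `&` cdom phi') `*` (cdom psi `&` cdom psi').
  by apply/seteqP; split => z [[/= ? ?] [/= ? ?]].
rewrite /good_transition /= DE !imageX !interiorX; split.
  exists (fun z => (h1 z.1, h2 z.2)).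
    by move=> [x y] [[/= ? ?] [? ?]]; congr pair; [apply: h1E|apply: h2E].
  apply: C_C_on => n nr; rewrite interiorX; apply: C_prod; try exact: open_interior;
    try exact: interior_subset.
  - by apply: C_on_C h1C => //; exact: chart_hausdorff c1'.
  - by apply: C_on_C h2C => //; exact: chart_hausdorff c2'.
by move=> [x y] [[/= ? ?] [? ?]] [/= ? ?]; split => /=; [apply: i1|apply: i2].
Qed.

(** Compatibility of charts alone: the common ground of rough manifolds and of the generated atlas
    of the real line. *)
Definition charts_ok r M := (forall E (phi : chart M E), catlas M phi -> is_chart phi) /\
  forall E E' (phi : chart M E) (psi : chart M E'), catlas M phi -> catlas M psi ->
    good_transition r phi psi.

Lemma rough_charts_ok r M : rough_manifold r M -> charts_ok r M.
Proof. by case=> _ []. Qed.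

Lemma prod_chart_in r M N E F (phi : chart M E) (psi : chart N F) :
  charts_ok r M -> charts_ok r N -> catlas M phi -> catlas N psi ->
  catlas (prod_manifold r M N) (prod_chart phi psi).
Proof.
move=> [c1 t1] [c2 t2] A1 A2; split; first by apply: is_chart_prod; auto.
by move=> G chi [E' F' phi' psi' A1' A2']; split; apply: good_transition_prod; auto.
Qed.

Lemma prod_fi r M N E F (phi : chart M E) (psi : chart N F) z :
  charts_ok r M -> charts_ok r N -> catlas M phi -> catlas N psi ->
  cdom phi z.1 -> cdom psi z.2 ->
  @formal_interior R (prod_manifold r M N) z <-> (cimg phi)° (phi z.1) /\ (cimg psi)° (psi z.2).
Proof.
move=> o1 o2 A1 A2 d1 d2; have cin := prod_chart_in o1 o2 A1 A2.
have [c1 _] := o1; have [c2 _] := o2.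
have cc := is_chart_prod (c1 _ _ A1) (c2 _ _ A2).
have dz : cdom (prod_chart phi psi) z by [].
split => [h|[h1 h2] G chi [cchi tchi] dchi].
  by have := h _ _ cin dz; rewrite prod_cimg interiorX.
have [_ [_ hi]] := tchi _ _ (ProdAtlas A1 A2).
have nd : nbhs z (cdom (prod_chart phi psi) `&` cdom chi).
  by apply: open_nbhs_nbhs; split => //; apply: openI; exact: chart_open.
have h3 : (prod_chart phi psi @` (cdom (prod_chart phi psi) `&` cdom chi))° (prod_chart phi psi z).
  apply/(img_interior cc (@subIsetl _ _ _) dz).
  by split => //; rewrite prod_cimg interiorX.
by have /(img_interior cchi (@subIsetr _ _ _) dchi)[] := hi z (conj dz dchi) h3.
Qed.

Lemma line_charts_ok : charts_ok None (real_line R).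
Proof.
split; first by move=> E phi [].
move=> E E' phi psi A1 A2.
have [c1 [[[m mE mC] mi] _]] := line_generated A1.
have [c2 [_ [[m' m'E m'C] mi']]] := line_generated A2.
rewrite setIT in mE mC mi; rewrite setTI /= image_id in m'E m'C mi'.
have c0 : is_chart (@line_chart R) by apply: is_chart_id; exact: hausdorff_R.
split.
  exists (fun y => m' (m y)); first by move=> x [dx dx'] /=; rewrite mE// m'E.
  apply: C_C_on => n _.
  apply: (@C_comp _ n _ _ _ _ _ (cdom psi) (cdom psi)° m m') => //.
  - exact: open_interior.
  - exact: interior_subset.
  - by move=> _ [x [dx dx'] <-]; rewrite mE.
  - move=> _ /(img_interiorE c1 (@subIsetl _ _ _))[x [[dx dx'] nd _ ->]]; rewrite mE//.
    by apply: interiorS nd; exact: subIsetr.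
  - apply: (@C_sub _ _ _ _ (phi @` cdom phi) (phi @` cdom phi)°).
    + by apply: image_subset; exact: subIsetl.
    + by apply: interiorS; apply: image_subset; exact: subIsetl.
    + by apply: C_on_C mC => //; exact: hausdorff_R.
  - by apply: C_on_C m'C => //; exact: chart_hausdorff c2.
move=> x [dx dx'] /(img_interior c1 (@subIsetl _ _ _) dx)[nd nc].
apply/(img_interior c2 (@subIsetr _ _ _) dx'); split => //.
have h1 := mi x dx nc; rewrite /= in h1.
have h2 : (cdom psi : set R^o)° x.
  by apply: open_nbhs_nbhs; split => //; exact: chart_open c2.
exact: mi' h2.
Qed.

Lemma line_chart_in : catlas (real_line R) (@line_chart R).
Proof.
split; first by apply: is_chart_id; exact: hausdorff_R.
have g : good_transition None (@line_chart R) (@line_chart R).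
  split; last by move=> x _.
  by exists id => //; apply: C_C_on => n _; apply: C_lin; exact: clin_id.
by move=> E _ [].
Qed.

(** Near each point an arbitrary chart of the product is compared with the product of the identity
    chart of the line and a chart of [M]. In the latter the map is C^{n,n}, hence C^n by [Q_C]. *)
Lemma LQ_joint M N (D1 : set (real_line R)) (V : set M) (H : real_line R * M -> N) :
  rough_manifold None M -> rough_manifold None N -> open V ->
  (D1 : set R^o) `<=` closure (D1 : set R^o)° ->
  (forall n t x, D1 t -> V x ->
    LQ n n (D1 : set R^o) (D1 : set R^o)° (H : R^o * M -> N) t x) ->
  @RC_on R (prod_manifold None (real_line R) M) N None (D1 `*` V) H.
Proof.
move=> rM rN oV D1D hL.
have nM n : nice n M by exact: rough_nice rM _. have nN n : nice n N by exact: rough_nice rN _.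
have oM := rough_charts_ok rM. have [_ covM _ _] := nM 0%N.
split.
- apply/cont_onP => -[t x] [/= Dt Vx] W nW.
  have := LQ_cont (nM 0%N) (nN 0%N) (hL 0%N t x Dt Vx) Dt nW.
  by apply: filterS => -[t' x'] h [/= ? _]; exact: h.
- move=> [t x]; rewrite interiorX => -[/= /interior_subset Dt /interior_subset Vx] fz.
  have [E [F [phi [psi [U1 [U2 [[_ U1p] [_ U2x] U2d [Aphi _] [_ hfi _]]]]]]]] := hL 0%N t x Dt Vx.
  apply: hfi => //; apply/(nice_fi (nM 0%N) Aphi); first exact: U2d.
  by have [] := (prod_fi line_charts_ok oM line_chart_in Aphi (z := (t, x)) I (U2d _ U2x)).1 fz.
move=> G F Phi psi [cPhi tPhi] Apsi D'.
have cq := nice_chart (nN 0%N) Apsi.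
have Dd : D' `<=` cdom Phi by move=> z [[]].
have Hc z : D' z -> forall W, nbhs (H z) W -> \forall w \near z, (D1 `*` V) w -> W (H w).
  move: z => [t x] [[[/= Dt Vx] _] _] W nW.
  have := LQ_cont (nM 0%N) (nN 0%N) (hL 0%N t x Dt Vx) Dt nW.
  by apply: filterS => -[t' x'] h [/= ? _]; exact: h.
have DD : D' `<=` closure D'°.
  move=> [t x] D'z; have [[[/= Dt Vx] dz] dH] := D'z => W nW.
  have nd' : nbhs (H (t, x)) (cdom psi) by apply: open_nbhs_nbhs; split => //; exact: chart_open cq.
  have nd : nbhs (t, x) (cdom Phi) by apply: open_nbhs_nbhs; split => //; exact: chart_open cPhi.
  have nn : nbhs ((t, x) : R^o * M) ((fun w => (D1 `*` V) w -> cdom psi (H w)) `&` (cdom Phi `&` W)).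
    by apply: filterI (Hc _ D'z _ nd') _; exact: filterI.
  have cl : closure ((D1 : set R^o)° `*` V) (t, x).
    by apply: closure_setX; [exact: D1D|exact: subset_closure].
  have [w [w1 w2]] := cl _ (nbhs_interior nn).
  exists w; split; last by have [_ []] := interior_subset w2.
  have oDV : open ((D1 : set R^o)° `*` V) by apply: openX => //; exact: open_interior.
  have nw1 : nbhs w ((D1 : set R^o)° `*` V) by exact: open_nbhs_nbhs.
  apply: filterS2 nw1 w2 => v [/interior_subset v1 v2] [v3 [v4 _]].
  by have v12 : (D1 `*` V) v by []; split => //; exact: v3.
have [[z0 _]|nD] := pselect (exists x, D' x); last first.
  exists (fun=> 0); first by move=> x Dx; case: nD; exists x.
  by apply: C_C_on => n _; exact: C_cst.
exists (fun y => psi (H (cinv Phi z0 y))).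
  by move=> z Dz; rewrite cinvK//; exact: Dd.
apply: C_C_on => n _; apply: Q_local => //.
- exact: chart_hausdorff cq.
- by move=> y _; exact: subset_closure.
- by apply: (img_regular cPhi Dd); exact: DD.
- exact: interior_subset.
- exact: open_interior.
move=> p _ _ [[t x] D'z <-]; have [[[/= Dt Vx] dz] dH] := D'z.
have [E [phi [Aphi dx]]] := covM x; have cp := nice_chart (nM 0%N) Aphi.
have [U1 [U2 [[oU1 U1t] [oU2 U2x] _ U2d [hd _ [h0 [h0E h0Q]]]]]] :=
  LQ_chart (nM (n + n)%N) (nN (n + n)%N) (leqnn _) (fun _ => @open_interior R^o D1)
    (@interior_subset _ _) Dt Aphi Apsi dx dH (hL n t x Dt Vx) filterT filterT.
pose c := prod_chart (@line_chart R) phi.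
have oc : is_chart c by apply: is_chart_prod => //; apply: is_chart_id; exact: hausdorff_R.
have [[[m mE mC] mi] _] := tPhi _ _ (ProdAtlas line_chart_in Aphi).
have m1E u : cdom Phi u -> U2 u.2 -> m (Phi u) = (u.1, phi u.2).
  by move=> du Uu; apply: mE; split => //; split => //; have [] := U2d _ Uu.
have oB : open (cdom Phi `&` (U1 `*` U2)).
  by apply: openI; [exact: chart_open cPhi|exact: openX].
have [V0 oV0 V0E] := chart_img cPhi oB (@subIsetl _ _ _).
have V0P u : cdom Phi u -> V0 (Phi u) -> (U1 `*` U2) u.
  move=> du Vu; have : (V0 `&` cimg Phi) (Phi u) by split => //; exists u.
  by rewrite -V0E => -[v [dv Uv] /(chart_inj cPhi dv du) <-].
exists setT, V0; split => //; first exact: openT.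
  have : (Phi @` (cdom Phi `&` (U1 `*` U2))) (Phi (t, x)) by exists (t, x).
  by rewrite V0E => -[].
rewrite !setIT; apply: (@C_ext _ n _ _ _ _ (fun y => h0 (m y)) (fun y => psi (H (cinv Phi z0 y)))).
- by apply: openI => //; exact: open_interior.
- by apply: setSI; exact: interior_subset.
- move=> _ [[u D'u <-] Vu]; have du := Dd _ D'u; have [U1u U2u] := V0P u du Vu.
  have [[[Du _] _] _] := D'u.
  by rewrite m1E// h0E// cinvK//; case: (u).
apply: (@C_comp _ n _ _ _ _ _ (((D1 : set R^o) `&` U1) `*` (phi @` U2))
  (((D1 : set R^o)° `&` U1) `*` (phi @` U2)°) m h0).
- by apply: openX; [apply: openI => //|]; exact: open_interior.
- by move=> v [/= [/interior_subset ? ?] /interior_subset ?].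
- move=> _ [[u D'u <-] Vu]; have du := Dd _ D'u; have [U1u U2u] := V0P u du Vu.
  by have [[[Du _] _] _] := D'u; rewrite m1E//; split => //=; exists u.2.
- move=> _ [/(img_interiorE cPhi Dd)[u [D'u nD nc ->]] Vu].
  have du := Dd _ D'u; have [U1u U2u] := V0P u du Vu; rewrite m1E//.
  have : (D1 `*` V)° u by apply: interiorS nD => v [[]].
  rewrite interiorX => -[nD1 _].
  have dcu : cdom c u by split => //; have [] := U2d _ U2u.
  have no : nbhs u (cdom Phi `&` cdom c).
    by apply: open_nbhs_nbhs; split => //; apply: openI; exact: chart_open.
  have hi : (Phi @` (cdom Phi `&` cdom c))° (Phi u).
    by apply/(img_interior cPhi) => //; exact: subIsetl.
  have /(img_interior oc (@subIsetr _ _ _) dcu)[_] := mi u (conj du dcu) hi.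
  rewrite prod_cimg interiorX => -[_ nphi].
  split => //; apply/(img_interior cp) => //; first by move=> v /U2d[].
    by case: dcu.
  by split => //; exact: open_nbhs_nbhs.
- apply: (@C_sub _ n _ _ (Phi @` (cdom Phi `&` cdom c)) (Phi @` (cdom Phi `&` cdom c))°).
  + move=> _ [[u D'u <-] Vu]; have du := Dd _ D'u; have [U1u U2u] := V0P u du Vu.
    by exists u => //; split => //; split => //; have [] := U2d _ U2u.
  + have sub : Phi @` D' `&` V0 `<=` Phi @` (cdom Phi `&` cdom c).
      move=> _ [[u D'u <-] Vu]; have du := Dd _ D'u; have [U1u U2u] := V0P u du Vu.
      by exists u => //; split => //; split => //; have [] := U2d _ U2u.
    move=> y [Dy Vy]; apply: (interiorS sub); rewrite interiorI; split => //.
    exact: open_nbhs_nbhs.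
  + by apply: C_on_C mC => //; exact: chart_hausdorff oc.
apply: Q_C h0Q.
- by apply: openI => //; exact: open_interior.
- exact: open_interior.
- by apply: setSI; exact: interior_subset.
- exact: interior_subset.
Qed.

End Products.

(** * Finite-dimensional charts and bundle charts in a maximal atlas *)

Section MaximalAtlas.
Context {R : realType}.
Implicit Types (M N : charted_space R) (E F P : tvsType R).
Lemma catlas_max r M E (phi : chart M E) : rough_manifold r M -> is_chart phi ->
  (forall E' (psi : chart M E'), catlas M psi ->
    good_transition r phi psi /\ good_transition r psi phi) -> catlas M phi.
Proof.
move=> [_ [hc hcov ht] hmax] cphi tphi.
(* The atlas enlarged by [phi]. Charts with different model spaces are compared as dependent pairs,
   so the cases below transport properties along equalities of such pairs. *)
pose A : atlas R M := fun E' psi => catlas M psi \/ existT (fun E => chart M E) E phi = existT _ E' psi.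
apply: (hmax A) => [|E' psi Apsi|]; [|by left|by right].
have tself : good_transition r phi phi.
  split; last by [].
  by exists id => //; apply: C_C_on => n _; apply: C_lin; exact: clin_id.
split.
- move=> E' psi [/hc//|e].
  by have : (fun c : {E : tvsType R & chart M E} => is_chart (projT2 c)) (existT _ E' psi) by rewrite -e.
- by move=> x; have [E' [psi [A1 dx]]] := hcov x; exists E', psi; split => //; left.
have tphi' E' (psi : chart M E') : A E' psi -> good_transition r phi psi /\ good_transition r psi phi.
  move=> [/tphi//|e].
  have : (fun c : {E : tvsType R & chart M E} => good_transition r phi (projT2 c) /\
    good_transition r (projT2 c) phi) (existT _ E' psi) by rewrite -e.
  by [].
move=> E1 E2 p1 p2 [A1|e1] A2; last first.
  have : (fun c : {E : tvsType R & chart M E} => good_transition r (projT2 c) p2) (existT _ E1 p1).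
    by rewrite -e1 /=; have [] := tphi' _ _ A2.
  by [].
case: A2 => [A2|e2]; first exact: ht.
have : (fun c : {E : tvsType R & chart M E} => good_transition r p1 (projT2 c)) (existT _ E2 p2).
  by rewrite -e2 /=; have [] := tphi _ _ A1.
by [].
Qed.

Section LinearChange.
Variables (M : charted_space R) (E E' : tvsType R) (phi : chart M E) (L : E -> E') (T : E' -> E).
Hypotheses (cL : clin L) (cT : clin T) (TL : cancel L T) (LT : cancel T L).
Hypotheses (hE' : hausdorff_space E') (cphi : is_chart phi).
Local Notation Lphi := (Chart (cdom phi) (fun x => L (phi x))).

Lemma linear_image (A : set E) : L @` A = T @^-1` A.
Proof.
apply/seteqP; split => [_ [x Ax <-]|y Ay]; first by rewrite /= TL.
by exists (T y) => //; rewrite LT.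
Qed.

Lemma linear_interior (A : set E) y : (L @` A)° (L y) <-> A° y.
Proof.
have [_ _ Lc] := cL; have [_ _ Tc] := cT; split => h.
  have {}h : nbhs y (L @^-1` (L @` A)) by apply: Lc.
  by apply: filterS h => z [w Aw /(can_inj TL) <-].
by rewrite linear_image; apply: Tc; rewrite TL.
Qed.

Lemma linear_imgE (D : set M) : Lphi @` D = L @` (phi @` D).
Proof. by rewrite image_comp. Qed.

Lemma is_chart_linear : is_chart Lphi.
Proof.
have [_ [od rg] _ _ _] := cphi; have [_ _ Lc] := cL; have [_ _ Tc] := cT; split => //.
- split => //; rewrite /regular_set /cimg linear_imgE => _ [y Cy <-] W nW.
  have [z [Cz Wz]] := rg y Cy _ (Lc y W nW).
  by exists (L z); split => //; apply/linear_interior.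
- move=> x y /set_mem dx /set_mem dy /(can_inj TL); exact: (chart_inj cphi).
- apply/cont_onP; apply: (@cont_on_comp _ _ _ _ setT) (chart_cont cphi) _ => //.
  exact: continuous_cont_on.
- move=> O oO Od; have [B' oB' e] := chart_img cphi oO Od.
  exists (T @^-1` B'); first by apply: open_comp => // x _; exact: Tc.
  by rewrite /cimg !linear_imgE e !linear_image.
Qed.

Lemma good_transition_linear r F (psi : chart M F) : is_chart psi ->
  good_transition r phi psi -> good_transition r psi phi ->
  good_transition r Lphi psi /\ good_transition r psi Lphi.
Proof.
move=> cpsi [[h hE hC] hi] [[k kE kC] ki]; split; (split; last first).
- by move=> x dx; rewrite linear_imgE => /linear_interior; exact: hi.
- exists (fun y => h (T y)); first by move=> x dx /=; rewrite TL hE.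
  apply: C_C_on => n nr; rewrite linear_imgE.
  apply: (@C_comp _ n _ _ _ _ _ _ _ T h) (C_on_C _ nr hC); first exact: open_interior.
  + exact: interior_subset.
  + by move=> _ [y hy <-]; rewrite TL.
  + by move=> y; rewrite -[y in X in X -> _]LT => /linear_interior.
  + exact: C_lin.
  + exact: chart_hausdorff cpsi.
- by move=> x dx h1; rewrite linear_imgE; apply/linear_interior; exact: ki.
- exists (fun y => L (k y)); first by move=> x dx /=; rewrite kE.
  apply: C_C_on => n nr.
  apply: (@C_comp _ n _ _ _ _ _ setT setT k L) => //; first exact: openT.
    exact: C_on_C (chart_hausdorff cphi) nr kC.
  exact: C_lin.
Qed.

End LinearChange.

Lemma compact_nbhd (T : topologicalType) (x : T) (O : set T) : hausdorff_space T ->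
  locally_compact [set: T] -> open O -> O x ->
  exists K : set T, [/\ compact K, closed K, nbhs x K & K `<=` O].
Proof.
move=> hT lT oO Ox; have := lT x I; rewrite withinET => -[B nB [cB clB]].
have rg := compact_regular hT cB nB.
have nOB : nbhs x (O `&` B) by apply: filterI => //; exact: open_nbhs_nbhs.
have [W nW hW] := rg _ nOB.
exists (closure W); split.
- apply: (subclosed_compact _ cB); first exact: closed_closure.
  by move=> y /hW[].
- exact: closed_closure.
- by apply: filterS nW; exact: subset_closure.
- by move=> y /hW[].
Qed.

(** The image of [x] may lie on the boundary, where a compact neighbourhood in [M] gives none in the
    model space. Regularity supplies a point [x1] of the same chart domain whose image is interior;
    there a compact neighbourhood in [M] becomes one in [E], so [E] is finite-dimensional and the
    chart can be transported linearly. *)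
Lemma riesz_chart r M x : rough_manifold r M -> locally_compact [set: M] ->
  exists d (phi : chart M ('rV[R]_d)), catlas M phi /\ cdom phi x.
Proof.
move=> rM lM; have [hM [hc hcov ht] _] := rM.
have [E [phi [Aphi dx]]] := hcov x; have cphi := hc _ _ Aphi.
have [_ [od rg] _ _ _] := cphi.
have cx : cimg phi (phi x) by exists x.
have [y [ny _]] := rg _ cx setT filterT.
have [x1 dx1 e] := interior_subset ny; subst y.
have [K [cK _ nK Kd]] := compact_nbhd hM lM od dx1.
have niK : nbhs (phi x1) (phi @` K) by apply/(img_interior cphi Kd dx1).
have ciK : compact (phi @` K).
  apply: continuous_compact => //; apply/cont_onP.
  exact: cont_on_sub Kd (chart_cont cphi).
pose K0 : set E := (fun y => 1 *: (y - phi x1)) @` (phi @` K).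
have cK0 : compact K0.
  apply: continuous_compact => //; apply: continuous_subspaceT.
  exact: continuous_dilation.
have nK0 : nbhs (0 : E) K0.
  have h : nbhs (0 : E) [set z | (phi @` K) (1 *: (z - - phi x1))].
    by apply: (@continuous_dilation _ E 1 (- phi x1) 0); rewrite scale1r opprK add0r.
  apply: filterS h => z /= hz; exists (1 *: (z - - phi x1)) => //.
  by rewrite !scale1r opprK addrK.
have [d [T [L [cT cL LT TL]]]] := riesz (chart_hausdorff cphi) cK0 nK0.
exists d, (Chart (cdom phi) (fun x => L (phi x))); split => //.
have hV : hausdorff_space ('rV[R]_d : tvsType R) by exact: norm_hausdorff.
apply: (catlas_max rM); first exact: (@is_chart_linear _ _ _ _ L T).
move=> E' psi A'; apply: (@good_transition_linear _ _ _ _ L T) => //.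
- exact: hc.
- exact: ht.
- exact: ht.
Qed.

(** [Psi] is a bundle trivialization followed by the product of [phi] and a chart of the fibre; it
    belongs to the maximal atlas because the trivialization is a diffeomorphism. The fibre has no
    boundary, so its coordinates fill an open set, and boundary phenomena remain in the base. In
    such a chart a section is a function with values in an open set of [G]. *)
Lemma bundle_chart r M N (pi : N -> M) E (phi : chart M E) (y0 : N) :
  rough_manifold r M -> fibre_bundle r pi -> catlas M phi -> cdom phi (pi y0) ->
  exists (G : tvsType R) (Psi : chart N (E * G)%type) (U : set M) (O : set G),
    [/\ catlas N Psi /\ cdom Psi y0, open U /\ U `<=` cdom phi, open O,
        cimg Psi = (phi @` U) `*` O &
        forall y, cdom Psi y -> U (pi y) /\ (Psi y).1 = phi (pi y)].
Proof.
move=> rM [rN pi_RC _ hloc] Aphi dphi.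
have [U0 [F [oU0 U0y [rF oF] [th [th' [[rth rth' [thD th'D] thK th'K] thpi]]]]]] := hloc (pi y0).
have okM := rough_charts_ok rM; have okF := rough_charts_ok rF.
have r0 : le_order 0 r by case: (r).
have nF := rough_nice rF r0; have nM := rough_nice rM r0; have nN := rough_nice rN r0.
have [_ covF _ _] := nF.
have [G [psi [Apsi dpsi]]] := covF (th y0).2.
have cphi := nice_chart nM Aphi; have cpsi := nice_chart nF Apsi.
have opsi := oF _ _ Apsi.
pose c := prod_chart phi psi.
have Ac : catlas (prod_manifold r M F) c by exact: prod_chart_in.
have cc : is_chart c by exact: is_chart_prod.
have [/cont_onP pic _ _] := pi_RC.
have opi : open (pi @^-1` U0).
  rewrite openE => y Uy; have : nbhs (pi y) U0 by exact: open_nbhs_nbhs.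
  by move=> /(pic y I) h; apply: filterS h => z; exact.
have [/cont_onP cth thfi thch] := rth; have [/cont_onP cth' th'fi th'ch] := rth'.
pose D := (pi @^-1` U0) `&` th @^-1` cdom c.
have oD : open D.
  rewrite openE => y [Uy dy].
  have nd : nbhs (th y) (cdom c) by apply: open_nbhs_nbhs; split => //; exact: chart_open.
  have nU : nbhs y (pi @^-1` U0) by exact: open_nbhs_nbhs.
  by apply: filterS2 nU (cth y Uy _ nd) => z Uz b; split => //; exact: b.
have dc : D y0.
  by split => //; split => //=; rewrite thpi.
pose Psi : chart N (E * G)%type := Chart D (fun y => c (th y)).
pose U := U0 `&` cdom phi.
have oU : open U by apply: openI => //; exact: chart_open.
have oUT : open (U0 `*` [set: F]) by apply: openX => //; exact: openT.
have PsiE : cimg Psi = c @` ((U0 `*` setT) `&` cdom c).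
  apply/seteqP; split => [_ [y [Uy dy] <-]|_ [z [zU dz] <-]].
    by exists (th y) => //; split => //; exact: thD.
  exists (th' z); last by rewrite /= th'K.
  by split; [exact: th'D|rewrite /= th'K].
have UE : (U0 `*` [set: F]) `&` cdom c = U `*` cdom psi.
  by apply/seteqP; split => -[a b]; [move=> [[/= ? ?] [/= ? ?]]|move=> [[/= ? ?] /= ?]].
have PsiE' : cimg Psi = (phi @` U) `*` cimg psi by rewrite PsiE UE imageX.
have D_sub O : O `<=` D -> Psi @` O = c @` ((U0 `*` setT) `&` (cdom c) `&` th' @^-1` O).
  move=> OD; apply/seteqP; split => [_ [y Oy <-]|_ [z [[zU dz] Oz] <-]].
    have [Uy dy] := OD y Oy; exists (th y) => //; split; first by split => //; exact: thD.
    by rewrite /= thK.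
  by exists (th' z) => //=; rewrite th'K.
have sub_c A : (U0 `*` [set: F]) `&` cdom c `&` A `<=` cdom c by move=> z [[_ ?] _].
have cPsi : is_chart Psi.
  split.
  - exact: chart_hausdorff cc.
  - split => //; rewrite PsiE' /regular_set interiorX => -[u v] [/= uU vO].
    apply: closure_setX; last by apply: subset_closure; rewrite /interior; exact: open_nbhs_nbhs.
    apply: (img_regular cphi (@subIsetr _ _ _)) => // a Ua; apply: subset_closure.
    by rewrite /interior; exact: open_nbhs_nbhs.
  - move=> y y' /set_mem[Uy dy] /set_mem[Uy' dy'] /= e.
    by rewrite -(thK _ Uy) -(thK _ Uy') (chart_inj cc dy dy' e).
  - apply/cont_onP; apply: (@cont_on_comp _ _ _ _ (cdom c) th) (chart_cont cc); first by move=> y [].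
    by apply: cont_on_sub cth => y [].
  - move=> O oO OD; rewrite (D_sub _ OD).
    pose O1 := (U0 `*` [set: F]) `&` cdom c `&` th' @^-1` O.
    have oO1 : open O1.
      rewrite openE => z [[zU dz] Oz]; rewrite /interior.
      have nO : nbhs (th' z) O by exact: open_nbhs_nbhs.
      have n1 : nbhs z (U0 `*` [set: F]) by exact: open_nbhs_nbhs.
      have n2 : nbhs z (cdom c) by apply: open_nbhs_nbhs; split => //; exact: chart_open.
      have n3 := cth' z zU O nO.
      apply: filterS2 (filterI n1 n2) n3 => w [w1 w2] w3.
      by split => //; exact: w3.
    have [B' oB' e] := chart_img cc oO1 (@sub_c _).
    exists B' => //; rewrite e; apply/seteqP; split => [z [B'z cz]|z [B'z]].
      split => //; have : (c @` O1) z by rewrite e.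
      by move=> [w [wU _] <-]; rewrite PsiE; exists w.
    rewrite PsiE => -[w [wU dw] e2]; split; first exact: B'z.
    by exists w.
exists G, Psi, U, (cimg psi); split => //.
- split => //; apply: (catlas_max rN cPsi) => K kap Akap.
  have ckap := nice_chart nN Akap.
  have [h hE hC] := thch _ _ _ _ Akap Ac.
  have [k kE kC] := th'ch _ _ _ _ Ac Akap.
  have DE : D `&` cdom kap = pi @^-1` U0 `&` cdom kap `&` th @^-1` cdom c.
    by apply/seteqP; split => y [[? ?] ?].
  have DE2 : Psi @` (D `&` cdom kap) =
      c @` ((U0 `*` setT) `&` cdom c `&` th' @^-1` cdom kap).
    rewrite (D_sub _ (@subIsetl _ _ _)); congr (c @` _); apply/seteqP; split => z.
      by move=> [zz [_ ?]].
    by move=> [[zU dz] zk]; split => //; split => //; split; [exact: th'D|rewrite /= th'K].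
  split; split => /=.
  + exists k; last by rewrite DE2.
    move=> y [[Uy dy] ky] /=; rewrite -[in RHS](thK _ Uy); apply: kE.
    by split; [split => //; exact: thD|rewrite /= thK].
  + move=> y [[Uy dy] ky]; rewrite DE2 => /(img_interior cc (@sub_c _) dy)[nz nc].
    apply/(img_interior ckap (@subIsetr _ _ _) ky); split.
      by apply: open_nbhs_nbhs; split => //; apply: openI => //; exact: chart_open.
    apply/(nice_fi nN Akap ky); rewrite -(thK _ Uy); apply: th'fi.
      by rewrite /interior; apply: open_nbhs_nbhs; split => //; exact: thD.
    move: nc; rewrite prod_cimg interiorX => nc.
    by apply/(prod_fi okM okF Aphi Apsi) => //; case: dy.
  + exists h; last by rewrite setIC DE.
    by move=> y [ky [Uy dy]]; rewrite hE.
  + move=> y [ky [Uy dy]] /(img_interior ckap (@subIsetl _ _ _) ky)[nD nc].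
    apply/(img_interior cPsi (@subIsetr _ _ _)); first by split.
    split => //; rewrite PsiE; apply/(img_interior cc (@subIsetr _ _ _) dy); split.
      apply: open_nbhs_nbhs; split; last by split => //; exact: thD.
      by apply: openI => //; exact: chart_open.
    have := thfi y; rewrite /interior => /(_ (open_nbhs_nbhs (conj opi Uy))).
    by move=> /(_ ((nice_fi nN Akap ky).2 nc)) h'; exact: (h' _ _ Ac dy).
- by split => //; exact: subIsetr.
- by move=> y [Uy [d1 d2]]; split; [split => //; rewrite -thpi|rewrite /= thpi].
Qed.

End MaximalAtlas.

(** * Tangent spaces and tangent maps *)

Section Differentials.
Context {R : realType}.
Implicit Types (M N : charted_space R) (E F G P : tvsType R).
Lemma differential_sub E F (S S' : set E) (f : E -> F) df : S' `<=` S ->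
  is_differential S f df -> is_differential S' f df.
Proof.
move=> SS [/cont_onP cdf hdf]; split.
  by apply/cont_onP; apply: cont_on_sub cdf => -[x y] [/= ? ?]; split => //; exact: SS.
by move=> x v Sx; apply: hdf; exact: interiorS SS _ Sx.
Qed.

Lemma has_dirder_eq E F (O : set E) (f f' : E -> F) x v d : open O -> O x ->
  (forall y, O y -> f y = f' y) -> has_dirder f x v d -> has_dirder f' x v d.
Proof.
move=> oO Ox e /has_dirderE h; apply/has_dirderE.
have [r r0 hr] := open_line v oO Ox; apply: (dcurve_eq_near r0) h => t tr.
by rewrite add0r; apply: e; exact: hr.
Qed.

Lemma differential_uniq E F (S S1 S2 : set E) (f f' : E -> F) df df' : hausdorff_space F ->
  S `<=` closure S° -> S `<=` S1 -> S `<=` S2 -> (forall x, S x -> f x = f' x) ->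
  is_differential S1 f df -> is_differential S2 f' df' ->
  forall x v, S x -> df (x, v) = df' (x, v).
Proof.
move=> hF SS s1 s2 e /(differential_sub s1)[/cont_onP c1 h1] /(differential_sub s2)[/cont_onP c2 h2] x v Sx.
apply: (@cont_on_uniq _ _ _ (S `*` setT) (S° `*` setT) df df' (x, v) hF c1 c2) => //.
- by move=> [y w] [/= /interior_subset].
- by apply: closure_setX; [exact: SS|exact: in_closureT].
move=> [y w] [/= Sy _]; apply: (has_dirder_uniq hF (h1 y w Sy)).
apply: (@has_dirder_eq _ _ S° f') => //; first exact: open_interior.
  by move=> z /interior_subset /e.
exact: h2.
Qed.

Lemma differential_comp E F G (S : set E) (S' : set F) (f : E -> F) (g : F -> G) df dg :
  (forall x, S x -> S' (f x)) -> (forall x, S° x -> S'° (f x)) ->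
  is_differential S f df -> is_differential S' g dg -> cont_on S f ->
  is_differential S (fun x => g (f x)) (fun z => dg (f z.1, df z)).
Proof.
move=> h1 h2 [/cont_onP cdf hdf] [/cont_onP cdg hdg] cf; split.
  apply/cont_onP; apply: (@cont_on_comp _ _ _ _ _ (fun z => (f z.1, df z))) cdg.
    by move=> [x v] [/= Sx _]; split => //; exact: h1.
  apply: cont_on_pair cdf; apply: (@cont_on_comp _ _ _ _ S fst) cf; first by move=> z [].
  exact: cont_on_fst.
move=> x v Sx; apply/has_dirderE.
have := @chain_curve R F G S'° g dg (fun t => f (x + t *: v)) 0 (df (x, v)).
rewrite scale0r addr0; apply.
- exact: open_interior.
- exact: hdg.
- by apply: cont_on_sub cdg => z [/= /interior_subset].
- exact: h2.
- by apply/has_dirderE; exact: hdf.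
Qed.

Lemma differential_id E (S : set E) : is_differential S id snd.
Proof.
split; first by apply/cont_onP; exact: cont_on_snd.
move=> x v _; apply/has_dirderE.
have := @dcurve_affine R E E id 0 x v 0 (@clin_id _ E).
by congr (dcurve _ _ _); apply/funext => t; rewrite addr0.
Qed.

Lemma C_differential n E F (S : set E) (f : E -> F) : C n.+1 S S° f ->
  exists2 df, C n (S `*` setT) (S° `*` setT) df & is_differential S f df.
Proof.
move=> /C_inv[df hdf Cdf]; exists df => //; split; first by apply/cont_onP; exact: C_cont Cdf.
by move=> x v Sx; apply/has_dirderE; exact: hdf.
Qed.

End Differentials.

Lemma tangent_openE {R : realType} (M : charted_space R) (W : set (tangent_space M)) :
  open W = @tangent_open R M W.
Proof. by []. Qed.

Section TangentCharts.
Context {R : realType}.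
Variables (n : nat) (M : charted_space R) (nM : nice n.+1 M).
Implicit Types (E F G P : tvsType R).

Lemma chart_atP (x : M) : catlas M (projT2 (chart_at x)) /\ cdom (projT2 (chart_at x)) x.
Proof.
rewrite /chart_at; case: pselect => [ex|nex]; first by case: cid => c [].
case: nex; have [_ cov _ _] := nM; have [E [phi [A d]]] := cov x.
by exists (existT _ E phi).
Qed.

Lemma nice_diff E E' (phi : chart M E) (psi : chart M E') : catlas M phi -> catlas M psi ->
  let D := cdom phi `&` cdom psi in exists m dm,
  [/\ forall x, D x -> m (phi x) = psi x, C n.+1 (phi @` D) (phi @` D)° m,
      C n ((phi @` D) `*` setT) ((phi @` D)° `*` setT) dm &
      is_differential (phi @` D) m dm].
Proof.
move=> A1 A2 D; have [_ _ h _] := nM; have [m mE mC] := h _ _ _ _ A1 A2.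
by have [dm dmC hdm] := C_differential mC; exists m, dm; split.
Qed.

Lemma img_open_regular E (phi : chart M E) (U : set M) : catlas M phi -> open U ->
  U `<=` cdom phi -> phi @` U `<=` closure (phi @` U)°.
Proof.
move=> A oU Ud; apply: (img_regular (nice_chart nM A) Ud) => x Ux.
by apply: subset_closure; rewrite /interior; exact: open_nbhs_nbhs.
Qed.

Lemma img_int_trans E E' (phi : chart M E) (psi : chart M E') (U V : set M) :
  catlas M phi -> catlas M psi -> open V -> U `<=` cdom phi -> U `<=` V -> V `<=` cdom psi ->
  forall y, (phi @` U)° y -> exists x, [/\ U x, y = phi x & (psi @` V)° (psi x)].
Proof.
move=> A1 A2 oV Ud UV Vd y /(nice_imgE nM A1 Ud)[x [Ux _ fx ->]]; exists x; split => //.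
apply/(nice_img nM A2) => //; first by auto.
by split => //; apply: open_nbhs_nbhs; split => //; exact: UV.
Qed.

(** The definition of [tcoord] selects the differential of some representative. Differentials of two
    representatives agree on the interior of the chart image and hence, by regularity and
    continuity, everywhere; so any representative near the base point computes it. *)
Lemma tcoordE (xi : tangent M) E (phi : chart M E) (U : set M) h dh :
  let c0 := projT2 (chart_at (tbase xi)) in
  catlas M phi -> open U -> U (tbase xi) -> U `<=` cdom c0 `&` cdom phi ->
  (forall y, U y -> h (c0 y) = phi y) -> is_differential (c0 @` U) h dh ->
  tcoord phi xi = dh (c0 (tbase xi), tvect xi).
Proof.
move=> c0 Aphi oU Ux Ud hE hdh; have [A0 d0] := chart_atP (tbase xi).
have [m [dm [mE _ _ hdm]]] := nice_diff A0 Aphi.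
pose D' := setT `&` cdom c0 `&` (@id M) @^-1` cdom phi.
have DE : D' = cdom c0 `&` cdom phi by rewrite /D' setTI.
rewrite /tcoord; case: xgetP => [w _ [h' [dh' [h'E hdh' ->]]]|]; last first.
  move=> /(_ (dm (c0 (tbase xi), tvect xi))) []; exists m, dm; rewrite -/D' -/c0 DE.
  by split.
have s1 : c0 @` U `<=` c0 @` D' by apply: image_subset; rewrite DE.
apply: (differential_uniq (S := c0 @` U) (S1 := c0 @` D') (S2 := c0 @` U) (f := h') (f' := h)) => //.
- exact: chart_hausdorff (nice_chart nM Aphi).
- by apply: img_open_regular => // y /Ud[].
- by move=> _ [y Uy <-]; rewrite h'E ?hE// -/D' DE; exact: Ud.
- by exists (tbase xi).
Qed.

Lemma tcoord_change (xi : tangent M) E E' (phi : chart M E) (psi : chart M E') (U : set M) h dh :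
  catlas M phi -> catlas M psi -> open U -> U (tbase xi) -> U `<=` cdom phi `&` cdom psi ->
  (forall y, U y -> h (phi y) = psi y) -> is_differential (phi @` U) h dh ->
  tcoord psi xi = dh (phi (tbase xi), tcoord phi xi).
Proof.
move=> A1 A2 oU Ux Ud hE hdh; have [A0 d0] := chart_atP (tbase xi).
pose c0 := projT2 (chart_at (tbase xi)); rewrite -/c0 in A0 d0.
have [m [dm [mE mC _ hdm]]] := nice_diff A0 A1.
pose U' := U `&` cdom c0.
have oU' : open U' by apply: openI => //; exact: chart_open (nice_chart nM A0).
have U'd : U' `<=` cdom c0 `&` cdom phi by move=> y [/Ud[]].
have hdm' : is_differential (c0 @` U') m dm by apply: differential_sub hdm; exact: image_subset.
have dx : (cdom c0 `&` cdom phi) (tbase xi) by split => //; have [] := Ud _ Ux.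
rewrite (tcoordE (phi := phi) (U := U') (h := m) (dh := dm)) => //; last first.
  by move=> y /U'd; exact: mE.
rewrite -(mE _ dx).
rewrite (tcoordE (phi := psi) (U := U') (h := fun y => h (m y))
  (dh := fun z => dh (m z.1, dm z))) => //.
- by move=> y [/Ud[]].
- by move=> y Uy; rewrite mE ?hE//; [case: Uy|exact: U'd].
apply: (differential_comp _ _ hdm' hdh).
- by move=> _ [y Uy <-]; rewrite mE; [exists y => //; case: Uy|exact: U'd].
- move=> y /(img_int_trans A0 A1 oU (fun z h => (U'd z h).1) (@subIsetl _ _ _)) h3.
  have [z [Uz -> nz]] := h3 (fun z h => (Ud z h).1).
  by rewrite mE//; exact: U'd.
- by apply: cont_on_sub (C_cont mC); exact: image_subset.
Qed.

Lemma differential_inverse E E' (phi : chart M E) (psi : chart M E') m dm m' dm' :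
  catlas M phi -> catlas M psi ->
  (forall x, (cdom phi `&` cdom psi) x -> m (phi x) = psi x) ->
  (forall x, (cdom psi `&` cdom phi) x -> m' (psi x) = phi x) ->
  C n.+1 (phi @` (cdom phi `&` cdom psi)) (phi @` (cdom phi `&` cdom psi))° m ->
  is_differential (phi @` (cdom phi `&` cdom psi)) m dm ->
  is_differential (psi @` (cdom psi `&` cdom phi)) m' dm' ->
  forall x v, cdom phi x -> cdom psi x -> dm' (psi x, dm (phi x, v)) = v.
Proof.
move=> A1 A2 mE mE' mC hdm hdm' x v d1 d2.
have oD : open (cdom phi `&` cdom psi).
  by apply: openI; [exact: chart_open (nice_chart nM A1)|exact: chart_open (nice_chart nM A2)].
rewrite -(mE x)//.
apply: (@differential_uniq _ _ _ (phi @` (cdom phi `&` cdom psi)) (phi @` (cdom phi `&` cdom psi)) setT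
  (fun y => m' (m y)) id (fun z => dm' (m z.1, dm z)) snd) => //.
- exact: chart_hausdorff (nice_chart nM A1).
- by apply: img_open_regular => //; exact: subIsetl.
- by move=> _ [y [dy dy'] <-]; rewrite mE// mE'.
- apply: (differential_comp _ _ hdm hdm').
  + by move=> _ [y [dy dy'] <-]; rewrite mE//; exists y.
  + have oD' : open (cdom psi `&` cdom phi) by rewrite setIC.
    have sw : cdom phi `&` cdom psi `<=` cdom psi `&` cdom phi by rewrite setIC.
    move=> y /(img_int_trans A1 A2 oD' (@subIsetl _ _ _) sw (@subIsetl _ _ _))[z [[dz dz'] -> nz]].
    by rewrite mE.
  + exact: C_cont mC.
- exact: differential_id.
- by exists x.
Qed.

Lemma tangent_eq E (phi : chart M E) (a b : tangent M) : catlas M phi ->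
  cdom phi (tbase a) -> tbase a = tbase b -> tcoord phi a = tcoord phi b -> a = b.
Proof.
case: a => x v; case: b => x' v' A /= dx e; subst x' => e.
have [A0 d0] := chart_atP x.
have [m [dm [mE mC _ hdm]]] := nice_diff A0 A.
have [m' [dm' [mE' _ _ hdm']]] := nice_diff A A0.
have oD : open (cdom (projT2 (chart_at x)) `&` cdom phi).
  by apply: openI; [exact: chart_open (nice_chart nM A0)|exact: chart_open (nice_chart nM A)].
have E1 u : tcoord phi (Tangent u) = dm (projT2 (chart_at x) x, u).
  by apply: (tcoordE (xi := Tangent u) (U := cdom (projT2 (chart_at x)) `&` cdom phi) (h := m)).
have E2 := differential_inverse A0 A mE mE' mC hdm hdm' _ d0 dx.
by rewrite -(E2 v) -(E2 v') -!E1 e.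
Qed.

Lemma tangent_ex E (phi : chart M E) x (w : E) : catlas M phi -> cdom phi x ->
  exists2 xi : tangent M, tbase xi = x & tcoord phi xi = w.
Proof.
move=> A dx; have [A0 d0] := chart_atP x.
have [m [dm [mE mC _ hdm]]] := nice_diff A0 A.
have [m' [dm' [mE' mC' _ hdm']]] := nice_diff A A0.
exists (Tangent (dm' (phi x, w))) => //.
have oD : open (cdom (projT2 (chart_at x)) `&` cdom phi).
  by apply: openI; [exact: chart_open (nice_chart nM A0)|exact: chart_open (nice_chart nM A)].
rewrite (tcoordE (xi := Tangent _) (U := cdom (projT2 (chart_at x)) `&` cdom phi) (h := m) (dh := dm)) //=.
exact: (differential_inverse A A0 mE' mE mC' hdm' hdm w dx d0).
Qed.

Definition Tchart E (phi : chart M E) : chart (tangent_space M) (E * E)%type :=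
  Chart (tbase (M := M) @^-1` cdom phi) (tangent_chart phi).

Lemma T_img E (phi : chart M E) (D : set M) : catlas M phi -> D `<=` cdom phi ->
  Tchart phi @` (tbase (M := M) @^-1` D) = (phi @` D) `*` setT.
Proof.
move=> A Dd; apply/seteqP; split => [_ [xi Dxi <-]|[_ w] [/= [x Dx <-] _]].
  by split => //=; exists (tbase xi).
have [xi e1 e2] := tangent_ex w A (Dd _ Dx).
by exists xi; rewrite /= ?e1// /tangent_chart e1 e2.
Qed.

Lemma T_cimg E (phi : chart M E) : catlas M phi -> cimg (Tchart phi) = cimg phi `*` setT.
Proof. by move=> A; exact: T_img. Qed.

Lemma open_tbase (U : set M) : open U -> open (tbase (M := M) @^-1` U : set (tangent_space M)).
Proof.
move=> oU; rewrite tangent_openE => E phi A; have cphi := nice_chart nM A.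
have oU' : open (U `&` cdom phi) by apply: openI => //; exact: chart_open.
have [B oB BE] := chart_img cphi oU' (@subIsetr _ _ _).
exists (B `*` setT); first by apply: openX => //; exact: openT.
move=> xi dxi; split => [Uxi|[/= Bxi _]].
  split => //; have : (phi @` (U `&` cdom phi)) (phi (tbase xi)) by exists (tbase xi).
  by rewrite BE => -[].
have : (B `&` cimg phi) (phi (tbase xi)) by split => //; exists (tbase xi).
by rewrite -BE => -[y [Uy dy] /(chart_inj cphi dy dxi) <-].
Qed.

Lemma is_chart_T E (phi : chart M E) : catlas M phi -> is_chart (Tchart phi).
Proof.
move=> A; have cphi := nice_chart nM A.
have TE : cimg (Tchart phi) = cimg phi `*` setT by exact: T_img.
split.
- by apply: hausdorffX; exact: chart_hausdorff cphi.
- split; first by apply: open_tbase; exact: chart_open.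
  rewrite /regular_set TE interiorX interiorT => -[y w] [/= cy _].
  have [_ [_ rg] _ _ _] := cphi.
  by apply: closure_setX; [exact: rg|exact: in_closureT].
- move=> a b /set_mem da /set_mem db /= [e1 e2].
  by apply: (tangent_eq A) => //; exact: (chart_inj cphi).
- apply/cont_onP => xi dxi W nW.
  suff h : nbhs xi (Tchart phi @^-1` W° `&` cdom (Tchart phi)).
    by apply: filterS h => eta [/interior_subset].
  apply: open_nbhs_nbhs; split; last by split => //; exact: nW.
  rewrite tangent_openE => E' psi A'; have cpsi := nice_chart nM A'.
  have [m [dm [mE mC _ [/cont_onP cdm hdm]]]] := nice_diff A' A.
  set D := cdom psi `&` cdom phi.
  have oD : open D by apply: openI; exact: chart_open.
  pose tm (z : E' * E') := (m z.1, dm z).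
  have ctm : cont_on ((psi @` D) `*` setT) tm.
    apply: cont_on_pair => //; apply: (@cont_on_comp _ _ _ _ (psi @` D) fst) (C_cont mC).
      by move=> z [].
    exact: cont_on_fst.
  have tmE eta : D (tbase eta) -> tm (tangent_chart psi eta) = tangent_chart phi eta.
    move=> Deta; rewrite /tm /tangent_chart /= mE//; congr pair.
    have hd : is_differential (psi @` D) m dm by split => //; apply/cont_onP.
    by rewrite -(tcoord_change (xi := eta) (U := D) (h := m) (dh := dm) A' A).
  have [B oB BE] := chart_img cpsi oD (@subIsetl _ _ _).
  (* The preimage is only relatively open in the chart image. The union of all open sets whose trace
     on that image is mapped into the target provides an open set of the ambient space. *)
  exists (\bigcup_(Q in [set Q | open Q /\ forall z, Q z -> (B `*` setT) z /\
    ((cimg psi `*` setT) z -> W° (tm z))]) Q); first by apply: bigcup_open => Q [].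
  move=> eta deta; split => [[W1 d1]|[Q [oQ hQ] Qeta]].
    have De : D (tbase eta) by split.
    have im : ((psi @` D) `*` setT) (tangent_chart psi eta) by split => //=; exists (tbase eta).
    have nW1 : nbhs (tm (tangent_chart psi eta)) W°.
      by rewrite tmE//; apply: open_nbhs_nbhs; split => //; exact: open_interior.
    have nQ := ctm _ im _ nW1.
    have nB : nbhs (tangent_chart psi eta) (B `*` setT).
      apply: open_nbhs_nbhs; split; first by apply: openX => //; exact: openT.
      by move: im; rewrite BE => -[[]].
    exists (((fun z => ((psi @` D) `*` setT) z -> W° (tm z)) `&` (B `*` setT))°); last exact: filterI.
    split; first exact: open_interior.
    move=> z /interior_subset[h1 h2]; split => // -[cz _]; apply: h1.
    by split => //; rewrite BE; split => //; case: h2.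
  have [[Beta _] h2] := hQ _ Qeta.
  have : (psi @` D) (psi (tbase eta)) by rewrite BE; split => //; exists (tbase eta).
  move=> [y Dy /(chart_inj cpsi Dy.1 deta) e]; rewrite e in Dy.
  split; last by case: Dy.
  have ci : (cimg psi `*` setT) (tangent_chart psi eta) by split => //; exists (tbase eta).
  by have := h2 ci; rewrite tmE.
- move=> Q; rewrite tangent_openE => oQ Qd; have [B oB BE] := oQ E phi A.
  exists B => //; apply/seteqP; split => [_ [xi Qxi <-]|z [Bz [xi dxi e]]].
    by split; [apply/BE => //; exact: Qd|exists xi => //; exact: Qd].
  by exists xi => //; apply/BE => //; rewrite /Tchart /= in e; rewrite e.
Qed.

(** The transition maps of the tangent charts are the pairs (m, dm), which costs one order of
    differentiability. *)
Lemma nice_T : nice n (tangent_space M).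
Proof.
split.
- by move=> _ _ [E phi A]; exact: is_chart_T.
- move=> xi; have [_ cov _ _] := nM; have [E [phi [A d]]] := cov (tbase xi).
  by exists _, (Tchart phi); split.
- move=> _ _ _ _ [E phi A] [E' psi A'] D.
  have [m [dm [mE mC dmC hdm]]] := nice_diff A A'.
  have oD : open (cdom phi `&` cdom psi).
    by apply: openI; [exact: chart_open (nice_chart nM A)|exact: chart_open (nice_chart nM A')].
  exists (fun z => (m z.1, dm z)).
    move=> eta Deta; rewrite /tangent_chart /= mE//; congr pair.
    by rewrite -(tcoord_change (xi := eta) (U := cdom phi `&` cdom psi) (h := m) (dh := dm) A A').
  have -> : Chart (tbase (M := M) @^-1` cdom phi) (tangent_chart phi) @` D =
      (phi @` (cdom phi `&` cdom psi)) `*` setT.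
    by apply: (T_img A); exact: subIsetl.
  rewrite interiorX interiorT; apply: C_pair => //.
  by apply: C_fst; exact: C_le mC.
- move=> _ _ _ _ [E phi A] [E' psi A'] xi dxi dxi'.
  change ((cimg (Tchart phi))° (Tchart phi xi) -> (cimg (Tchart psi))° (Tchart psi xi)).
  rewrite (T_cimg A) (T_cimg A') !interiorX !interiorT => -[/= h _]; split => //.
  by apply/(nice_fi nM A') => //; apply/(nice_fi nM A).
Qed.

Lemma fi_T (xi : tangent_space M) : formal_interior xi <-> formal_interior (tbase xi).
Proof.
have [_ cov _ _] := nM; have [E [phi [A d]]] := cov (tbase xi).
have h1 := nice_fi nM A d.
have h2 := nice_fi nice_T (TangentAtlas A) (d : cdom (Tchart phi) xi).
have h3 : (cimg (Tchart phi))° (Tchart phi xi) <-> (cimg phi)° (phi (tbase xi)).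
  rewrite (T_cimg A) interiorX interiorT.
  by split => [[]|].
by rewrite h2 h1; exact: h3.
Qed.

Lemma T_regular (D : set M) : D `<=` closure D° ->
  (tbase (M := M) @^-1` D : set (tangent_space M)) `<=` closure (tbase (M := M) @^-1` D : set (tangent_space M))°.
Proof.
move=> DD xi Dxi W nW; have [_ cov _ _] := nM; have [E [phi [A d]]] := cov (tbase xi).
have [B nB hB] := chart_nbhs_img (is_chart_T A) (d : cdom (Tchart phi) xi) nW.
have [[B1 B2] /= [nB1 nB2] B12] := nB.
have [x [Dx [dx Bx]]] := DD _ Dxi _ (chart_nbhs (nice_chart nM A) d nB1).
have [eta e1 e2] := tangent_ex (tcoord phi xi) A dx.
exists eta; split; last first.
  apply: hB; first by rewrite /= e1.
  by apply: B12; split => /=; rewrite ?e1 ?e2//; exact: nbhs_singleton.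
have : (tbase (M := M) @^-1` D° : set (tangent_space M)) `<=` tbase (M := M) @^-1` D.
  by move=> ? /interior_subset.
move=> /interiorS; apply; apply: open_nbhs_nbhs; split; last by rewrite /= e1.
by apply: open_tbase; exact: open_interior.
Qed.

End TangentCharts.

(** * Tangent maps and openness of the compact-open conditions *)

Section TangentMaps.
Context {R : realType}.
Implicit Types (M N : charted_space R) (E F G P : tvsType R).
Definition tmap M N (f : M -> N) (xi : tangent_space M) : tangent_space N :=
  @Tangent R N (f (tbase xi)) (xget 0 [set w | chart_differential setT f
    (projT2 (chart_at (tbase xi))) (projT2 (chart_at (f (tbase xi)))) (tbase xi) (tvect xi) w]).

Section OneMap.
Variables (n : nat) (M N : charted_space R) (nM : nice n.+1 M) (nN : nice n.+1 N).
Variables (f : M -> N) (Lf : forall x, LC n.+1 f x).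

Lemma LC_continuous : continuous f.
Proof. by move=> x; exact: (LC_cont nM nN (Lf x)). Qed.

Lemma LC_fi x : formal_interior x -> formal_interior (f x).
Proof.
have [E [F [phi [psi [U1 [U2 [[_ U1p] [_ U2x] _ _ [_ hfi _]]]]]]]] := Lf x.
exact: (hfi 0 x).
Qed.

Lemma open_dom E F (phi : chart M E) (psi : chart N F) : catlas M phi -> catlas N psi ->
  open (cdom phi `&` f @^-1` cdom psi).
Proof.
move=> A B; apply: openI; first exact: chart_open (nice_chart nM A).
apply: open_comp; last exact: chart_open (nice_chart nN B).
by move=> x _; exact: LC_continuous.
Qed.

Lemma LC_rep E F (phi : chart M E) (psi : chart N F) (U : set M) : catlas M phi ->
  catlas N psi -> open U -> U `<=` cdom phi `&` f @^-1` cdom psi ->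
  exists2 h : E -> F, forall y, U y -> h (phi y) = psi (f y) &
    C n.+1 (phi @` U) (phi @` U)° h.
Proof.
move=> A B oU Ud.
have : rep 0 n.+1 setT setT U (fun z : R^o * M => f z.2) phi psi.
  apply: (@LQ_glob _ 0 n.+1 n.+1) => //; first by move=> y _; apply: subset_closure.
  - by move=> y /Ud[].
  - by move=> p x _ /Ud[].
  - by move=> p x _ Ux; apply: (@LC_LQ _ n.+1 M N _ _ _ f).
move=> [_ _ [h [hE hQ]]]; exists (fun y => h (0, y)); first by move=> y; exact: hE.
by apply: (@Q_param _ _ _ _ _ _ _ _ _ _ _ _ (fun=> 0)) hQ => //; exact: cont_on_cst.
Qed.

(** Where all four charts involved are defined, k o h0 and h o m represent the same map. The chain
    rule computes the differential of each, and by uniqueness the results agree. *)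
Lemma tmap_coord E F (phi : chart M E) (psi : chart N F) (U : set M) h dh (xi : tangent_space M) :
  catlas M phi -> catlas N psi -> open U -> U (tbase xi) ->
  U `<=` cdom phi `&` f @^-1` cdom psi -> (forall y, U y -> h (phi y) = psi (f y)) ->
  is_differential (phi @` U) h dh ->
  tcoord psi (tmap f xi) = dh (phi (tbase xi), tcoord phi xi).
Proof.
move=> A B oU Ux Ud hE hdh; set x := tbase xi in Ux *; set v := tvect xi.
have [A0 d0] := chart_atP nM x; have [B0 e0] := chart_atP nN (f x).
set c0 := projT2 (chart_at x) in A0 d0; set psi0 := projT2 (chart_at (f x)) in B0 e0.
have cpsi := nice_chart nN B; have cphi := nice_chart nM A.
have cc0 := nice_chart nM A0; have cpsi0 := nice_chart nN B0.
pose D0 := cdom c0 `&` f @^-1` cdom psi0.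
have oD0 : open D0 by exact: open_dom.
have [h0 h0E h0C] := LC_rep A0 B0 oD0 (@subset_refl _ _).
have [dh0 _ hdh0] := C_differential h0C.
have [k [dk [kE kC _ hdk]]] := nice_diff nN B0 B.
have [m [dm [mE mC _ hdm]]] := nice_diff nM A0 A.
have [dx dfx] := Ud _ Ux.
have w0 : tvect (tmap f xi) = dh0 (c0 x, v).
  rewrite /=; case: xgetP => [w _ [h1 [dh1 [h1E hdh1 ->]]]|]; last first.
    move=> /(_ (dh0 (c0 x, v))) []; exists h0, dh0.
    by rewrite setTI.
  rewrite setTI in h1E hdh1.
  apply: (differential_uniq (S := c0 @` D0) (S1 := c0 @` D0) (S2 := c0 @` D0) (f := h1) (f' := h0)) => //.
  - exact: chart_hausdorff cpsi0.
  - by apply: (img_open_regular nM) => //; exact: subIsetl.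
  - by move=> _ [y Dy <-]; rewrite h1E// h0E.
  - by exists x.
have oV : open (cdom psi0 `&` cdom psi) by apply: openI; exact: chart_open.
rewrite (@tcoordE _ n N nN (tmap f xi) F psi (cdom psi0 `&` cdom psi) k dk)// w0.
have oW : open (cdom c0 `&` cdom phi) by apply: openI; exact: chart_open.
rewrite (@tcoordE _ n M nM xi E phi (cdom c0 `&` cdom phi) m dm)//.
rewrite /= -/x -/c0 -/psi0 -/v.
have -> : psi0 (f x) = h0 (c0 x) by rewrite h0E.
have -> : phi x = m (c0 x) by rewrite mE.
pose Z := U `&` D0.
have oZ : open Z by exact: openI.
have ZD : c0 @` Z `<=` c0 @` D0 by apply: image_subset; exact: subIsetr.
have Zm : c0 @` Z `<=` c0 @` (cdom c0 `&` cdom phi).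
  by apply: image_subset => y [/Ud[? _] []].
have hdm' : is_differential (c0 @` Z) m dm by exact: differential_sub hdm.
have hdh' : is_differential (c0 @` Z) h0 dh0 by exact: differential_sub hdh0.
have Zd : Z `<=` cdom c0 by move=> y [_ []].
apply: (@differential_uniq R _ F (c0 @` Z) (c0 @` Z) (c0 @` Z) (fun y => k (h0 y)) (fun y => h (m y))
  (fun z => dk (h0 z.1, dh0 z)) (fun z => dh (m z.1, dm z)) _ _ _ _ _ _ _ (c0 x) v) => //.
- exact: chart_hausdorff cpsi.
- exact: (img_open_regular nM).
- move=> _ [y [Uy Dy] <-]; have [d1 d2] := Ud _ Uy; have [d3 d4] := Dy.
  by rewrite h0E// kE// mE// hE.
- apply: (differential_comp _ _ hdh' hdk).
  + move=> _ [y [Uy Dy] <-]; have [d1 d2] := Ud _ Uy; have [d3 d4] := Dy.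
    by rewrite h0E//; exists (f y).
  + move=> y /(nice_imgE nM A0 Zd)[z [[Uz Dz] _ fz ->]].
    have [d1 d2] := Ud _ Uz; have [d3 d4] := Dz; rewrite h0E//.
    apply/(nice_img nN B0 (@subIsetl _ _ _) d4).
    split; last exact: LC_fi.
    by apply: open_nbhs_nbhs; split.
  + exact: cont_on_sub ZD (C_cont h0C).
- apply: (differential_comp _ _ hdm' hdh).
  + move=> _ [y [Uy Dy] <-]; have [d1 d2] := Ud _ Uy; have [d3 d4] := Dy.
    by rewrite mE//; exists y.
  + have UU : Z `<=` U by exact: subIsetl. have Up : U `<=` cdom phi by move=> y /Ud[].
    move=> y /(img_int_trans nM A0 A oU Zd UU Up)[z [[Uz [d1 d2]] -> nz]].
    by rewrite mE//; split => //; exact: Up.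
  + exact: cont_on_sub Zm (C_cont mC).
- by exists x.
Qed.

Lemma is_tangent_map_tmap (D : set M) : is_tangent_map D f (tmap f).
Proof.
move=> xi Dx; split => // E F phi psi A B dx dfx.
have oU := open_dom A B.
have [h hE hC] := LC_rep A B oU (@subset_refl _ _).
have [dh _ hdh] := C_differential hC.
exists h, dh; split.
- by move=> y [[Dy dy] dfy]; exact: hE.
- by apply: differential_sub hdh; apply: image_subset => y [[Dy dy] dfy].
- exact: (tmap_coord A B oU _ _ hE hdh).
Qed.

(** A tangent map of the restriction of [f] to [D] is determined on the interior of [D]; density of
    the interior settles the remaining base points. *)
Lemma tmap_uniq (D : set M) g xi : D `<=` closure D° -> is_tangent_map D f g ->
  D (tbase xi) -> g xi = tmap f xi.
Proof.
move=> DD hg Dx; have [e hgc] := hg xi Dx.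
have [_ covM _ _] := nM; have [_ covN _ _] := nN.
have [E [phi [A dx]]] := covM (tbase xi); have [F [psi [B dfx]]] := covN (f (tbase xi)).
apply: (tangent_eq nN B); rewrite ?e//.
have [h' [dh' [h'E hdh' ->]]] := hgc _ _ phi psi A B dx dfx.
have oU := open_dom A B.
have [h hE hC] := LC_rep A B oU (@subset_refl _ _).
have [dh _ hdh] := C_differential hC.
rewrite (tmap_coord A B oU _ _ hE hdh)//.
set D' := (_ `&` _) in h'E hdh'.
have D'E : D' = D `&` (cdom phi `&` f @^-1` cdom psi) by rewrite setIA.
have D'd : D' `<=` cdom phi by rewrite D'E => y [_ []].
apply: (@differential_uniq R _ F (phi @` D') (phi @` D') (phi @` (cdom phi `&` f @^-1` cdom psi)) h' h) => //.
- exact: chart_hausdorff (nice_chart nN B).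
- apply: (img_regular (nice_chart nM A) D'd); rewrite D'E interiorI => y [Dy Uy].
  have -> : (cdom phi `&` f @^-1` cdom psi)° = cdom phi `&` f @^-1` cdom psi.
    apply/seteqP; split; first exact: interior_subset.
    by move=> z Uz; rewrite /interior; exact: open_nbhs_nbhs.
  by apply: closureI_open => //; exact: DD.
- by apply: image_subset; rewrite D'E; exact: subIsetr.
- by move=> _ [y D'y <-]; rewrite h'E// hE//; move: D'y; rewrite D'E => -[].
- by exists (tbase xi).
Qed.

End OneMap.

Lemma LQ_tmap n M N P (S1 : set P) (f : P * M -> N) p (xi : tangent_space M) :
  nice n.+1 M -> nice n.+1 N -> (forall p x, S1 p -> LQ 0 n.+1 S1 S1 f p x) -> S1 p ->
  LQ 0 n S1 S1 (fun z => tmap (fun y => f (z.1, y)) z.2) p xi.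
Proof.
move=> nM nN Lf Sp; have LCf q x : S1 q -> LC n.+1 (fun y => f (q, y)) x.
  by move=> Sq; apply: LQ_LC (Lf q x Sq).
have [E [F [phi [psi [U1 [U2 [[oU1 U1p] [oU2 U2x] U2d [A B] [hd hfi [h [hE hQ]]]]]]]]]] := Lf p (tbase xi) Sp.
have /QE[ch /(_ n erefl)[g hg gQ] _] := hQ.
exists _, _, (Tchart phi), (Tchart psi), U1, (tbase (M := M) @^-1` U2); split => //.
- by split => //; exact: (open_tbase nM).
- by move=> eta /U2d.
split.
- by move=> q eta Sq Ueta; exact: hd.
- move=> q eta Sq Ueta /(fi_T nM) fe; apply/(fi_T nN).
  exact: hfi.
exists (fun z => (h (z.1, z.2.1), g z)); split.
  move=> q eta Sq Ueta; rewrite /= hE//; congr pair.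
  have oU : open (U2 `&` (fun y => f (q, y)) @^-1` cdom psi).
    apply: openI => //; apply: open_comp; last exact: chart_open (nice_chart nN B).
    by move=> y _; apply: (LC_continuous nM nN) => z; apply: LCf; case: Sq.
  rewrite (@tmap_coord n M N nM nN (fun y => f (q, y)) (fun y => LCf q y Sq.1) _ _ phi psi U2
    (fun y => h (q, y)) (fun z => g (q, z)))//.
  - by move=> y Uy; split; [exact: U2d|exact: hd].
  - by move=> y Uy; rewrite hE.
  split; first by apply/cont_onP; apply: continuous_eval (Q_cont gQ).
  by move=> y w ny; apply/has_dirderE; exact: hg.
rewrite (T_img nM A U2d) interiorX interiorT; apply: Q_pair => //.
by apply: (@Q_fst _ 0 n _ _ _ _ _ _ _ _ h); apply: Q_le hQ.
Qed.

Lemma is_tangent_map_eq M N (D : set M) (f f' : M -> N) g : (forall x, D x -> f x = f' x) ->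
  is_tangent_map D f g -> is_tangent_map D f' g.
Proof.
move=> e hg xi Dx; have [e1 h1] := hg xi Dx; split; first by rewrite -e.
move=> E F phi psi A B dx dfx; rewrite -(e _ Dx) in dfx.
have [h [dh [hE hdh w]]] := h1 E F phi psi A B dx dfx.
have DE : D `&` cdom phi `&` f' @^-1` cdom psi = D `&` cdom phi `&` f @^-1` cdom psi.
  by apply/seteqP; split => y [[Dy dy]] /=; rewrite (e _ Dy).
exists h, dh; rewrite DE; split => // y [[Dy dy] dfy].
by rewrite hE// (e _ Dy).
Qed.

Lemma iter_tangent_map_eq j M N (D : set M) (f f' : M -> N) g : (forall x, D x -> f x = f' x) ->
  @is_iter_tangent_map R j M N D f g -> @is_iter_tangent_map R j M N D f' g.
Proof.
case: j g => [|j] g e /= h; first by move=> x Dx; rewrite h// e.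
by have [f1 h1 h2] := h; exists f1 => //; exact: is_tangent_map_eq e h1.
Qed.

(** Membership in a compact-open condition only asserts that some iterated tangent map exists.
    Uniqueness over a regular [D] identifies it with a member of one family that is jointly
    continuous in parameter and point. *)
Lemma iter_tangent_family j n M N P (S1 : set P) (f : P * M -> N) :
  nice (j + n) M -> nice (j + n) N -> (forall p x, S1 p -> LQ 0 (j + n) S1 S1 f p x) ->
  exists g : P * iter_tangent j M -> iter_tangent j N,
  [/\ forall p z, S1 p -> forall W, nbhs (g (p, z)) W -> \forall w \near (p, z), S1 w.1 -> W (g w),
      forall p (D : set M), S1 p -> is_iter_tangent_map D (fun x => f (p, x)) (fun z => g (p, z)) &
      forall p (D : set M) g', S1 p -> D `<=` closure D° ->
        is_iter_tangent_map D (fun x => f (p, x)) g' ->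
        forall z, iter_tangent_set D z -> g' z = g (p, z)].
Proof.
elim: j M N f => [|j IH] M N f nM nN Lf.
  exists f; split => [p z Sp W nW|//|p D g' Sp DD /= e z Dz]; last exact: e.
  exact: (LQ_cont nM nN (Lf p z Sp) Sp nW).
have LCf q : S1 q -> forall x, LC (j + n).+1 (fun y => f (q, y)) x.
  by move=> Sq x; apply: LQ_LC (Lf q x Sq).
have [g [g1 g2 g3]] := IH (tangent_space M) (tangent_space N)
  (fun z => tmap (fun y => f (z.1, y)) z.2) (nice_T nM) (nice_T nN)
  (fun p xi Sp => LQ_tmap xi nM nN Lf Sp).
exists g; split => //.
  move=> p D Sp /=; exists (tmap (fun y => f (p, y))); last exact: g2.
  exact: (is_tangent_map_tmap nM nN (LCf p Sp)).
move=> p D g' Sp DD /= [f1 hf1 hg'] z Dz; apply: g3 Dz => //.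
  exact: (T_regular nM).
apply: iter_tangent_map_eq hg' => xi Dxi.
exact: (tmap_uniq nM nN (LCf p Sp) DD hf1).
Qed.

(** Joint continuity of the iterated tangent maps, together with compactness of [K], yields one
    neighbourhood of the parameter that serves all points of [K]. *)
Lemma co_open l M N P (S1 : set P) (f : P * M -> N) (D : set M) (B : set (M -> N)) p0 :
  nice l M -> nice l N -> (forall p x, S1 p -> LQ 0 l S1 S1 f p x) -> D `<=` closure D° ->
  co_subbasis l D B -> S1 p0 -> B (fun x => f (p0, x)) ->
  \forall p \near p0, S1 p -> B (fun x => f (p, x)).
Proof.
move=> nM nN Lf DD [j [K [Q [jl [cK KD] oQ ->]]]] Sp0 [g' hg' gK].
have e : (j + (l - j) = l)%N by rewrite subnKC.
have [|||g [g1 g2 g3]] := @iter_tangent_family j (l - j) M N P S1 f; rewrite ?e//.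
have /compact_near_coveringP ncK := cK.
have h : \forall p \near p0, K `<=` (fun z => S1 p -> Q (g (p, z))).
  apply: (ncK _ _ (fun p z => S1 p -> Q (g (p, z)))) => z Kz.
  have gQ : nbhs (g (p0, z)) Q.
    apply: open_nbhs_nbhs; split => //; apply: gK; exists z => //.
    by apply: (g3 p0 D) => //; exact: KD.
  have [[A1 A2] /= [nA1 nA2] A12] := g1 p0 z Sp0 Q gQ.
  by exists (A2, A1) => //= -[z' p'] [/= A2z A1p]; exact: (A12 (p', z')).
apply: filterS h => p hp Sp; exists (fun z => g (p, z)); first exact: g2.
by move=> _ [z Kz <-]; exact: hp.
Qed.

Lemma co_fin_open l M N P (S1 : set P) (f : P * M -> N) (D : set M) (s : M -> N) B p0 :
  nice l M -> nice l N -> (forall p x, S1 p -> LQ 0 l S1 S1 f p x) -> D `<=` closure D° ->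
  finI_from [set B | co_subbasis l D B /\ B s] id B -> S1 p0 -> B (fun x => f (p0, x)) ->
  \forall p \near p0, S1 p -> B (fun x => f (p, x)).
Proof.
move=> nM nN Lf DD [D' D's <-] Sp0 Bf.
have h : \forall p \near p0, forall i : set (M -> N), i \in D' -> S1 p -> i (fun x => f (p, x)).
  have : forall i : set (M -> N), i \in enum_fset D' -> i \in D' by [].
  suff H (r : seq (set (M -> N))) : (forall i : set (M -> N), i \in r -> i \in D') ->
      \forall p \near p0, forall i : set (M -> N), i \in r -> S1 p -> i (fun x => f (p, x)).
    by move=> h; apply: filterS (H _ h) => p hp i iD; exact: hp.
  elim: r => [|i r IH] hr; first by apply: filterE.
  have iD' : i \in D' by apply: hr; exact: mem_head.
  have [Bi _] := set_mem (D's i iD').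
  have h1 := co_open nM nN Lf DD Bi Sp0 (Bf i iD').
  have h2 : \forall p \near p0, forall i : set (M -> N), i \in r -> S1 p -> i (fun x => f (p, x)).
    by apply: IH => k kr; apply: hr; rewrite in_cons kr orbT.
  apply: filterS2 h1 h2 => p hi hp k; rewrite in_cons => /orP[/eqP -> //|]; exact: hp.
by apply: filterS h => p hp Sp i /= iD; exact: hp.
Qed.

Lemma co_fin_eq l M N (D : set M) (s f f' : M -> N) B : (forall x, D x -> f x = f' x) ->
  finI_from [set B | co_subbasis l D B /\ B s] id B -> B f -> B f'.
Proof.
move=> e [D' D's <-] Bf i iD; have [[j [K [Q [_ _ _ iE]]]] _] := set_mem (D's i iD).
have := Bf i iD; rewrite /= iE => -[g hg gK]; exists g => //.
exact: iter_tangent_map_eq e hg.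
Qed.

End TangentMaps.

(** * The smoothing step *)

Section Slices.
Context {R : realType}.
Implicit Types (E F G P : tvsType R).
Lemma Q_swap k l E1 E2 F (S1 O1 : set E1) (S2 O2 : set E2) (f : E1 * E2 -> F) :
  Q k l S1 O1 S2 O2 f -> Q 0 k S2 O2 S1 O1 (fun z => f (z.2, z.1)).
Proof.
elim: k E1 S1 O1 f => [|k IH] E1 S1 O1 f /QE[cf _ hk]; apply/QE; split => //.
- apply: (@cont_on_comp _ _ _ _ _ (fun z : E2 * E1 => (z.2, z.1))) cf; first by move=> z [].
  by apply: cont_on_pair; [exact: cont_on_snd|exact: cont_on_fst].
- apply: (@cont_on_comp _ _ _ _ _ (fun z : E2 * E1 => (z.2, z.1))) cf; first by move=> z [].
  by apply: cont_on_pair; [exact: cont_on_snd|exact: cont_on_fst].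
move=> _ [<-]; have [g hg gQ] := hk k erefl.
exists (fun z => g (z.2, z.1)); last exact: IH.
by move=> y x v Oy Ox; exact: hg.
Qed.

(** For [y] in [O2] this is immediate. A point of [S2] outside [O2] is reached by exchanging the
    variables, which makes [y] a mere parameter, and then using [Q_dense_param]. *)
Lemma Q_slice k l E1 E2 F (S1 O1 : set E1) (S2 O2 : set E2) (f : E1 * E2 -> F) y :
  S2 `<=` closure O2 -> O2 `<=` S2 -> open O1 -> O1 `<=` S1 -> S2 y ->
  Q k l S1 O1 S2 O2 f -> C k S1 O1 (fun x => f (x, y)).
Proof.
move=> SO OS oO1 OS1 Sy /Q_swap /(Q_dense_param SO OS OS1 oO1) h.
by apply: (@Q_param _ _ _ _ _ _ S2 S2 S1 O1 setT setT (fun=> y)) h => //; exact: cont_on_cst.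
Qed.

Lemma cinv_spec (T : topologicalType) E (phi : chart T E) x0 y : cimg phi y ->
  cdom phi (cinv phi x0 y) /\ phi (cinv phi x0 y) = y.
Proof. by move=> [x dx e]; rewrite /cinv; case: xgetP => [z _ []//|/(_ x) []]. Qed.

Lemma open_chart_pre (T : topologicalType) E (phi : chart T E) (B : set E) :
  is_chart phi -> open B -> open (cdom phi `&` phi @^-1` B).
Proof.
move=> cphi oB; rewrite openE => x [dx Bx]; rewrite /interior.
by apply: (chart_nbhs cphi dx); exact: open_nbhs_nbhs.
Qed.

End Slices.

Section UnitInterval.
Context {R : realType}.

Definition I01 : set R^o := [set t : R | 0 <= t <= 1].
Definition I01' : set R^o := [set t : R | 0 < t <= 1].
Definition J01 : set R^o := [set t : R | 0 < t < 1].

Lemma J01_open : open J01.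
Proof.
rewrite (_ : J01 = [set t : R | 0 < t] `&` [set t | t < 1]).
  by apply: openI; [exact: (@open_gt R 0)|exact: (@open_lt R 1)].
by apply/seteqP; split => t => [/andP//|[? ?]]; exact/andP.
Qed.

Lemma J01_sub : J01 `<=` I01'. Proof. by move=> t /andP[h1 h2]; apply/andP; split => //; exact: ltW. Qed.

Lemma I01'_sub : I01' `<=` I01. Proof. by move=> t /andP[h1 h2]; apply/andP; split => //; exact: ltW. Qed.

Lemma I01_closure : I01 `<=` closure J01.
Proof.
move=> t /andP[t0 t1] W /nbhs_ballP[e /= e0 he].
pose d : R := Num.min (e / 2) (1 / 2); have d0 : 0 < d by rewrite lt_min !divr_gt0.
have d1 : d <= 1 / 2 by rewrite ge_min lexx orbT.
have d2 : d <= e / 2 by rewrite ge_min lexx.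
have [th|th] := leP t (1 / 2).
  exists (t + d / 2); split; first by apply/andP; split; lra.
  by apply: he; rewrite /ball/= opprD addrA subrr sub0r normrN gtr0_norm; lra.
exists (t - d / 2); split; first by apply/andP; split; lra.
by apply: he; rewrite /ball/= opprB addrC subrK gtr0_norm; lra.
Qed.

Lemma I01'_closure : I01' `<=` closure J01.
Proof. by move=> t /I01'_sub/I01_closure. Qed.

Lemma I01_compact : compact I01.
Proof.
rewrite (_ : I01 = `[0, 1]%classic); first exact: segment_compact.
by apply/seteqP; split => t /=; rewrite in_itv.
Qed.

Lemma I01'_interior : (I01' : set R^o)° `<=` J01.
Proof.
move=> t nt; have /andP[t0 t1] := interior_subset nt; apply/andP; split => //.
rewrite lt_neqAle t1 andbT; apply/eqP => e; move: nt; rewrite /interior => /nbhs_ballP[d /= d0 hd].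
have : I01' (t + d / 2).
  by apply: hd; rewrite /ball/= opprD addrA subrr sub0r normrN gtr0_norm; lra.
by move=> /andP[_]; rewrite e; lra.
Qed.

End UnitInterval.

Section Step.
Context {R : realType}.
Variables (r : diff_order) (l : nat) (hlr : le_order l r).
Variables (M N : charted_space R) (rM : rough_manifold r M) (pi : N -> M).
Hypotheses (M_corners : (0 < l)%N -> manifold_with_corners r M).
Hypotheses (M_loc : locally_compact [set: M]) (bun : fibre_bundle r pi).
Variables (sigma : M -> N) (sig_c : continuous sigma) (sig_pi : forall x, pi (sigma x) = x).

Definition ord1 (k : nat) := le_order k (sub_order r l).

Lemma ord1_l k : ord1 k -> le_order (k + l) r.
Proof. by rewrite /ord1; move: hlr; case: r => //= n ln kn; rewrite addnC -leq_subRL. Qed.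

Lemma ord1_0 : ord1 0. Proof. by rewrite /ord1; case: r. Qed.

Lemma le_order_trans m n o : (m <= n)%N -> le_order n o -> le_order m o.
Proof. by case: o => //= a; exact: leq_trans. Qed.

Lemma base_nice n : le_order n r -> nice n M. Proof. exact: rough_nice. Qed.

Lemma bundle_nice n : le_order n r -> nice n N. Proof. by case: bun => rN _ _ _; exact: rough_nice. Qed.

Lemma smooth_chart (x0 : M) : exists d (phi : chart M ('rV[R]_d)),
  [/\ catlas M phi, cdom phi x0 & forall V0, open V0 -> V0 `<=` cdom phi -> V0 x0 ->
      smoothable l (phi @` V0) (phi x0)].
Proof.
have [l0|l0] := posnP l.
  have [d [phi [A dx]]] := riesz_chart x0 rM M_loc.
  exists d, phi; split => // V0 oV0 V0d V0x; rewrite l0; apply: smoothable_rough.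
    apply: (img_regular (nice_chart (base_nice hlr) A) V0d) => x Vx.
    by apply: subset_closure; rewrite /interior; exact: open_nbhs_nbhs.
  by exists x0.
have [_ /(_ x0)[d [m [phi [_ A dx [Q oQ QE]]]]]] := M_corners l0.
exists d, phi; split => // V0 oV0 V0d V0x.
have [B oB BE] := chart_img (nice_chart (base_nice hlr) A) oV0 V0d.
have e : phi @` V0 = (B `&` Q) `&` corner_set m by rewrite BE QE setIA.
have : (phi @` V0) (phi x0) by exists x0.
by rewrite e => -[[Bx Qx] cx]; apply: smoothable_corner => //; exact: openI.
Qed.

(** The invariant of the construction; [G] is the region where H_t has been made regular for t > 0.
    On [G] all orders with k <= r - l and k + j <= r are kept, so that the case k = 0 yields
    RC^{0,r}, and r infinite leaves both orders unrestricted. *)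
Definition sec_hom (G : set M) (H : R^o * M -> N) : Prop :=
  [/\ forall t x, I01 t -> LQ 0 l I01 I01 H t x,
      forall t x, I01 t -> pi (H (t, x)) = x,
      forall x, H (0, x) = sigma x,
      forall k, ord1 k -> forall t x, I01' t -> LQ k l I01' J01 H t x &
      forall k j, ord1 k -> le_order (k + j) r -> forall t x, I01' t -> G x ->
        LQ k j I01' J01 H t x].

Definition famdom (e : R) : set (R^o * R^o)%type := [set s : R^o | 0 <= s <= e] `*` I01.

(* [F ((s, t), _)] is [H (t, _)], smoothed at scale s on [W] and unchanged off [L];
   the new homotopy uses the scale s = e t, which vanishes at t = 0. *)
Definition stepper (L W : set M) (Cd : set N) : Prop := forall G H, open G -> sec_hom G H ->
  (forall t x, I01 t -> L x -> Cd (H (t, x))) ->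
  exists2 e0 : R, 0 < e0 & exists F : (R^o * R^o) * M -> N,
  [/\ forall s t x, ~ L x -> F ((s, t), x) = H (t, x),
      forall t x, I01 t -> F ((0, t), x) = H (t, x),
      forall p x, famdom e0 p -> LQ 0 l (famdom e0) (famdom e0) F p x &
      forall e : R, 0 < e <= e0 -> sec_hom (G `|` W) (fun z => F ((e * z.1, z.1), z.2))].

Lemma stepper_ex (x0 : M) (V1 : set M) : open V1 -> V1 x0 -> exists L W Cd,
  [/\ compact L /\ closed L, L `<=` V1, open W /\ W x0, open Cd /\ (forall x, L x -> Cd (sigma x)) &
      stepper L W Cd].
Proof.
move=> oV1 V1x0; have hM : hausdorff_space M by case: rM.
have r0 : le_order 0 r by case: (r).
have [d [phi [Aphi dx0 hsm]]] := smooth_chart x0.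
have cphi := nice_chart (base_nice r0) Aphi.
have [|Gt [Psi [U1 [OG [[APsi dPsi] [oU1 U1d] oOG PsiE PsiP]]]]] := bundle_chart (y0 := sigma x0) rM bun Aphi.
  by rewrite sig_pi.
have cPsi := nice_chart (bundle_nice r0) APsi.
have oC : open (sigma @^-1` cdom Psi).
  by apply: open_comp; [move=> x _; exact: sig_c|exact: chart_open].
pose V1' := V1 `&` U1 `&` sigma @^-1` cdom Psi.
have oV1' : open V1' by apply: openI => //; exact: openI.
have V1'x0 : V1' x0 by split => //; split => //; have [] := PsiP _ dPsi; rewrite sig_pi.
have [L [cL clL nL LV]] := compact_nbhd hM M_loc oV1' V1'x0.
pose V0 := L°; have oV0 : open V0 by exact: open_interior.
have V0L : V0 `<=` L by exact: interior_subset.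
have V0d : V0 `<=` cdom phi by move=> x /V0L/LV[[_ /U1d]].
have [L2 [cL2 clL2 nL2 L2V]] := compact_nbhd hM M_loc oV0 (nL : V0 x0).
have [W0 nW0 hW0] := chart_nbhs_img cphi dx0 nL2.
pose S := phi @` V0.
have [B [oB Bx0 BW hop]] := hsm V0 oV0 V0d nL _ nW0.
have [h2 [K [h2C clK KB h20 h21]]] := cutoff (open_nbhs_nbhs (conj oB Bx0)).
(* As [KM] lies in the compact set [L2] within the chart domain, it is closed in all of [M]; this
   allows the new map to be joined with [H] outside. *)
pose KM := cdom phi `&` phi @^-1` K.
have KML2 : KM `<=` L2 by move=> x [dx /KB/BW]; exact: hW0.
have KMV0 : KM `<=` V0 by move=> x /KML2/L2V.
have oKM : open (~` KM).
  rewrite openE => x nKx; rewrite /interior; have [L2x|nL2x] := pselect (L2 x).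
    have dx : cdom phi x by exact/V0d/L2V.
    have nK : (~` K) (phi x) by move=> Kx; apply: nKx.
    have : nbhs (phi x) (~` K) by apply: open_nbhs_nbhs; split => //; exact: closed_openC.
    by move=> /(chart_nbhs cphi dx); apply: filterS => y [dy nKy] [_].
  have : nbhs x (~` L2) by apply: open_nbhs_nbhs; split => //; exact: closed_openC.
  by apply: filterS => y nLy /KML2.
have cKM : compact KM.
  by apply: (subclosed_compact _ cL2 KML2); rewrite -[KM]setCK; exact: open_closedC.
pose W := cdom phi `&` phi @^-1` [set y | h2 y = 1]°.
have oW : open W by apply: open_chart_pre => //; exact: open_interior.
have WKM : W `<=` KM.
  move=> x [dx /interior_subset /= h1]; split => //=; apply: contrapT => nK.
  by move: h1; rewrite h20// => /eqP; rewrite eq_sym oner_eq0.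
exists L, W, (cdom Psi); split => //.
- by move=> x /LV[[]].
- split => //; first exact: chart_open.
  by move=> x /LV[].
move=> G0 H oG0 [hA hB hC hD hE] hd.
have nl := base_nice hlr; have nl' := bundle_nice hlr.
have hV x : V0 x -> U1 x by move=> /V0L/LV[[]].
have HP t x : I01 t -> V0 x -> exists v, Psi (H (t, x)) = (phi x, v) /\ OG v.
  move=> It Vx; have dH := hd t x It (V0L _ Vx).
  have [_ e] := PsiP _ dH; rewrite hB// in e.
  exists (Psi (H (t, x))).2; split; first by rewrite -e; case: (Psi _).
  have : cimg Psi (Psi (H (t, x))) by exists (H (t, x)).
  by rewrite PsiE => -[].
have [_ _ [h [hhE hQ]]] : rep 0 l I01 I01 V0 H phi Psi.
  apply: (LQ_glob nl nl') => //; first by move=> t It; exact: subset_closure.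
  - by move=> t x It Vx; apply: hd => //; exact: V0L.
  - by move=> t x It Vx; exact: hA.
(* The fibre model inherits the Hausdorff property from the product as the slice over 0. *)
have hGt : hausdorff_space Gt.
  move=> a b hab; suff : (0 : 'rV[R]_d, a) = (0, b) by case.
  apply: (chart_hausdorff cPsi) => X Y [[X1 X2] /= [nX1 nX2] X12] [[Y1 Y2] /= [nY1 nY2] Y12].
  have [c [Xc Yc]] := hab _ _ nX2 nY2; exists (0, c); split.
    by apply: X12; split => //=; exact: nbhs_singleton.
  by apply: Y12; split => //=; exact: nbhs_singleton.
pose g (z : R^o * 'rV[R]_d) : Gt := (h z).2.
have gE t x : I01 t -> V0 x -> Psi (H (t, x)) = (phi x, g (t, phi x)) /\ OG (g (t, phi x)).
  by move=> It Vx; have [v [e Ov]] := HP t x It Vx; rewrite /g hhE// e.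
have Qg : Q 0 l I01 I01 S S° (g : R^o * ('rV[R]_d : tvsType R) -> Gt).
  by apply: Q_linear hQ; exact: clin_snd.
have [gs [gs1 gs2 gs3]] := hop _ _ _ _ hGt Qg.
pose w (z : (R^o * R^o) * 'rV[R]_d) : Gt := g (z.1.2, z.2) + h2 z.2 *: (gs z - g (z.1.2, z.2)).
have SB0 : (S `&` B)° `<=` S° `&` B by rewrite interiorI => y [? /interior_subset].
have Qw : Q 0 l (I01 `*` I01) (I01 `*` I01) (S `&` B) (S° `&` B)
    (w : (R^o * R^o) * ('rV[R]_d : tvsType R) -> Gt).
  have Qg' : Q 0 l (I01 `*` I01) (I01 `*` I01) (S `&` B) (S° `&` B)
      (fun z : (R^o * R^o) * ('rV[R]_d : tvsType R) => g (z.1.2, z.2)).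
    apply: (@Q_param _ _ _ _ _ _ I01 I01 _ _ _ _ snd (g : R^o * ('rV[R]_d : tvsType R) -> Gt)).
    - exact: cont_on_snd.
    - by move=> u [].
    - by move=> u [].
    - by apply: Q_sub Qg => // y [].
  apply: Q_add => //; apply: Q_scale.
    apply: (@Q_snd _ _ _ _ _ _ _ _ _ _ h2).
    by apply: (@C_sub _ _ _ _ setT setT) => //; exact: h2C.
  apply: Q_add => //.
  have -> : (fun z : (R^o * R^o) * ('rV[R]_d : tvsType R) => - g (z.1.2, z.2)) =
      (fun z => (-1) *: g (z.1.2, z.2)) by apply/funext => z; rewrite scaleN1r.
  by apply: (@Q_linear _ _ _ _ _ _ _ _ _ _ _ _ (fun y => (-1) *: y)) Qg'; apply: clin_scale; exact: clin_id.
have VB x : KM x -> (S `&` B) (phi x).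
  by move=> Kx; split; [exists x => //; exact: KMV0|apply: KB; case: Kx].
(* For s = 0 the fibre coordinate is that of [H], which lies in the open set [OG]; compactness of
   I01 x KM extends this to all small s at once. *)
have [e0 /andP[e00 e01] he0] : exists2 e0 : R, 0 < e0 <= 1 & forall s t x, 0 <= s <= e0 ->
    I01 t -> KM x -> OG (w ((s, t), phi x)).
  have := compact_setX (@I01_compact R) cKM; rewrite compact_near_coveringP => cIK.
  have h3 : \forall s \near (0 : R^o), I01 `*` KM `<=` (fun tx => 0 <= s <= 1 -> I01 tx.1 ->
      KM tx.2 -> OG (w ((s, tx.1), phi tx.2))).
    apply: (cIK R^o (nbhs (0 : R^o)) (fun s tx => 0 <= s <= 1 -> I01 tx.1 ->
      KM tx.2 -> OG (w ((s, tx.1), phi tx.2)))) => -[t x] [/= It Kx].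
    have nO : nbhs (w ((0, t), phi x)) OG.
      have [Sx Bx] := VB x Kx; rewrite /w /= gs2// subrr scaler0 addr0.
      by apply: open_nbhs_nbhs; split => //; have [] := gE t x It (KMV0 _ Kx).
    have I0 : I01 (0 : R) by rewrite /I01 /= lexx ler01.
    have cw := Q_cont Qw.
    have [[X Y] /= [[[X1 X2] /= [nX1 nX2] X12] nY] XY] :=
      cw ((0, t), phi x) (conj (conj I0 It) (VB x Kx)) _ nO.
    exists (X2 `*` (cdom phi `&` phi @^-1` Y), X1) => /=.
      split => //; exists (X2, cdom phi `&` phi @^-1` Y) => //=; split => //.
      by apply: chart_nbhs => //; case: Kx.
    move=> [[t' x'] s] [/= [X2t [dx' Yx']] X1s] hs It' Kx'.
    apply: (XY ((s, t'), phi x')); first by split => //; apply: X12.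
    by split; [split|exact: VB].
  have [e /= e_gt0 he] := h3.
  exists (Num.min (e / 2) 1); first by rewrite lt_min divr_gt0// ltr01 ge_min lexx orbT.
  move=> s t x /andP[s0]; rewrite le_min => /andP[se s1] It Kx.
  apply: (he s _ (t, x)) => //=; last by rewrite s0 s1.
  by rewrite sub0r normrN ger0_norm//; lra.
(* Outside [KM] the cut-off vanishes, so on [V2] both branches have the same chart expression; this
   is [FE], from which regularity across the boundary of [KM] follows. *)
pose F (z : (R^o * R^o) * M) : N :=
  if `[< KM z.2 >] then cinv Psi (H (z.1.2, z.2)) (phi z.2, w (z.1, phi z.2)) else H (z.1.2, z.2).
pose V2 := V0 `&` (cdom phi `&` phi @^-1` B).
have oV2 : open V2 by apply: openI => //; exact: open_chart_pre.
have V2d : V2 `<=` cdom phi by move=> x [_ []].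
have KMV2 : KM `<=` V2 by move=> x Kx; split; [exact: KMV0|case: Kx => ? /KB].
have FE s t x : 0 <= s <= e0 -> I01 t -> V2 x ->
    cdom Psi (F ((s, t), x)) /\ Psi (F ((s, t), x)) = (phi x, w ((s, t), phi x)).
  move=> hs It [Vx [dx Bx]]; rewrite /F /=; case: asboolP => Kx.
    apply: cinv_spec; rewrite PsiE; split => /=; last exact: he0.
    by exists x => //; exact: hV.
  split; first by apply: hd => //; exact: V0L.
  have [-> _] := gE t x It Vx; congr pair; rewrite /w /= h20 ?scale0r ?addr0//.
  by move=> Kx'; apply: Kx.
have Fout s t x : ~ KM x -> F ((s, t), x) = H (t, x).
  by move=> Kx; rewrite /F /=; case: asboolP.
have wO s t x : 0 <= s <= e0 -> I01 t -> V2 x -> OG (w ((s, t), phi x)).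
  move=> hs It V2x; have [dF e] := FE s t x hs It V2x.
  have : cimg Psi (Psi (F ((s, t), x))) by exists (F ((s, t), x)).
  by rewrite e PsiE => -[].
have Ffi s t x : 0 <= s <= e0 -> I01 t -> V2 x -> formal_interior x ->
    formal_interior (F ((s, t), x)).
  move=> hs It V2x fx; have [dF e] := FE s t x hs It V2x.
  apply/(nice_fi nl' APsi dF); rewrite e PsiE interiorX; split => /=.
    apply/(nice_img nl Aphi U1d); first exact: V2d.
    by split => //; apply: open_nbhs_nbhs; split => //; apply: hV; case: V2x.
  by apply: open_nbhs_nbhs; split => //; exact: wO.
have Fpi s t x : 0 <= s <= e0 -> I01 t -> pi (F ((s, t), x)) = x.
  move=> hs It; have [Kx|/Fout ->] := pselect (KM x); last exact: hB.
  have [dF e] := FE s t x hs It (KMV2 _ Kx).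
  have [Up e'] := PsiP _ dF; rewrite e /= in e'.
  by apply: (chart_inj cphi) => //; [exact: U1d|case: Kx].
have Fzero t x : I01 t -> F ((0, t), x) = H (t, x).
  move=> It; have [Kx|/Fout ->//] := pselect (KM x).
  have h0 : 0 <= (0 : R) <= e0 by rewrite lexx ltW.
  have [dF e] := FE 0 t x h0 It (KMV2 _ Kx).
  apply: (chart_inj cPsi) => //; first by apply: hd => //; exact/V0L/KMV0.
  have [Sx Bx] := VB x Kx.
  have [-> _] := gE t x It (KMV0 _ Kx); rewrite e; congr pair.
  by rewrite /w /= gs2// subrr scaler0 addr0.
have phiV2 : phi @` V2 `<=` S `&` B.
  by move=> _ [x [Vx [dx Bx]] <-]; split => //; exists x.
have phiV2i : (phi @` V2)° `<=` S° `&` B by move=> y /(interiorS phiV2)/SB0.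
have nKM x : ~ KM x -> nbhs x (~` KM) by move=> Kx; apply: open_nbhs_nbhs.
have FA p x : famdom e0 p -> LQ 0 l (famdom e0) (famdom e0) F p x.
  move: p => [s t] [/= hs It]; have [Kx|Kx] := pselect (KM x); last first.
    apply: (@LQ_ext _ _ _ _ _ _ _ _ (fun z => H (z.1.2, z.2))).
      apply: (@LQ_param _ _ _ _ _ _ I01 I01 _ _ snd H) => //; first exact: cont_on_snd.
      - by move=> q [].
      - by move=> q [].
      - exact: hA.
    by apply: filterS (nKM x Kx) => y Ky [s' t'] _; rewrite Fout.
  exists _, _, phi, Psi, setT, V2; split => //.
  - by split => //; exact: openT.
  - by split => //; exact: KMV2.
  split.
  - by move=> [s' t'] x' [[/= hs' It'] _] Vx'; have [] := FE s' t' x' hs' It' Vx'.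
  - by move=> [s' t'] x' [[/= hs' It'] _] Vx'; exact: Ffi.
  exists (fun z => (z.2, w z)); split.
    by move=> [s' t'] x' [[/= hs' It'] _] Vx'; have [_ ->] := FE s' t' x' hs' It' Vx'.
  apply: Q_pair; first by apply: (@Q_snd _ _ _ _ _ _ _ _ _ _ id); apply: C_lin; exact: clin_id.
  have sub : famdom e0 `&` setT `<=` I01 `*` I01.
    move=> [s' t'] [[/= /andP[a b] It'] _]; split => //=; rewrite /I01 /= a /=.
    exact: le_trans b e01.
  exact: Q_sub Qw.
exists e0 => //; exists F; split => //.
  by move=> s t x Lx; apply: Fout => /KMV0/V0L.
move=> e /andP[ep ee0].
have es t : I01 t -> 0 <= e * t <= e0.
  move=> /andP[t0 t1]; rewrite mulr_ge0 ?(ltW ep)//=; apply: le_trans ee0.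
  by rewrite ler_piMr// ltW.
pose H' (z : R^o * M) := F ((e * z.1, z.1), z.2).
pose sc (t : R^o) : (R^o * R^o)%type := (e * t, t).
have csc : clin sc.
  by apply: clin_pair; [apply: clin_scale; exact: clin_id|exact: clin_id].
have H'A t x : I01 t -> LQ 0 l I01 I01 H' t x.
  move=> It; apply: (@LQ_param _ _ _ _ _ _ (famdom e0) (famdom e0) I01 I01 sc F t x) => //.
  - exact: cont_clin.
  - by move=> q Iq; split => //; exact: es.
  - by move=> q Iq; split => //; exact: es.
  - by apply: FA; split => //; exact: es.
have H'0 x k j (S1 O1 : set R^o) t : ~ KM x -> LQ k j S1 O1 H t x -> LQ k j S1 O1 H' t x.
  move=> Kx h3; apply: (LQ_ext h3); apply: filterS (nKM x Kx) => y Ky q _.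
  by rewrite /H' Fout.
(* For t > 0 the scale e t is positive, where [gs] is smooth in y and inherits its class in t from
   the curves g (t, y) with y fixed. That class k is read off from the C^{k,l}-property of [H] in
   charts of class k + l <= r. *)
have Qgs k j : ord1 k -> (k + j <= k + j)%N -> Q k j I01' J01 (S `&` B) (S° `&` B)
    (fun z : R^o * ('rV[R]_d : tvsType R) => gs (sc z.1, z.2)).
  move=> ok _; have kr := ord1_l ok.
  have nk := base_nice kr; have nk' := bundle_nice kr.
  have [_ _ [h1 [h1E h1Q]]] : rep k l I01' J01 V0 H phi Psi.
    apply: (LQ_glob nk nk' (leqnn _)) => //.
    - by move=> _; exact: J01_open.
    - exact: J01_sub.
    - exact: I01'_closure.
    - by move=> t x /I01'_sub It Vx; apply: hd => //; exact: V0L.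
    - by move=> t x It Vx; exact: hD.
  have regS : S `<=` closure S°.
    apply: (img_regular cphi V0d) => x Vx; apply: subset_closure.
    by rewrite /interior; exact: open_nbhs_nbhs.
  apply: (@Q_precomp _ k j _ _ _ _ _ ([set s : R^o | 0 < s] `*` I01') ([set s : R^o | 0 < s] `*` J01)
    (S `&` B) (S° `&` B) I01' J01 _ _ sc id (gs : (R^o * R^o) * ('rV[R]_d : tvsType R) -> Gt)) => //.
  - by move=> _; apply: openX; [exact: (@open_gt R 0)|exact: J01_open].
  - by apply: openI => //; exact: open_interior.
  - by move=> [s t] [/= ? /J01_sub].
  - by move=> y [/interior_subset].
  - by move=> t It; split => //=; have /andP[t0 _] := It; rewrite mulr_gt0.
  - by move=> t It; split => //=; have /andP[t0 _] := It; rewrite mulr_gt0.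
  - exact: C_lin.
  - by apply: C_lin; exact: clin_id.
  - apply: gs3; [exact: J01_open|exact: J01_sub|exact: I01'_closure|].
    move=> y Sy; apply: (@C_ext _ _ _ _ _ _ (fun t => (h1 (t, y)).2)).
    + exact: J01_open.
    + exact: J01_sub.
    + move=> t It; have [x Vx <-] := Sy; have [e1 _] := gE t x (I01'_sub It) Vx.
      by rewrite h1E// e1.
    + apply: (@Q_slice R k l _ _ Gt I01' J01 S S° (fun z => (h1 z).2) y regS
        (@interior_subset _ _) J01_open J01_sub Sy).
      by apply: Q_linear h1Q; exact: clin_snd.
have H'1 x k j t (Q' : set M) : KM x -> ord1 k -> le_order (k + j) r -> open Q' -> Q' x ->
    I01' t -> (forall t x, I01' t -> Q' x -> LQ k j I01' J01 H t x) \/ Q' `<=` W ->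
    LQ k j I01' J01 H' t x.
  move=> Kx ok kjr oQ Qx It hQW.
  pose V3 := V2 `&` Q'.
  have oV3 : open V3 by exact: openI.
  have V3d : V3 `<=` cdom phi by move=> y [/V2d].
  have iV3 : phi @` V3 `<=` phi @` V2 by apply: image_subset; exact: subIsetl.
  have iV3' : (phi @` V3)° `<=` (phi @` V2)° by exact: interiorS.
  exists _, _, phi, Psi, setT, V3; split => //.
  - by split => //; exact: openT.
  - by split => //; split => //; exact: KMV2.
  split.
  - move=> t' x' [/I01'_sub It' _] [Vx' _].
    by have [] := FE (e * t') t' x' (es _ It') It' Vx'.
  - by move=> t' x' [/I01'_sub It' _] [Vx' _]; apply: Ffi => //; exact: es.
  exists (fun z => (z.2, w (sc z.1, z.2))); split.
    move=> t' x' [/I01'_sub It' _] [Vx' _].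
    by have [_ ->] := FE (e * t') t' x' (es _ It') It' Vx'.
  rewrite !setIT.
  apply: Q_pair; first by apply: (@Q_snd _ _ _ _ _ _ _ _ _ _ id); apply: C_lin; exact: clin_id.
  have Qgs3 : Q k j I01' J01 (phi @` V3) (phi @` V3)°
      (fun z : R^o * ('rV[R]_d : tvsType R) => gs (sc z.1, z.2)).
    apply: Q_sub (Qgs k j ok (leqnn _)) => //.
      exact: subset_trans iV3 phiV2.
    exact: subset_trans iV3' phiV2i.
  (* On [W] the cut-off is 1 and the fibre coordinate is [gs] itself, smooth in y. Elsewhere [g]
     enters as well, and its class is provided by the assumption on [H]. *)
  case: hQW => [hG|hW]; last first.
    apply: Q_ext Qgs3.
    - by move=> _; exact: J01_open.
    - exact: open_interior.
    - exact: J01_sub.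
    - exact: interior_subset.
    move=> t' _ It' [x' [Vx' /hW[_ /interior_subset /= h1]] <-].
    by rewrite /w /= h1 scale1r subrKC.
  have Qg3 : Q k j I01' J01 (phi @` V3) (phi @` V3)° (g : R^o * ('rV[R]_d : tvsType R) -> Gt).
    have [_ _ [h1 [h1E h1Q]]] : rep k j I01' J01 V3 H phi Psi.
      apply: (LQ_glob (base_nice kjr) (bundle_nice kjr) (leqnn _)) => //.
      - by move=> _; exact: J01_open.
      - exact: J01_sub.
      - exact: I01'_closure.
      - by move=> t' x' /I01'_sub It' [[Vx' _] _]; apply: hd => //; exact: V0L.
      - by move=> t' x' It' [_ Qx']; exact: hG.
    apply: (@Q_ext _ _ _ _ _ _ _ _ _ _ (fun z => (h1 z).2)).
    - by move=> _; exact: J01_open.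
    - exact: open_interior.
    - exact: J01_sub.
    - exact: interior_subset.
    - move=> t' _ It' [x' Vx' <-]; have [[V0x' _] _] := Vx'.
      by have [e1 _] := gE t' x' (I01'_sub It') V0x'; rewrite h1E// e1.
    - by apply: Q_linear h1Q; exact: clin_snd.
  have -> : (fun z : R^o * ('rV[R]_d : tvsType R) => w (sc z.1, z.2)) =
      (fun z => g z + h2 z.2 *: (gs (sc z.1, z.2) + (-1) *: g z)).
    by apply/funext => -[a b]; rewrite scaleN1r.
  apply: (Q_add Qg3); apply: Q_scale.
    apply: (@Q_snd _ _ _ _ _ _ _ _ _ _ h2).
    by apply: (@C_sub _ _ _ _ setT setT) => //; exact: h2C.
  apply: (Q_add Qgs3); apply: (@Q_linear _ _ _ _ _ _ _ _ _ _ _ _ (fun y => (-1) *: y)) Qg3.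
  by apply: clin_scale; exact: clin_id.
split.
- exact: H'A.
- by move=> t x It; apply: Fpi => //; exact: es.
- by move=> x /=; rewrite mulr0 Fzero// /I01 /= lexx ler01.
- move=> k ok t x It; have [Kx|Kx] := pselect (KM x); last by apply: H'0 => //; exact: hD.
  by apply: (H'1 x k l t setT) => //; [exact: ord1_l|exact: openT|left => t' x' It' _; exact: hD].
- move=> k j ok kjr t x It GWx; have [Kx|Kx] := pselect (KM x); last first.
    by apply: H'0 => //; case: GWx => [?|/WKM//]; exact: hE.
  case: GWx => [Gx|Wx]; last by apply: (H'1 x k j t W) => //; right.
  by apply: (H'1 x k j t G0) => //; left => t' x' It' Gx'; exact: hE.
Qed.

End Step.

(** * Locally finite sequences of steps *)

Section LocallyFinite.
Definition loc_finite (T : topologicalType) (D : nat -> set T) : Prop := forall x : T,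
  exists m (V : set T), nbhs x V /\ forall n, (m <= n)%N -> D n `&` V = set0.

Lemma loc_finite_compact (T : topologicalType) (D : nat -> set T) (C : set T) :
  loc_finite D -> compact C -> exists m, forall n, (m <= n)%N -> D n `&` C = set0.
Proof.
move=> lD /compact_near_coveringP cC.
have [m _ hm] : \forall m \near \oo, C `<=` (fun x => forall n, (m <= n)%N -> ~ D n x).
  apply: (cC nat \oo (fun m x => forall n, (m <= n)%N -> ~ D n x)) => x _.
  have [m [V [nV hV]]] := lD x; exists (V, [set n | (m <= n)%N]) => /=.
    by split => //; exists m.
  move=> [y k] [/= Vy mk] n kn Dy; have := hV n (leq_trans mk kn).
  by move=> e; have : (D n `&` V) y by []; rewrite e.
exists m => n mn; apply/seteqP; split => // x [Dx Cx].
exact: (hm m (leqnn m) x Cx n mn).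
Qed.

Lemma finite_set_bounded (A : set nat) : finite_set A -> exists m, forall n, A n -> (n < m)%N.
Proof.
move=> /finite_seqP[s ->]; exists (\max_(i <- s) i).+1 => n /= ns.
by rewrite ltnS; exact: leq_bigmax_seq.
Qed.

End LocallyFinite.

Section Assembly.
Context {R : realType}.
Variables (r : diff_order) (l : nat) (hlr : le_order l r).
Variables (M N : charted_space R) (pi : N -> M) (sigma : M -> N).
Local Notation sec_hom := (@sec_hom R r l M N pi sigma).
Local Notation stepper := (@stepper R r l M N pi sigma).
Variables (Inv : nat -> (M -> N) -> Prop) (D : nat -> set M).
Hypothesis Inv_eq : forall n f f', (forall x, D n x -> f x = f' x) -> Inv n f -> Inv n f'.
Hypothesis Inv_open : forall n (S1 : set (R^o * R^o)%type) (f : (R^o * R^o) * M -> N) p0,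
  (forall p x, S1 p -> LQ 0 l S1 S1 f p x) -> S1 p0 -> Inv n (fun x => f (p0, x)) ->
  \forall p \near p0, S1 p -> Inv n (fun x => f (p, x)).
Hypothesis D_lf : loc_finite D.

Definition inv_hom (H : R^o * M -> N) := forall n t, I01 t -> Inv n (fun x => H (t, x)).

(** Conditions whose set misses [L] do not notice the step. The finitely many others hold at s = 0
    and are open; compactness of the time interval makes a single bound on the scale sufficient for
    all t. *)
Lemma step_inv (L W : set M) Cd G H : compact L -> stepper L W Cd -> open G -> sec_hom G H ->
  inv_hom H -> (forall t x, I01 t -> L x -> Cd (H (t, x))) ->
  exists H', [/\ sec_hom (G `|` W) H', inv_hom H' & forall t x, ~ L x -> H' (t, x) = H (t, x)].
Proof.
move=> cL st oG hH iH hC; have [e0 e00 [F [F1 F2 F3 F4]]] := st G H oG hH hC.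
have [m hm] := loc_finite_compact D_lf cL.
have loc n : \forall s \near (0 : R^o), I01 `<=` (fun t => famdom e0 (s, t) -> Inv n (fun x => F ((s, t), x))).
  have := @I01_compact R; rewrite compact_near_coveringP => cI.
  apply: (cI R^o (nbhs (0 : R^o)) (fun s t => famdom e0 (s, t) -> Inv n (fun x => F ((s, t), x)))) => t It.
  have f0 : famdom e0 (0, t) by split => //=; rewrite lexx ltW.
  have := @Inv_open n (famdom e0) F (0, t) F3 f0.
  have -> : (fun x => F ((0, t), x)) = (fun x => H (t, x)) by apply/funext => x; exact: F2.
  move=> /(_ (iH n t It))[[X1 X2] /= [nX1 nX2] X12].
  by exists (X2, X1) => // -[t' s'] [/= Xt Xs]; exact: (X12 (s', t')).
have locm k : \forall s \near (0 : R^o), forall n, (n < k)%N -> forall t, I01 t ->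
    famdom e0 (s, t) -> Inv n (fun x => F ((s, t), x)).
  elim: k => [|k IH]; first by apply: filterE.
  apply: filterS2 IH (loc k) => s h1 h2 n; rewrite ltnS leq_eqVlt => /orP[/eqP ->|]; last exact: h1.
  by move=> t It; exact: h2.
have [e /= e_gt0 he] := locm m.
pose e1 := Num.min (e / 2) e0.
have e1_gt0 : 0 < e1 by rewrite lt_min divr_gt0.
have e1e0 : e1 <= e0 by rewrite ge_min lexx orbT.
have e1e : e1 <= e / 2 by rewrite ge_min lexx.
exists (fun z => F ((e1 * z.1, z.1), z.2)); split.
- by apply: F4; rewrite e1_gt0.
- move=> n t It; have /andP[t0 t1] := It.
  have [nm|mn] := ltnP n m; last first.
    apply: Inv_eq (iH n t It) => x Dx; rewrite F1// => Lx.
    by have : (D n `&` L) x by []; rewrite hm.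
  have h0 : 0 <= e1 * t by rewrite mulr_ge0// ltW.
  have h1 : e1 * t <= e1 by rewrite ler_piMr// ltW.
  apply: (he (e1 * t)) => //=.
    by rewrite sub0r normrN ger0_norm//; lra.
  by split => //=; rewrite h0 /=; exact: le_trans h1 e1e0.
- by move=> t x Lx; exact: F1.
Qed.

Lemma hom_sub G G' H : G' `<=` G -> sec_hom G H -> sec_hom G' H.
Proof. by move=> GG [h1 h2 h3 h4 h5]; split => // k j ok kj t x It /GG; exact: h5. Qed.

(** The chart condition of a later step is not destroyed by the earlier ones because it is implied
    by [Inv], which every step preserves. *)
Lemma stage (J : eqType) (L W : J -> set M) (Cd : J -> set N) (s : seq J) G H : open G ->
  (forall j, j \in s -> [/\ compact (L j), open (W j), stepper (L j) (W j) (Cd j) &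
    forall f, (forall n, Inv n f) -> forall x, L j x -> Cd j (f x)]) ->
  sec_hom G H -> inv_hom H ->
  exists H', [/\ sec_hom (G `|` [set x | exists2 j, j \in s & W j x]) H', inv_hom H' &
    forall t x, (forall j, j \in s -> ~ L j x) -> H' (t, x) = H (t, x)].
Proof.
elim: s G H => [|j s IH] G H oG hs hH iH.
  exists H; split => //; apply: hom_sub hH => x [//|[]]; by [].
have [cL oW st hC] := hs j (mem_head _ _).
have [|H1 [h1 h2 h3]] := step_inv cL st oG hH iH.
  by move=> t x It Lx; apply: (hC (fun y => H (t, y))) => // n; exact: iH.
have [||H2 [k1 k2 k3]] := IH (G `|` W j) H1 _ _ h1 h2.
- exact: openU.
- by move=> i si; apply: hs; rewrite in_cons si orbT.
exists H2; split => //.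
- apply: hom_sub k1 => x [Gx|[i]]; first by left; left.
  by rewrite in_cons => /orP[/eqP -> ?|si Wx]; [left; right|right; exists i].
- move=> t x hx; rewrite k3 ?h3//; first by apply: hx; exact: mem_head.
  by move=> i si; apply: hx; rewrite in_cons si orbT.
Qed.

Section Limit.
Variables (J : eqType) (L W : J -> set M) (Cd : J -> set N) (pts : nat -> seq J) (G0 : set M).
Hypothesis oG0 : open G0.
Hypothesis hpts : forall n j, j \in pts n -> [/\ compact (L j), open (W j),
  stepper (L j) (W j) (Cd j) & forall f, (forall n, Inv n f) -> forall x, L j x -> Cd j (f x)].
Hypothesis D_L : forall n j, j \in pts n -> L j `<=` D n.
Hypothesis D_cpt : forall n, exists2 C, compact C & D n `<=` C.
Variable H0 : R^o * M -> N.
Hypotheses (hom0 : sec_hom G0 H0) (inv0 : inv_hom H0).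

Definition region n : set M := G0 `|` [set x | exists i j, [/\ (i < n)%N, j \in pts i & W j x]].
Definition moved n : set M := [set x | exists2 j, j \in pts n & L j x].

Lemma region_open n : open (region n).
Proof.
apply: openU => //; rewrite openE => x [i [j [lin jp Wx]]]; have [_ oW _ _] := hpts jp.
have : nbhs x (W j) by exact: open_nbhs_nbhs.
by apply: filterS => y Wy; exists i, j.
Qed.

Lemma next n H : sec_hom (region n) H /\ inv_hom H -> exists H',
  (sec_hom (region n.+1) H' /\ inv_hom H') /\ forall t x, ~ moved n x -> H' (t, x) = H (t, x).
Proof.
move=> [hH iH]; have [H' [h1 h2 h3]] := stage (region_open n) (@hpts n) hH iH.
exists H'; split; last by move=> t x nx; apply: h3 => j jp Lx; apply: nx; exists j.
split => //; apply: hom_sub h1 => x [Gx|[i [j [lin jp Wx]]]]; first by left; left.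
move: lin; rewrite ltnS leq_eqVlt => /orP[/eqP e|lin]; last by left; right; exists i, j.
by right; exists j; rewrite -?e.
Qed.

Lemma start : sec_hom (region 0) H0 /\ inv_hom H0.
Proof. by split => //; apply: hom_sub hom0 => x [//|[i [j []]]]. Qed.

(** The invariants are part of the data, as the choice of the next homotopy depends on them. *)
Fixpoint Hseq n : {H | sec_hom (region n) H /\ inv_hom H} :=
  if n is m.+1 then
    exist _ (sval (cid (next (svalP (Hseq m))))) (svalP (cid (next (svalP (Hseq m))))).1
  else exist _ H0 start.

Lemma Hseq_eq n t x : ~ moved n x -> sval (Hseq n.+1) (t, x) = sval (Hseq n) (t, x).
Proof. exact: (svalP (cid (next (svalP (Hseq n))))).2. Qed.

Lemma Hseq_stable n m t x : (n <= m)%N -> (forall k, (n <= k)%N -> ~ moved k x) ->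
  sval (Hseq m) (t, x) = sval (Hseq n) (t, x).
Proof.
move=> nm hx; rewrite -(subnKC nm); elim: (m - n)%N => [|k IH]; first by rewrite addn0.
by rewrite addnS Hseq_eq//; apply: hx; exact: leq_addr.
Qed.

Lemma moved_lf (x : M) : exists mV : nat * set M, open mV.2 /\ mV.2 x /\
  forall n y, (mV.1 <= n)%N -> mV.2 y -> ~ moved n y.
Proof.
have [m [V [nV hV]]] := D_lf x; exists (m, V°); split; first exact: open_interior.
split; first exact: nV.
move=> n y mn /interior_subset Vy [j jp Lx]; have : (D n `&` V) y by split => //; exact: D_L Lx.
by rewrite hV.
Qed.

Definition nu x : nat := (sval (cid (moved_lf x))).1.

Definition Hlim (z : R^o * M) : N := sval (Hseq (nu z.2)) z.

Lemma Hlim_eq m t x : (forall k, (m <= k)%N -> ~ moved k x) ->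
  Hlim (t, x) = sval (Hseq m) (t, x).
Proof.
move=> hm; rewrite /Hlim /=; have := svalP (cid (moved_lf x)); rewrite -/(nu x).
move=> [_ [Vx hV]]; have h1 : forall k, (nu x <= k)%N -> ~ moved k x by move=> k nk; exact: hV.
rewrite -(Hseq_stable t (leq_maxl (nu x) m) h1).
exact: (Hseq_stable t (leq_maxr (nu x) m) hm).
Qed.

(** The limit agrees near each point with one member of the sequence, so local regularity passes to
    it. The index can be taken beyond any [m], so that the point already belongs to the
    corresponding region. *)
Lemma Hlim_loc (x : M) m : exists n, (m <= n)%N /\
  nbhs x [set y : M | forall t, sval (Hseq n) (t, y) = Hlim (t, y)].
Proof.
have [[n V] /= [oV [Vx hV]]] := moved_lf x; exists (maxn m n); split; first exact: leq_maxl.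
have nV : nbhs x V by exact: open_nbhs_nbhs.
apply: filterS nV => y Vy t; rewrite (Hlim_eq (m := maxn m n))// => k.
by rewrite geq_max => /andP[_ nk]; exact: hV.
Qed.

Definition limit_region : set M := \bigcup_n region n.

Lemma hom_Hlim : sec_hom limit_region Hlim.
Proof.
have hn n := (svalP (Hseq n)).1.
split.
- move=> t x It; have [n [_ hE]] := Hlim_loc x 0; have [h1 _ _ _ _] := hn n.
  by apply: (LQ_ext (h1 t x It)); apply: filterS hE => y hy q _; exact: hy.
- move=> t x It; have [n [_ /nbhs_singleton <-]] := Hlim_loc x 0; have [_ h2 _ _ _] := hn n.
  exact: h2.
- move=> x; have [n [_ /nbhs_singleton <-]] := Hlim_loc x 0; have [_ _ h3 _ _] := hn n.
  exact: h3.
- move=> k ok t x It; have [n [_ hE]] := Hlim_loc x 0; have [_ _ _ h4 _] := hn n.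
  by apply: (LQ_ext (h4 k ok t x It)); apply: filterS hE => y hy q _; exact: hy.
- move=> k j ok kj t x It [m _ Gx]; have [n [mn hE]] := Hlim_loc x m; have [_ _ _ _ h5] := hn n.
  have Gx' : region n x.
    case: Gx => [?|[i [a [im ? ?]]]]; [by left|right; exists i, a; split => //].
    exact: leq_trans im mn.
  by apply: (LQ_ext (h5 k j ok kj t x It Gx')); apply: filterS hE => y hy q _; exact: hy.
Qed.

(** The n-th condition concerns all of [D n] at once. This set lies in a compact set, which only
    finitely many stages touch, so one member of the sequence coincides with the limit on the whole
    of [D n]. *)
Lemma inv_Hlim : inv_hom Hlim.
Proof.
move=> n t It; have [C cC DC] := D_cpt n; have [m hm] := loc_finite_compact D_lf cC.
apply: (@Inv_eq n (fun x => sval (Hseq m) (t, x))); last exact: (svalP (Hseq m)).2.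
move=> x Dx; rewrite (Hlim_eq (m := m))// => k mk [j jp Lx].
have : (D k `&` C) x by split; [exact: D_L Lx|exact: DC].
by rewrite hm.
Qed.

Lemma Hlim_off t x : (forall n j, j \in pts n -> ~ L j x) -> Hlim (t, x) = H0 (t, x).
Proof.
move=> hx; rewrite (Hlim_eq (m := 0%N)) => // k _ [j jp]; exact: (hx k j jp).
Qed.

Lemma limit_regionE x : G0 x \/ (exists n j, j \in pts n /\ W j x) -> limit_region x.
Proof.
move=> [Gx|[n [j [jp Wx]]]]; first by exists 0%N => //; left.
by exists n.+1 => //; right; exists n, j.
Qed.

End Limit.
End Assembly.

(** * The choice of the steps and the theorem *)

Section Final.
Context {R : realType}.
Implicit Types (M N : charted_space R).
Lemma LQ_dense j M N (P : tvsType R) (S1 O1 : set P) (f : P * M -> N) p x :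
  S1 `<=` closure O1 -> O1 `<=` S1 -> LQ 0 j S1 O1 f p x -> LQ 0 j S1 S1 f p x.
Proof.
move=> SO OS [E [F [phi [psi [U1 [U2 [[oU1 U1p] [oU2 U2x] h3 h4 [hd hfi [h [hE hQ]]]]]]]]]].
exists E, F, phi, psi, U1, U2; split => //; split => //; exists h; split => //.
apply: Q_dense_param hQ.
- by move=> q [Sq Uq]; apply: closureI_open => //; exact: SO.
- exact: setSI.
- exact: interior_subset.
- exact: open_interior.
Qed.

Lemma LC_LQ_cst n k j M N (f : M -> N) (S1 O1 : set R^o) t x : (j <= n)%N -> LC n f x ->
  LQ k j S1 O1 (fun z => f z.2) t x.
Proof.
move=> jn [E [F [phi [psi [U1 [U2 [[oU1 U1p] h2 h3 h4 [hd hfi [h [hE hQ]]]]]]]]]].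
have I0 : ([set: R^o] `&` U1) 0 by [].
exists E, F, phi, psi, setT, U2; split => //; first by split => //; exact: openT.
split.
- by move=> q y _ Uy; exact: (hd 0).
- by move=> q y _ Uy; exact: (hfi 0).
exists (fun z => h (0, z.2)); split; first by move=> q y _ Uy; exact: (hE 0).
apply: (@Q_snd _ _ _ _ _ _ _ _ _ _ (fun y => h (0, y))).
apply: (@Q_param _ _ _ _ _ _ _ _ _ _ _ _ (fun=> 0)) (Q_le (leqnn _) jn hQ) => //.
exact: cont_on_cst.
Qed.

Section Data.
Variables (r : diff_order) (l : nat) (hlr : le_order l r).
Variables (M N : charted_space R) (rM : rough_manifold r M) (pi : N -> M).
Hypotheses (M_corners : (0 < l)%N -> manifold_with_corners r M).
Hypotheses (M_loc : locally_compact [set: M]) (bun : fibre_bundle r pi).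
Variables (sigma : M -> N) (hsigma : sections pi (Some l) sigma).

Let nM n : le_order n r -> nice n M := base_nice rM (n := n).
Let nN n : le_order n r -> nice n N := bundle_nice bun (n := n).
Let hM : hausdorff_space M. Proof. by case: rM. Qed.

Lemma sigma_LC x : LC l sigma x.
Proof.
by have [s _] := hsigma; apply: (RC_on_LC (nM hlr) (nN hlr) _ openT s) => //=.
Qed.

Lemma sigma_continuous : continuous sigma.
Proof. by move=> x; exact: (LC_cont (nM hlr) (nN hlr) (sigma_LC x)). Qed.

(** The union of all open sets on which the section is already regular; starting from it, one
    homotopy serves all sets V of condition (b) simultaneously. *)
Definition reg_set : set M := [set x | exists V, [/\ open V, V x & RC_on r V sigma]].

Lemma reg_set_open : open reg_set.
Proof.
rewrite openE => x [V [oV Vx sV]]; have : nbhs x V by exact: open_nbhs_nbhs.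
by apply: filterS => y Vy; exists V.
Qed.

Lemma sec_hom_sigma : @sec_hom R r l M N pi sigma reg_set (fun z => sigma z.2).
Proof.
have [_ spi] := hsigma; split => //.
- by move=> t x _; apply: LC_LQ_cst (leqnn l) (sigma_LC x).
- by move=> k _ t x _; apply: LC_LQ_cst (leqnn l) (sigma_LC x).
move=> k j ok kj t x _ [V [oV Vx sV]].
have jr : le_order j r by apply: le_order_trans kj; exact: leq_addl.
exact: LC_LQ_cst (leqnn j) (RC_on_LC (nM jr) (nN jr) jr oV sV Vx).
Qed.

Variables (U : set M) (U_open : open U) (K : nat -> set M) (K_cover : whitney_cover K).
Variables (C : set M) (C_closed : closed C) (CU : C `<=` U).
Variable (B : nat -> set (M -> N)).
Hypothesis hB : forall n, finI_from [set B | co_subbasis l (K n) B /\ B sigma] id (B n).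

(** The support of a step is kept inside the interior of some member [K m] of the Whitney cover, and
    m is recorded: local finiteness of the supports is deduced from that of the cover. *)
Lemma step_dat (x : M) : exists d : (set M * set M * set N) * nat, U x ->
  [/\ compact d.1.1.1, d.1.1.1 `<=` U `&` (K d.2)° /\ (K d.2)° x, open d.1.1.2 /\ d.1.1.2 x,
      open d.1.2 /\ (forall y, d.1.1.1 y -> d.1.2 (sigma y)) &
      @stepper R r l M N pi sigma d.1.1.1 d.1.1.2 d.1.2].
Proof.
have [Ux|nU] := pselect (U x); last by exists ((set0, set0, set0), 0%N).
have [_ _ Kc _] := K_cover; have [m _ Kx] : (\bigcup_n (K n)°) x by rewrite Kc.
have oV : open (U `&` (K m)°) by apply: openI => //; exact: open_interior.
have [_ spi] := hsigma.
have [L [W [Cd [[cL clL] LV [oW Wx] [oC LC_] st]]]] :=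
  stepper_ex hlr rM M_corners M_loc bun sigma_continuous spi oV (conj Ux Kx).
by exists ((L, W, Cd), m) => _; split.
Qed.

Definition dat x := sval (cid (step_dat x)).
Definition Ls x := (dat x).1.1.1.
Definition Ws x := (dat x).1.1.2.
Definition Cs x := (dat x).1.2.
Definition ms x := (dat x).2.

Lemma datP x : U x -> [/\ compact (Ls x), Ls x `<=` U `&` (K (ms x))° /\ (K (ms x))° x,
  open (Ws x) /\ Ws x x, open (Cs x) /\ (forall y, Ls x y -> Cs x (sigma y)) &
  @stepper R r l M N pi sigma (Ls x) (Ws x) (Cs x)].
Proof. exact: (svalP (cid (step_dat x))). Qed.

Lemma closure_K_compact n : compact (closure (K n)).
Proof. by have [h _ _ _] := K_cover; move: (h n); rewrite precompactE. Qed.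

Lemma pts_ex n : exists s : seq M, (forall j, j \in s -> C j /\ closure (K n) j) /\
  forall x, C x -> closure (K n) x -> exists2 j, j \in s & Ws j x.
Proof.
pose Cn := closure (K n) `&` C.
have cCn : compact Cn by apply: compact_closedI => //; exact: closure_K_compact.
have [x Cx|s hs] := @compact_finite_cover M M Cn (fun j => [set y | Cn j /\ Ws j y]) cCn.
  exists x; have [_ Cx'] := Cx; have [_ _ [oW Wx] _ _] := datP (CU Cx').
  have : nbhs x (Ws x) by exact: open_nbhs_nbhs.
  by apply: filterS.
exists [seq j <- s | `[< Cn j >]]; split.
  by move=> j; rewrite mem_filter => /andP[/asboolP[]].
move=> x Cx Kx; have [j js [Cj Wj]] := hs x (conj Kx Cx).
by exists j => //; rewrite mem_filter js andbT; exact/asboolP.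
Qed.

Definition pts n := sval (cid (pts_ex n)).

Lemma ptsP n j : j \in pts n -> C j /\ closure (K n) j.
Proof. by have [h _] := svalP (cid (pts_ex n)); exact: h. Qed.

(* What every smoothing step has to preserve: the n-th Whitney condition, and the
   fact that the steps of stage n take place in the domain of a bundle chart. *)
Definition Invs n (f : M -> N) := B n f /\ forall j, j \in pts n -> forall x, Ls j x -> Cs j (f x).
Definition Ds n : set M := K n `|` [set x | exists2 j, j \in pts n & Ls j x].

Lemma Invs_eq n f f' : (forall x, Ds n x -> f x = f' x) -> Invs n f -> Invs n f'.
Proof.
move=> e [h1 h2]; split.
  by apply: (co_fin_eq _ (hB n) h1) => x Kx; apply: e; left.
by move=> j jp x Lx; rewrite -e; [exact: h2 jp x Lx|right; exists j].
Qed.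

Lemma Invs_open n (S1 : set (R^o * R^o)%type) (f : (R^o * R^o) * M -> N) p0 :
  (forall p x, S1 p -> LQ 0 l S1 S1 f p x) -> S1 p0 -> Invs n (fun x => f (p0, x)) ->
  \forall p \near p0, S1 p -> Invs n (fun x => f (p, x)).
Proof.
move=> Lf Sp [h1 h2]; have [_ rg _ _] := K_cover.
have n1 := co_fin_open (nM hlr) (nN hlr) Lf (rg n) (hB n) Sp h1.
have n2 : \forall p \near p0, S1 p -> forall j, j \in pts n -> forall x, Ls j x -> Cs j (f (p, x)).
  have loc j : j \in pts n -> \forall p \near p0, Ls j `<=` (fun x => S1 p -> Cs j (f (p, x))).
    move=> jp; have [cL _ _ [oC _] _] := datP (CU (ptsP jp).1).
    move: cL; rewrite compact_near_coveringP => cL.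
    apply: (cL _ (nbhs p0) (fun p x => S1 p -> Cs j (f (p, x)))) => x Lx.
    have nC : nbhs (f (p0, x)) (Cs j) by apply: open_nbhs_nbhs; split => //; exact: h2.
    have [[A1 A2] /= [nA1 nA2] A12] := LQ_cont (nM hlr) (nN hlr) (Lf p0 x Sp) Sp nC.
    by exists (A2, A1) => //= -[x' p'] [/= A2x A1p]; exact: (A12 (p', x')).
  suff H (s : seq M) : (forall j, j \in s -> j \in pts n) -> \forall p \near p0, S1 p ->
      forall j, j \in s -> forall x, Ls j x -> Cs j (f (p, x)) by exact: H.
  elim: s => [|j s IH] hs; first by apply: filterE.
  have IHs : forall i, i \in s -> i \in pts n by move=> i si; apply: hs; rewrite in_cons si orbT.
  apply: filterS2 (loc j (hs j (mem_head _ _))) (IH IHs) => p k1 k2 S1p i.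
  by rewrite in_cons => /orP[/eqP -> x Lx|si]; [exact: k1|exact: k2].
by apply: filterS2 n1 n2 => p k1 k2 S1p; split; [exact: k1|exact: k2].
Qed.

Lemma K_lf : loc_finite K.
Proof.
move=> x; have [_ _ _ /(_ x)[V nV /finite_set_bounded[m hm]]] := K_cover.
exists m, V; split => // n mn; apply/eqP/negPn/negP => /set0P h.
by have := hm n h; rewrite ltnNge mn.
Qed.

(** A neighbourhood V meeting finitely many [K m] can meet the support of a step at j only if its
    recorded index m is one of them. If that step belongs to stage n, then j lies both in the
    closure of [K n] and in the interior of [K m], so [K n] meets [K m]. The compact closure of
    [K m] meets only finitely many [K n], so n is bounded. *)
Lemma Ds_lf : loc_finite Ds.
Proof.
move=> x; have [m0 [V [nV hV]]] := K_lf x.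
have hb m : exists b, forall n, (b <= n)%N -> K n `&` closure (K m) = set0.
  exact: (loc_finite_compact K_lf (@closure_K_compact m)).
pose b m := sval (cid (hb m)).
have bP m n : (b m <= n)%N -> K n `&` closure (K m) = set0 by exact: (svalP (cid (hb m))).
exists (maxn m0 (\max_(m < m0) b m)), V; split => // n; rewrite geq_max => /andP[mn bn].
apply/seteqP; split => // y [[Ky|[j jp Lj]] Vy].
  by have : (K n `&` V) y by []; rewrite hV.
have [Cj Kj] := ptsP jp; have [_ [LU Kmj] _ _ _] := datP (CU Cj).
have [_ Kmy] := LU y Lj.
have [ltm|mlt] := ltnP (ms j) m0; last first.
  have KV : (K (ms j) `&` V) y by split; [exact: (interior_subset Kmy)|exact: Vy].
  by move: KV; rewrite hV.
have bm : (b (ms j) <= n)%N.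
  by apply: leq_trans bn; exact: (leq_bigmax (Ordinal ltm)).
have [z [Kz Kmz]] := Kj _ (nbhs_interior (Kmj : nbhs j (K (ms j)))).
have : (K n `&` closure (K (ms j))) z.
  by split => //; apply: subset_closure; exact: interior_subset.
by rewrite bP.
Qed.

Lemma Ds_compact n : exists2 Q, compact Q & Ds n `<=` Q.
Proof.
exists (closure (K n) `|` [set x | exists2 j, j \in pts n & Ls j x]); last first.
  by apply: setSU; exact: subset_closure.
apply: compactU; first exact: closure_K_compact.
suff H (s : seq M) : (forall j, j \in s -> j \in pts n) ->
    compact [set x | exists2 j, j \in s & Ls j x] by exact: H.
elim: s => [|j s IH] hs.
  rewrite (_ : [set x | _] = set0); first exact: compact0.
  by apply/seteqP; split => // x [].
have -> : [set x | exists2 i, i \in j :: s & Ls i x] = Ls j `|` [set x | exists2 i, i \in s & Ls i x].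
  apply/seteqP; split => x.
    by move=> [i]; rewrite in_cons => /orP[/eqP ->|si] Lx; [left|right; exists i].
  move=> [Lx|[i si Lx]]; first by exists j => //; exact: mem_head.
  by exists i => //; rewrite in_cons si orbT.
apply: compactU; last by apply: IH => i si; apply: hs; rewrite in_cons si orbT.
by have [] := datP (CU (ptsP (hs j (mem_head _ _))).1).
Qed.

Lemma smoothing_homotopy : exists G H, [/\ open G, reg_set `<=` G /\ C `<=` G,
  @sec_hom R r l M N pi sigma G H, forall n t, I01 t -> B n (fun x => H (t, x)) &
  forall t x, ~ U x -> H (t, x) = sigma x].
Proof.
have hp n j : j \in pts n -> [/\ compact (Ls j), open (Ws j),
    @stepper R r l M N pi sigma (Ls j) (Ws j) (Cs j) &
    forall f, (forall n, Invs n f) -> forall x, Ls j x -> Cs j (f x)].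
  move=> jp; have [cL [LU Kmj] [oW Wj] [oC LCj] st] := datP (CU (ptsP jp).1).
  by split => // f hf x Lx; have [_ h] := hf n; exact: h jp x Lx.
have DL n j : j \in pts n -> Ls j `<=` Ds n by move=> jp x Lx; right; exists j.
have inv0 : inv_hom Invs (fun z : R^o * M => sigma z.2).
  move=> n t It; split; last first.
    by move=> j jp x Lx; have [_ _ _ [_ h] _] := datP (CU (ptsP jp).1); exact: h.
  by have [D' D's <-] := hB n; move=> i iD; have [] := set_mem (D's i iD).
pose H := Hlim Invs_eq Invs_open Ds_lf reg_set_open hp DL sec_hom_sigma inv0.
exists (limit_region Ws pts reg_set), H; split.
- by apply: bigcup_open => n _; exact: (region_open reg_set_open hp).
- split=> [x sx|x Cx]; apply: limit_regionE; first by left.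
  have [_ _ Kc _] := K_cover; have [n _ Kx] : (\bigcup_n (K n)°) x by rewrite Kc.
  have [_ h] := svalP (cid (pts_ex n)).
  have [j js Wj] := h x Cx (subset_closure (interior_subset Kx)).
  by right; exists n, j.
- exact: hom_Hlim.
- move=> n t It; have [h _] := inv_Hlim Invs_eq Invs_open Ds_lf reg_set_open hp DL Ds_compact sec_hom_sigma inv0 n It.
  exact: h.
- move=> t x Ux; apply: Hlim_off => n j jp Lx.
  by have [_ [LU _] _ _ _] := datP (CU (ptsP jp).1); have [] := LU x Lx.
Qed.

End Data.
End Final.

Theorem theorem14p5 (R : realType) (r : diff_order) (l : nat) (hlr : le_order l r)
  (M : charted_space R)
  (M_rough : rough_manifold r M)
  (M_corners : (0 < l)%N -> manifold_with_corners r M)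
  (M_sigma : sigma_compact M) (M_loc : locally_compact [set: M])
  (N : charted_space R) (pi : N -> M) (N_bundle : fibre_bundle r pi)
  (sigma : M -> N) (hsigma : sections pi (Some l) sigma)
  (Omega : set (M -> N))
  (hOmega : whitney_nbhs l (sections pi (Some l)) sigma Omega)
  (U : set M) (U_open : open U) (A : set M) (A_closed : closed A)
  (sigma_reg : exists O : set M,
     [/\ open O, A `\` U `<=` O & RC_on r O sigma]) :
  let I01 : set (real_line R) := [set t : R | 0 <= t <= 1] in
  let I01' : set (real_line R) := [set t : R | 0 < t <= 1] in
  exists (tau : M -> N) (H : real_line R * M -> N) (W : set M),
    let Ht (t : R) (x : M) := H (t, x) in
    [/\ Omega tau,
        [/\ {within I01 `*` setT, continuous H},
            Ht 0 = sigma, Ht 1 = tau &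
            forall t : R, I01 t -> Omega (Ht t)],
        [/\ (forall t : R, I01 t -> forall x, (~` U) x -> sigma x = Ht t x),
            (forall V : set M, open V -> RC_on r V sigma ->
               forall t : R, I01 t -> RC_on r V (Ht t)) &
            [/\ open W, A `<=` W & forall t : R, I01' t -> RC_on r W (Ht t)]] &
        [/\ RC2_on (Some 0%N) (Some l) I01 setT H,
            RC2_on (sub_order r l) (Some l) I01' setT H &
            forall V : set M, open V -> RC_on r V sigma ->
              if r is Some n then
                RC2_on (Some 0%N) (Some n) I01' (V `|` W) H
              else
                @RC_on R (prod_manifold None (real_line R) M) N None
                  (I01' `*` (V `|` W)) H]].
Proof.
move=> I01_ I01'_.
have nM n : le_order n r -> nice n M by exact: rough_nice.
have nN n : le_order n r -> nice n N by exact: (bundle_nice N_bundle).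
have [_ [K Kc [P hP hO]]] := hOmega.
have /choice[B hB] : forall n, exists B, finI_from [set B | co_subbasis l (K n) B /\ B sigma] id B /\
    B `&` RC_on (Some l) (K n) `<=` P n.
  by move=> n; have [B b1 b2] := hP n; exists B.
case: sigma_reg => O [oO AO sO].
(* Only A \ O has to be treated: it is closed and contained in [U], so the steps can stay inside
   [U], while on [O] the section is regular from the start. *)
have clC : closed (A `\` O) by rewrite setDE; apply: closedI => //; exact: open_closedC.
have CU : A `\` O `<=` U.
  by move=> x [Ax nOx]; apply: contrapT => nU; apply: nOx; exact: AO.
have [W [H [oW [regW CW] [hA hPi h0 hC hD] hBt hoff]]] :=
  smoothing_homotopy hlr M_rough M_corners M_loc N_bundle hsigma U_open Kc clC CU (fun n => (hB n).1).
have I1 : I01 (1 : R) by rewrite /I01 /= ler01 lexx.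
have lel n : (n <= l)%N -> le_order n r by move=> nl; exact: le_order_trans hlr.
have LCt t x n : I01 t -> (n <= l)%N -> LC n (fun y => H (t, y)) x.
  move=> It nl; apply: (LQ_LC It); exact: (LQ_sub _ nl _ _ (hA t x It)).
have sec t : I01 t -> sections pi (Some l) (fun x => H (t, x)).
  move=> It; split; last by move=> x; exact: hPi.
  apply: LC_RC_on; first exact: openT.
    by move=> n nl; split; [exact/nM/lel|exact/nN/lel].
  by move=> x n _ nl; exact: LCt.
have Om t : I01 t -> Omega (fun x => H (t, x)).
  move=> It; apply: hO; split; first exact: sec.
  move=> n /=; have [_ h] := hB n; apply: h; split; first exact: hBt.
  by have [s _] := sec t It; exact: RC_on_sub s.
have regt (V : set M) t : open V -> V `<=` W -> I01' t -> RC_on r V (fun x => H (t, x)).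
  move=> oV VW It; apply: LC_RC_on => // [n nr|x n Vx nr]; first by split; auto.
  (* The regularity of [H] over ]0, 1] is given with active times in ]0, 1[ only; density extends
     the derivatives in space to t = 1. *)
  apply: (LQ_LC It); apply: (LQ_dense (O1 := J01)).
  - exact: I01'_closure.
  - exact: J01_sub.
  by apply: hD => //; [exact: ord1_0|exact: VW].
have Vreg V : open V -> RC_on r V sigma -> V `<=` W.
  by move=> oV sV x Vx; apply: regW; exists V.
have cJ : (I01' : set R^o) `<=` closure (I01' : set R^o)°.
  move=> t /I01'_closure; apply: closure_subset; rewrite -[X in X `<=` _]((interior_id _).1 J01_open).
  by apply: interiorS; exact: J01_sub.
have cI : (I01 : set R^o) `<=` closure (I01 : set R^o)°.
  move=> t /I01_closure; apply: closure_subset; rewrite -[X in X `<=` _]((interior_id _).1 J01_open).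
  by apply: interiorS => s /J01_sub/I01'_sub.
(* Every admissible V already lies in [W], since [W] contains [reg_set]; so the last assertion
   reduces to [W]. *)
have Wt (V : set M) : open V -> RC_on r V sigma -> V `|` W = W.
  by move=> oV sV; apply/seteqP; split => [x [/(Vreg V oV sV)|]//|x Wx]; right.
exists (fun x => H (1, x)), H, W => Ht; split.
- exact: Om.
- split => //; last by apply/funext => x; exact: h0.
  apply/cont_onP => -[t x] [/= It _] Q nQ.
  have := LQ_cont (nM _ hlr) (nN _ hlr) (hA t x It) It nQ.
  by apply: filterS => -[t' x'] h [/= ? _]; exact: h.
- split.
  + by move=> t It x Ux; rewrite /Ht hoff.
  (* The regularity on [W] holds for positive times only; at t = 0 the homotopy is the given
     section, regular on V by assumption. *)
  + move=> V oV sV t It; have [t0|t0] := eqVneq t 0.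
      have -> : Ht t = sigma by apply/funext => x; rewrite /Ht t0.
      by [].
    apply: regt => //; first exact: Vreg.
    have /andP[a b] := It; apply/andP; split => //.
    by rewrite lt_neqAle eq_sym t0.
  + split => // [x Ax|t It]; last exact: regt.
    by have [Ox|nOx] := pselect (O x); [apply: regW; exists O|apply: CW].
have ordl i j : le_order i (sub_order r l) -> (j <= l)%N -> le_order (i + j) r.
  move=> ir jl; apply: le_order_trans (ord1_l hlr ir).
  by rewrite leq_add2l.
split.
- apply: LQ_RC2_on => //; first exact: openT.
    move=> i j /= i0 jl; move: i0; rewrite leqn0 => /eqP ->.
    by split; [exact/nM/lel|exact/nN/lel].
  move=> i j /= i0 jl t x It _; move: i0; rewrite leqn0 => /eqP ->.
  apply: LQ_sub (hA t x It) => //; exact: interior_subset.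
- apply: LQ_RC2_on => //; first exact: openT.
    by move=> i j ir jl; split; [exact/nM/ordl|exact/nN/ordl].
  move=> i j ir jl t x It _; apply: LQ_sub (hC i ir t x It) => //.
  exact: I01'_interior.
move=> V oV sV; rewrite (Wt V oV sV); move: hlr; case E : r => [n|] _.
  apply: LQ_RC2_on => //.
    move=> i j /= i0 jl; move: i0; rewrite leqn0 => /eqP ->.
    by split; [apply: nM|apply: nN]; rewrite E.
  move=> i j /= i0 jl t x It Wx; move: i0; rewrite leqn0 => /eqP ->.
  have := hD 0%N j (ord1_0 r l); rewrite E => /(_ jl t x It Wx).
  by apply: LQ_sub => //; exact: I01'_interior.
apply: LQ_joint => //.
- by rewrite -E.
- by rewrite -E; case: N_bundle.
move=> n t x It Wx; have := hD n n; rewrite /ord1 E => /(_ I I t x It Wx).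
by apply: LQ_sub => //; exact: I01'_interior.
Qed.
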